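(* Let $T\subset\mathbb{R}^d$ be compact and let $f:T\to\mathbb{R}$ be a Gaussian random field satisfying conditions (A1)–(A4) of the context. Let $v>0$, put $\rho=2d/\beta+dv+1$, and let $\lambda,b_0\in(0,\infty)$, $b_0\ge1$, be constants (independent of $a$) such that for all $a>0$ and $b\ge b_0$ $$P\Big(\max_{t\in T}f(t)\le b+a/b\ \Big|\ \max_{t\in T}f(t)>b\Big)\le\lambda ab^{\rho},\qquad P\Big(\max_{t\in T}f(t)>\gamma_{a,b},\ \max_{t\in T}f(t)\le b\Big)\le\lambda ab^\rho P\Big(\max_{t\in T}f(t)>\gamma_{a,b}\Big),$$ and $P(\max_{t\in T}f(t)>\gamma_{a,b})(1-\lambda ab^\rho)\le P(\max_{t\in T}f(t)>b)$. Put $a=\varepsilon/(4\lambda b^\rho)$. Then there exist $c,\varepsilon_0>0$ such that for all $\varepsilon\le\varepsilon_0$ (and all sufficiently large $b$), $$|w(b)-w_M(\gamma_{a,b})|\le\varepsilon\, w(b)\qquad\text{if } M=\big\lceil c\,\varepsilon^{-1}(b/a)^{(4+4v)d/\beta}\big\rceil .$$ Consequently, the Monte Carlo procedure $\mathcal{A}$ of the context (with these $a$, $M$ and a suitable number $n$ of replications) is a fully polynomial randomized approximation scheme (FPRAS) for $w(b)$ with running time $O(M^3\cdot M^2\cdot\varepsilon^{-2}\delta^{-1})$.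
   Context: Notation. $|x|=\sum_{j=1}^d|x_j|$; $m$ is Lebesgue measure; $\mu(t)=E f(t)$, $\mathcal{C}(s,t)=\mathrm{Cov}(f(s),f(t))$, $\sigma^2(t)=\mathcal{C}(t,t)>0$, $r(s,t)=\mathcal{C}(s,t)/(\sigma(s)\sigma(t))$; $\gamma_{a,b}=b-a/b$; $w(b)=P(\max_{t\in T}f(t)>b)$; $w_M(x)=P(\max_{1\le i\le M}f(U_i)>x)$, where $U=(U_1,\dots,U_M)$ has i.i.d. entries uniform on $T$, independent of $f$. Conditions (for some constants $\kappa_H,\beta>0$): (A1) $f$ is almost surely continuous on $T$; (A2) for some $\delta_1>0$, whenever $|s-t|<\delta_1$, $|\sigma(t)-\sigma(s)|+|\mu(t)-\mu(s)|\le\kappa_H|s-t|^{\beta}$; (A3) for some $\delta_1>0$, whenever $|s-s'|<\delta_1$ and $|t-t'|<\delta_1$, $|r(t,s)-r(t',s')|\le\kappa_H[|t-t'|^\beta+|s-s'|^\beta]$; (A4) $0\in T$, and there exist $\kappa_0>0$ and $\omega_d=m(B(0,1))$ such that for every $t\in T$ and all $\varepsilon$ small enough $m(B(t,\varepsilon)\cap T)\ge\kappa_0\varepsilon^d\omega_d$, where $B(t,\varepsilon)=\{s:|t-s|\le\varepsilon\}$. Computational model. Cost (running time) is measured in function evaluations, each costing at most a fixed amount of computer time: a single addition, multiplication or comparison; generation of one uniform random variable on $T$; generation of one standard Gaussian random variable; evaluation of $\Phi(x)$ (standard normal distribution function) at a fixed $x\ge0$; evaluation of $\mu(t)$ and $\mathcal{C}(s,t)$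 for given $s,t\in T$. Generating an $M$-dimensional Gaussian vector by Cholesky factorization costs $O(M^3)$. FPRAS. For events $\{B_b: b\ge b_0\}$ with $0<P(B_b)\to0$ as $b\to\infty$ (here $B_b=\{\max_{t\in T} f(t)>b\}$), a Monte Carlo procedure is a fully polynomial randomized approximation scheme for $P(B_b)$ if, for some $q,q_1,q_2\in[0,\infty)$, it outputs an averaged estimator (an average of i.i.d. replications) guaranteed to have at most $\varepsilon>0$ relative error with confidence at least $1-\delta\in(0,1)$ in $\Theta(\varepsilon^{-q_1}\delta^{-q_2}|\log P(B_b)|^{q})$ function evaluations. Procedure $\mathcal{A}$ with parameters $a>0$, $M,n\in\mathbb{N}$. (1) Generate $n$ i.i.d. copies of $U$. (2) For each copy, independently, let $X_i=f(U_i)$, sample $X=(X_1,\dots,X_M)$ from the law $$Q''(X\in B\mid U)=\sum_{i=1}^M p_U(i)\,P[X\in B\mid X_i>\gamma_{a,b},U],\qquad p_U(i)=\frac{P(X_i>\gamma_{a,b}\mid U)}{\sum_{j=1}^M P(X_j>\gamma_{a,b}\mid U)},$$ and compute $L_b(U)=\sum_{i=1}^M P(X_i>\gamma_{a,b}\mid U)\big/\sum_{i=1}^M \mathbf{1}(X_i>\gamma_{a,b})$. (3) Output the average of the $n$ i.i.d. values of $L_b(U)$. *)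

(* Defs.v *)
From HB Require Import structures.
From mathcomp Require Import all_boot all_order all_algebra.
From mathcomp Require Import all_classical all_reals all_analysis.

Set Implicit Arguments.
Unset Strict Implicit.
Unset Printing Implicit Defensive.
Import Order.TTheory GRing.Theory Num.Theory.
Import numFieldNormedType.Exports.
Local Open Scope classical_set_scope.
Local Open Scope ring_scope.

Definition rV_display : measure_display -> measure_display.
Proof. exact. Qed.

Section rV_measurable.
Context {R : realType} (d : nat).

Let coors : 'I_d -> 'rV[R]_d -> R := fun i x => x ord0 i.

Let rV_set0 : g_sigma_preimage coors set0.
Proof. exact: sigma_algebra0. Qed.

Let rV_setC A : g_sigma_preimage coors A -> g_sigma_preimage coors (~` A).
Proof. exact: sigma_algebraC. Qed.

Let rV_bigcup (F : _^nat) : (forall i, g_sigma_preimage coors (F i)) ->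
  g_sigma_preimage coors (\bigcup_i (F i)).
Proof. exact: sigma_algebra_bigcup. Qed.

HB.instance Definition _ := @isMeasurable.Build (rV_display default_measure_display)
  'rV[R]_d (g_sigma_preimage coors) rV_set0 rV_setC rV_bigcup.

End rV_measurable.

(* The n-fold product measure; the law of n i.i.d. variables when mu is a
   probability. *)
Fixpoint power_measure {R : realType} {disp} {X : measurableType disp}
    (mu : set X -> \bar R) (n : nat) : set (n.-tuple X) -> \bar R :=
  match n with
  | 0 => fun A => \d_([tuple] : 0.-tuple X) A
  | n'.+1 => fun A =>
      (\int[mu]_x power_measure mu [set v : n'.-tuple X | A [tuple of x :: v]])%E
  end.

Definition lebesgue_rV {R : realType} {d : nat} (A : set 'rV[R]_d) : \bar R :=
  power_measure (@lebesgue_measure R)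
    [set v : d.-tuple R | A (\row_j tnth v j)].

Definition uniform_on {R : realType} {d : nat} (T A : set 'rV[R]_d) : \bar R :=
  (lebesgue_rV (A `&` T) * (fine (lebesgue_rV T))^-1%:E)%E.

Definition norm1 {R : realType} {d : nat} (x : 'rV[R]_d) : R :=
  \sum_(j < d) `|x ord0 j|.

Definition cball1 {R : realType} {d : nat} (t : 'rV[R]_d) (e : R) :
  set 'rV[R]_d := [set s | norm1 (t - s) <= e].

(* [normal_prob m 0] of the library is not the Dirac mass at m. *)
Definition normal_law {R : realType} (m s : R) : set R -> \bar R :=
  if s == 0 then \d_m else normal_prob m s.

Definition Phi_normal {R : realType} (x : R) : R :=
  fine (normal_prob 0 1 `]-oo, x]).

Section field.
Context {R : realType} {disp} {Omega : measurableType disp}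
        (P : probability Omega R) {d : nat} (T : set 'rV[R]_d)
        (f : 'rV[R]_d -> {RV P >-> R}).

(* Only the values f t with t in T are ever constrained or used. *)
Definition gaussian_field : Prop :=
  forall (n : nat) (t : 'I_n -> 'rV[R]_d) (c : 'I_n -> R),
    (forall i, T (t i)) ->
    exists m s : R, 0 <= s /\
      forall A : set R, measurable A ->
        P [set omega | A (\sum_(i < n) c i * f (t i) omega)] = normal_law m s A.

Definition mean (t : 'rV[R]_d) : R := fine ('E_P[f t])%E.
Definition cov (s t : 'rV[R]_d) : R := fine (covariance P (f s) (f t)).
Definition sdev (t : 'rV[R]_d) : R := Num.sqrt (cov t t).
Definition corr (s t : 'rV[R]_d) : R := cov s t / (sdev s * sdev t).

Definition condA1 : Prop :=
  {ae P, forall omega, {within T, continuous (fun t => f t omega : R)}}.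

Definition condA2 (kappaH beta : R) : Prop :=
  exists2 delta1 : R, 0 < delta1 & forall s t, T s -> T t ->
    norm1 (s - t) < delta1 ->
    `|sdev t - sdev s| + `|mean t - mean s| <= kappaH * norm1 (s - t) `^ beta.

Definition condA3 (kappaH beta : R) : Prop :=
  exists2 delta1 : R, 0 < delta1 & forall s s' t t', T s -> T s' -> T t -> T t' ->
    norm1 (s - s') < delta1 -> norm1 (t - t') < delta1 ->
    `|corr t s - corr t' s'|
      <= kappaH * (norm1 (t - t') `^ beta + norm1 (s - s') `^ beta).

(* The threshold for "epsilon small enough" does not depend on t. *)
Definition condA4 : Prop :=
  T 0 /\ exists kappa0 eps1 : R, [/\ 0 < kappa0, 0 < eps1 &
    forall (t : 'rV[R]_d) (eps : R), T t -> 0 < eps -> eps < eps1 ->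
      ((kappa0 * eps ^+ d)%:E * lebesgue_rV (@cball1 R d 0 1)
        <= lebesgue_rV (cball1 t eps `&` T))%E].

(* Probability for the completion of P: paths are only almost surely
   continuous, so events on the maximum are measurable up to a null set. *)
Definition pr (E : set Omega) : R := fine (mu_ext P E).

Definition condpr (E F : set Omega) : R := pr (E `&` F) / pr F.

Definition maxT (omega : Omega) : R := sup [set f t omega | t in T].

Definition w (b : R) : R := pr [set omega | b < maxT omega].

Definition points (M : nat) : set (M.-tuple 'rV[R]_d) :=
  [set u | forall i, T (tnth u i)].
Arguments points M : clear implicits.

Definition max_at M (u : M.-tuple 'rV[R]_d) (omega : Omega) : R :=
  sup [set f (tnth u i) omega | i in [set: 'I_M]].

(* The product measure makes the M i.i.d. uniform points independent of f. *)
Definition wM (M : nat) (x : R) : R :=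
  fine ((power_measure (uniform_on T) (n := M) \x P)%E
    [set p | points M p.1 /\ x < max_at p.1 p.2]).

Definition Xat M (u : M.-tuple 'rV[R]_d) (omega : Omega) : M.-tuple R :=
  [tuple f (tnth u i) omega | i < M].

Definition ptail M (g : R) (u : M.-tuple 'rV[R]_d) (i : 'I_M) : R :=
  fine (P [set omega | g < f (tnth u i) omega]).

Definition pU M (g : R) (u : M.-tuple 'rV[R]_d) (i : 'I_M) : R :=
  ptail g u i / \sum_(j < M) ptail g u j.

Definition Q'' M (g : R) (u : M.-tuple 'rV[R]_d) (B : set (M.-tuple R)) : R :=
  \sum_(i < M) pU g u i *
    (fine (P [set omega | B (Xat u omega) /\ g < f (tnth u i) omega])
       / ptail g u i).

Definition Lb M (g : R) (u : M.-tuple 'rV[R]_d) (x : M.-tuple R) : R :=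
  (\sum_(i < M) ptail g u i) / (\sum_(i < M) (g < tnth x i)%R%:R).

Definition Lb_law M (g : R) (A : set R) : \bar R :=
  (\int[power_measure (uniform_on T) (n := M)]_(u in points M)
     (Q'' g u [set x | A (Lb g u x)])%:E)%E.

End field.

Definition gamma {R : realType} (a b : R) : R := b - a / b.

(* Every constructor other than [Ret], [Bind] and [Repeat] is one function
   evaluation.  [Repeat p] runs independent copies of p until one returns
   [Some a], and returns a. *)
Inductive prog (R : realType) (d : nat) : Type -> Type :=
| Ret A of A : prog R d A
| Bind A B of prog R d A & (A -> prog R d B) : prog R d B
| Repeat A of prog R d (option A) : prog R d A
| Add of R & R : prog R d R
| Sub of R & R : prog R d R
| Mul of R & R : prog R d R
| Div of R & R : prog R d R
| Sqrt of R : prog R d R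
| Leq of R & R : prog R d bool
| Uniform : prog R d 'rV[R]_d
| Gauss : prog R d R
| Phi of R : prog R d R
| Mean of 'rV[R]_d : prog R d R
| Cov of 'rV[R]_d & 'rV[R]_d : prog R d R.

Arguments Ret {R d A}.
Arguments Add {R d}.
Arguments Sub {R d}.
Arguments Mul {R d}.
Arguments Div {R d}.
Arguments Sqrt {R d}.
Arguments Leq {R d}.
Arguments Uniform {R d}.
Arguments Gauss {R d}.
Arguments Phi {R d}.
Arguments Mean {R d}.
Arguments Cov {R d}.

Declare Scope prog_scope.
Delimit Scope prog_scope with prog.
Notation "x <-- p ; q" := (Bind p (fun x => q))
  (at level 95, p at level 90, q at level 200, right associativity) : prog_scope.

Section semantics.
Context {R : realType} {d : nat} (T : set 'rV[R]_d)
        (mu : 'rV[R]_d -> R) (C : 'rV[R]_d -> 'rV[R]_d -> R).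
Local Open Scope ereal_scope.

(* [expect p g] is the expectation of g (>= 0) at the output of p; the output
   law is A |-> expect p \1_A.  In [Repeat p], a failure has probability
   q = expect p 1_{None}, and the successful run is preceded by j failures. *)
Fixpoint expect A (p : prog R d A) : (A -> \bar R) -> \bar R :=
  match p in prog _ _ A0 return (A0 -> \bar R) -> \bar R with
  | Ret _ a => fun g => g a
  | Bind _ _ p k => fun g => expect p (fun a => expect (k a) g)
  | Repeat _ p => fun g =>
      (\sum_(0 <= j <oo) expect p (fun o => if o is None then 1 else 0) ^+ j)
      * expect p (fun o => if o is Some a then g a else 0)
  | Add x y => fun g => g (x + y)%R
  | Sub x y => fun g => g (x - y)%R
  | Mul x y => fun g => g (x * y)%R
  | Div x y => fun g => g (x / y)%R
  | Sqrt x => fun g => g (Num.sqrt x)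
  | Leq x y => fun g => g (x <= y)%R
  | Uniform => fun g => \int[uniform_on T]_(u in T) g u
  | Gauss => fun g => \int[normal_prob 0%R 1%R]_z g z
  | Phi x => fun g => g (Phi_normal x)
  | Mean t => fun g => g (mu t)
  | Cov s t => fun g => g (C s t)
  end.

(* Expected number of function evaluations: only [Repeat] makes it random. *)
Fixpoint cost A (p : prog R d A) : \bar R :=
  match p with
  | Ret _ _ => 0
  | Bind _ _ p k => cost p + expect p (fun a => cost (k a))
  | Repeat _ p =>
      (\sum_(0 <= j <oo) expect p (fun o => if o is None then 1 else 0) ^+ j)
      * cost p
  | _ => 1
  end.

End semantics.

Section procedure.
Context {R : realType} {d : nat}.
Local Notation prog := (prog R d).
Local Open Scope prog_scope.

Fixpoint foldP A S (k : A -> S -> prog S) (s : S) (l : seq A) : prog S :=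
  if l is a :: l' then s' <-- k a s ; foldP k s' l' else Ret s.

Fixpoint mapP A B (k : A -> prog B) (l : seq A) : prog (seq B) :=
  if l is a :: l' then b <-- k a ; bs <-- mapP k l' ; Ret (b :: bs)
  else Ret [::].

Definition repeatP A (n : nat) (p : prog A) : prog (seq A) :=
  mapP (fun _ => p) (iota 0 n).

Definition sumP (l : seq R) : prog R := foldP (fun x s => Add s x) 0 l.

(* truncates to the shorter of the two lists *)
Definition dotP (u v : seq R) : prog R :=
  foldP (fun p s => m <-- Mul p.1 p.2 ; Add s m) 0 (zip u v).

(* P(Z > x) for Z standard Gaussian; Phi is only evaluated at points >= 0. *)
Definition upper_tail (x : R) : prog R :=
  nonneg <-- Leq 0 x ;
  if nonneg then p <-- Phi x ; Sub 1 p else y <-- Sub 0 x ; Phi y.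

(* uniform on [0, 1], as 2 Phi(|Z|) - 1 *)
Definition unit_uniform : prog R :=
  z <-- Gauss ;
  nonneg <-- Leq 0 z ;
  y <-- (if nonneg then Ret z else Sub 0 z) ;
  p <-- Phi y ;
  q <-- Add p p ;
  Sub q 1.

(* Z given Z > x, by rejection.  For x > 1 (Marsaglia) the proposal
   r = sqrt(x^2 + z1^2 + z2^2) has density r exp(-(r^2 - x^2)/2) on r > x and
   is accepted with probability x / r. *)
Definition gauss_above (x : R) : prog R :=
  low <-- Leq x 1 ;
  if low then
    Repeat (z <-- Gauss ;
            fail <-- Leq z x ;
            Ret (if fail then None else Some z))
  else
    Repeat (z1 <-- Gauss ;
            z2 <-- Gauss ;
            v <-- unit_uniform ;
            s <-- dotP [:: x; z1; z2] [:: x; z1; z2] ;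
            r <-- Sqrt s ;
            t <-- Mul v r ;
            ok <-- Leq t x ;
            Ret (if ok then Some r else None)).

(* first index at which the partial sums of ws, added to acc, reach t *)
Fixpoint pick_from (i : nat) (acc t : R) (ws : seq R) : prog nat :=
  if ws is w :: ws' then
    acc' <-- Add acc w ;
    stop <-- Leq t acc' ;
    if stop then Ret i else pick_from i.+1 acc' t ws'
  else Ret i.

(* index i with probability proportional to ws_i; total is the sum of ws *)
Definition pick_index (ws : seq R) (total : R) : prog nat :=
  v <-- unit_uniform ;
  t <-- Mul v total ;
  pick_from 0 0 t ws.

(* Next row of the lower triangular Cholesky factor, given the row c of the
   matrix and the previous rows Ls (row j has length j + 1).  A zero pivot,
   possible for a singular covariance matrix, gives a zero entry. *)
Definition cholesky_row (c : seq R) (Ls : seq (seq R)) : prog (seq R) :=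
  row <-- foldP (fun p row =>
      s <-- dotP row p.2 ;
      num <-- Sub p.1 s ;
      zero <-- Leq (last 0 p.2) 0 ;
      l <-- (if zero then Ret 0 else Div num (last 0 p.2)) ;
      Ret (rcons row l)) [::] (zip c Ls) ;
  s <-- dotP row row ;
  v <-- Sub (nth 0 c (size Ls)) s ;
  l <-- Sqrt v ;
  Ret (rcons row l).

Definition cholesky (Cs : seq (seq R)) : prog (seq (seq R)) :=
  foldP (fun c Ls => row <-- cholesky_row c Ls ; Ret (rcons Ls row)) [::] Cs.

Definition gauss_vector (ms : seq R) (Cs : seq (seq R)) : prog (seq R) :=
  Ls <-- cholesky Cs ;
  zs <-- repeatP (size ms) Gauss ;
  mapP (fun p => s <-- dotP p.2 zs ; Add p.1 s) (zip ms Ls).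

(* One value of L_b(U).  X given X_i > g is obtained from an unconditioned
   Gaussian vector Y and an independent x_i with the law of X_i given X_i > g,
   as X_j = Y_j + C(U_i,U_j) (x_i - Y_i) / C(U_i,U_i). *)
Definition replication (a b : R) (M : nat) : prog R :=
  q <-- Div a b ;
  g <-- Sub b q ;
  us <-- repeatP M Uniform ;
  ms <-- mapP Mean us ;
  Cs <-- mapP (fun s => mapP (fun t => Cov s t) us) us ;
  sds <-- mapP (fun t => c <-- Cov t t ; Sqrt c) us ;
  xs <-- mapP (fun p => y <-- Sub g p.1 ; Div y p.2) (zip ms sds) ;
  ps <-- mapP upper_tail xs ;
  total <-- sumP ps ;
  i <-- pick_index ps total ;
  z <-- gauss_above (nth 0 xs i) ;
  sz <-- Mul (nth 0 sds i) z ;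
  xi <-- Add (nth 0 ms i) sz ;
  Y <-- gauss_vector ms Cs ;
  delta <-- Sub xi (nth 0 Y i) ;
  k <-- Div delta (nth 0 (nth [::] Cs i) i) ;
  X <-- mapP (fun p => t <-- Mul p.1 k ; Add p.2 t) (zip (nth [::] Cs i) Y) ;
  N <-- foldP (fun x n => below <-- Leq x g ; if below then Ret n else Add n 1)
        0 X ;
  Div total N.

Definition average (n : nat) (p : prog R) : prog R :=
  xs <-- repeatP n p ;
  s <-- sumP xs ;
  Div s n%:R.

Definition procedureA (a b : R) (M n : nat) : prog R :=
  average n (replication a b M).

End procedure.

(* [rep eps delta b] is one replication of the estimator of w b and
   [n eps delta b] the number of replications; eps0 and b1 bound the range in
   which the scheme is run. *)
Definition fpras {R : realType} {d : nat} (T : set 'rV[R]_d)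
    (mu : 'rV[R]_d -> R) (C : 'rV[R]_d -> 'rV[R]_d -> R)
    (w : R -> R) (eps0 b1 : R)
    (rep : R -> R -> R -> prog R d R) (n : R -> R -> R -> nat) : Prop :=
  [/\ forall b, b1 <= b -> 0 < w b,
      w b @[b --> +oo] --> (0 : R) &
      exists q q1 q2 k1 k2 : R,
        [/\ 0 <= q, 0 <= q1, 0 <= q2, 0 < k1 & 0 < k2] /\
        forall eps delta b : R, 0 < eps -> eps <= eps0 ->
          0 < delta -> delta < 1 -> b1 <= b ->
          let alg := average (n eps delta b) (rep eps delta b) in
          let bound := eps `^ (- q1) * delta `^ (- q2) * `|ln (w b)| `^ q in
          [/\ (0 < n eps delta b)%N,
              ((1 - delta)%:E <= expect T mu C alg
                 (fun y => (\1_[set y | `|y - w b| <= eps * w b] y)%:E))%E,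
              ((k1 * bound)%:E <= cost T mu C alg)%E &
              (cost T mu C alg <= (k2 * bound)%:E)%E]].

(* Main.v *)
Require Import Defs.
From HB Require Import structures.
From mathcomp Require Import all_boot all_order all_algebra.
From mathcomp Require Import finmap.
From mathcomp Require Import all_classical all_reals all_analysis measurable_realfun.
From mathcomp Require Import ring lra zify.

Set Implicit Arguments.
Unset Strict Implicit.
Unset Printing Implicit Defensive.
Import Order.TTheory GRing.Theory Num.Theory.
Import numFieldNormedType.Exports.
Local Open Scope classical_set_scope.
Local Open Scope ring_scope.

(* Bias.  Put eta = a / b.  The hypothesis on the maximum gives
   w (b - eta) <= (1 + eps / 2) w b.  By chaining, outside an event whose
   probability is negligible with respect to eps w b (as w b >= c exp (- C b^2)),
   paths vary by at most eta on balls of radius of order eta^(4 / beta).  Hence a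
   path exceeding b exceeds b - eta on a ball of volume p of order
   eta^(4 d / beta), and M uniform points miss that ball with probability
   (1 - p)^M <= 1 / (M p) <= eps / 8.

   Law of one replication.  The vector X computed by the program is an affine
   image of M + 1 independent standard normals.  Its covariance matrix is that of
   f at the points U, because the Cholesky factor has the right Gram matrix, and
   its i-th coordinate is the one that was drawn above the threshold.  By the
   Cramer-Wold device X has the law of f at U.  With S the sum of the tails and N
   the number of coordinates above the threshold, the output thus has the law of
   S / N under the density N / S with respect to the joint law of U and f: its
   mean is w_M (gamma) and its second moment is at most M w (gamma)^2.

   Chebyshev's inequality then asks for n of order M^2 eps^-2 delta^-1.  One
   replication costs M^3 up to constants, the lower bound coming from the Cholesky
   factorization.  Since |ln (w b)| is of order b^2, M is of order
   eps^-(1 + kappa) |ln (w b)|^((rho + 1) kappa / 2) with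
   kappa = (4 + 4 v) d / beta. *)

(** * Measures and the standard normal law *)

(** The exponent 4/beta comes from the choice of the chaining scale. By (A2) and (A3) an increment
    across a distance 2^-k has variance of order 2^(-k beta), which is r^(4k) for r = 2^(-beta/4).
    Allowing increments of size r^k, the square root of the deviation r^(2k), leaves tails exp(-K
    r^(-2k)), doubly exponential in k: they absorb any exponential number of grid points, and at a
    scale r^k of order eta the total error is exp(-c / eta^2). As eta is at most of order eps b^-2,
    this error beats exp(-C b^2) and eps at once. Two obstacles shape the rest. Programs handle
    lists and branch on reals, so their semantics is a functional on arbitrary functions and not a
    measure; laws are recovered by testing against measurable functions, and integrands are kept
    nonnegative wherever possible to avoid integrability conditions. The field is measurable in
    omega for each fixed t only; Fubini for random points needs a jointly measurable version, which
    the continuity of paths provides. *)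

Section functional.
Local Open Scope ereal_scope.
Context d (T : measurableType d) (R : realType).
Variable (mu : {measure set T -> \bar R}) (I : (T -> \bar R) -> \bar R).
Hypothesis I_indic : forall A, measurable A -> I (fun x => (\1_A x)%:E) = mu A.
Hypothesis I_add : forall f g : T -> \bar R, measurable_fun setT f -> measurable_fun setT g ->
  (forall x, 0 <= f x) -> (forall x, 0 <= g x) ->
  I (fun x => f x + g x) = I f + I g.
Hypothesis I_scale : forall (k : R) (f : T -> \bar R), (0 <= k)%R -> measurable_fun setT f ->
  (forall x, 0 <= f x) -> I (fun x => k%:E * f x) = k%:E * I f.
Hypothesis I_lim : forall f_ : nat -> T -> \bar R,
  (forall n, measurable_fun setT (f_ n)) -> (forall n x, 0 <= f_ n x) ->
  (forall x, nondecreasing_seq (f_ ^~ x)) ->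
  I (fun x => limn (f_ ^~ x)) = limn (fun n => I (f_ n)).

Import HBNNSimple.

(** Agreement on indicators extends to simple functions by additivity and homogeneity, then to [f]
    along its simple approximations by [I_lim]. Changes of density and of variable below come from a
    suitable choice of [I]. *)
Lemma functional_integral f : measurable_fun setT f -> (forall x, 0 <= f x) ->
  I f = \int[mu]_x f x.
Proof.
move=> mf f0; pose f_ := nnsfun_approx measurableT mf.
have fE : f = fun x => limn (fun n => (f_ n x)%:E).
  apply/funext => x; apply/esym/cvg_lim => //.
  by apply: cvg_nnsfun_approx => // y _; exact: f0.
rewrite fE I_lim; last 3 first.
- by move=> n; exact/measurable_EFinP.
- by move=> n x; rewrite lee_fin.
- by move=> x m n mn; rewrite lee_fin; exact/lefP/nd_nnsfun_approx.
rewrite monotone_convergence//; last 3 first.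
- by move=> n; exact/measurable_EFinP.
- by move=> n x _; rewrite lee_fin.
- by move=> x _ m n mn; rewrite lee_fin; exact/lefP/nd_nnsfun_approx.
congr (limn _); apply/funext => n.
(* A simple function is written as a sum over a list of values, on which the functional is computed
   by induction. *)
have [s [k0 gE]] : exists s : seq R, (forall k, k \in s -> (0 <= k)%R) /\
    (fun x => (f_ n x)%:E) = (fun x => \sum_(k <- s)
    (k * \1_(f_ n @^-1` [set k]) x)%:E) :> (T -> \bar R).
  exists (enum_fset (fset_set (range (f_ n)))); split.
    by move=> k; rewrite in_fset_set// inE => -[x _ <-].
  by apply/funext => x; rewrite fimfunE fsbig_finite//= sumEFin.
rewrite gE.
have mset k : measurable (f_ n @^-1` [set k]) by exact: measurable_sfunP.
have mk k : measurable_fun setT (fun x => (k * \1_(f_ n @^-1` [set k]) x)%:E).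
  by apply/measurable_EFinP/measurable_funM => //; exact: measurable_indic.
elim: s k0 {gE} => [_|k s IH k0].
  under eq_fun do rewrite big_nil.
  rewrite integral0; apply: (@eq_trans _ _ (mu set0)); last exact: measure0.
  by rewrite -(I_indic measurable0); congr I; apply/funext=> x; rewrite indic0.
have ms : measurable_fun setT (fun x =>
    \sum_(j <- s) (j * \1_(f_ n @^-1` [set j]) x)%:E).
  by apply: emeasurable_sum.
have s0 x : 0 <= \sum_(j <- s) (j * \1_(f_ n @^-1` [set j]) x)%:E.
  rewrite big_seq; apply: sume_ge0 => j js.
  by rewrite lee_fin mulr_ge0// ?k0// inE js orbT.
have k1 : (0 <= k)%R by apply: k0; rewrite inE eqxx.
under eq_fun do rewrite big_cons.
have kk x : 0 <= (k * \1_(f_ n @^-1` [set k]) x)%:E :> \bar R.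
  by rewrite lee_fin mulr_ge0.
rewrite I_add// ge0_integralD// IH; last by move=> j js; apply: k0; rewrite inE js orbT.
congr (_ + _); under eq_fun do rewrite EFinM.
rewrite I_scale//; first last.
  by apply/measurable_EFinP; exact: measurable_indic.
rewrite I_indic// ge0_integralZl_EFin//; last first.
  by apply/measurable_EFinP; exact: measurable_indic.
by rewrite integral_indic// setIT.
Qed.

End functional.

Section integral_lemmas.
Local Open Scope ereal_scope.

(** The integral of a nonnegative function is a supremum over the simple functions below it, so
    monotonicity asks for no measurability. Expectations of programs are taken at arbitrary
    functions and rely on this. *)
Lemma ge0_le_integral_nonmeas d (T : measurableType d) (R : realType)
    (mu : {measure set T -> \bar R}) (D : set T) (f g : T -> \bar R) :
  (forall x, D x -> 0 <= f x) -> (forall x, D x -> f x <= g x) ->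
  \int[mu]_(x in D) f x <= \int[mu]_(x in D) g x.
Proof.
move=> f0 fg; rewrite !ge0_integralE//; last by move=> x Dx; apply: le_trans (fg _ Dx); exact: f0.
apply: le_ereal_sup => _ [h/= hf <-]; exists h => //= x; apply: (le_trans (hf x)).
by rewrite !patchE; case: ifPn => //; rewrite inE => /fg.
Qed.

Lemma ge0_integral_density d (T : measurableType d) (R : realType)
    (mu nu : {measure set T -> \bar R}) (g : T -> R) :
  measurable_fun setT g -> (forall x, (0 <= g x)%R) ->
  (forall A, measurable A -> nu A = \int[mu]_(x in A) (g x)%:E) ->
  forall f, measurable_fun setT f -> (forall x, 0 <= f x) ->
  \int[nu]_x f x = \int[mu]_x (f x * (g x)%:E).
Proof.
move=> mg' g0 nuE f mf f0; apply/esym.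
have mg : measurable_fun setT (fun x => (g x)%:E) by exact/measurable_EFinP.
have eg0 x : 0 <= (g x)%:E by rewrite lee_fin.
apply: (functional_integral (I := fun f => \int[mu]_x (f x * (g x)%:E))) => //.
- move=> A mA; rewrite nuE// [in RHS]integral_mkcond; apply: eq_integral => x _.
  by rewrite patchE indicE; case: ifPn; rewrite (mul1e,mul0e).
- move=> f1 f2 mf1 mf2 f10 f20; rewrite -ge0_integralD//.
  + by apply: eq_integral => x _; rewrite ge0_muleDl.
  + by move=> x _; rewrite mule_ge0.
  + exact: emeasurable_funM.
  + by move=> x _; rewrite mule_ge0.
  + exact: emeasurable_funM.
- move=> k h k0 mh h0; rewrite -ge0_integralZl_EFin//.
  + by apply: eq_integral => x _; rewrite muleA.
  + by move=> x _; rewrite mule_ge0.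
  + exact: emeasurable_funM.
- move=> f_ mf_ f_0 ndf_; rewrite -monotone_convergence//.
  + apply: eq_integral => x _; apply/esym/cvg_lim => //.
    by apply: cvgeZr => //; apply: ereal_nondecreasing_is_cvgn.
  + by move=> n; exact: emeasurable_funM.
  + by move=> n x _; rewrite mule_ge0.
  + by move=> x _ m n mn; apply: lee_wpmul2r => //; exact: ndf_.
Qed.

End integral_lemmas.

Lemma measurable_preimageT d1 d2 (X : measurableType d1) (Y : measurableType d2)
    (phi : X -> Y) (A : set Y) : measurable_fun setT phi -> measurable A ->
  measurable [set x | A (phi x)].
Proof. by move=> mphi mA; rewrite -[X in measurable X]setTI; exact: mphi. Qed.

(** Carrying the measurability proof as an argument lets a measure structure be attached to the
    name. The same device serves [uniform_law], [density_measure] and [total_one]. *)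
Definition image_measure d1 d2 (X : measurableType d1) (Y : measurableType d2)
    (R : realType) (mu : {measure set X -> \bar R}) (phi : X -> Y)
    (mphi : measurable_fun setT phi) : set Y -> \bar R := pushforward mu phi.

Section image_measure.
Context d1 d2 (X : measurableType d1) (Y : measurableType d2) (R : realType).
Variables (mu : {measure set X -> \bar R}) (phi : X -> Y).
Variable (mphi : measurable_fun setT phi).
Local Notation nu := (image_measure mu mphi).

Let nu0 : nu set0 = 0%E.
Proof. by rewrite /image_measure /pushforward preimage_set0 measure0. Qed.

Let nu_ge0 A : (0 <= nu A)%E.
Proof. exact: measure_ge0. Qed.

Let mpre A : measurable A -> measurable (phi @^-1` A).
Proof. by move=> mA; rewrite -[X in measurable X]setTI; exact: mphi. Qed.

Let nu_sigma_additive : semi_sigma_additive nu.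
Proof.
move=> F mF tF mUF; rewrite /image_measure /pushforward preimage_bigcup.
apply: measure_semi_sigma_additive.
- by move=> i; exact: mpre.
- by apply/trivIsetP => i j _ _ ij; rewrite -preimage_setI;
    move/trivIsetP : tF => /(_ _ _ _ _ ij) ->//; rewrite preimage_set0.
- by rewrite -preimage_bigcup; exact: mpre.
Qed.

HB.instance Definition _ := isMeasure.Build _ _ _ nu nu0 nu_ge0 nu_sigma_additive.

Lemma integral_image_measure (f : Y -> \bar R) :
  measurable_fun setT f -> (forall y, 0 <= f y)%E ->
  (\int[nu]_y f y = \int[mu]_x f (phi x))%E.
Proof.
move=> mf f0; apply/esym.
apply: (functional_integral (I := fun f => (\int[mu]_x f (phi x))%E)) => //.
- move=> A mA; transitivity (\int[mu]_x (\1_(phi @^-1` A) x)%:E)%E => //.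
  by rewrite integral_indic ?setIT//; exact: mpre.
- by move=> h k mh mk h0 k0; rewrite ge0_integralD//; exact: measurableT_comp.
- by move=> k h k0 mh h0; rewrite ge0_integralZl_EFin//; exact: measurableT_comp.
- move=> f_ mf_ f_0 nd; rewrite monotone_convergence//.
  + by move=> n; exact: measurableT_comp.
Qed.

End image_measure.

Section affine.
Context (R : realType).
Local Notation leb := (@lebesgue_measure R).

Lemma measurable_affine (a b : R) : measurable_fun setT (fun x : R => a * x + b).
Proof. by apply: measurable_funD => //; exact: measurable_funM. Qed.

Let measurable_affineR (a b : R) :
  measurable_fun setT (fun x : measurableTypeR R => (a * x + b : measurableTypeR R)).
Proof. exact: measurable_affine. Qed.

(** The image measure scaled by |a| agrees with Lebesgue measure on half-open intervals, which
    determine it. For a < 0 the preimage of such an interval is closed at the other end and has the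
    expected length. *)
Lemma lebesgue_affine (a b : R) (A : set R) : a != 0 -> measurable A ->
  (leb [set x | A (a * x + b)%R] = `|a|^-1%:E * leb A)%E.
Proof.
move=> a0 mA.
have na : 0 <= `|a| by [].
suff -> : leb A = (`|a|%:E * leb [set x | A (a * x + b)%R])%E.
  by rewrite muleA -EFinM mulVf ?normr_eq0// mul1e.
pose m : {measure set (measurableTypeR R) -> \bar R} :=
  mscale (NngNum na) (image_measure leb (@measurable_affineR a b)).
transitivity (m A) => //; apply: (@lebesgue_measure_unique R m) => // _ [[c e]] _ <-.
rewrite (_ : m _ = (`|a|%:E * leb [set x | `]c, e]%classic (a * x + b)%R])%E)//.
rewrite lebesgue_measure_itv/= lte_fin.
have [lta|gta|] := ltgtP a 0; last by move/eqP; rewrite (negbTE a0).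
- rewrite (_ : [set x | _] = `[(e - b) / a, (c - b) / a[%classic); last first.
    apply/seteqP; split => x /=; rewrite !in_itv/= => /andP[h1 h2]; apply/andP; split.
    + by rewrite ler_ndivrMr// mulrC; lra.
    + by rewrite ltr_ndivlMr// mulrC; lra.
    + by move: h2; rewrite ltr_ndivlMr// mulrC; lra.
    + by move: h1; rewrite ler_ndivrMr// mulrC; lra.
  rewrite lebesgue_measure_itv/= lte_fin ltr_nM2r ?invr_lt0// ltrBlDr subrK.
  case: ifPn => ce; last by rewrite mule0.
  by rewrite -!EFinD -EFinM ltr0_norm//; congr EFin; field; exact: a0.
- rewrite (_ : [set x | _] = `](c - b) / a, (e - b) / a]%classic); last first.
    apply/seteqP; split => x /=; rewrite !in_itv/= => /andP[h1 h2]; apply/andP; split.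
    + by rewrite ltr_pdivrMr// mulrC; lra.
    + by rewrite ler_pdivlMr// mulrC; lra.
    + by move: h1; rewrite ltr_pdivrMr// mulrC; lra.
    + by move: h2; rewrite ler_pdivlMr// mulrC; lra.
  rewrite lebesgue_measure_itv/= lte_fin ltr_pM2r ?invr_gt0// ltrBlDr subrK.
  case: ifPn => ce; last by rewrite mule0.
  by rewrite -!EFinD -EFinM gtr0_norm//; congr EFin; field; exact: a0.
Qed.

Lemma integral_affine (a b : R) (f : R -> \bar R) : a != 0 ->
  measurable_fun setT f -> (forall x, 0 <= f x)%E ->
  (\int[leb]_x f (a * x + b)%R = `|a|^-1%:E * \int[leb]_x f x)%E.
Proof.
move=> a0 mf f0.
have na : 0 <= `|a|^-1 by rewrite invr_ge0.
rewrite -(@integral_image_measure _ _ _ _ _ leb _ (@measurable_affineR a b))//.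
transitivity (\int[mscale (NngNum na) leb]_x f x)%E.
  by apply: eq_measure_integral => A mA _; rewrite /mscale/=; exact: lebesgue_affine.
by rewrite ge0_integral_mscale.
Qed.

End affine.

(** Locked so that simplification leaves the density folded; [std_pdfE] gives the formula. *)
HB.lock Definition std_pdf (R : realType) (x : R) : R := normal_pdf 0 1 x.

Section std_normal.
Context (R : realType).
Local Notation leb := (@lebesgue_measure R).

Local Notation std_pdf := (@std_pdf R).

Definition std_normal := @normal_prob R 0 1.
HB.instance Definition _ := Probability.on std_normal.

Lemma std_pdfE x : std_pdf x = normal_peak 1 * expR (- x ^+ 2 / 2).
Proof.
rewrite std_pdf.unlock normal_pdfE ?oner_eq0// /normal_fun subr0 expr1n.
by rewrite -mulr_natr mul1r.
Qed.

Lemma std_pdf_gt0 x : 0 < std_pdf x.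
Proof. by rewrite std_pdfE mulr_gt0 ?expR_gt0// normal_peak_gt0 ?oner_eq0. Qed.

Lemma measurable_std_pdf : measurable_fun setT std_pdf.
Proof. by rewrite std_pdf.unlock; exact: measurable_normal_pdf. Qed.

Lemma integral_std_normal (f : R -> \bar R) :
  measurable_fun setT f -> (forall x, 0 <= f x)%E ->
  (\int[std_normal]_x f x = \int[leb]_x (f x * (std_pdf x)%:E))%E.
Proof.
move=> mf f0; apply: (@ge0_integral_density _ _ _ leb std_normal std_pdf) => //.
- exact: measurable_std_pdf.
- by move=> x; exact/ltW/std_pdf_gt0.
- by rewrite std_pdf.unlock.
Qed.

Lemma std_normalE (A : set R) : measurable A ->
  std_normal A = (\int[leb]_(x in A) (std_pdf x)%:E)%E.
Proof. by rewrite std_pdf.unlock. Qed.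

(** The affine image z -> m + s z of the standard law also covers the Dirac case s = 0, so later
    computations never separate degenerate variances. For s != 0 it is the affine change of variable
    in the density. *)
Lemma normal_lawE (m s : R) (A : set R) : measurable A ->
  normal_law m s A = std_normal [set z | A (m + s * z)].
Proof.
move=> mA; rewrite /normal_law; case: ifPn => [/eqP ->|s0].
  under eq_set do rewrite mul0r addr0.
  rewrite diracE; have [Am|Am] := boolP (m \in A).
    rewrite (_ : [set _ | _] = setT) ?probability_setT//.
    by apply/seteqP; split => // z _; rewrite inE in Am.
  rewrite (_ : [set _ | _] = set0) ?measure0//.
  by apply/seteqP; split => // z /= Amm; move: Am; rewrite notin_setE; exact.
have mpre : measurable [set z | A (m + s * z)].
  apply: (@measurable_preimageT _ _ _ _ (fun z : R => m + s * z)) => //.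
  by apply: measurable_funD => //; exact: measurable_funM.
rewrite std_normalE//.
pose h (x : R) := ((\1_A x)%:E * (normal_pdf m s x)%:E)%E.
have mh : measurable_fun setT h.
  apply: emeasurable_funM; first exact/measurable_EFinP/measurable_indic.
  by apply/measurable_EFinP; exact: measurable_normal_pdf.
have h0 x : (0 <= h x)%E by rewrite mule_ge0// lee_fin normal_pdf_ge0.
transitivity (`|s|%:E * \int[leb]_z h (s * z + m)%R)%E.
  rewrite integral_affine// muleA -EFinM mulfV ?normr_eq0// mul1e.
  rewrite /normal_prob integral_mkcond; apply: eq_integral => x _.
  by rewrite /h patchE indicE; case: ifPn; rewrite ?mul1e ?mul0e.
rewrite -ge0_integralZl_EFin//; last first.
  by apply: measurableT_comp => //; exact: measurable_affine.
rewrite [in RHS]integral_mkcond; apply: eq_integral => z _.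
rewrite patchE /h addrC indicE.
have -> : (m + s * z \in A) = (z \in [set z | A (m + s * z)]) by apply/idP/idP; rewrite !in_setE.
case: ifPn; rewrite ?mul1e ?mul0e ?mule0// => _; rewrite -EFinM; congr EFin.
rewrite std_pdfE normal_pdfE// /normal_peak /normal_fun mulrA; congr (_ * expR _).
  rewrite expr1n mul1r -mulrnAr sqrtrM ?sqr_ge0// sqrtr_sqr invfM mulrA divff ?normr_eq0//.
  by rewrite mul1r.
rewrite addrAC subrr add0r exprMn -[s ^+ 2 *+ 2]mulr_natr; field; exact: s0.
Qed.

End std_normal.

Section std_normal_facts.
Context (R : realType).
Local Notation leb := (@lebesgue_measure R).
Local Notation g := (@std_normal R).
Local Notation phi := (@std_pdf R).

Lemma std_pdf_ge0 x : 0 <= phi x.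
Proof. exact/ltW/std_pdf_gt0. Qed.

Lemma std_pdfN x : phi (- x) = phi x.
Proof. by rewrite !std_pdfE sqrrN. Qed.

Lemma measurable_std_pdf_EFin : measurable_fun setT (fun x => (phi x)%:E).
Proof. by apply/measurable_EFinP; exact: measurable_std_pdf. Qed.

(** The product of two standard densities depends only on the distance to the origin; rotation
    invariance enters through this identity. *)
Lemma std_pdfM x y x' y' : x ^+ 2 + y ^+ 2 = x' ^+ 2 + y' ^+ 2 ->
  phi x * phi y = phi x' * phi y'.
Proof.
move=> e; rewrite !std_pdfE mulrACA [RHS]mulrACA -!expRD; congr (_ * expR _).
lra.
Qed.

Lemma ge0_integral_lebZl (c : \bar R) (F : R -> R) : measurable_fun setT F ->
  (forall x, 0 <= F x) -> (0 <= c)%E ->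
  (\int[leb]_x (c * (F x)%:E) = c * \int[leb]_x (F x)%:E)%E.
Proof.
move=> mF F0 c0; rewrite ge0_integralZl//; first exact/measurable_EFinP.
by move=> x _; rewrite lee_fin.
Qed.

Lemma integral_std_pdf_affine a b : a != 0 ->
  (\int[leb]_x (phi (a * x + b))%:E = `|a|^-1%:E)%E.
Proof.
move=> a0; rewrite (@integral_affine _ a b (fun x => (phi x)%:E))//.
- by rewrite -std_normalE// probability_setT mule1.
- exact: measurable_std_pdf_EFin.
- by move=> x; rewrite lee_fin std_pdf_ge0.
Qed.

Lemma integral_std_normalN (h : R -> \bar R) :
  measurable_fun setT h -> (forall x, 0 <= h x)%E ->
  (\int[g]_x h (- x)%R = \int[g]_x h x)%E.
Proof.
move=> mh h0; rewrite !integral_std_normal//; last exact: measurableT_comp.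
have := @integral_affine R (-1) 0 (fun x => h x * (phi x)%:E)%E.
rewrite normrN normr1 invr1 mul1e => <-.
- by apply: eq_integral => x _; rewrite addr0 mulN1r std_pdfN.
- by rewrite oppr_eq0 oner_eq0.
- by apply: emeasurable_funM => //; exact: measurable_std_pdf_EFin.
- by move=> x; rewrite mule_ge0// lee_fin std_pdf_ge0.
Qed.

(** Symmetry of the standard law. It serves the case b = 0 of the rotation below, where sqrt(a^2) is
    |a|. *)
Lemma integral_std_normal_abs (h : R -> \bar R) (a : R) :
  measurable_fun setT h -> (forall x, 0 <= h x)%E ->
  (\int[g]_x h (`|a| * x)%R = \int[g]_x h (a * x)%R)%E.
Proof.
move=> mh h0; have [a0|a0] := leP 0 a; first by rewrite ger0_norm.
rewrite ltr0_norm// -[LHS]integral_std_normalN.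
- by under eq_integral do rewrite mulrNN.
- by apply: measurableT_comp => //; exact: measurable_funM.
- by [].
Qed.

(* The change of variables [w = a x + b y] in the inner integral, followed by
   the identity [x^2 + ((w - a x) / b)^2 = (s x / b - a w / (s b))^2 + (w / s)^2]
   with [s^2 = a^2 + b^2]. *)
Lemma std_normal_rotation (a b : R) (h : R -> \bar R) :
  measurable_fun setT h -> (forall x, 0 <= h x)%E ->
  (\int[g]_x \int[g]_y h (a * x + b * y)%R
   = \int[g]_z h (Num.sqrt (a ^+ 2 + b ^+ 2) * z)%R)%E.
Proof.
move=> mh h0.
have [->|b0] := eqVneq b 0.
  rewrite expr0n addr0 sqrtr_sqr integral_std_normal_abs//.
  apply: eq_integral => x _; under eq_integral do rewrite mul0r addr0.
  by rewrite integral_cst// [X in (_ * X)%E](probability_setT g) mule1.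
set s := Num.sqrt _.
have s2 : s ^+ 2 = a ^+ 2 + b ^+ 2 by rewrite sqr_sqrtr// addr_ge0// sqr_ge0.
have s0 : 0 < s.
  by rewrite sqrtr_gt0 ltr_pwDr ?sqr_ge0// exprn_even_gt0.
have sn0 : s != 0 by rewrite gt_eqF.
move: s2 s0 sn0; move: (s) => {}s s2 s0 sn0.
have e1 : (a ^+ 2 + b ^+ 2) / s ^+ 2 = 1 by rewrite -s2 divff// expf_neq0.
(* The kernel is drawn from an existential to stay opaque; [kdef] unfolds it on demand. *)
have [k kdef] : exists k : R -> R -> R, forall x w, k x w = phi x * phi ((w - a * x) / b).
  by exists (fun x w => phi x * phi ((w - a * x) / b)).
have mk : measurable_fun setT (fun p : R * R => (k p.1 p.2)%:E).
  under eq_fun do rewrite kdef.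
  apply/measurable_EFinP; apply: measurable_funM.
    by apply: measurableT_comp => //; exact: measurable_std_pdf.
  apply: measurableT_comp => //; first exact: measurable_std_pdf.
  apply: measurable_funM => //; apply: measurable_funB => //.
  by apply: measurable_funM.
have k0 x w : 0 <= k x w by rewrite kdef mulr_ge0// std_pdf_ge0.
have mhx (x : R) : measurable_fun [set: R] (fun w : R => h w * (phi ((w - a * x) / b))%:E)%E.
  apply: emeasurable_funM; [exact: mh|apply/measurable_EFinP].
  apply: measurableT_comp; first exact: measurable_std_pdf.
  by apply: measurable_funM => //; exact: measurable_funB.
have inner x : (\int[g]_y h (a * x + b * y)%R =
    `|b|^-1%:E * \int[leb]_w (h w * (phi ((w - a * x) / b))%:E))%E.
  rewrite integral_std_normal//; last first.
    by apply: measurableT_comp => //; apply: measurable_funD => //; exact: measurable_funM.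
  rewrite -(@integral_affine R b (a * x) _ b0 (mhx x)); last first.
    by move=> w; rewrite mule_ge0// lee_fin std_pdf_ge0.
    apply: eq_integral => y _.
    have -> : (b * y + a * x - a * x) / b = y by field.
    by rewrite addrC.
under eq_integral do rewrite inner.
have mhk : measurable_fun setT (fun p : R * R => h p.2 * (k p.1 p.2)%:E)%E.
  by apply: emeasurable_funM => //; exact: measurableT_comp.
have bV : 0 <= `|b|^-1 by rewrite invr_ge0.
have mI : measurable_fun setT (fun x => `|b|^-1%:E *
    \int[leb]_w (h w * (phi ((w - a * x) / b))%:E))%E.
  apply: measurable_funeM.
  apply: (@measurable_fun_fubini_tonelli_F _ _ _ _ R leb
    (fun p : R * R => h p.2 * (phi ((p.2 - a * p.1) / b))%:E)%E) => //.
    apply: emeasurable_funM; first exact: measurableT_comp.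
    apply/measurable_EFinP.
    apply: measurableT_comp => //; first exact: measurable_std_pdf.
    by apply: measurable_funM => //; apply: measurable_funB => //; exact: measurable_funM.
  by move=> p; rewrite mule_ge0// lee_fin std_pdf_ge0.
rewrite (integral_std_normal mI); last first.
  move=> x; rewrite mule_ge0// integral_ge0// => w _.
  by rewrite mule_ge0// lee_fin std_pdf_ge0.
clear mI; transitivity (`|b|^-1%:E * \int[leb]_x \int[leb]_w (h w * (k x w)%:E))%E.
  rewrite -(@ge0_integralZl_EFin _ _ _ _ _ measurableT _ _ _ _ bV); last first.
  - apply: (@measurable_fun_fubini_tonelli_F _ _ _ _ R leb
      (fun p : R * R => h p.2 * (k p.1 p.2)%:E)%E) => //.
    by move=> p; rewrite mule_ge0// lee_fin.
  - by move=> x _; apply: integral_ge0 => w _; rewrite mule_ge0// lee_fin.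
  apply: eq_integral => x _; rewrite -muleA; congr (_ * _)%E.
  rewrite -(@ge0_integralZr _ _ R leb _ measurableT _ (mhx x)) ?lee_fin ?std_pdf_ge0//; last first.
    by move=> w _; rewrite mule_ge0// lee_fin std_pdf_ge0.
  apply: eq_integral => w _; rewrite -muleA -EFinM; congr (_ * _%:E)%E.
  by rewrite kdef mulrC.
have fub : (\int[leb]_x \int[leb]_w (h w * (k x w)%:E) =
            \int[leb]_w \int[leb]_x (h w * (k x w)%:E))%E.
  apply: (@fubini_tonelli _ _ _ _ R leb leb
    (fun p : R * R => h p.2 * (k p.1 p.2)%:E)%E) => //.
  by move=> p; rewrite mule_ge0// lee_fin.
rewrite fub.
have mkw (w : R) : measurable_fun [set: R] (fun x : R => k x w).
  under eq_fun do rewrite kdef.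
  apply: measurable_funM; first exact: measurable_std_pdf.
  apply: (@measurableT_comp _ _ _ _ _ _ phi); first exact: measurable_std_pdf.
  rewrite (_ : (fun x => _) = fun x : R => - a / b * x + w / b).
    exact: measurable_affine.
  by apply/funext => x; field.
have innerx w : (\int[leb]_x (h w * (k x w)%:E) =
    (`|b| / s)%:E * (h w * (phi (s^-1 * w + 0))%:E))%E.
  rewrite (ge0_integral_lebZl (mkw w) (k0^~ w) (h0 w)).
  have kE x : k x w = phi (s^-1 * w + 0) * phi (s / b * x + (- (a * w) / (s * b))).
    rewrite kdef; apply: std_pdfM.
    transitivity ((s ^+ 2 * x ^+ 2 - 2 * a * w * x + w ^+ 2) / b ^+ 2).
      by rewrite s2; field.
    have -> : (s^-1 * w + 0) ^+ 2 + (s / b * x + - (a * w) / (s * b)) ^+ 2 =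
      (s ^+ 2 * x ^+ 2 - 2 * a * w * x + (a ^+ 2 + b ^+ 2) / s ^+ 2 * w ^+ 2) / b ^+ 2.
      by field; rewrite b0 sn0.
    by rewrite e1 mul1r.
  under eq_integral do rewrite kE EFinM.
  have mpa : measurable_fun [set: R] (fun x : R => phi (s / b * x + - (a * w) / (s * b))).
    apply: (@measurableT_comp _ _ _ _ _ _ phi); first exact: measurable_std_pdf.
    exact: measurable_affine.
  rewrite (ge0_integral_lebZl mpa); first last.
  - by rewrite lee_fin std_pdf_ge0.
  - by move=> x; exact: std_pdf_ge0.
  have sb0 : s / b != 0 by rewrite mulf_neq0 ?invr_eq0.
  rewrite (integral_std_pdf_affine (- (a * w) / (s * b)) sb0).
  rewrite muleA muleC normrM normfV (gtr0_norm s0) invfM invrK.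
  by rewrite (mulrC s^-1 `|b|).
under eq_integral do rewrite innerx.
clear innerx fub mkw mhk mhx kdef mk inner e1 k0 k.
have mH : measurable_fun [set: R] (fun w : R => h w * (phi (s^-1 * w + 0))%:E)%E.
  apply: emeasurable_funM; [exact: mh|apply/measurable_EFinP].
  apply: (@measurableT_comp _ _ _ _ _ _ phi); first exact: measurable_std_pdf.
  exact: measurable_affine.
have H0 w : (0 <= h w * (phi (s^-1 * w + 0))%:E)%E.
  apply: mule_ge0.
  exact: h0.
  rewrite lee_fin.
  exact: std_pdf_ge0.
have bs0 : 0 <= `|b| / s by apply: divr_ge0; [exact: normr_ge0|exact: ltW].
rewrite (@ge0_integralZl_EFin _ _ R leb _ measurableT _ (fun w _ => H0 w) mH _ bs0).
rewrite muleA -EFinM mulrA mulVf ?normr_eq0// mul1r.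
have mhs : measurable_fun [set: R] (fun z : R => h (s * z)%R).
  by apply: measurableT_comp => //; exact: measurable_funM.
rewrite integral_std_normal//.
have := @integral_affine R s 0 (fun w => h w * (phi (s^-1 * w + 0))%:E)%E sn0 mH H0.
rewrite (gtr0_norm s0) => <-; apply: eq_integral => z _.
by rewrite !addr0 mulKf.
Qed.

End std_normal_facts.

Section std_normal_calculus.
Context (R : realType).
Local Notation leb := (@lebesgue_measure R).
Local Notation g := (@std_normal R).
Local Notation phi := (@std_pdf R).

Lemma is_derive_std_pdf (x : R) : is_derive x 1 phi (- x * phi x).
Proof.
have -> : phi = normal_peak 1 \*o (expR \o (fun x : R => - x ^+ 2 / 2)).
  by apply/funext => y; rewrite std_pdfE.
have h : is_derive x 1 (fun x : R => - x ^+ 2 / 2) (- x).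
  have -> : (fun x : R => - x ^+ 2 / 2) = (- 2^-1) \*o (fun x : R => x ^+ 2).
    by apply/funext => y /=; rewrite mulNr mulNr mulrC.
  by apply: is_derive_eq; rewrite /GRing.scale/=; field.
have := is_deriveZ (normal_peak 1) (is_derive1_comp (is_derive_expR _) h).
by move/is_derive_eq; apply; rewrite /GRing.scale/=; ring.
Qed.

Lemma continuous_std_pdf : continuous phi.
Proof.
rewrite std_pdf.unlock; apply: continuous_normal_pdf; exact: oner_neq0.
Qed.

Lemma cvg_std_pdf : phi x @[x --> +oo] --> (0 : R).
Proof.
have -> : phi = fun x => normal_peak 1 * gauss_fun ((Num.sqrt 2)^-1 * x).
  apply/funext => x; rewrite std_pdfE /gauss_fun; congr (_ * expR _).
  by rewrite exprMn exprVn sqr_sqrtr// mulNr mulrC.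
rewrite -[0](mulr0 (normal_peak 1)); apply: cvgM; first exact: cvg_cst.
apply: cvg_comp (@cvg_gauss_fun R).
by apply/gt0_cvgMry; [rewrite invr_gt0 sqrtr_gt0|exact: cvg_id].
Qed.

Lemma integral_itvcy_mul_std_pdf (a : R) : 0 <= a ->
  (\int[leb]_(w in `[a, +oo[) (w * phi w)%:E = (phi a)%:E)%E.
Proof.
move=> a0.
have dF x : is_derive (x : R) 1 (- phi)%R (x * phi x).
  by have /is_derive_eq := is_deriveN (is_derive_std_pdf x); apply; rewrite mulNr opprK.
rewrite (@ge0_continuous_FTC2y R _ (- phi)%R a 0).
- by rewrite sub0e -EFinN opprK.
- by move=> x ax; rewrite mulr_ge0 ?(le_trans a0 ax)// std_pdf_ge0.
- apply: continuous_subspaceT => x; apply: cvgM; first exact: cvg_id.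
  exact: continuous_std_pdf.
- by rewrite -[0]oppr0; apply: cvgN; exact: cvg_std_pdf.
- by move=> x _; exact: (@ex_derive _ _ _ _ _ _ _ (dF x)).
- by apply: cvg_at_right_filter; apply: cvgN; exact: continuous_std_pdf.
- by move=> x _; rewrite derive1E; exact: (@derive_val _ _ _ _ _ _ _ (dF x)).
Qed.

Lemma ge0_integral_even (f : R -> \bar R) : measurable_fun setT f ->
  (forall x, 0 <= f x)%E -> (forall x, f (- x) = f x) ->
  (\int[leb]_x f x = 2%:E * \int[leb]_(x in `[0%R, +oo[) f x)%E.
Proof.
move=> mf f0 fN.
have -> : [set: R] = `]-oo, 0] `|` `]0, +oo[ :> set R.
  by apply/seteqP; split => // x _ /=; rewrite !in_itv/= andbT; case: leP; [left|right].
rewrite ge0_integral_setU//=; last 2 first.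
- by apply: measurable_funTS.
- apply/disj_setPS => x [] /=; rewrite !in_itv/= andbT => h1 h2.
  by have := lt_le_trans h2 h1; rewrite ltxx.
rewrite integral_itv_obnd_cbnd; last exact: measurable_funTS.
have := @ge0_integration_by_substitution0 R f mf f0.
under [X in _ = X -> _]eq_integral do rewrite fN.
by move=> <-; rewrite mule_natl.
Qed.

Lemma integral_std_normal_itvcy (a : R) :
  g `[a, +oo[ = (\int[leb]_x (\1_`[0, +oo[ x * phi (x + a))%:E)%E.
Proof.
pose h (x : R) : \bar R := (\1_`[a, +oo[%classic x * phi x)%:E.
have mh : measurable_fun setT h.
  by apply/measurable_EFinP; apply: measurable_funM;
    [exact: measurable_indic|exact: measurable_std_pdf].
have h0 x : (0 <= h x)%E by rewrite lee_fin mulr_ge0// std_pdf_ge0.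
have := @integral_affine R 1 a h (oner_neq0 _) mh h0.
rewrite normr1 invr1 mul1e std_normalE// => H.
transitivity (\int[leb]_x h x)%E.
  rewrite integral_mkcond.
  by apply: eq_integral => x _; rewrite patchE /h indicE; case: ifPn; rewrite ?mul1r ?mul0r.
rewrite -H; apply: eq_integral => x _; rewrite /h mul1r; congr (_ * _)%:E.
by rewrite !indicE !mem_setE !in_itv/= !andbT lerDr.
Qed.

(** After a shift by [a] the bound is pointwise: phi (x + a) <= exp(-a^2/2) phi x for x >= 0, and
    phi has integral 1. *)
Lemma std_normal_tail_le (a : R) : 0 <= a ->
  (g `[a, +oo[ <= (expR (- a ^+ 2 / 2))%:E)%E.
Proof.
move=> a0; rewrite integral_std_normal_itvcy.
have -> : ((expR (- a ^+ 2 / 2))%:E = \int[leb]_x ((expR (- a ^+ 2 / 2))%:E * (phi x)%:E))%E.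
  rewrite ge0_integral_lebZl ?lee_fin ?expR_ge0//.
  - by rewrite -std_normalE// probability_setT mule1.
  - exact: measurable_std_pdf.
  - exact: std_pdf_ge0.
apply: ge0_le_integral_nonmeas => x _.
  by rewrite lee_fin mulr_ge0// std_pdf_ge0.
rewrite -EFinM lee_fin indicE mem_setE in_itv/= andbT.
have [x0|_] := leP 0 x; last by rewrite mul0r mulr_ge0 ?expR_ge0 ?std_pdf_ge0.
rewrite mul1r !std_pdfE mulrCA ler_pM2l; last exact/normal_peak_gt0/oner_neq0.
rewrite -expRD ler_expR -mulrDl ler_pM2r ?invr_gt0// -opprD lerN2.
by have := mulr_ge0 x0 a0; nra.
Qed.

(** An interval of length [h] inside the ray, on which the density is at least its value at the
    right end. The choice h = 1 gives the lower bound on [w], and h = 1/x the acceptance rate of the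
    sampler. *)
Lemma std_normal_ray_ge (a h : R) : 0 <= a -> 0 < h ->
  ((h * phi (a + h))%:E <= g `]a, +oo[)%E.
Proof.
move=> a0 h0; rewrite std_normalE//.
have -> : ((h * phi (a + h))%:E = \int[leb]_(x in `]a, (a + h)%R]) (phi (a + h))%:E)%E.
  rewrite integral_cst//= lebesgue_measure_itv/= lte_fin ltrDl h0.
  by rewrite -EFinD addrAC subrr add0r muleC.
apply: (@le_trans _ _ (\int[leb]_(x in `]a, (a + h)%R]) (phi x)%:E)%E).
  apply: ge0_le_integral_nonmeas => x /=; rewrite in_itv/= => /andP[ax xa].
    by rewrite lee_fin std_pdf_ge0.
  rewrite lee_fin !std_pdfE ler_pM2l; last exact/normal_peak_gt0/oner_neq0.
  rewrite ler_expR ler_pM2r ?invr_gt0// lerN2 ler_sqr ?nnegrE//.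
    by rewrite (le_trans a0)// ltW.
  by rewrite addr_ge0// ltW.
apply: ge0_subset_integral => //.
- by apply: measurable_funTS; exact: measurable_std_pdf_EFin.
- by move=> x _; rewrite lee_fin std_pdf_ge0.
- by move=> x /=; rewrite !in_itv/= => /andP[-> _].
Qed.

End std_normal_calculus.

Section std_normal_moments.
Context (R : realType).
Local Notation leb := (@lebesgue_measure R).
Local Notation g := (@std_normal R).
Local Notation phi := (@std_pdf R).

Lemma integral_std_pdf : (\int[leb]_x (phi x)%:E = 1)%E.
Proof. by rewrite -std_normalE// probability_setT. Qed.

Lemma integral_mul_indic (A : set R) (F : R -> R) : measurable A ->
  (\int[leb]_(x in A) (F x)%:E = \int[leb]_x (\1_A x * F x)%:E)%E.
Proof.
move=> mA; rewrite integral_mkcond; apply: eq_integral => x _.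
by rewrite patchE indicE; case: ifPn => _; rewrite ?mul1r ?mul0r.
Qed.

(** Write phi z as the integral of w phi w over w >= z and exchange the integrals: the inner one,
    over z in [0, w], is [w]. *)
Lemma integral_sqr_std_pdf :
  (\int[leb]_(w in `[0%R, +oo[) (w * (w * phi w))%:E
   = \int[leb]_(z in `[0%R, +oo[) (phi z)%:E)%E.
Proof.
pose G (p : R * R) : R :=
  \1_`[0, +oo[%classic p.1 * (\1_`[p.1, +oo[%classic p.2 * (p.2 * phi p.2)).
have G0 p : 0 <= G p.
  rewrite /G !indicE !mem_setE !in_itv/= !andbT.
  case: (leP 0 p.1) => p0; rewrite ?mul0r// mul1r.
  case: (leP p.1 p.2) => p1; rewrite ?mul0r// mul1r.
  by rewrite mulr_ge0 ?(le_trans p0 p1) ?std_pdf_ge0.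
have mG : measurable_fun setT G.
  apply: measurable_funM.
    by apply: measurableT_comp => //; exact: measurable_indic.
  apply: measurable_funM; last first.
    by apply: measurable_funM => //; apply: measurableT_comp => //; exact: measurable_std_pdf.
  rewrite (_ : (fun _ => _) = \1_[set p : R * R | p.1 <= p.2]); last first.
    by apply/funext => p; rewrite !indicE mem_setE in_itv/= andbT;
      rewrite (_ : (p \in [set p | p.1 <= p.2]) = (p.1 <= p.2))//; apply/idP/idP; rewrite inE.
  apply: measurable_indic.
  rewrite -[X in measurable X]setTI; apply: measurable_fun_le => //.
rewrite (@integral_mul_indic `[0, +oo[%classic (fun w => w * (w * phi w)))//.
rewrite (@integral_mul_indic `[0, +oo[%classic phi)//.
have -> : (\int[leb]_z (\1_`[0, +oo[%classic z * phi z)%:E =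
           \int[leb]_z \int[leb]_w (G (z, w))%:E)%E.
  apply: eq_integral => z _; rewrite /G/=.
  have [z0|z0] := leP 0 z; last first.
    rewrite indicE mem_setE in_itv/= andbT leNgt z0/= mul0r.
    by under eq_integral do rewrite mul0r; rewrite integral0.
  rewrite indicE mem_setE in_itv/= andbT z0 mul1r.
  under eq_integral do rewrite mul1r.
  by rewrite -(@integral_mul_indic `[z, +oo[%classic (fun w => w * phi w))// integral_itvcy_mul_std_pdf.
rewrite (@fubini_tonelli _ _ _ _ R leb leb (fun p => (G p)%:E)); last 2 first.
- exact/measurable_EFinP.
- by move=> p; rewrite lee_fin.
apply: eq_integral => w _; rewrite /G/=.
under eq_integral do rewrite mulrA EFinM.
have [w0|w0] := leP 0 w; last first.
  rewrite indicE mem_setE in_itv/= andbT leNgt w0/= mul0r.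
  rewrite integral0_eq// => z _; rewrite -EFinM !indicE !mem_setE !in_itv/= !andbT.
  case: (leP 0 z) => z0; rewrite ?mul0r// mul1r leNgt (lt_le_trans w0 z0)/=.
  by rewrite mul0r.
rewrite ge0_integralZr//; last 2 first.
- suff : measurable_fun [set: R] (fun z : R => (\1_`[0, +oo[%classic z * \1_`[z, +oo[%classic w : R)).
    by move/measurable_EFinP.
  apply: measurable_funM; first exact: measurable_indic.
  rewrite (_ : (fun _ => _) = \1_`]-oo, w]%classic :> (R -> R)); first exact: measurable_indic.
  by apply/funext => z; rewrite !indicE !mem_setE !in_itv/= andbT.
- by rewrite lee_fin mulr_ge0// std_pdf_ge0.
have -> : (\int[leb]_z (\1_`[0, +oo[%classic z * \1_`[z, +oo[%classic w)%:E = w%:E)%E.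
  transitivity (\int[leb]_z (\1_`[0%R, w]%classic z)%:E)%E.
    apply: eq_integral => z _; rewrite !indicE !mem_setE !in_itv/= !andbT.
    by case: (0 <= z); case: (z <= w); rewrite ?mul1r ?mul0r.
  rewrite integral_indic// setIT [LHS](lebesgue_measure_itv `[0, w])/= lte_fin.
  have [w1|w1] := ltP 0 w; first by rewrite oppr0 adde0.
  by congr EFin; lra.
by rewrite indicE mem_setE in_itv/= andbT w0 mul1r -EFinM.
Qed.

Lemma std_normal_second_moment : (\int[g]_x (x ^+ 2)%:E = 1)%E.
Proof.
have m2 : measurable_fun [set: R] (fun x : R => (x ^+ 2)%:E).
  by apply/measurable_EFinP; exact: exprn_measurable.
rewrite integral_std_normal//; last by move=> x; rewrite lee_fin sqr_ge0.
rewrite ge0_integral_even; first last.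
- by move=> x; rewrite sqrrN std_pdfN.
- by move=> x; rewrite -EFinM lee_fin mulr_ge0 ?sqr_ge0 ?std_pdf_ge0.
- by apply: emeasurable_funM => //; exact: measurable_std_pdf_EFin.
under eq_integral do rewrite -EFinM expr2 -mulrA.
rewrite integral_sqr_std_pdf -ge0_integral_even ?integral_std_pdf//.
- exact: measurable_std_pdf_EFin.
- by move=> x; rewrite lee_fin std_pdf_ge0.
- by move=> x; rewrite std_pdfN.
Qed.

Lemma integrable_std_normal_id : g.-integrable setT (fun x : R => x%:E).
Proof.
have m1 : measurable_fun [set: R] (fun x : R => x%:E) by apply/measurable_EFinP.
have m2 : measurable_fun [set: R] (fun x : R => (x ^+ 2)%:E).
  by apply/measurable_EFinP; exact: exprn_measurable.
apply/integrableP; split => //.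
apply: (@le_lt_trans _ _ (\int[g]_x (1 + (x ^+ 2)%:E))%E).
  apply: ge0_le_integral_nonmeas => x _; first exact: abse_ge0.
  rewrite -EFinD lee_fin.
  have [h|h] := leP `|x| 1; first by rewrite (le_trans h)// lerDl sqr_ge0.
  by rewrite -[x ^+ 2]real_normK ?num_real// (@le_trans _ _ (`|x| ^+ 2))// ?lerDr// ler_eXnr// ltW.
rewrite ge0_integralD//; last by move=> x _; rewrite lee_fin sqr_ge0.
by rewrite std_normal_second_moment integral_cst// [X in (1 * X)%E](probability_setT g) mule1 -EFinD ltry.
Qed.

Lemma std_normal_mean : (\int[g]_x x%:E = 0)%E.
Proof.
rewrite integralE.
have -> : (\int[g]_x (fun x : R => x%:E)^\- x = \int[g]_x (fun x : R => x%:E)^\+ x)%E.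
  rewrite -(@integral_std_normalN _ (fun x : R => x%:E)^\+%E).
  - by apply: eq_integral => x _; rewrite funenegE funeposE EFinN.
  - by apply: measurable_funepos; exact/measurable_EFinP.
  - by move=> x; exact: funepos_ge0.
rewrite subee//; apply: integrable_fin_num => //.
exact: integrable_funepos integrable_std_normal_id.
Qed.

End std_normal_moments.

(** * The normal distribution function and a uniform variable *)

Section cdf.
Context (R : realType).
Local Notation leb := (@lebesgue_measure R).
Local Notation g := (@std_normal R).
Local Notation phi := (@std_pdf R).
Local Notation Phi := (@Phi_normal R).

Lemma std_normal_fin_num (A : set R) : measurable A -> g A \is a fin_num.
Proof. by move=> mA; apply: fin_num_measure. Qed.

Lemma std_normal_set1 (a : R) : g [set a] = 0%E.
Proof.
rewrite std_normalE//; apply: null_set_integral => //.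
  by apply: measurable_funTS; exact: measurable_std_pdf_EFin.
exact: lebesgue_measure_set1.
Qed.

Lemma std_normal_oppr (A : set R) : measurable A -> g [set z | A (- z)] = g A.
Proof.
move=> mA.
have e (B : set R) : measurable B -> g B = (\int[g]_x (\1_B x)%:E)%E.
  by move=> mB; rewrite integral_indic// setIT.
have mB : measurable [set z | A (- z)] by apply: measurable_preimageT.
rewrite (e A mA) (e _ mB) -[RHS]integral_std_normalN//.
by apply/measurable_EFinP; exact: measurable_indic.
Qed.

Lemma Phi_normalE x : (Phi x)%:E = g `]-oo, x].
Proof. by rewrite /Phi_normal fineK//; exact: std_normal_fin_num. Qed.

Lemma Phi_ge0 x : 0 <= Phi x.
Proof. by rewrite -lee_fin Phi_normalE. Qed.

Lemma Phi_le1 x : Phi x <= 1.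
Proof. by rewrite -lee_fin Phi_normalE; exact: probability_le1. Qed.

Lemma std_normal_tailE x : g `]x, +oo[ = (1 - Phi x)%:E.
Proof.
have -> : `]x, +oo[%classic = ~` `]-oo, x] :> set R by rewrite setCitvl.
by rewrite probability_setC// EFinB Phi_normalE.
Qed.

Lemma std_normal_ctailE x : g `[x, +oo[ = (1 - Phi x)%:E.
Proof.
rewrite -std_normal_tailE.
have -> : `[x, +oo[%classic = x |` `]x, +oo[ :> set R by rewrite setU1itv.
rewrite measureU//.
- by rewrite [X in (X + _)%E](std_normal_set1 x) add0e.
- by apply/seteqP; split => // y /= [->]; rewrite in_itv/= ltxx.
Qed.

Lemma PhiN x : Phi (- x) = 1 - Phi x.
Proof.
apply: EFin_inj; rewrite -std_normal_ctailE Phi_normalE -std_normal_oppr//.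
by congr (g _); apply/seteqP; split => y /=; rewrite !in_itv/= andbT; lra.
Qed.

Lemma Phi_sub x y : x <= y -> (Phi y - Phi x)%:E = g `]x, y].
Proof.
move=> xy; rewrite EFinB !Phi_normalE.
have -> : `]-oo, y]%classic = `]-oo, x] `|` `]x, y] :> set R.
  apply/seteqP; split => z /=; rewrite !in_itv/=.
    by move=> zy; case: (leP z x) => zx; [left|right].
  by case=> [zx|/andP[_ //]]; exact: le_trans xy.
rewrite measureU//; first by rewrite addeAC subee ?add0e// std_normal_fin_num.
by apply/seteqP; split => // z [] /=; rewrite !in_itv/= => h /andP[h' _]; have := le_lt_trans h h'; rewrite ltxx.
Qed.

Lemma Phi_lt x y : x < y -> Phi x < Phi y.
Proof.
move=> xy; rewrite -subr_gt0 -lte_fin Phi_sub ?ltW// std_normalE//.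
have [m m0 mP] : exists2 m : R, 0 < m & forall z, x < z -> z <= y -> m <= phi z.
  exists (normal_peak 1 * expR (- (`|x| + `|y|) ^+ 2 / 2)).
    by rewrite mulr_gt0 ?expR_gt0// normal_peak_gt0 ?oner_eq0.
  move=> z xz zy; rewrite std_pdfE ler_pM2l ?normal_peak_gt0 ?oner_eq0//.
  rewrite ler_expR ler_pM2r ?invr_gt0// lerN2 -[z ^+ 2]real_normK ?num_real//.
  rewrite ler_sqr ?nnegrE ?addr_ge0// ler_norml; apply/andP; split.
    by have := ler_norm (- x); rewrite normrN; have := normr_ge0 y; lra.
  by have := ler_norm y; have := normr_ge0 x; lra.
apply: (@lt_le_trans _ _ (\int[leb]_(z in `]x, y]) m%:E)%E).
  rewrite integral_cst//= lebesgue_measure_itv/= lte_fin xy -EFinD -EFinM lte_fin.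
  by rewrite mulr_gt0// subr_gt0.
apply: ge0_le_integral_nonmeas => z /=; first by rewrite lee_fin ltW.
by rewrite in_itv/= => /andP[xz zy]; rewrite lee_fin mP.
Qed.

Lemma Phi_lt1 x : Phi x < 1.
Proof. by rewrite (lt_le_trans (@Phi_lt x (x + 1) _)) ?ltrDl// Phi_le1. Qed.

Lemma Phi_le : {homo Phi : x y / x <= y}.
Proof.
by move=> x y; rewrite le_eqVlt => /predU1P[->//|/Phi_lt/ltW].
Qed.

Lemma Phi_le_mono : {mono Phi : x y / x <= y}.
Proof. by apply: le_mono => x y; exact: Phi_lt. Qed.

Lemma Phi_lipschitz x y : x <= y -> Phi y - Phi x <= normal_peak 1 * (y - x).
Proof.
move=> xy; rewrite -lee_fin Phi_sub// std_normalE//.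
apply: (@le_trans _ _ (\int[leb]_(z in `]x, y]) (normal_peak 1)%:E)%E).
  apply: ge0_le_integral_nonmeas => z _; first by rewrite lee_fin std_pdf_ge0.
  by rewrite lee_fin std_pdf.unlock normal_pdf_ub ?oner_eq0.
rewrite integral_cst//= lebesgue_measure_itv/= lte_fin; case: ifPn => h.
  by rewrite -EFinD -EFinM.
by rewrite mule0 lee_fin mulr_ge0 ?normal_peak_ge0// subr_ge0.
Qed.

Lemma continuous_Phi : continuous Phi.
Proof.
move=> x; apply/cvgrPdist_lt => e e0.
have p0 := normal_peak_gt0 (oner_neq0 R).
have d0 : 0 < e / normal_peak (1 : R) by rewrite divr_gt0.
apply/nbhs_ballP; exists (e / normal_peak 1) => //= y; rewrite /ball/= => xy.
suff : `|Phi x - Phi y| <= normal_peak 1 * `|x - y|.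
  by move/le_lt_trans; apply; rewrite mulrC -ltr_pdivlMr.
have [h|h] := leP x y.
  rewrite distrC ger0_norm ?subr_ge0 ?Phi_le// distrC ger0_norm ?subr_ge0//.
  exact: Phi_lipschitz.
have yx := ltW h; rewrite ger0_norm ?subr_ge0 ?Phi_le// ger0_norm ?subr_ge0//.
exact: Phi_lipschitz.
Qed.

Lemma Phi0 : Phi 0 = 2^-1.
Proof. by have := PhiN 0; rewrite oppr0 => h; lra. Qed.

Lemma Phi_surj t : 2^-1 <= t -> t < 1 -> exists2 y, 0 <= y & Phi y = t.
Proof.
move=> t0 t1.
have [y1 y10 hy1] : exists2 y1 : R, 0 <= y1 & t <= Phi y1.
  have e0 : 0 < 1 - t by rewrite subr_gt0.
  (* With this y, y/2 exceeds (1 - t)^-1; since y <= y^2, exp(y^2/2) >= 1 + y^2/2 >= (1 - t)^-1,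
     which bounds the tail at y by 1 - t. *)
  exists (1 + 2 * (1 - t)^-1).
    by rewrite addr_ge0// mulr_ge0// invr_ge0 ltW.
  set y := 1 + _.
  have y1 : 1 <= y by rewrite lerDl mulr_ge0// invr_ge0 ltW.
  have := @std_normal_tail_le R y (le_trans ler01 y1).
  rewrite std_normal_ctailE lee_fin => h.
  suff : expR (- y ^+ 2 / 2) <= 1 - t by lra.
  rewrite mulNr expRN -[1 - t]invrK lef_pV2 ?posrE ?expR_gt0 ?invr_gt0//.
  apply: (le_trans _ (expR_ge1Dx _)).
  have : y * 1 <= y ^+ 2 by rewrite expr2 ler_wpM2l// (le_trans ler01).
  rewrite /y; lra.
have [||y /[!in_itv]/= /andP[y0 _] <-] := @IVT R Phi 0 y1 t y10; last by exists y.
  by apply: continuous_subspaceT; exact: continuous_Phi.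
by rewrite Phi0 ge_min le_max t0 hy1 orbT.
Qed.

(** The event is |z| <= y with Phi y = (1 + t)/2. This is why 2 Phi |z| - 1 is uniform on [0, 1].
    The case t = 1 is separate because no finite y reaches it. *)
Lemma std_normal_abs_cdf t : 0 <= t -> t <= 1 ->
  g [set z : R | 2 * Phi `|z| - 1 <= t] = t%:E.
Proof.
move=> t0; rewrite le_eqVlt => /predU1P[->|t1].
  rewrite (_ : [set _ | _] = setT) ?probability_setT//.
  by apply/seteqP; split => // z _ /=; have := Phi_le1 `|z|; lra.
have [||y y0 yt] := @Phi_surj ((1 + t) / 2); [lra..|].
have -> : [set z : R | 2 * Phi `|z| - 1 <= t] = `]-oo, y] `\` `]-oo, (- y)[.
  apply/seteqP; split => z /=; rewrite !in_itv/=.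
    move=> h; have : Phi `|z| <= Phi y by rewrite yt; lra.
    by rewrite Phi_le_mono ler_norml => /andP[h1 h2]; split => //; apply/negP; rewrite -leNgt.
  move=> [h1 /negP]; rewrite -leNgt => h2.
  have : `|z| <= y by rewrite ler_norml h1 h2.
  by move/Phi_le; rewrite yt; lra.
rewrite measureD//; last by rewrite -ge0_fin_numE// std_normal_fin_num.
rewrite setIidr; last by move=> z /=; rewrite !in_itv/= => h; rewrite (le_trans (ltW h))//; lra.
rewrite [X in (_ - X)%E](_ : _ = (Phi (- y))%:E); last first.
  rewrite Phi_normalE.
  have -> : `]-oo, (- y)]%classic = `]-oo, (- y)[ `|` [set - y] :> set R by rewrite setUitv1.
  rewrite measureU//.
  - by rewrite [X in (_ + X)%E](std_normal_set1 (- y)) adde0.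
  - by apply/seteqP; split => // z [] /= h zy; move: h; rewrite zy in_itv/= ltxx.
rewrite [X in (X - _)%E](_ : _ = (Phi y)%:E); last by rewrite Phi_normalE.
by rewrite -EFinB PhiN yt; congr EFin; field.
Qed.

Lemma measurable_abs_cdf : measurable_fun setT (fun z : R => 2 * Phi `|z| - 1).
Proof.
apply: continuous_measurable_fun => z; apply: cvgB; last exact: cvg_cst.
apply: cvgM; first exact: cvg_cst.
apply: (@continuous_comp _ _ _ (fun z : R => `|z|) Phi); last exact: continuous_Phi.
exact: norm_continuous.
Qed.

End cdf.

(** Closed rays are stable under intersection and generate the Borel sets; the rays starting at -n
    exhaust the line, so finiteness on rays is enough. *)
Lemma ray_measure_unique (R : realType) (m1 m2 : {measure set R -> \bar R}) :
  (forall a : R, m1 `[a, +oo[%classic = m2 `[a, +oo[%classic) ->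
  (forall a : R, (m1 `[a, +oo[%classic < +oo)%E) ->
  forall A, measurable A -> m1 A = m2 A.
Proof.
move=> m12 fin1 A mA.
apply: (@measure_unique _ R _ (@RGenCInfty.G R) (fun n => `[- n%:R, +oo[%classic)) => //.
- exact: RGenCInfty.measurableE.
- move=> _ _ [x ->] [y ->]; exists (Num.max x y); apply/seteqP; split => z /=;
    rewrite !in_itv/= !andbT ge_max.
    by move=> [-> ->].
  by move/andP.
- by move=> i; exists (- i%:R).
- apply/seteqP; split => // z _; exists (Num.bound `|z|) => //=.
  rewrite in_itv/= andbT lerNl; apply/ltW/(le_lt_trans _ (archi_boundP (normr_ge0 z))).
  by rewrite (le_trans (ler_norm _))// normrN.
- by move=> _ [a ->]; exact: m12.
Qed.

(** * The law of the sum of two squared normal variables *)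

Section rayleigh.
Context (R : realType).
Local Notation leb := (@lebesgue_measure R).
Local Notation g := (@std_normal R).
Local Notation phi := (@std_pdf R).

Lemma integral_std_normal2 (h : R * R -> \bar R) : measurable_fun setT h ->
  (forall p, 0 <= h p)%E ->
  (\int[g]_x \int[g]_y h (x, y)
   = \int[leb]_x \int[leb]_y (h (x, y) * (phi x * phi y)%:E))%E.
Proof.
move=> mh h0.
have mhx (x : R) : measurable_fun [set: R] (fun y : R => h (x, y)).
  exact: measurableT_comp mh (pair1_measurable x).
rewrite integral_std_normal; last 2 first.
- exact: (@measurable_fun_fubini_tonelli_F _ _ _ _ R g h).
- by move=> x; apply: integral_ge0.
apply: eq_integral => x _.
rewrite (integral_std_normal (mhx x))// muleC.
rewrite -(@ge0_integralZl_EFin _ _ R leb _ measurableT _ _ _ _ (std_pdf_ge0 x)).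
- by apply: eq_integral => y _; rewrite muleCA -EFinM.
- by move=> y _; rewrite mule_ge0// lee_fin std_pdf_ge0.
- by apply: emeasurable_funM; [exact: mhx|exact: measurable_std_pdf_EFin].
Qed.

Let J (h : R -> \bar R) : \bar R :=
  (\int[leb]_u ((`|u| * (phi 0 * phi u))%:E * h (u ^+ 2)%R))%E.
Let K : \bar R := (\int[leb]_k ((1 + k ^+ 2)^-1)%:E)%E.

Lemma measurable_slope_kernel (h : R -> \bar R) : measurable_fun setT h ->
  measurable_fun setT (fun p : R * R =>
    `|p.1|%:E * (h (p.1 ^+ 2 * (1 + p.2 ^+ 2))%R
       * (phi 0 * phi (p.1 * Num.sqrt (1 + p.2 ^+ 2)))%:E))%E.
Proof.
move=> mh; apply: emeasurable_funM.
  by apply/measurable_EFinP; apply: measurableT_comp => //; exact: measurable_fst.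
have mq : measurable_fun setT (fun p : R * R => 1 + p.2 ^+ 2).
  by apply: measurable_funD => //; apply: measurable_funX; exact: measurable_snd.
apply: emeasurable_funM.
  apply: (@measurableT_comp _ _ _ _ _ _ h) => //; apply: measurable_funM => //.
  by apply: measurable_funX; exact: measurable_fst.
apply/measurable_EFinP; apply: measurable_funM => //.
apply: (@measurableT_comp _ _ _ _ _ _ phi); first exact: measurable_std_pdf.
apply: measurable_funM; first exact: measurable_fst.
apply: (@measurableT_comp _ _ _ _ _ _ (@Num.sqrt R)) => //.
by apply: continuous_measurable_fun; exact: sqrt_continuous.
Qed.

Lemma slope_inner (h : R -> \bar R) (k : R) : measurable_fun setT h ->
  (forall x, 0 <= h x)%E ->
  (\int[leb]_x (`|x|%:E * (h (x ^+ 2 * (1 + k ^+ 2))%R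
       * (phi 0 * phi (x * Num.sqrt (1 + k ^+ 2)))%:E))
   = ((1 + k ^+ 2)^-1)%:E * J h)%E.
Proof.
move=> mh h0; set q := Num.sqrt _.
have q2 : q ^+ 2 = 1 + k ^+ 2 by rewrite sqr_sqrtr// addr_ge0// sqr_ge0.
have q0 : 0 < q by rewrite sqrtr_gt0 ltr_pwDl// sqr_ge0.
rewrite -q2; move: q q2 q0 => {}q _ q0.
have qn0 : q != 0 by rewrite gt_eqF.
pose H (u : R) : \bar R := (q^-1%:E * ((`|u| * (phi 0 * phi u))%:E * h (u ^+ 2)%R))%E.
have mj : measurable_fun [set: R] (fun u : R => (`|u| * (phi 0 * phi u))%:E * h (u ^+ 2)%R)%E.
  apply: emeasurable_funM.
    apply/measurable_EFinP; apply: measurable_funM => //.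
    by apply: measurable_funM => //; exact: measurable_std_pdf.
  by apply: (@measurableT_comp _ _ _ _ _ _ h) => //; exact: exprn_measurable.
have j0 (u : R) : (0 <= (`|u| * (phi 0 * phi u))%:E * h (u ^+ 2)%R)%E.
  by rewrite mule_ge0// lee_fin !mulr_ge0// std_pdf_ge0.
have qV : 0 <= q^-1 by rewrite invr_ge0 ltW.
have mH : measurable_fun setT H by apply: measurable_funeM.
have H0 u : (0 <= H u)%E by rewrite /H mule_ge0// lee_fin.
transitivity (\int[leb]_x H (q * x + 0)%R)%E.
  apply: eq_integral => x _; rewrite /H addr0 normrM (gtr0_norm q0).
  rewrite [RHS]muleA -EFinM !mulrA mulVf// mul1r exprMn.
  rewrite [(x * q)%R]mulrC [(x ^+ 2 * _)%R]mulrC -[in RHS]mulrA [in RHS]EFinM -[in RHS]muleA.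
  by rewrite [(h _ * _)%E]muleC (_ : q * x ^+ 2 * q = q ^+ 2 * x ^+ 2)//; ring.
rewrite (integral_affine 0 qn0 mH H0) (gtr0_norm q0) /H.
rewrite (@ge0_integralZl_EFin _ _ R leb _ measurableT _ (fun u _ => j0 u) mj _ qV).
by rewrite muleA -EFinM -invfM expr2.
Qed.

Lemma K_ge0 : (0 <= K)%E.
Proof. by apply: integral_ge0 => k _; rewrite lee_fin invr_ge0 addr_ge0// sqr_ge0. Qed.

Lemma measurable_inv_oneDsqr : measurable_fun [set: R] (fun k : R => (1 + k ^+ 2)^-1).
Proof.
apply: continuous_measurable_fun => k; apply: cvgV.
  by rewrite gt_eqF// ltr_pwDl// sqr_ge0.
by apply: cvgD; [exact: cvg_cst|exact: exprn_continuous].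
Qed.

(** Polar coordinates with the slope in place of the angle: substituting y = x k gives x^2 + y^2 =
    x^2 (1 + k^2), and after exchanging the integrals u = x sqrt(1 + k^2) separates the slope factor
    [K] from the radial factor [J]. *)
Lemma std_normal_slope (h : R -> \bar R) : measurable_fun setT h ->
  (forall x, 0 <= h x)%E ->
  (\int[g]_x \int[g]_y h (x ^+ 2 + y ^+ 2)%R = K * J h)%E.
Proof.
move=> mh h0.
have mhh : measurable_fun setT (fun p : R * R => h (p.1 ^+ 2 + p.2 ^+ 2)%R).
  apply: (@measurableT_comp _ _ _ _ _ _ h) => //.
  by apply: measurable_funD; apply: measurable_funX.
rewrite (@integral_std_normal2 (fun p => h (p.1 ^+ 2 + p.2 ^+ 2)%R))//=.
pose G (p : R * R) := (`|p.1|%:E * (h (p.1 ^+ 2 * (1 + p.2 ^+ 2))%R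
       * (phi 0 * phi (p.1 * Num.sqrt (1 + p.2 ^+ 2)))%:E))%E.
have G0 p : (0 <= G p)%E by rewrite /G !mule_ge0// lee_fin ?mulr_ge0// std_pdf_ge0.
have mG : measurable_fun setT G by exact: measurable_slope_kernel.
have mF : measurable_fun setT (fun p : R * R =>
    h (p.1 ^+ 2 + p.2 ^+ 2)%R * (phi p.1 * phi p.2)%:E)%E.
  apply: emeasurable_funM => //; apply/measurable_EFinP; apply: measurable_funM;
    by apply: (@measurableT_comp _ _ _ _ _ _ phi) => //; exact: measurable_std_pdf.
transitivity (\int[leb]_x \int[leb]_k G (x, k))%E.
  apply: ge0_ae_eq_integral => //.
  - apply: (@measurable_fun_fubini_tonelli_F _ _ _ _ R leb (fun p : R * R =>
      h (p.1 ^+ 2 + p.2 ^+ 2)%R * (phi p.1 * phi p.2)%:E)%E) => //.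
    by move=> p; rewrite mule_ge0// lee_fin mulr_ge0// std_pdf_ge0.
  - exact: (@measurable_fun_fubini_tonelli_F _ _ _ _ R leb G).
  - by move=> x _; apply: integral_ge0 => y _; rewrite mule_ge0// lee_fin mulr_ge0// std_pdf_ge0.
  - by move=> x _; apply: integral_ge0 => y _; exact: G0.
  (* The substitution y = x k fails only at x = 0, a null set. *)
  exists [set 0]; split => //; first exact: lebesgue_measure_set1.
  move=> x /= /not_implyP[_]; apply: contra_notP => /eqP x0.
  have mFx : measurable_fun [set: R] (fun y : R => h (x ^+ 2 + y ^+ 2)%R * (phi x * phi y)%:E)%E.
    exact: (measurableT_comp mF (pair1_measurable x)).
  have F0 (y : R) : (0 <= h (x ^+ 2 + y ^+ 2)%R * (phi x * phi y)%:E)%E.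
    by rewrite mule_ge0// lee_fin mulr_ge0// std_pdf_ge0.
  have := integral_affine 0 x0 mFx F0 => /(congr1 (fun e => `|x|%:E * e)%E).
  rewrite muleA -EFinM mulfV ?normr_eq0// mul1e => <-.
  rewrite -ge0_integralZl_EFin//; last first.
    apply: (@measurableT_comp _ _ _ _ _ _ (fun y : R => h (x ^+ 2 + y ^+ 2)%R * (phi x * phi y)%:E)%E) => //.
    exact: measurable_affine.
  apply: eq_integral => k _; rewrite /G/= addr0; congr (_ * (h _ * _%:E))%E.
    by rewrite exprMn mulrDr mulr1.
  apply: std_pdfM; rewrite expr0n add0r exprMn exprMn sqr_sqrtr ?addr_ge0 ?sqr_ge0//.
  by rewrite mulrDr mulr1.
rewrite (@fubini_tonelli _ _ _ _ R leb leb G)//.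
under eq_integral do rewrite /G/= slope_inner//.
rewrite ge0_integralZr//.
- by apply/measurable_EFinP; exact: measurable_inv_oneDsqr.
- by move=> k _; rewrite lee_fin invr_ge0 addr_ge0// sqr_ge0.
- by apply: integral_ge0 => u _; rewrite mule_ge0// lee_fin !mulr_ge0// std_pdf_ge0.
Qed.

Lemma J_half (h : R -> \bar R) : measurable_fun setT h -> (forall x, 0 <= h x)%E ->
  J h = (2%:E * ((phi 0)%:E * \int[leb]_(u in `[0%R, +oo[) ((u * phi u)%:E * h (u ^+ 2)%R)))%E.
Proof.
move=> mh h0.
have mj : measurable_fun [set: R] (fun u : R => (`|u| * (phi 0 * phi u))%:E * h (u ^+ 2)%R)%E.
  apply: emeasurable_funM.
    apply/measurable_EFinP; apply: measurable_funM => //.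
    by apply: measurable_funM => //; exact: measurable_std_pdf.
  by apply: (@measurableT_comp _ _ _ _ _ _ h) => //; exact: exprn_measurable.
have j0 (u : R) : (0 <= (`|u| * (phi 0 * phi u))%:E * h (u ^+ 2)%R)%E.
  by rewrite mule_ge0// lee_fin !mulr_ge0// std_pdf_ge0.
rewrite /J (ge0_integral_even mj j0); last by move=> x; rewrite normrN sqrrN std_pdfN.
congr (_ * _)%E; rewrite -ge0_integralZl_EFin ?std_pdf_ge0//; last 2 first.
- by move=> u /=; rewrite in_itv/= andbT => u0; rewrite mule_ge0// lee_fin mulr_ge0// std_pdf_ge0.
- apply: measurable_funTS; apply: emeasurable_funM.
    by apply/measurable_EFinP; apply: measurable_funM => //; exact: measurable_std_pdf.
  by apply: (@measurableT_comp _ _ _ _ _ _ h) => //; exact: exprn_measurable.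
apply: eq_integral => u; rewrite inE/= in_itv/= andbT => u0.
by rewrite ger0_norm// muleA -EFinM mulrCA.
Qed.

(* The constant [K] is identified by normalisation: take [h = 1]. *)
Lemma std_normal_rayleigh (h : R -> \bar R) : measurable_fun setT h ->
  (forall x, 0 <= h x)%E ->
  (\int[g]_x \int[g]_y h (x ^+ 2 + y ^+ 2)%R
   = (phi 0)^-1%:E * \int[leb]_(u in `[0%R, +oo[) ((u * phi u)%:E * h (u ^+ 2)%R))%E.
Proof.
move=> mh h0; rewrite std_normal_slope// J_half//.
have p0 := std_pdf_gt0 (0 : R).
have := @std_normal_slope (cst 1%E) (measurable_cst _) (fun=> lee01).
rewrite J_half//; under [X in X = _ -> _]eq_integral do
  rewrite integral_cst// [X in (1 * X)%E](probability_setT g) mule1.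
rewrite integral_cst// [X in (1 * X)%E](probability_setT g) mule1.
under eq_integral do rewrite mule1.
rewrite integral_itvcy_mul_std_pdf// -!EFinM => K1.
have -> : K = ((2 * (phi 0 * phi 0))^-1)%:E.
  have := K_ge0; move: K1; case: K => [r|//|//].
    rewrite -EFinM => -[e] _; congr EFin.
    have n0 : 2 * (phi 0 * phi 0) != 0 :> R by rewrite !mulf_neq0 ?gt_eqF.
    by rewrite -[LHS](mulfK n0) -e mul1r.
  by rewrite gt0_mulye// lte_fin !mulr_gt0.
rewrite !muleA -!EFinM; congr (_%:E * _)%E.
by field; rewrite gt_eqF.
Qed.

End rayleigh.

(** * Product measures and uniform points *)

Section tuple_measurable.
Context d (X : measurableType d).

Definition tcons n (p : X * n.-tuple X) : n.+1.-tuple X := [tuple of p.1 :: p.2].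

Lemma measurable_tcons n : measurable_fun setT (@tcons n).
Proof. by apply: measurable_cons. Qed.

Lemma measurable_thead n : measurable_fun setT (@thead n X).
Proof. exact: measurable_tnth. Qed.

Definition tuncons n (v : n.+1.-tuple X) : X * n.-tuple X :=
  (thead v, [tuple of behead v]).

Lemma measurable_tuncons n : measurable_fun setT (@tuncons n).
Proof.
by apply/measurable_fun_pairP; split; [exact: measurable_thead|exact: measurable_behead].
Qed.

End tuple_measurable.

Section power_measure_theory.
Context d (X : measurableType d) (R : realType).
Variable mu : {sigma_finite_measure set X -> \bar R}.

Section step.
Context n (nu : {sigma_finite_measure set (n.-tuple X) -> \bar R}).
Definition cons_measure : set (n.+1.-tuple X) -> \bar R :=
  image_measure (mu \x nu)%E (@measurable_tcons _ X n).
HB.instance Definition _ := Measure.on cons_measure.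

Let cons_sigma_finite : sigma_finite setT cons_measure.
Proof.
have /sigma_finiteP[F [FT ndF Foo]] := sigma_finiteT mu.
have /sigma_finiteP[G [GT ndG Goo]] := sigma_finiteT nu.
exists (fun i => @tuncons _ X n @^-1` (F i `*` G i)).
  apply/seteqP; split => // v _.
  have [i _ Fi] : (\bigcup_i F i) (tuncons v).1 by rewrite -FT.
  have [j _ Gj] : (\bigcup_i G i) (tuncons v).2 by rewrite -GT.
  exists (maxn i j) => //; split.
    by have /subsetPset := ndF _ _ (leq_maxl i j); exact.
  by have /subsetPset := ndG _ _ (leq_maxr i j); exact.
move=> i; have [mF Fi] := Foo i; have [mG Gi] := Goo i; split.
  by apply: (measurable_preimageT (@measurable_tuncons _ X n)); exact: measurableX.
rewrite /cons_measure /image_measure /pushforward.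
rewrite (_ : _ @^-1` _ = F i `*` G i).
  rewrite [ltLHS](_ : _ = (mu (F i) * nu (G i))%E); last exact: product_measure1E.
  by apply: lte_mul_pinfty => //; rewrite ge0_fin_numE.
have tK p : tuncons (@tcons _ X n p) = p.
  by case: p => x v; congr pair; exact/val_inj.
have e : @tuncons _ X n \o @tcons _ X n = id by apply/funext => p; exact: tK.
by rewrite -comp_preimage e.
Qed.

HB.instance Definition _ :=
  @Measure_isSigmaFinite.Build _ _ _ cons_measure cons_sigma_finite.

End step.

(** A bundled twin of [power_measure], built as the image of binary products under [tcons]. The two
    agree on measurable sets, and the measure axioms of [power_measure] are carried over from it. *)
Fixpoint power_sigma_finite n : {sigma_finite_measure set (n.-tuple X) -> \bar R} :=
  match n with
  | 0 => \d_([tuple] : 0.-tuple X)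
  | n'.+1 => cons_measure (power_sigma_finite n')
  end.

Lemma power_measureE n (A : set (n.-tuple X)) : measurable A ->
  power_measure mu A = power_sigma_finite n A.
Proof.
elim: n A => // n IH A mA /=.
rewrite /cons_measure /image_measure /pushforward /product_measure1.
apply: eq_integral => x _; rewrite /= IH.
  by congr (power_sigma_finite n _); apply/seteqP; split => v /=; rewrite /xsection/= inE.
have mc : measurable (@tcons _ X n @^-1` A).
  exact: (measurable_preimageT (@measurable_tcons _ X n)).
have := measurable_xsection x mc.
rewrite (_ : xsection _ _ = [set v : n.-tuple X | A [tuple of x :: v]])//.
by apply/seteqP; split => v /=; rewrite /xsection/= inE.
Qed.

Let power0 n : power_measure mu (@set0 (n.-tuple X)) = 0%E.
Proof. by rewrite power_measureE ?measure0. Qed.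

Let power_ge0 n (A : set (n.-tuple X)) : (0 <= power_measure mu A)%E.
Proof.
by elim: n A => [|n IH] A; [exact: measure_ge0|apply: integral_ge0 => x _; exact: IH].
Qed.

Let power_sigma_additive n : semi_sigma_additive (power_measure mu (n := n)).
Proof.
move=> F mF tF mUF; rewrite power_measureE//.
have := @measure_semi_sigma_additive _ _ _ (power_sigma_finite n) F mF tF mUF.
apply: cvg_trans; apply: near_eq_cvg; apply: nearW => k.
by apply: eq_bigr => i _; rewrite power_measureE.
Qed.

HB.instance Definition _ n := isMeasure.Build _ _ _ (power_measure mu (n := n))
  (@power0 n) (@power_ge0 n) (@power_sigma_additive n).

Let power_sigma_finiteT n : sigma_finite setT (power_measure mu (n := n)).
Proof.
have [F FT Foo] := sigma_finiteT (power_sigma_finite n).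
exists F => // i; have [mF Fi] := Foo i; split => //.
by rewrite power_measureE.
Qed.

HB.instance Definition _ n :=
  @Measure_isSigmaFinite.Build _ _ _ (power_measure mu (n := n)) (@power_sigma_finiteT n).

Lemma integral_power_measureS n (h : n.+1.-tuple X -> \bar R) :
  measurable_fun setT h -> (forall v, 0 <= h v)%E ->
  (\int[power_measure mu (n := n.+1)]_v h v =
   \int[mu]_x \int[power_measure mu (n := n)]_v h [tuple of x :: v])%E.
Proof.
move=> mh h0.
transitivity (\int[power_sigma_finite n.+1]_v h v)%E.
  by apply: eq_measure_integral => A mA _; exact: power_measureE.
rewrite /= integral_image_measure//.
rewrite (@fubini_tonelli1 _ _ _ _ R mu (power_sigma_finite n) (h \o @tcons _ X n))//.
  apply: eq_integral => x _; rewrite /fubini_F/=.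
  by apply/esym/eq_measure_integral => A mA _; exact: power_measureE.
  by apply: measurableT_comp => //; exact: measurable_tcons.
by move=> p; exact: h0.
Qed.

Lemma integral_power_measure0 (h : 0.-tuple X -> \bar R) :
  (\int[power_measure mu (n := 0)]_v h v = h [tuple])%E.
Proof.
transitivity (\int[\d_([tuple] : 0.-tuple X)]_v h v)%E.
  by apply: eq_measure_integral => A mA _.
rewrite integral_dirac ?diracT ?mul1e//.
move=> _ Y mY; rewrite setTI.
have [h0|h0] := pselect (Y (h [tuple])).
  rewrite (_ : _ @^-1` _ = setT)//; apply/seteqP; split => // v _.
  by rewrite /preimage/= (tuple0 v).
rewrite (_ : _ @^-1` _ = set0)//; apply/seteqP; split => // v.
by rewrite /preimage/= (tuple0 v).
Qed.

Lemma power_measure_box (A : set X) n : measurable A ->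
  power_measure mu [set v : n.-tuple X | forall i, A (tnth v i)] = (mu A ^+ n)%E.
Proof.
move=> mA; elim: n => [|n IH] /=.
  by rewrite diracE mem_set// => -[].
transitivity (\int[mu]_x ((\1_A x)%:E * mu A ^+ n))%E.
  apply: eq_integral => x _; rewrite indicE.
  have [/set_mem Ax|/negP Ax] := boolP (x \in A).
    rewrite mul1e -IH; congr (power_measure _ _); apply/seteqP; split => v /=.
      by move=> Av i; have := Av (lift ord0 i); rewrite tnthS.
    move=> Av i; case: (unliftP ord0 i) => [j ->|->]; first by rewrite tnthS.
    by rewrite tnth0.
  rewrite mul0e (_ : [set v | _] = set0) ?measure0//.
  by apply/seteqP; split => // v /= /(_ ord0); rewrite tnth0 => Ax'; apply: Ax; rewrite inE.
rewrite ge0_integralZr//.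
- rewrite integral_indic// setIT; case: {IH} n => [|n]//.
  by rewrite expe0 mule1.
- by apply/measurable_EFinP; exact: measurable_indic.
- by rewrite expe_ge0.
Qed.

End power_measure_theory.

Section power_probability.
Context d (X : measurableType d) (R : realType).
Variable mu : probability X R.

Lemma power_measureT n : power_measure mu (@setT (n.-tuple X)) = 1%E.
Proof.
elim: n => [|n IH] /=; first by rewrite diracT.
under eq_integral do rewrite (_ : [set v | _] = setT)// IH.
by rewrite integral_cst//; rewrite mul1e; exact: probability_setT.
Qed.

HB.instance Definition _ n := Measure_isProbability.Build _ _ _
  (power_measure mu (n := n)) (@power_measureT n).

End power_probability.

Section rV_measurable.
Context (R : realType) (d : nat).

Lemma measurable_coord (j : 'I_d) :
  measurable_fun setT (fun x : 'rV[R]_d => x ord0 j).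
Proof.
move=> _ Y mY; rewrite setTI; apply: sub_sigma_algebra => /=.
rewrite -bigcup_seq/=; exists j => /=; first by rewrite mem_index_enum.
by exists Y => //; rewrite setTI.
Qed.

Lemma measurable_rV d' (X : measurableType d') (h : X -> 'rV[R]_d) :
  (forall j, measurable_fun setT (fun x => h x ord0 j)) -> measurable_fun setT h.
Proof.
move=> mh _ Y mY; rewrite setTI.
suff : <<s \big[setU/set0]_(j < d) preimage_set_system setT
    (fun x : 'rV[R]_d => x ord0 j) measurable >> `<=`
    [set Y | measurable (h @^-1` Y)] by exact.
apply: smallest_sub.
  split.
  - by rewrite /= preimage_set0.
  - by move=> A /= mA; rewrite setTD preimage_setC; exact: measurableC.
  - by move=> F /= mF; rewrite preimage_bigcup; exact: bigcupT_measurable.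
rewrite -bigcup_seq => A [j _ [B mB <-]] /=; rewrite setTI.
by rewrite -[X in measurable X]setTI; exact: (mh j).
Qed.

Definition row_of_tuple (v : d.-tuple R) : 'rV[R]_d := \row_j tnth v j.

Lemma measurable_row_of_tuple : measurable_fun setT row_of_tuple.
Proof.
apply: measurable_rV => j; rewrite /row_of_tuple; under eq_fun do rewrite mxE.
exact: measurable_tnth.
Qed.

Lemma lebesgue_rVE (A : set 'rV[R]_d) : lebesgue_rV A =
  image_measure (power_measure (@lebesgue_measure R) (n := d)) measurable_row_of_tuple A.
Proof. by []. Qed.

Let lebesgue_rV0 : lebesgue_rV (@set0 'rV[R]_d) = 0%E.
Proof. by rewrite lebesgue_rVE measure0. Qed.

Let lebesgue_rV_ge0 (A : set 'rV[R]_d) : (0 <= lebesgue_rV A)%E.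
Proof. by rewrite lebesgue_rVE. Qed.

Let lebesgue_rV_sigma_additive : semi_sigma_additive (@lebesgue_rV R d).
Proof.
rewrite (_ : @lebesgue_rV R d =
  image_measure (power_measure (@lebesgue_measure R) (n := d)) measurable_row_of_tuple)//.
exact: measure_semi_sigma_additive.
Qed.

HB.instance Definition _ := isMeasure.Build _ _ _ (@lebesgue_rV R d)
  lebesgue_rV0 lebesgue_rV_ge0 lebesgue_rV_sigma_additive.

End rV_measurable.

Definition uniform_law (R : realType) (d : nat) (T : set 'rV[R]_d)
    (mT : measurable T) (T0 : lebesgue_rV T != 0%E) (Tfin : lebesgue_rV T \is a fin_num) :=
  uniform_on T.

Section uniform_law.
Context (R : realType) (d : nat) (T : set 'rV[R]_d) (mT : measurable T).
Variables (T0 : lebesgue_rV T != 0%E) (Tfin : lebesgue_rV T \is a fin_num).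
Local Notation U := (uniform_law mT T0 Tfin).

Let vol_ge0 : 0 <= (fine (lebesgue_rV T))^-1.
Proof. by rewrite invr_ge0 fine_ge0// measure_ge0. Qed.

Let UE A : U A = mscale (NngNum vol_ge0) (mrestr (@lebesgue_rV R d) mT) A.
Proof. by rewrite /mscale/= /mrestr muleC. Qed.

Let U0 : U set0 = 0%E.
Proof. by rewrite UE measure0. Qed.

Let U_ge0 A : (0 <= U A)%E.
Proof. by rewrite UE measure_ge0. Qed.

Let U_sigma_additive : semi_sigma_additive U.
Proof.
move=> F mF tF mUF; rewrite UE.
rewrite (_ : (fun _ => _) = fun n => (\sum_(0 <= i < n)
   mscale (NngNum vol_ge0) (mrestr (@lebesgue_rV R d) mT) (F i))%E).
  exact: measure_semi_sigma_additive.
by apply/funext => n; apply: eq_bigr => i _; rewrite UE.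
Qed.

HB.instance Definition _ := isMeasure.Build _ _ _ U U0 U_ge0 U_sigma_additive.

Let U_setT : U setT = 1%E.
Proof.
rewrite /uniform_law /uniform_on setTI -{1}(fineK Tfin) -EFinM mulfV//.
by rewrite fine_eq0.
Qed.

HB.instance Definition _ := Measure_isProbability.Build _ _ _ U U_setT.

Lemma uniform_lawT : U T = 1%E.
Proof.
by rewrite /uniform_law /uniform_on setIid -{1}(fineK Tfin) -EFinM mulfV// fine_eq0.
Qed.

End uniform_law.

(** * Continuous paths on a compact set *)

Lemma cvg_half (R : realType) : (fun n : nat => 2 ^- n : R) @ \oo --> (0 : R).
Proof.
rewrite (_ : (fun n => _) = (fun n => 2^-1 ^+ n)); last first.
  by apply/funext => n; rewrite exprVn.
by apply: cvg_expr; rewrite ger0_norm// invf_lt1 ?ltr1n.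
Qed.

Section ball_rV.
Context (R : realType) (d : nat).
Implicit Types x y : 'rV[R]_d.

Lemma norm1_ge0 x : 0 <= norm1 x.
Proof. by apply: sumr_ge0. Qed.

Lemma norm1_le x (e : R) : (forall j, `|x ord0 j| <= e) -> norm1 x <= d%:R * e.
Proof.
move=> xe; apply: (le_trans (ler_sum _ (fun j _ => xe j))).
by rewrite big_const_ord iter_addr addr0 mulr_natl.
Qed.

Lemma norm1_triangle x y : norm1 (x + y) <= norm1 x + norm1 y.
Proof.
rewrite /norm1 -big_split/=; apply: ler_sum => j _; rewrite mxE.
exact: ler_normD.
Qed.

Lemma norm1N x : norm1 (- x) = norm1 x.
Proof. by apply: eq_bigr => j _; rewrite mxE normrN. Qed.

Lemma norm1_distC x y : norm1 (x - y) = norm1 (y - x).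
Proof. by rewrite -norm1N opprB. Qed.

Lemma nbhs_norm1 x (A : set 'rV[R]_d) : nbhs x A ->
  exists2 e : R, 0 < e & forall y, (forall j, `|x ord0 j - y ord0 j| < e) -> A y.
Proof.
move=> /nbhs_ballP[e /= e0 eA]; exists e => // y xy; apply: eA; split => // i j.
by rewrite (ord1 i) /ball/=; exact: xy.
Qed.

Lemma cvg_within_seq (T : set 'rV[R]_d) (h : 'rV[R]_d -> R) (x : 'rV[R]_d)
    (u : nat -> 'rV[R]_d) : {within T, continuous h} -> T x -> (forall n, T (u n)) ->
  (forall n j, `|x ord0 j - u n ord0 j| <= 2 ^- n) ->
  h (u n) @[n --> \oo] --> h x.
Proof.
move=> ch Tx Tu ux.
have ch' : h @ within T (nbhs x) --> h x.
  by have := ch x; rewrite /continuous_at nbhs_subspace_in.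
move=> A /ch'; rewrite /fmap/= nbhs_filterE => -/nbhs_norm1[e e0 eA].
have := @cvg_half R.
move=> /cvgrPdist_lt /(_ e e0) ne.
change (\forall n \near \oo, A (h (u n))); near=> n; apply: (eA (u n) _ (Tu n)) => j.
apply: (le_lt_trans (ux n j)); have : `|0 - 2 ^- n| < e by near: n.
by rewrite sub0r normrN ger0_norm// invr_ge0 exprn_ge0.
Unshelve. all: by end_near. Qed.

End ball_rV.

(** * Dyadic cells and projection onto cell points *)

Section grid.
Context (R : realType) (d : nat) (T : set 'rV[R]_d) (N : nat).
Hypothesis T0 : T !=set0.
Hypothesis TN : forall x, T x -> forall j, `|x ord0 j| <= N%:R.

(** The number of dyadic steps of length 2^-k from -N to N. Indices range up to this value included,
    since a coordinate equal to N falls into one further half-open cell. *)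
Definition grid_bound k := ((2 * N) * 2 ^ k)%N.
Local Notation I k := {ffun 'I_d -> 'I_(grid_bound k).+1}.

Definition cell k (i : I k) : set 'rV[R]_d :=
  [set x | forall j, (i j)%:R <= 2 ^+ k * (x ord0 j + N%:R) < (i j).+1%:R].

Lemma measurable_cell k (i : I k) : measurable (cell i).
Proof.
have -> : cell i = \big[setI/setT]_(j < d)
    [set x : 'rV[R]_d | `[(i j)%:R, (i j).+1%:R[%classic (2 ^+ k * (x ord0 j + N%:R))].
  rewrite -bigcap_seq; apply/seteqP; split => x /= h j.
    by move=> _; rewrite /= in_itv/=; exact: h.
  by have := h j (mem_index_enum j); rewrite /= in_itv/=.
apply: bigsetI_measurable => j _.
apply: (@measurable_preimageT _ _ _ _ (fun x : 'rV[R]_d => 2 ^+ k * (x ord0 j + N%:R))) => //.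
by apply: measurable_funM => //; apply: measurable_funD => //; exact: measurable_coord.
Qed.

Lemma cell_unique k (i i' : I k) x : cell i x -> cell i' x -> i = i'.
Proof.
move=> ci ci'; apply/ffunP => j; apply/val_inj/eqP => /=.
have /andP[a1 a2] := ci j; have /andP[b1 b2] := ci' j.
by rewrite eqn_leq; apply/andP; split; rewrite -ltnS -(ltr_nat R);
  [exact: le_lt_trans a1 b2|exact: le_lt_trans b1 a2].
Qed.

Lemma cell_cover k x : T x -> exists i : I k, cell i x.
Proof.
move=> Tx; pose y j := 2 ^+ k * (x ord0 j + N%:R).
have xN j : 0 <= x ord0 j + N%:R <= (2 * N)%:R.
  have := TN Tx j; rewrite ler_norml natrM => /andP[h1 h2].
  by apply/andP; split; lra.
have y0 j : 0 <= y j <= (grid_bound k)%:R.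
  have /andP[h1 h2] := xN j.
  by rewrite /y mulr_ge0 ?exprn_ge0//= /grid_bound natrM mulrC natrX ler_pM2r ?exprn_gt0.
have [t tP] : exists t : 'I_d -> nat, forall j, (t j)%:R <= y j < (t j).+1%:R.
  exists (fun j => Num.truncn (y j)) => j; apply: truncn_itv.
  by have /andP[] := y0 j.
have tb j : (t j < (grid_bound k).+1)%N.
  rewrite ltnS -(ler_nat R); have /andP[_] := y0 j.
  by apply: le_trans; have /andP[] := tP j.
by exists [ffun j => Ordinal (tb j)] => j; rewrite ffunE/=; exact: tP.
Qed.

(** The default, taken when the cell misses [T], is a fixed point of [T]; hence the value lies in
    [T] for every index. *)
Definition cell_point k (i : I k) : 'rV[R]_d :=
  xget (xget 0 T) (T `&` cell i).

Lemma T_cell_point k (i : I k) : T (cell_point i).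
Proof.
rewrite /cell_point; case: xgetP => [y _ []//|_].
by case: T0 => t Tt; apply: (@xgetPex _ 0 T); exists t.
Qed.

Definition cell_index k x : I k := xget [ffun=> ord0] (fun i => cell i x).

Lemma cell_indexP k x : T x -> cell (cell_index k x) x.
Proof.
by move=> Tx; apply: (@xgetPex _ _ (fun i : I k => cell i x)); exact: cell_cover.
Qed.

Definition proj k x := cell_point (cell_index k x).

Lemma T_proj k x : T (proj k x).
Proof. exact: T_cell_point. Qed.

Lemma cell_dist k (i : I k) x y j : cell i x -> cell i y ->
  `|x ord0 j - y ord0 j| <= 2 ^- k.
Proof.
move=> /(_ j) /andP[a1 a2] /(_ j) /andP[b1 b2].
have k0 : 0 < 2 ^+ k :> R by rewrite exprn_gt0.
rewrite -(ler_pM2l k0) mulfV ?gt_eqF// -{1}(gtr0_norm k0) -normrM.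
have e : (i j).+1%:R = (i j)%:R + 1 :> R by rewrite natr1.
rewrite e in a2 b2; rewrite ler_norml mulrBr; apply/andP; split; lra.
Qed.

Lemma proj_dist k x j : T x -> `|x ord0 j - proj k x ord0 j| <= 2 ^- k.
Proof.
move=> Tx; apply: (@cell_dist k (cell_index k x)); first exact: cell_indexP.
rewrite /proj /cell_point; case: xgetP => [y _ []//|/(_ x)[]].
by split => //; exact: cell_indexP.
Qed.

Lemma proj_norm1 k x : T x -> norm1 (x - proj k x) <= d%:R * 2 ^- k.
Proof. by move=> Tx; apply: norm1_le => j; rewrite !mxE; exact: proj_dist. Qed.

Lemma cvg_proj (h : 'rV[R]_d -> R) x : {within T, continuous h} -> T x ->
  h (proj k x) @[k --> \oo] --> h x.
Proof.
move=> ch Tx; apply: (cvg_within_seq ch) => // [k|k j]; first exact: T_proj.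
exact: proj_dist.
Qed.

(** The sigma-algebra on row vectors is generated by the coordinates, so closed sets need an
    argument: a closed bounded set is the intersection over k of the finite unions of the level k
    cells that meet it. *)
Lemma measurable_compact (Tcl : closed T) : measurable T.
Proof.
have -> : T = \bigcap_k \bigcup_(i in [set i : I k | T `&` cell i !=set0]) cell i.
  apply/seteqP; split => [x Tx k _|x h].
    by exists (cell_index k x); [exists x|]; rewrite /=; do ?split => //; exact: cell_indexP.
  apply: Tcl => A /nbhs_norm1[e e0 eA].
  have := @cvg_half R.
  move=> /cvgrPdist_lt /(_ e e0) [k _ /(_ k (leqnn k))] /=.
  rewrite sub0r normrN ger0_norm ?invr_ge0 ?exprn_ge0// => ke.
  have [i [y [Ty iy]] ix] := h k Logic.I.
  exists y; split => //; apply: eA => j; exact: le_lt_trans (cell_dist j ix iy) ke.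
apply: bigcapT_measurable => k; apply: fin_bigcup_measurable => [|i _]; first exact: finite_finset.
exact: measurable_cell.
Qed.

End grid.

(** * Measurable versions of path events *)

Section paths.
Context (R : realType) (disp : measure_display) (Omega : measurableType disp).
Context (P : probability Omega R) (d : nat) (T : set 'rV[R]_d).
Context (f : 'rV[R]_d -> {RV P >-> R}) (N : nat) (G : set Omega).
Hypothesis T0 : T !=set0.
Hypothesis cT : compact T.
Hypothesis TN : forall x, T x -> forall j, `|x ord0 j| <= N%:R.
Hypothesis mG : measurable G.
Hypothesis PG : P (~` G) = 0%E.
Hypothesis Gc : forall omega, G omega ->
  {within T, continuous (fun t => f t omega : R)}.
Local Notation I k := {ffun 'I_d -> 'I_(grid_bound N k).+1}.

Lemma closed_T : closed T.
Proof. by apply: compact_closed => //; exact: norm_hausdorff. Qed.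

Lemma measurable_T : measurable T.
Proof. exact: (measurable_compact TN closed_T). Qed.

Lemma ae_pr (A B : set Omega) : measurable B ->
  (forall omega, G omega -> (A omega <-> B omega)) -> pr P A = fine (P B).
Proof.
move=> mB AB; rewrite /pr; congr fine; apply/eqP; rewrite eq_le; apply/andP; split.
  apply: (@le_trans _ _ (mu_ext P (B `|` ~` G))).
    apply: le_mu_ext => w Aw; have [Gw|nGw] := pselect (G w); last by right.
    by left; apply/AB.
  rewrite measurable_mu_extE; last by apply: measurableU => //; exact: measurableC.
  apply: (le_trans (measureU2 _ _ _)) => //; first exact: measurableC.
  by rewrite [X in (_ + X <= _)%E]PG adde0.
rewrite -(measurable_mu_extE P mB).
apply: (@le_trans _ _ (mu_ext P (A `|` ~` G))).
  apply: le_mu_ext => w Bw; have [Gw|nGw] := pselect (G w); last by right.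
  by left; apply/AB.
apply: (le_trans (outer_measureU2 _ _ _)).
by rewrite [X in (_ + X <= _)%E]measurable_mu_extE ?[X in (_ + X <= _)%E]PG ?adde0//; exact: measurableC.
Qed.

(** A measurable version of the event that the maximum exceeds [b]: for a continuous path the
    countably many cell points suffice. *)
Definition path_above (b : R) : set Omega :=
  \bigcup_k \bigcup_(i in [set: I k]) [set omega | b < f (cell_point T i) omega].

Lemma measurable_above (t : 'rV[R]_d) (b : R) : measurable [set omega | b < f t omega].
Proof.
rewrite (_ : [set _ | _] = [set omega | `]b, +oo[%classic (f t omega)]).
  exact: measurable_preimageT.
by apply/seteqP; split => w /=; rewrite in_itv/= andbT.
Qed.

Lemma measurable_path_above b : measurable (path_above b).
Proof.
apply: bigcupT_measurable => k; apply: fin_bigcup_measurable => [|i _].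
  exact: finite_finset.
exact: measurable_above.
Qed.

Lemma path_has_sup omega : G omega -> has_sup [set (f t omega : R) | t in T].
Proof.
move=> Gw; split.
  by have [t Tt] := T0; exists (f t omega); exists t.
have [c _ cmax] := EVT_max_rV T0 cT (Gc Gw).
by exists (f c omega) => _ [t Tt <-]; apply: cmax; rewrite inE.
Qed.

Lemma maxT_ge t omega : G omega -> T t -> f t omega <= maxT T f omega.
Proof.
by move=> Gw Tt; apply: sup_ubound; [have [] := path_has_sup Gw|exists t].
Qed.

Lemma maxT_gtP omega b : G omega -> (b < maxT T f omega) <-> exists2 t, T t & b < f t omega.
Proof.
move=> Gw; split.
  by move=> /(sup_gt (proj1 (path_has_sup Gw)))[_ [t Tt <-] bt]; exists t.
by move=> [t Tt bt]; apply: lt_le_trans (maxT_ge Gw Tt).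
Qed.

Lemma path_aboveP omega b : G omega -> (b < maxT T f omega) <-> path_above b omega.
Proof.
move=> Gw; rewrite maxT_gtP//; split.
  move=> [t Tt bt].
  have := cvg_proj T0 TN (Gc Gw) Tt.
  move=> /cvgrPdist_lt /(_ (f t omega - b)).
  rewrite subr_gt0 => /(_ bt)[k _ /(_ k (leqnn k))] /=.
  rewrite ltr_norml => /andP[_ h]; exists k => //; exists (cell_index N k t) => //=.
  rewrite -/(proj T N k t); move: h; lra.
by move=> [k _ [i _ bi]]; exists (cell_point T i) => //; exact: T_cell_point.
Qed.

Lemma pr_maxT b : pr P [set omega | b < maxT T f omega] = fine (P (path_above b)).
Proof. by apply: ae_pr; [exact: measurable_path_above|move=> w Gw; exact: path_aboveP]. Qed.

(** A jointly measurable version of the field, equal to it on [T] and [G] and zero elsewhere. Fubini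
    over random points and paths is applied to it. *)
Definition good_field (p : 'rV[R]_d * Omega) : R :=
  \1_T p.1 * (\1_G p.2 * f p.1 p.2).

Lemma good_fieldE t omega : T t -> G omega -> good_field (t, omega) = f t omega.
Proof. by move=> Tt Gw; rewrite /good_field/= !indicE !mem_set// !mul1r. Qed.

(** On [T] and [G] it is the limit of the fields frozen on dyadic cells, each a finite sum of
    products of a function of the point and a function of the path. *)
Lemma measurable_good_field : measurable_fun setT good_field.
Proof.
pose h k (p : 'rV[R]_d * Omega) : R :=
  \1_T p.1 * (\1_G p.2 * \sum_(i : I k) \1_(cell i) p.1 * f (cell_point T i) p.2).
apply: (@measurable_fun_cvg _ _ _ _ h).
  move=> k; apply: measurable_funM.
    by apply: measurableT_comp => //; apply: measurable_indic; exact: measurable_T.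
  apply: measurable_funM.
    by apply: measurableT_comp => //; exact: measurable_indic.
  apply: measurable_sum => i; apply: measurable_funM.
    by apply: measurableT_comp => //; apply: measurable_indic; exact: measurable_cell.
  exact: measurableT_comp.
move=> [t w] _; rewrite /h /good_field/=.
have [Tt|nTt] := pselect (T t); last first.
  rewrite indicE memNset// mul0r; under eq_fun do rewrite mul0r; exact: cvg_cst.
have [Gw|nGw] := pselect (G w); last first.
  rewrite [\1_G _]indicE memNset// mul0r mulr0.
  under eq_fun do rewrite mul0r mulr0; exact: cvg_cst.
rewrite !indicE !mem_set// !mul1r.
under eq_fun do rewrite !mul1r.
have e k : \sum_(i : I k) \1_(cell i) t * f (cell_point T i) w = f (proj T N k t) w.
  have ci := cell_indexP TN k Tt.
  rewrite (bigD1 (cell_index N k t))//= [X in _ + X]big1; last first.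
    move=> i /negP ni; rewrite indicE memNset ?mul0r// => cit.
    by apply: ni; apply/eqP; exact: (cell_unique cit ci).
  by rewrite addr0 indicE mem_set// mul1r.
under eq_fun do rewrite e.
exact: (cvg_proj T0 TN (Gc Gw) Tt).
Qed.

Definition good_vector M (p : M.-tuple 'rV[R]_d * Omega) : M.-tuple R :=
  [tuple good_field (tnth p.1 i, p.2) | i < M].

Lemma measurable_good_vector M : measurable_fun setT (@good_vector M).
Proof.
apply/measurable_fun_tnthP => i.
rewrite (_ : _ \o _ = good_field \o (fun p : M.-tuple 'rV[R]_d * Omega => (tnth p.1 i, p.2))).
  apply: measurableT_comp; first exact: measurable_good_field.
  apply/measurable_fun_pairP; split.
    by apply: (@measurableT_comp _ _ _ _ _ _ (fun u => tnth u i)) => //; exact: measurable_tnth.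
  exact: measurable_snd.
by apply/funext => p /=; rewrite tnth_mktuple.
Qed.

Lemma good_vectorE M (u : M.-tuple 'rV[R]_d) omega : points T u -> G omega ->
  good_vector (u, omega) = Xat f u omega.
Proof.
move=> Tu Gw; apply/eq_from_tnth => i; rewrite !tnth_mktuple.
by apply: good_fieldE => //; exact: Tu.
Qed.

Lemma measurable_points M : measurable (@points R d T M).
Proof.
rewrite (_ : @points R d T M = \big[setI/setT]_(i < M) [set u : M.-tuple 'rV[R]_d | T (tnth u i)]); last first.
  rewrite -bigcap_seq; apply/seteqP; split => u /= h i; first by move=> _; exact: h.
  exact: h (mem_index_enum i).
apply: bigsetI_measurable => i _.
by apply: measurable_preimageT; [exact: measurable_tnth|exact: measurable_T].
Qed.

Lemma measurable_Xat M (u : M.-tuple 'rV[R]_d) : measurable_fun setT (Xat f u).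
Proof.
apply/measurable_fun_tnthP => i.
rewrite (_ : _ \o _ = f (tnth u i)) //.
by apply/funext => w /=; rewrite tnth_mktuple.
Qed.

Lemma integral_Xat_good M (u : M.-tuple 'rV[R]_d) (h : M.-tuple R -> \bar R) :
  measurable_fun setT h -> (forall x, 0 <= h x)%E -> points T u ->
  (\int[P]_omega h (Xat f u omega) = \int[P]_omega h (good_vector (u, omega)))%E.
Proof.
move=> mh h0 Tu; apply: ge0_ae_eq_integral => //.
- by apply: measurableT_comp => //; exact: measurable_Xat.
- apply: measurableT_comp => //.
  exact: measurableT_comp (@measurable_good_vector M) (pair1_measurable u).
- exists (~` G); split => //; first exact: measurableC.
  by move=> w /= /not_implyP[_]; apply: contra_not => Gw; rewrite good_vectorE.
Qed.

End paths.

(** * The Cramer-Wold device *)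

Section cauchy_kernel.
Context (R : realType).
Local Notation leb := (@lebesgue_measure R).

(** An antiderivative in t of exp(-e t) (1 + cos(t x)). Adding 1 to the cosine keeps the integrand
    nonnegative, which is what Tonelli and the improper fundamental theorem ask for. *)
Let F (e x t : R) : R :=
  - expR (- e * t) / e + expR (- e * t) * (x * sin (t * x) - e * cos (t * x)) / (e ^+ 2 + x ^+ 2).

Lemma is_derive_laplace_cos (e x t : R) : 0 < e ->
  is_derive t 1 (F e x) (expR (- e * t) * (1 + cos (t * x))).
Proof.
move=> e0; have en0 : e != 0 by rewrite gt_eqF.
have d0 : e ^+ 2 + x ^+ 2 != 0 by rewrite gt_eqF// ltr_pwDl ?exprn_gt0 ?sqr_ge0.
have dE : is_derive t 1 (fun t : R => expR (- e * t)) (- e * expR (- e * t)).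
  have h : is_derive t 1 (fun t : R => - e * t) (- e).
    by have := is_deriveZ (- e) (is_derive_id t 1); move/is_derive_eq; apply; rewrite /GRing.scale/= mulr1.
  by have := is_derive1_comp (is_derive_expR _) h; move/is_derive_eq; apply; rewrite mulrC.
have hx : is_derive t 1 (fun t : R => t * x) x.
  have := is_deriveZ x (is_derive_id t 1); rewrite /GRing.scale/= mulr1.
  by rewrite (_ : x \*: _ = fun t => t * x)//; apply/funext => s; rewrite mulrC.
have dS : is_derive t 1 (fun t : R => sin (t * x)) (x * cos (t * x)).
  by have := is_derive1_comp (is_derive_sin _) hx; move/is_derive_eq; apply; rewrite mulrC.
have dC : is_derive t 1 (fun t : R => cos (t * x)) (- x * sin (t * x)).
  by have := is_derive1_comp (is_derive_cos _) hx; move/is_derive_eq; apply; ring.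
have dK : is_derive t 1 (fun t : R => x * sin (t * x) - e * cos (t * x))
    (x * (x * cos (t * x)) - e * (- x * sin (t * x))).
  exact: is_deriveB (is_deriveZ x dS) (is_deriveZ e dC).
have dEK := is_deriveM dE dK.
have d1 := is_deriveZ (- e^-1) dE.
have d2 := is_deriveZ ((e ^+ 2 + x ^+ 2)^-1) dEK.
have := is_deriveD d1 d2.
rewrite (_ : _ + _ = F e x); last first.
  apply/funext => s.
  transitivity (- e^-1 * expR (- e * s) + (e ^+ 2 + x ^+ 2)^-1 *
    (expR (- e * s) * (x * sin (s * x) - e * cos (s * x)))) => //.
  by rewrite /F; field; rewrite d0 en0.
move/is_derive_eq; apply; rewrite /GRing.scale/=; field; by rewrite d0 en0.
Qed.

Lemma cvg_expRN (e : R) : 0 < e -> expR (- e * t) @[t --> +oo] --> (0 : R).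
Proof.
move=> e0; apply/cvgrPdist_lt => d d0; near=> t.
have t0 : (e * d)^-1 < t by near: t; apply: nbhs_pinfty_gt; exact: num_real.
rewrite sub0r normrN ger0_norm ?expR_ge0// mulNr expRN invf_plt ?posrE ?expR_gt0//.
apply: (@lt_le_trans _ _ (1 + e * t)); last exact: expR_ge1Dx.
have : d^-1 < e * t by move: t0; rewrite invfM mulrC ltr_pdivrMr// mulrC.
lra.
Unshelve. all: by end_near. Qed.

Lemma laplace_cos (e x : R) : 0 < e ->
  (\int[leb]_(t in `[0%R, +oo[) (expR (- e * t) * (1 + cos (t * x)))%:E
   = (e^-1 + e / (e ^+ 2 + x ^+ 2))%:E)%E.
Proof.
move=> e0; have en0 : e != 0 by rewrite gt_eqF.
have d0 : 0 < e ^+ 2 + x ^+ 2 by rewrite ltr_pwDl ?exprn_gt0 ?sqr_ge0.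
have dn0 : e ^+ 2 + x ^+ 2 != 0 by rewrite gt_eqF.
have dF t := is_derive_laplace_cos x t e0.
rewrite (@ge0_continuous_FTC2y R _ (F e x) 0 0).
- rewrite sub0e -EFinN /F !mulr0 !mul0r expR0 sin0 cos0; congr EFin.
  by field; rewrite dn0 en0.
- move=> t _; have c := cos_geN1 (t * x); apply: mulr_ge0; [exact: expR_ge0|lra].
- apply: continuous_subspaceT => t; apply: cvgM.
    apply: continuous_comp; last exact: continuous_expR.
    by apply: cvgM; [exact: cvg_cst|exact: cvg_id].
  apply: cvgD; first exact: cvg_cst.
  apply: continuous_comp; last exact: continuous_cos.
  by apply: cvgM; [exact: cvg_id|exact: cvg_cst].
- apply/cvgrPdist_le => r r0.
  (* C bounds |F e x t| exp(e t), so the decay of the exponential gives the limit of F at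
     infinity. *)
  pose C := e^-1 + (`|x| + e) / (e ^+ 2 + x ^+ 2).
  have C0 : 0 < C.
    by rewrite ltr_pwDl ?invr_gt0// divr_ge0 ?(ltW d0)// addr_ge0// ltW.
  have := cvg_expRN e0 => /cvgrPdist_lt /(_ (r / C)).
  rewrite divr_gt0// => /(_ isT); apply: filterS => t.
  rewrite sub0r normrN ger0_norm ?expR_ge0// ltr_pdivlMr// => h.
  rewrite sub0r normrN; apply: (le_trans _ (ltW h)).
  rewrite /F /C [leRHS]mulrDr mulNr; apply: (le_trans (ler_normB _ _)) || apply: (le_trans (ler_normD _ _)).
  rewrite normrN; apply: lerD.
    by rewrite ger0_norm// divr_ge0 ?expR_ge0// ltW.
  rewrite -mulrA normrM ger0_norm ?expR_ge0// ler_wpM2l ?expR_ge0//.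
  rewrite normrM normfV (gtr0_norm d0) ler_pM2r ?invr_gt0//.
  apply: (le_trans (ler_normB _ _)); apply: lerD; rewrite normrM.
    rewrite ler_piMr// ler_norml; apply/andP; split; [exact: sin_geN1|exact: sin_le1].
  rewrite (gtr0_norm e0) ler_piMr ?(ltW e0)// ler_norml; apply/andP; split; [exact: cos_geN1|exact: cos_le1].
- by move=> t _; exact: (@ex_derive _ _ _ _ _ _ _ (dF t)).
- apply: cvg_at_right_filter; apply: differentiable_continuous.
  by apply/derivable1_diffP; exact: (@ex_derive _ _ _ _ _ _ _ (dF 0)).
- by move=> t _; rewrite derive1E; exact: (@derive_val _ _ _ _ _ _ _ (dF t)).
Qed.

Lemma cauchy_tail (e x a : R) : 0 < e ->
  (\int[leb]_(y in `[a, +oo[) (e / (e ^+ 2 + (y - x) ^+ 2))%:E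
   = (pi / 2 - atan ((a - x) / e))%:E)%E.
Proof.
move=> e0; have en0 : e != 0 by rewrite gt_eqF.
have d0 y : 0 < e ^+ 2 + (y - x) ^+ 2 by rewrite ltr_pwDl ?exprn_gt0 ?sqr_ge0.
have dF y : is_derive (y : R) 1 (fun y => atan ((y - x) / e)) (e / (e ^+ 2 + (y - x) ^+ 2)).
  have h : is_derive y 1 (fun y : R => (y - x) / e) e^-1.
    have h1 : is_derive y 1 (fun y : R => y - x) 1.
      have := is_deriveB (is_derive_id y 1) (is_derive_cst x y 1).
      by rewrite subr0.
    have := is_deriveZ e^-1 h1; rewrite (_ : e^-1 \*: _ = fun y => (y - x) / e); last first.
      by apply/funext => z; rewrite /GRing.scale/= mulrC.
    by move/is_derive_eq; apply; rewrite /GRing.scale/= mulr1.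
  have := is_derive1_comp (is_derive1_atan _) h; move/is_derive_eq; apply.
  have dn0 : e ^+ 2 + (y - x) ^+ 2 != 0 by rewrite gt_eqF.
  rewrite exprMn exprVn -[1](@divff _ (e ^+ 2)) ?expf_neq0// -mulrDl invf_div.
  by field; rewrite dn0 en0.
rewrite (@ge0_continuous_FTC2y R _ (fun y => atan ((y - x) / e)) a (pi / 2)).
- by rewrite EFinB.
- by move=> y _; rewrite divr_ge0 ?(ltW e0)// ltW.
- apply: continuous_subspaceT => y; apply: cvgM; first exact: cvg_cst.
  apply: cvgV; first by rewrite gt_eqF.
  apply: cvgD; first exact: cvg_cst.
  apply: (@continuous_comp _ _ _ (fun y : R => y - x) (fun z => z ^+ 2)).
    by apply: cvgB; [exact: cvg_id|exact: cvg_cst].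
  exact: exprn_continuous.
- apply: cvg_comp (@cvgy_atan R).
  apply: gt0_cvgMly; first by rewrite invr_gt0.
  exact: cvg_addrr.
- by move=> y _; exact: (@ex_derive _ _ _ _ _ _ _ (dF y)).
- apply: cvg_at_right_filter; apply: differentiable_continuous.
  by apply/derivable1_diffP; exact: (@ex_derive _ _ _ _ _ _ _ (dF a)).
- by move=> y _; rewrite derive1E; exact: (@derive_val _ _ _ _ _ _ _ (dF y)).
Qed.

End cauchy_kernel.

Definition density_measure d (X : measurableType d) (R : realType)
    (mu : {measure set X -> \bar R}) (D : X -> R) (mD : measurable_fun setT D)
    (D0 : forall x, 0 <= D x) : set X -> \bar R :=
  fun A => (\int[mu]_(x in A) (D x)%:E)%E.

Section density_measure.
Context d (X : measurableType d) (R : realType) (mu : {measure set X -> \bar R}).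
Variables (D : X -> R) (mD : measurable_fun setT D) (D0 : forall x, 0 <= D x).
Local Notation nu := (density_measure mu mD D0).

Let nu0 : nu set0 = 0%E.
Proof. by rewrite /density_measure integral_set0. Qed.

Let nu_ge0 A : (0 <= nu A)%E.
Proof. by apply: integral_ge0 => x _; rewrite lee_fin. Qed.

Let nu_sigma_additive : semi_sigma_additive nu.
Proof.
move=> F mF tF mUF; rewrite /density_measure ge0_integral_bigcup//.
- apply: is_cvg_nneseries => n _ _; apply: integral_ge0 => x _; by rewrite lee_fin.
- by apply/measurable_EFinP; exact: measurable_funTS.
- by move=> x _; rewrite lee_fin.
Qed.

HB.instance Definition _ := isMeasure.Build _ _ _ nu nu0 nu_ge0 nu_sigma_additive.

End density_measure.

Section cos_unique.
Context d (X : measurableType d) (R : realType) (m1 m2 : probability X R).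
Variables (Y D : X -> R).
Hypothesis mY : measurable_fun setT Y.
Hypothesis mD : measurable_fun setT D.
Hypothesis D0 : forall x, 0 <= D x.
Variable (C : R).
Hypothesis DC : forall x, D x <= C.
Local Notation leb := (@lebesgue_measure R).

Let fin_int (m : probability X R) (h : X -> R) (c : R) : measurable_fun setT h ->
  (forall x, 0 <= h x <= c) -> (\int[m]_x (h x)%:E)%E \is a fin_num.
Proof.
move=> mh h0; rewrite ge0_fin_numE; last first.
  by apply: integral_ge0 => x _; rewrite lee_fin; have /andP[] := h0 x.
apply: (@le_lt_trans _ _ (\int[m]_x c%:E)%E).
  by apply: ge0_le_integral_nonmeas => x _; rewrite lee_fin; have /andP[] := h0 x.
by rewrite integral_cst// [X in (_ * X)%E](probability_setT m) mule1 ltry.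
Qed.

Let laplace_swap (m : probability X R) (e y : R) : 0 < e ->
  (\int[leb]_t ((\1_`[0%R, +oo[%classic t * expR (- e * t))%:E *
     \int[m]_x (D x * (1 + cos (t * y + (- t) * Y x)))%:E))%E =
  ((e^-1)%:E * \int[m]_x (D x)%:E
   + \int[m]_x (D x * (e / (e ^+ 2 + (y - Y x) ^+ 2)))%:E)%E.
Proof.
move=> e0.
pose H (p : R * X) : R := (\1_`[0%R, +oo[%classic p.1 * expR (- e * p.1)) *
   (D p.2 * (1 + cos (p.1 * y + (- p.1) * Y p.2))).
have H0 p : 0 <= H p.
  have c := cos_geN1 (p.1 * y + (- p.1) * Y p.2).
  by rewrite /H !mulr_ge0 ?expR_ge0//; lra.
have mE : measurable_fun setT (fun t : R => \1_`[0%R, +oo[%classic t * expR (- e * t)).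
  apply: measurable_funM; first exact: measurable_indic.
  by apply: measurableT_comp => //; exact: measurable_funM.
have mc : measurable_fun setT (fun p : R * X => D p.2 * (1 + cos (p.1 * y + (- p.1) * Y p.2))).
  apply: measurable_funM; first exact: measurableT_comp.
  apply: measurable_funD => //.
  apply: (@measurableT_comp _ _ _ _ _ _ (@cos R)).
    by apply: continuous_measurable_fun; exact: continuous_cos.
  apply: measurable_funD; first exact: measurable_funM.
  by apply: measurable_funM; [exact: measurableT_comp|exact: measurableT_comp].
have mH : measurable_fun setT (fun p => (H p)%:E).
  by apply/measurable_EFinP; apply: measurable_funM => //; exact: measurableT_comp mE _.
transitivity (\int[leb]_t \int[m]_x (H (t, x))%:E)%E.
  apply: eq_integral => t _; rewrite -ge0_integralZl_EFin//.
  - by move=> x _; rewrite lee_fin mulr_ge0//; have := cos_geN1 (t * y + (- t) * Y x); lra.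
  - apply/measurable_EFinP; exact: measurableT_comp mc (pair1_measurable t).
rewrite (@fubini_tonelli _ _ _ _ R leb m (fun p => (H p)%:E)) //.
have mk : measurable_fun setT (fun x => e / (e ^+ 2 + (y - Y x) ^+ 2)).
  apply: (@measurableT_comp _ _ _ _ _ _ (fun z : R => e / (e ^+ 2 + (y - z) ^+ 2))) => //.
  apply: continuous_measurable_fun => z; apply: cvgM; first exact: cvg_cst.
  apply: cvgV; first by rewrite gt_eqF// ltr_pwDl ?exprn_gt0 ?sqr_ge0.
  apply: cvgD; first exact: cvg_cst.
  apply: (@continuous_comp _ _ _ (fun z : R => y - z) (fun z => z ^+ 2)).
    by apply: cvgB; [exact: cvg_cst|exact: cvg_id].
  exact: exprn_continuous.
have k0 x : 0 <= e / (e ^+ 2 + (y - Y x) ^+ 2).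
  by rewrite divr_ge0 ?addr_ge0 ?sqr_ge0 ?exprn_ge0// ltW.
transitivity (\int[m]_x ((e^-1)%:E * (D x)%:E + (D x * (e / (e ^+ 2 + (y - Y x) ^+ 2)))%:E))%E.
  apply: eq_integral => x _; rewrite /H/=.
  under eq_integral do rewrite mulrCA EFinM.
  rewrite ge0_integralZl_EFin//; last first.
    apply/measurable_EFinP; apply: measurable_funM => //.
    apply: measurable_funD => //; apply: (@measurableT_comp _ _ _ _ _ _ (@cos R)).
      by apply: continuous_measurable_fun; exact: continuous_cos.
    by apply: measurable_funD; apply: measurable_funM => //; exact: measurableT_comp.
  transitivity ((D x)%:E * (e^-1 + e / (e ^+ 2 + (y - Y x) ^+ 2))%:E)%E; last first.
    by rewrite -!EFinM -EFinD mulrDr [(D x * e^-1)%R]mulrC.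
  congr (_ * _)%E.
  rewrite -(laplace_cos (y - Y x) e0) (@integral_mul_indic R `[0, +oo[%classic)//.
  apply: eq_integral => t _; rewrite mulrA; congr (_ * (1 + cos _))%:E.
  by rewrite mulrBr mulNr.
rewrite ge0_integralD//.
- congr (_ + _)%E; rewrite ge0_integralZl_EFin//.
  + by move=> x _; rewrite lee_fin.
  + exact/measurable_EFinP.
  + by rewrite invr_ge0 ltW.
- by move=> x _; rewrite -EFinM lee_fin mulr_ge0// invr_ge0 ltW.
- by apply: measurable_funeM; exact/measurable_EFinP.
- by move=> x _; rewrite lee_fin mulr_ge0.
- by apply/measurable_EFinP; exact: measurable_funM.
Qed.

Let tail_swap (m : probability X R) (e a : R) : 0 < e ->
  (\int[leb]_(y in `[a, +oo[) \int[m]_x (D x * (e / (e ^+ 2 + (y - Y x) ^+ 2)))%:E =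
   \int[m]_x (D x * (pi / 2 - atan ((a - Y x) / e)))%:E)%E.
Proof.
move=> e0.
pose H (p : R * X) : R := \1_`[a, +oo[%classic p.1 * (D p.2 * (e / (e ^+ 2 + (p.1 - Y p.2) ^+ 2))).
have q0 (z : R) : 0 < e ^+ 2 + z ^+ 2 by rewrite ltr_pwDl ?exprn_gt0 ?sqr_ge0.
have H0 p : 0 <= H p.
  by rewrite /H !mulr_ge0// ?invr_ge0// ltW.
have mk : measurable_fun setT (fun p : R * X => e / (e ^+ 2 + (p.1 - Y p.2) ^+ 2)).
  apply: (@measurableT_comp _ _ _ _ _ _ (fun z : R => e / (e ^+ 2 + z ^+ 2))).
    apply: continuous_measurable_fun => z; apply: cvgM; first exact: cvg_cst.
    apply: cvgV; first by rewrite gt_eqF.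
    by apply: cvgD; [exact: cvg_cst|exact: exprn_continuous].
  by apply: measurable_funB => //; exact: measurableT_comp.
have mH : measurable_fun setT (fun p => (H p)%:E).
  apply/measurable_EFinP; apply: measurable_funM.
    by apply: measurableT_comp => //; exact: measurable_indic.
  by apply: measurable_funM => //; exact: measurableT_comp.
transitivity (\int[leb]_y \int[m]_x (H (y, x))%:E)%E.
  rewrite integral_mkcond; apply: eq_integral => y _; rewrite patchE.
  case: ifPn => ya; rewrite /H/= indicE.
    by rewrite ya; apply: eq_integral => x _; rewrite mul1r.
  by rewrite (negbTE ya) integral0_eq// => x _; rewrite mul0r.
rewrite (@fubini_tonelli _ _ _ _ R leb m (fun p => (H p)%:E)) //.
apply: eq_integral => x _; rewrite /H/=.
under eq_integral do rewrite mulrCA EFinM.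
rewrite ge0_integralZl_EFin//; last 2 first.
- by move=> y _; rewrite lee_fin !mulr_ge0// ?invr_ge0// ltW.
- apply/measurable_EFinP; apply: measurable_funM; first exact: measurable_indic.
  exact: measurableT_comp mk (pair2_measurable x).
by rewrite -(@integral_mul_indic R `[a, +oo[%classic)// cauchy_tail.
Qed.

Hypothesis m12 : forall b t : R,
  (\int[m1]_x (D x * (1 + cos (b + t * Y x)))%:E =
   \int[m2]_x (D x * (1 + cos (b + t * Y x)))%:E)%E.

Let total : (\int[m1]_x (D x)%:E = \int[m2]_x (D x)%:E)%E.
Proof.
have e (m : probability X R) :
    (\int[m]_x (D x * (1 + cos (0 + 0 * Y x)))%:E = 2%:E * \int[m]_x (D x)%:E)%E.
  rewrite -ge0_integralZl_EFin//; last 2 first.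
  - by move=> x _; rewrite lee_fin.
  - exact/measurable_EFinP.
  by apply: eq_integral => x _; rewrite mul0r addr0 cos0 mulrC EFinM.
have := m12 0 0; rewrite !e => /(congr1 (fun z => 2^-1%:E * z)%E).
by rewrite !muleA -!EFinM mulVf// !mul1e.
Qed.

Let atan_eq (e a : R) : 0 < e ->
  (\int[m1]_x (D x * (pi / 2 - atan ((a - Y x) / e)))%:E =
   \int[m2]_x (D x * (pi / 2 - atan ((a - Y x) / e)))%:E)%E.
Proof.
move=> e0; rewrite -!tail_swap//; apply: eq_integral => y _.
have h := laplace_swap m1 y e0; have h2 := laplace_swap m2 y e0.
have : (\int[leb]_t ((\1_`[0%R, +oo[%classic t * expR (- e * t))%:E *
     \int[m1]_x (D x * (1 + cos (t * y + (- t) * Y x)))%:E) =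
   \int[leb]_t ((\1_`[0%R, +oo[%classic t * expR (- e * t))%:E *
     \int[m2]_x (D x * (1 + cos (t * y + (- t) * Y x)))%:E))%E.
  by apply: eq_integral => t _; rewrite m12.
rewrite h h2 total => /(congr1 (fun z => z - (e^-1)%:E * \int[m2]_x (D x)%:E)%E).
(* The common term e^-1 times the integral of [D] is finite because [D] is bounded by [C], and can
   be subtracted. *)
have /fineK <- : (\int[m2]_x (D x)%:E)%E \is a fin_num.
  by apply: (fin_int _ mD (c := C)) => x; rewrite D0 DC.
by rewrite -EFinM ![(_%:E + _)%E]addeC !addeK.
Qed.

Let pi0 : 0 < pi :> R. Proof. exact: pi_gt0. Qed.

Let atan_cvg (z : nat -> R) : (\forall n \near \oo, n.+1%:R <= z n) ->
  atan (z n) @[n --> \oo] --> pi / 2.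
Proof.
move=> hz; apply: (@squeeze_cvgr _ _ _ _ (fun n => atan n.+1%:R) (cst (pi / 2))).
- by near=> n; rewrite le_atan ?(near hz n)//= ltW ?atan_ltpi2.
- apply: (@cvg_comp _ _ _ (fun n : nat => n.+1%:R : R) atan _ +oo); last exact: cvgy_atan.
  apply/cvgryPge => A; near=> n; apply: (@le_trans _ _ n%:R); last by rewrite ler_nat.
  by near: n; exact: nbhs_infty_ger.
- exact: cvg_cst.
Unshelve. all: by end_near. Qed.

(** The shift by 1/(n + 1) makes the argument of atan at most -(n + 1) at y = a as well, so that the
    limit is the indicator of the closed ray. *)
Let ray_cvg (a y : R) :
  pi / 2 - atan ((a - n.+1%:R^-1 - y) * n.+1%:R ^+ 2) @[n --> \oo]
   --> pi * \1_`[a, +oo[%classic y.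
Proof.
have n1 n : 0 < n.+1%:R :> R by rewrite ltr0n.
have e n : (a - n.+1%:R^-1 - y) * n.+1%:R ^+ 2 = n.+1%:R * ((a - y) * n.+1%:R - 1).
  by field; rewrite gt_eqF.
rewrite indicE mem_setE in_itv/= andbT; have [aY|Ya] := leP a y.
  rewrite mulr1 [X in _ --> X](_ : _ = pi / 2 + pi / 2); last by field.
  under eq_fun do rewrite -atanN.
  apply: cvgD; [exact: cvg_cst|apply: atan_cvg; apply: nearW => n].
  rewrite e -mulrN ler_peMr ?(ltW (n1 n))//.
  by have := n1 n; nra.
rewrite mulr0 -[0](subrr (pi / 2)).
apply: cvgB; [exact: cvg_cst|apply: atan_cvg].
near=> n; rewrite e ler_peMr ?(ltW (n1 n))// lerBrDr -ler_pdivrMl ?subr_gt0//.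
apply: (@le_trans _ _ n%:R); last by rewrite ler_nat.
by near: n; exact: nbhs_infty_ger.
Unshelve. all: by end_near. Qed.

Let mray (a : R) : measurable_fun setT (fun x => \1_`[a, +oo[%classic (Y x) : R).
Proof.
rewrite (_ : (fun x => _) = \1_(Y @^-1` `[a, +oo[%classic)); last first.
  by apply/funext => x; rewrite !indicE; congr (_%:R); apply/idP/idP; rewrite !in_setE.
by apply: measurable_indic; exact: measurable_preimageT.
Qed.

Let ray_lim (m : probability X R) (a : R) :
  (\int[m]_x (D x * (pi / 2 - atan ((a - n.+1%:R^-1 - Y x) * n.+1%:R ^+ 2)))%:E @[n --> \oo]
   --> \int[m]_x (D x * (pi * \1_`[a, +oo[%classic (Y x)))%:E)%E.
Proof.
have mA n : measurable_fun setT (fun x => D x * (pi / 2 - atan ((a - n.+1%:R^-1 - Y x) * n.+1%:R ^+ 2))).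
  apply: measurable_funM => //.
  apply: (@measurableT_comp _ _ _ _ _ _ (fun z : R => pi / 2 - atan z)).
    by apply: continuous_measurable_fun => z; apply: cvgB; [exact: cvg_cst|exact: continuous_atan].
  by apply: measurable_funM => //; exact: measurable_funB.
apply: (@dominated_cvg _ _ _ m setT measurableT _ _ (fun=> (C * pi)%:E)).
- by move=> n; exact/measurable_EFinP.
- move=> x _; apply: cvg_EFin; first by apply: nearW.
  by apply: cvgM; [exact: cvg_cst|exact: ray_cvg].
- by [].
- exact: (finite_measure_integrable_cst m (C * pi)).
- move=> n x _; have h1 := atan_ltpi2 ((a - n.+1%:R^-1 - Y x) * n.+1%:R ^+ 2).
  have h2 := atan_gtNpi2 ((a - n.+1%:R^-1 - Y x) * n.+1%:R ^+ 2).
  rewrite lee_fin ger0_norm; last by apply: mulr_ge0 => //; lra.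
  by apply: ler_pM => //; lra.
Qed.

(* Integrating the hypothesis against exp(-e t) dt yields the Cauchy kernel
   e / (e^2 + (Y - s)^2), whose integral over s >= a - 1/n with e = n^-2 tends
   to pi times the indicator of Y >= a. *)
Lemma cos_unique (A : set R) : measurable A ->
  (\int[m1]_x (D x * \1_A (Y x))%:E = \int[m2]_x (D x * \1_A (Y x))%:E)%E.
Proof.
have rays a : (\int[m1]_x (D x * \1_`[a, +oo[%classic (Y x))%:E =
    \int[m2]_x (D x * \1_`[a, +oo[%classic (Y x))%:E)%E.
  have h : (\int[m1]_x (D x * (pi * \1_`[a, +oo[%classic (Y x)))%:E =
    \int[m2]_x (D x * (pi * \1_`[a, +oo[%classic (Y x)))%:E)%E.
    rewrite -(cvg_lim _ (@ray_lim m1 a))// -(cvg_lim _ (@ray_lim m2 a))//.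
    congr (limn _); apply/funext => n.
    have e0 : 0 < (n.+1%:R ^+ 2)^-1 :> R by rewrite invr_gt0 exprn_gt0.
    by have := atan_eq (a - n.+1%:R^-1) e0; rewrite invrK => ->.
  have e (m : probability X R) : (\int[m]_x (D x * (pi * \1_`[a, +oo[%classic (Y x)))%:E =
     pi%:E * \int[m]_x (D x * \1_`[a, +oo[%classic (Y x))%:E)%E.
    rewrite -ge0_integralZl_EFin ?(ltW pi0)//.
    - by apply: eq_integral => x _; rewrite mulrCA EFinM.
    - by move=> x _; rewrite lee_fin mulr_ge0.
    - apply/measurable_EFinP; by apply: measurable_funM => //; exact: mray.
  move: h; rewrite !e => /(congr1 (fun z => pi^-1%:E * z)%E).
  by rewrite !muleA -!EFinM mulVf ?gt_eqF// !mul1e.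
move=> mA.
have e (m : probability X R) (B : set R) : measurable B ->
    (\int[m]_x (D x * \1_B (Y x))%:E = image_measure (density_measure m mD D0) mY B)%E.
  move=> mB; rewrite /image_measure /pushforward /density_measure [RHS]integral_mkcond.
  apply: eq_integral => x _; rewrite patchE indicE.
  have -> : (Y x \in B) = (x \in Y @^-1` B) by apply/idP/idP; rewrite !in_setE.
  by case: ifPn => _; rewrite ?mulr1 ?mulr0.
rewrite !e//; apply: ray_measure_unique => // a; first by have := rays a; rewrite !e.
rewrite [X in (X < _)%E](_ : _ = \int[m1]_x (D x * \1_`[a, +oo[%classic (Y x))%:E)%E; last by rewrite e.
rewrite -ge0_fin_numE; last by apply: integral_ge0 => x _; rewrite lee_fin mulr_ge0.
apply: (fin_int _ _ (c := C)).
  by apply: measurable_funM => //; exact: mray.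
move=> x; rewrite mulr_ge0//=; apply: le_trans (DC x).
by rewrite ler_piMr// indicE; case: (_ \in _).
Qed.

End cos_unique.

Section tuple_unique.
Context (R : realType) (M : nat).
Local Notation V := (M.-tuple R).

Definition boxes : set (set V) :=
  [set A | exists B : 'I_M -> set R, (forall i, measurable (B i)) /\
     A = [set x : V | forall i, B i (tnth x i)]].

Lemma measurable_box (B : 'I_M -> set R) : (forall i, measurable (B i)) ->
  measurable [set x : V | forall i, B i (tnth x i)].
Proof.
move=> mB.
rewrite (_ : [set x | _] = \big[setI/setT]_(i < M) [set x : V | B i (tnth x i)]).
  apply: bigsetI_measurable => i _.
  by apply: measurable_preimageT => //; exact: measurable_tnth.
rewrite -bigcap_seq; apply/seteqP; split => x /= h i; first by move=> _; exact: h.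
exact: h (mem_index_enum i).
Qed.

Lemma tuple_measurableE : (@measurable _ V) = <<s boxes>>.
Proof.
apply/seteqP; split; last first.
  apply: smallest_sub; first exact: sigma_algebra_measurable.
  by move=> _ [B [mB ->]]; exact: measurable_box.
apply: smallest_sub; first exact: smallest_sigma_algebra.
rewrite -bigcup_seq => A [i _ [B mB <-]]; rewrite setTI.
apply: sub_sigma_algebra.
exists (fun j => if j == i then B else setT); split.
  by move=> j; case: ifP.
apply/seteqP; split => x /= h; last by have := h i; rewrite eqxx.
by move=> j; case: ifPn => // /eqP ->.
Qed.

Lemma box_unique (m1 m2 : probability V R) :
  (forall B : 'I_M -> set R, (forall i, measurable (B i)) ->
     m1 [set x : V | forall i, B i (tnth x i)] = m2 [set x : V | forall i, B i (tnth x i)]) ->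
  forall A, measurable A -> m1 A = m2 A.
Proof.
move=> m12 A mA.
apply: (@measure_unique _ R V boxes (fun=> setT)) => //.
- exact: tuple_measurableE.
- move=> _ _ [B [mB ->]] [B' [mB' ->]]; exists (fun i => B i `&` B' i); split.
    by move=> i; exact: measurableI.
  apply/seteqP; split => x /=; first by move=> [h h'] i; split; [exact: h|exact: h'].
  by move=> h; split => i; have [] := h i.
- by move=> i; exists (fun=> setT); split => //; apply/seteqP; split.
- by rewrite bigcup_const//; exists 0%N.
- by move=> _ [B [mB ->]]; exact: m12.
- by move=> k; rewrite [X in (X < _)%E]probability_setT ltry.
Qed.

Definition lin (c : 'I_M -> R) (x : V) : R := \sum_(i < M) c i * tnth x i.

Lemma measurable_lin c : measurable_fun setT (lin c).
Proof.
apply: measurable_sum => i; apply: measurable_funM => //.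
exact: measurable_tnth.
Qed.

Lemma measurable_cos_lin b c : measurable_fun setT (fun x : V => 1 + cos (b + lin c x)).
Proof.
apply: (@measurableT_comp _ _ _ _ _ _ (fun z : R => 1 + cos (b + z))); last exact: measurable_lin.
apply: continuous_measurable_fun => z; apply: cvgD; first exact: cvg_cst.
apply: (@continuous_comp _ _ _ (fun z : R => b + z) (@cos R)); last exact: continuous_cos.
by apply: cvgD; [exact: cvg_cst|exact: cvg_id].
Qed.

Lemma cosD1_ge0 (p : R) : 0 <= 1 + cos p.
Proof. by have := cos_geN1 p; lra. Qed.

Lemma cosD1_le2 (p : R) : 1 + cos p <= 2.
Proof. by have := cos_le1 p; lra. Qed.

(* Products of the nonnegative test functions 1 + cos reduce to such functions:
   [cos_unique] applies with a weight of this form and adds one coordinate to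
   the box. *)
Lemma cosD1M (p q : R) : (1 + cos p) * (1 + cos q) + (1 + cos 0) =
  2^-1 * (1 + cos (p + q)) + 2^-1 * (1 + cos (p - q)) + (1 + cos p) + (1 + cos q).
Proof. by rewrite cos0 cosD cosB; field. Qed.

Definition boxw (B : 'I_M -> set R) (k : nat) (x : V) : R :=
  \prod_(i < M | (i < k)%N) \1_(B i) (tnth x i).

Lemma boxw_bound B k x : 0 <= boxw B k x <= 1.
Proof.
apply/andP; split; first by apply: prodr_ge0 => i _; rewrite indicE.
by apply: prodr_ile1 => i _; rewrite indicE; case: (_ \in _); rewrite ler01 lexx.
Qed.

Lemma measurable_boxw B k : (forall i, measurable (B i)) ->
  measurable_fun setT (boxw B k).
Proof.
move=> mB; rewrite /boxw.
rewrite (_ : (fun x => _) = (fun x : V => \prod_(i < M) (if (i < k)%N then \1_(B i) (tnth x i) else 1))); last first.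
  by apply/funext => x; rewrite big_mkcond.
elim: (index_enum _) => [|i l IH].
  suff -> : (fun x : V => \prod_(i <- [::] : seq 'I_M) (if (i < k)%N then \1_(B i) (tnth x i) else 1)) = cst 1 :> (V -> R) by [].
  by apply/funext => x; rewrite big_nil.
have -> : (fun x : V => \prod_(j <- i :: l) (if (j < k)%N then \1_(B j) (tnth x j) else 1)) =
  (fun x : V => (if (i < k)%N then \1_(B i) (tnth x i) else 1) *
    \prod_(j <- l) (if (j < k)%N then \1_(B j) (tnth x j) else 1)) :> (V -> R).
  by apply/funext => x; exact: big_cons.
apply: measurable_funM => //; case: (i < k)%N => //=.
apply: (@measurableT_comp _ _ _ _ _ _ (\1_(B i) : R -> R) _ (fun x : V => tnth x i)).
  exact: measurable_indic.
exact: measurable_tnth.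
Qed.

Variables m1 m2 : probability V R.
Hypothesis m12 : forall b c,
  (\int[m1]_x (1 + cos (b + lin c x))%:E = \int[m2]_x (1 + cos (b + lin c x))%:E)%E.

Let fin_int (m : probability V R) (h : V -> R) (c : R) : measurable_fun setT h ->
  (forall x, 0 <= h x <= c) -> (\int[m]_x (h x)%:E)%E \is a fin_num.
Proof.
move=> mh h0; rewrite ge0_fin_numE; last first.
  by apply: integral_ge0 => x _; rewrite lee_fin; have /andP[] := h0 x.
apply: (@le_lt_trans _ _ (\int[m]_x c%:E)%E).
  by apply: ge0_le_integral_nonmeas => x _; rewrite lee_fin; have /andP[] := h0 x.
by rewrite integral_cst// [X in (_ * X)%E](probability_setT m) mule1 ltry.
Qed.

(** [k] counts the coordinates already restricted to a box; the frequencies [c] live on the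
    remaining ones. *)
Let claim k := forall B b c, (forall i, measurable (B i)) ->
  (forall i : 'I_M, (i < k)%N -> c i = 0) ->
  (\int[m1]_x (boxw B k x * (1 + cos (b + lin c x)))%:E =
   \int[m2]_x (boxw B k x * (1 + cos (b + lin c x)))%:E)%E.

Let claim0 : claim 0.
Proof.
move=> B b c mB _.
have e x : boxw B 0 x = 1 by rewrite /boxw big1// => i; rewrite ltn0.
by under eq_integral do rewrite e mul1r; under [RHS]eq_integral do rewrite e mul1r.
Qed.

(** The identity [cosD1M] integrated against the box weight. The constant term stays on the left,
    since nonnegative integrals are only added here; it is cancelled later as a finite number. *)
Let cos_prod (m : probability V R) B k (p q : V -> R) : (forall i, measurable (B i)) ->
  measurable_fun setT (fun x => 1 + cos (p x)) -> measurable_fun setT (fun x => 1 + cos (q x)) ->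
  measurable_fun setT (fun x => 1 + cos (p x + q x)) ->
  measurable_fun setT (fun x => 1 + cos (p x - q x)) ->
  (\int[m]_x (boxw B k x * ((1 + cos (p x)) * (1 + cos (q x))))%:E
   + \int[m]_x (boxw B k x * (1 + cos 0))%:E =
   2^-1%:E * \int[m]_x (boxw B k x * (1 + cos (p x + q x)))%:E +
   2^-1%:E * \int[m]_x (boxw B k x * (1 + cos (p x - q x)))%:E +
   \int[m]_x (boxw B k x * (1 + cos (p x)))%:E + \int[m]_x (boxw B k x * (1 + cos (q x)))%:E)%E.
Proof.
move=> mB mp mq mpq mpq'.
have mw := measurable_boxw k mB.
have w0 x : 0 <= boxw B k x by have /andP[] := boxw_bound B k x.
have mh (h : V -> R) : measurable_fun setT h -> measurable_fun setT (fun x => (boxw B k x * h x)%:E).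
  by move=> mh; apply/measurable_EFinP; exact: measurable_funM.
have c0 := cosD1_ge0.
have b0 (h : V -> R) : (forall x, 0 <= h x) -> forall x, setT x -> (0 <= (boxw B k x * h x)%:E)%E.
  by move=> h0 x _; rewrite lee_fin mulr_ge0.
rewrite -ge0_integralD//; [|exact: b0 (fun x => mulr_ge0 (c0 _) (c0 _))|
  by apply: mh; exact: measurable_funM|exact: b0|exact: mh].
rewrite -!ge0_integralZl_EFin//; [|exact: b0|exact: mh|exact: b0|exact: mh].
have mS h : measurable_fun setT h -> measurable_fun setT (fun x => 2^-1%:E * (boxw B k x * h x)%:E)%E.
  by move=> ?; apply: measurable_funeM; exact: mh.
have S0 (h : V -> R) : (forall x, 0 <= h x) -> forall x, setT x -> (0 <= 2^-1%:E * (boxw B k x * h x)%:E)%E.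
  by move=> h0 x _; rewrite mule_ge0// lee_fin mulr_ge0.
rewrite -ge0_integralD//; [|exact: S0|exact: mS|exact: S0|exact: mS].
rewrite -ge0_integralD//; [|by move=> x xT; apply: adde_ge0; exact: (S0 (fun x => 1 + cos _))|
  by apply: emeasurable_funD; exact: mS|exact: b0|exact: mh].
rewrite -ge0_integralD//; [|by move=> x xT; apply: adde_ge0; [apply: adde_ge0; exact: (S0 (fun x => 1 + cos _))|exact: (b0 (fun x => 1 + cos _))]|
  by apply: emeasurable_funD; [apply: emeasurable_funD; exact: mS|exact: mh]|exact: b0|exact: mh].
apply: eq_integral => x _; rewrite -!EFinM -!EFinD; congr EFin.
rewrite -mulrDr cosD1M; ring.
Qed.

Let claimS k : claim k -> claim k.+1.
Proof.
move=> ck B b c mB c0.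
have [kM|Mk] := ltnP k M; last first.
  have e x : boxw B k.+1 x = boxw B k x.
    by apply: eq_bigl => i; rewrite !(leq_trans (ltn_ord i))// leqW.
  under eq_integral do rewrite e; under [RHS]eq_integral do rewrite e.
  by apply: ck => // i ik; apply: c0; exact: ltnW.
pose kk := Ordinal kM.
have e x : boxw B k.+1 x = boxw B k x * \1_(B kk) (tnth x kk).
  rewrite /boxw (bigD1 kk)/= ?ltnS// mulrC; congr (_ * _); apply: eq_bigl => i.
  by rewrite ltnS leq_eqVlt -val_eqE/=; case: ltngtP.
pose D x := boxw B k x * (1 + cos (b + lin c x)).
have D0 x : 0 <= D x.
  by have /andP[w0 _] := boxw_bound B k x; rewrite mulr_ge0// cosD1_ge0.
have D2 x : D x <= 2.
  have /andP[w0 w1] := boxw_bound B k x.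
  rewrite -[2]mul1r ler_pM// ?cosD1_ge0//; exact: cosD1_le2.
have mD : measurable_fun setT D.
  by apply: measurable_funM; [exact: measurable_boxw|exact: measurable_cos_lin].
have ex (x : V) : boxw B k.+1 x * (1 + cos (b + lin c x)) = D x * \1_(B kk) (tnth x kk).
  by rewrite e /D mulrAC.
under eq_integral do rewrite ex; under [RHS]eq_integral do rewrite ex.
apply: (@cos_unique _ V R m1 m2 (fun x => tnth x kk) D _ mD D0 2 D2) => //.
  exact: measurable_tnth.
move=> b' t.
pose cp i := if i == kk then t else 0.
have linp (x : V) : lin cp x = t * tnth x kk.
  rewrite /lin (bigD1 kk)//= /cp eqxx big1 ?addr0// => i /negPf ->.
  by rewrite mul0r.
have exp1 (x : V) : D x * (1 + cos (b' + t * tnth x kk)) =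
    boxw B k x * ((1 + cos (b' + lin cp x)) * (1 + cos (b + lin c x))).
  by rewrite linp /D mulrAC mulrA.
under eq_integral do rewrite exp1; under [RHS]eq_integral do rewrite exp1.
have eD (x : V) : (b' + lin cp x) + (b + lin c x) = (b' + b) + lin (fun i => cp i + c i) x.
  rewrite addrACA; congr (_ + _); rewrite /lin -big_split/=.
  by apply: eq_bigr => i _; rewrite mulrDl.
have eB (x : V) : (b' + lin cp x) - (b + lin c x) = (b' - b) + lin (fun i => cp i - c i) x.
  rewrite opprD addrACA; congr (_ + _); rewrite /lin -sumrB.
  by apply: eq_bigr => i _; rewrite mulrBl.
have mpq : measurable_fun setT (fun x : V => 1 + cos ((b' + lin cp x) + (b + lin c x))).
  by under eq_fun do rewrite eD; exact: measurable_cos_lin.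
have mpq' : measurable_fun setT (fun x : V => 1 + cos ((b' + lin cp x) - (b + lin c x))).
  by under eq_fun do rewrite eB; exact: measurable_cos_lin.
have H m := @cos_prod m B k _ _ mB (measurable_cos_lin b' cp) (measurable_cos_lin b c) mpq mpq'.
have cp0 (i : 'I_M) : (i < k)%N -> cp i = 0.
  by move=> ik; rewrite /cp; case: eqP => // ik'; move: ik; rewrite ik' ltnn.
have ck0 (i : 'I_M) : (i < k)%N -> c i = 0 by move=> ik; apply: c0; exact: ltnW.
have i0 : (\int[m1]_x (boxw B k x * (1 + cos 0))%:E = \int[m2]_x (boxw B k x * (1 + cos 0))%:E)%E.
  have h := ck B 0 (fun=> 0) mB (fun _ _ => erefl).
  have e0 (x : V) : 0 + lin (fun=> 0) x = 0.
    by rewrite add0r /lin big1// => i _; rewrite mul0r.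
  by move: h; under eq_integral do rewrite e0; under [X in _ = X -> _]eq_integral do rewrite e0.
have i1 : (\int[m1]_x (boxw B k x * (1 + cos ((b' + lin cp x) + (b + lin c x))))%:E =
           \int[m2]_x (boxw B k x * (1 + cos ((b' + lin cp x) + (b + lin c x))))%:E)%E.
  under eq_integral do rewrite eD; under [RHS]eq_integral do rewrite eD.
  by apply: ck => // i ik; rewrite cp0// ck0// addr0.
have i2 : (\int[m1]_x (boxw B k x * (1 + cos ((b' + lin cp x) - (b + lin c x))))%:E =
           \int[m2]_x (boxw B k x * (1 + cos ((b' + lin cp x) - (b + lin c x))))%:E)%E.
  under eq_integral do rewrite eB; under [RHS]eq_integral do rewrite eB.
  by apply: ck => // i ik; rewrite cp0// ck0// subr0.
have h1 := H m1; have h2 := H m2.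
rewrite -i1 -i2 -(ck B b' cp mB cp0) -(ck B b c mB ck0) -i0 -h1 in h2.
have fin : (\int[m1]_x (boxw B k x * (1 + cos 0))%:E)%E \is a fin_num.
  apply: (@fin_int m1 (fun x => boxw B k x * (1 + cos 0)) 2).
    by apply: measurable_funM => //; exact: measurable_boxw.
  move=> x; have /andP[w0 w1] := boxw_bound B k x.
  by rewrite mulr_ge0 ?cosD1_ge0//= -[2]mul1r ler_pM// ?cosD1_ge0// cosD1_le2.
move/(congr1 (fun z => z - \int[m1]_x (boxw B k x * (1 + cos 0))%:E)%E) : h2.
by rewrite !addeK.
Qed.

(** Once all coordinates are restricted and all frequencies vanish, the test function is the
    constant 1 + cos 0 = 2, which leaves the measure of a box. *)
Lemma cramer_wold (A : set V) : measurable A -> m1 A = m2 A.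
Proof.
apply: box_unique => B mB.
have cM : claim M by elim: M => [|k]; [exact: claim0|exact: claimS].
have h := cM B 0 (fun=> 0) mB (fun _ _ => erefl).
have e (m : probability V R) : (\int[m]_x (boxw B M x * (1 + cos (0 + lin (fun=> 0) x)))%:E =
    2%:E * m [set x : V | forall i, B i (tnth x i)])%E.
  have mb := measurable_box mB.
  have -> : m [set x : V | forall i, B i (tnth x i)] =
    (\int[m]_x (\1_[set x : V | forall i, B i (tnth x i)] x)%:E)%E.
    by rewrite integral_indic// setIT.
  rewrite -ge0_integralZl_EFin//; last first.
    by apply/measurable_EFinP; exact: measurable_indic.
  apply: eq_integral => x _; rewrite -EFinM; congr EFin.
  have -> : 0 + lin (fun=> 0) x = 0 by rewrite add0r /lin big1// => i _; rewrite mul0r.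
  rewrite cos0 mulrC; congr (_ * _); rewrite indicE /boxw.
  have [xB|xB] := pselect (forall i, B i (tnth x i)).
    by rewrite mem_set// big1// => i _; rewrite indicE mem_set.
  rewrite memNset//; have /existsNP[i nBi] := xB.
  by rewrite (bigD1 i)//= indicE memNset// mul0r.
move: h; rewrite !e => /(congr1 (fun z => 2^-1%:E * z)%E).
by rewrite !muleA -!EFinM mulVf// !mul1e.
Qed.

End tuple_unique.

(** * Gaussian fields *)

Section gaussian_linear.
Context (R : realType) (disp : measure_display) (Omega : measurableType disp).
Context (P : probability Omega R).
Local Notation g := (@std_normal R).

Section normal_variable.
Variables (Y : Omega -> R) (mY : measurable_fun setT Y) (m s : R).
Hypothesis Ylaw : forall A : set R, measurable A -> P [set omega | A (Y omega)] = normal_law m s A.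

Lemma normal_integral (h : R -> \bar R) : measurable_fun setT h -> (forall x, 0 <= h x)%E ->
  (\int[P]_omega h (Y omega) = \int[g]_z h (m + s * z)%R)%E.
Proof.
move=> mh h0.
have ma : measurable_fun [set: R] (fun z : R => m + s * z).
  by under eq_fun do rewrite addrC; exact: measurable_affine.
rewrite -(@integral_image_measure _ _ _ _ _ P _ mY)//.
rewrite -(@integral_image_measure _ _ _ _ _ g _ ma)//.
apply: eq_measure_integral => A mA _; rewrite /image_measure/pushforward.
rewrite [LHS](_ : _ = P [set omega | A (Y omega)])//.
by rewrite Ylaw// normal_lawE.
Qed.

Lemma normal_sqr : (\int[P]_omega ((Y omega - m) ^+ 2)%:E = (s ^+ 2)%:E)%E.
Proof.
rewrite (@normal_integral (fun y => ((y - m) ^+ 2)%:E)); first last.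
- by move=> x; rewrite lee_fin sqr_ge0.
- apply/measurable_EFinP; apply: measurable_funX; exact: measurable_funB.
rewrite (_ : (fun z => _) = (fun z : R => (s ^+ 2)%:E * (z ^+ 2)%:E)%E); last first.
  by apply/funext => z; rewrite addrC addKr exprMn EFinM.
rewrite ge0_integralZl_EFin ?sqr_ge0//.
- by rewrite std_normal_second_moment mule1.
- by move=> z _; rewrite lee_fin sqr_ge0.
- by apply/measurable_EFinP; exact: exprn_measurable.
Qed.

Lemma normal_expectation : 'E_P[Y]%E = m%:E.
Proof.
rewrite unlock integralE.
have mid : measurable_fun [set: R] (fun y : R => y%:E) by apply/measurable_EFinP.
rewrite (_ : (\int[P]_x _^\+ x)%E = (\int[g]_z (fun y : R => y%:E)^\+ (m + s * z)%R)%E); last first.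
  rewrite -(@normal_integral (fun y : R => y%:E)^\+%E)//.
      by apply: eq_integral => x _; rewrite !funeposE.
    exact: (measurable_funepos mid).
rewrite (_ : (\int[P]_x _^\- x)%E = (\int[g]_z (fun y : R => y%:E)^\- (m + s * z)%R)%E); last first.
  rewrite -(@normal_integral (fun y : R => y%:E)^\-%E)//.
      by apply: eq_integral => x _; rewrite !funenegE.
    exact: (measurable_funeneg mid).
rewrite (_ : (_ - _)%E = (\int[g]_z (m + s * z)%:E)%E); last first.
  by rewrite [RHS]integralE; congr (_ - _)%E; apply: eq_integral => z _; rewrite ?funeposE ?funenegE.
under eq_integral do rewrite EFinD EFinM.
have i1 := integrable_std_normal_id R.
rewrite integralD//=; first last.
- exact: integrableZl.
- by apply: finite_measure_integrable_cst.
rewrite integral_cst// [X in (m%:E * X)%E](probability_setT g) mule1 integralZl//.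
by rewrite std_normal_mean mule0 adde0.
Qed.

Lemma normal_Lfun2 : Y \in Lfun P 2%:E.
Proof.
have h : (fun omega => Y omega - m) \in Lfun P 2%:E.
  rewrite inE/=; apply/andP; split; rewrite inE/=; first exact: measurable_funB.
  rewrite /finite_norm unlock /=.
  apply: poweR_lty.
  rewrite (_ : (\int[P]_x _)%E = (s ^+ 2)%:E) ?ltry//.
  rewrite -normal_sqr; apply: eq_integral => x _.
  by rewrite powR_mulrn// real_normK// num_real.
rewrite (_ : Y = (fun omega => Y omega - m) \+ cst m); last first.
  by apply/funext => x /=; rewrite subrK.
by apply: rpredD => [|?|?]; [rewrite lee_fin ler1n|exact: h|exact: Lfun_cst].
Qed.

End normal_variable.

Context (d : nat) (T : set 'rV[R]_d) (f : 'rV[R]_d -> {RV P >-> R}).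
Hypothesis gaussf : gaussian_field T f.
Local Notation mu := (mean f).
Local Notation C := (cov f).

Lemma gaussian1 t : T t -> exists m s : R, 0 <= s /\
  forall A : set R, measurable A -> P [set omega | A (f t omega)] = normal_law m s A.
Proof.
move=> Tt; have [m [s [s0 h]]] := gaussf (fun _ : 'I_1 => 1) (fun _ => Tt).
exists m, s; split => // A mA; rewrite -h//; congr (P _); apply/seteqP.
by split => x /=; rewrite big_ord1 mul1r.
Qed.

Lemma field_Lfun2 t : T t -> (f t : Omega -> R) \in Lfun P 2%:E.
Proof.
by move=> /gaussian1[m [s [s0 h]]]; exact: (@normal_Lfun2 (f t) _ m s h).
Qed.

Lemma field_Lfun1 t : T t -> (f t : Omega -> R) \in Lfun P 1.
Proof.
move=> /field_Lfun2; apply: Lfun_subset12.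
by rewrite fin_num_measure.
Qed.

Definition centered t omega : R := f t omega - mu t.

Lemma centered_Lfun2 t : T t -> centered t \in Lfun P 2%:E.
Proof.
move=> Tt; rewrite (_ : centered t = (f t : Omega -> R) \- cst (mu t))//.
by apply: rpredB => [|?|?]; [rewrite lee_fin ler1n|exact: field_Lfun2|exact: Lfun_cst].
Qed.

Lemma integrable_centeredM s t : T s -> T t ->
  P.-integrable setT (fun omega => (centered s omega * centered t omega)%:E).
Proof.
move=> Ts Tt; apply/Lfun1_integrable.
by apply: Lfun2_mul_Lfun1; exact: centered_Lfun2.
Qed.

Lemma covE s t : T s -> T t ->
  (\int[P]_omega (centered s omega * centered t omega)%:E)%E = (C s t)%:E.
Proof.
move=> Ts Tt; rewrite /C fineK.
  rewrite unlock unlock.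
  apply: eq_integral => x _; by rewrite /centered /mean unlock.
rewrite unlock unlock.
rewrite (_ : (\int[P]_w _)%E = (\int[P]_omega (centered s omega * centered t omega)%:E)%E); last first.
  by apply: eq_integral => x _; rewrite /centered /mean unlock.
exact: (integrable_fin_num _ (integrable_centeredM Ts Tt)).
Qed.

Lemma covC s t : C s t = C t s.
Proof. by rewrite /C covarianceC. Qed.

Lemma meanE t : T t -> 'E_P[f t]%E = (mu t)%:E.
Proof. by move=> Tt; rewrite /mu fineK// expectation_fin_num// field_Lfun1. Qed.

Section combination.
Variables (n : nat) (t : 'I_n -> 'rV[R]_d) (c : 'I_n -> R).
Hypothesis Tt : forall i, T (t i).

Definition comb_mean := \sum_(i < n) c i * mu (t i).
Definition comb_var := \sum_(i < n) \sum_(j < n) c i * c j * C (t i) (t j).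

Let Y omega := \sum_(i < n) c i * f (t i) omega.

Let mY : measurable_fun setT Y.
Proof. by apply: measurable_sum => i; apply: measurable_funM. Qed.

Let YE : 'E_P[Y]%E = comb_mean%:E.
Proof.
have -> : Y = (\sum_(i < n) (c i \o* (f (t i) : Omega -> R))).
  by apply/funext => x; rewrite /Y fct_sumE; apply: eq_bigr => i _; rewrite /= mulrC.
rewrite unlock.
under eq_integral do rewrite fct_sumE -sumEFin.
rewrite integral_sum//; last first.
  by move=> i; apply/Lfun1_integrable; apply: Lfun_scale => //; exact: field_Lfun1.
rewrite /comb_mean -sumEFin; apply: eq_bigr => i _.
have := expectationZl (c i) (field_Lfun1 (Tt i)).
by rewrite unlock => ->; rewrite EFinM -meanE// unlock.
Qed.

Let YV : (\int[P]_omega ((Y omega - comb_mean) ^+ 2)%:E = comb_var%:E)%E.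
Proof.
have e omega : ((Y omega - comb_mean) ^+ 2)%:E = (\sum_(i < n) \sum_(j < n)
    (c i * c j)%:E * (centered (t i) omega * centered (t j) omega)%:E)%E.
  rewrite /Y /comb_mean -sumrB expr2 mulr_suml -sumEFin; apply: eq_bigr => i _.
  rewrite mulr_sumr -sumEFin; apply: eq_bigr => j _; rewrite -EFinM; congr EFin.
  by rewrite /centered; ring.
under eq_integral do rewrite e.
have iij i j : P.-integrable setT
   (fun omega => ((c i * c j)%:E * (centered (t i) omega * centered (t j) omega)%:E)%E).
  by apply: integrableZl => //; exact: integrable_centeredM.
rewrite integral_sum//; last first.
  by move=> i; exact: integrable_sum.
rewrite /comb_var -sumEFin; apply: eq_bigr => i _.
rewrite integral_sum// -sumEFin; apply: eq_bigr => j _.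
by rewrite integralZl//; [rewrite covE//|exact: integrable_centeredM].
Qed.

Lemma comb_var_ge0 : 0 <= comb_var.
Proof.
by rewrite -lee_fin -YV integral_ge0// => x _; rewrite lee_fin sqr_ge0.
Qed.

(** The parameters supplied by [gaussian_field] are identified by computing the expectation and the
    variance of the combination from the means and covariances of the field. *)
Lemma comb_law (A : set R) : measurable A ->
  P [set omega | A (\sum_(i < n) c i * f (t i) omega)] =
  normal_law comb_mean (Num.sqrt comb_var) A.
Proof.
have [m [s [s0 h]]] := gaussf c Tt.
have em : m = comb_mean.
  by have := normal_expectation mY h; rewrite YE => -[].
have es : s = Num.sqrt comb_var.
  have := normal_sqr mY h; rewrite em YV => -[->].
  by rewrite sqrtr_sqr ger0_norm.
by move=> mA; rewrite (h A mA) em es.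
Qed.

Lemma comb_integral (h : R -> \bar R) : measurable_fun setT h -> (forall x, 0 <= h x)%E ->
  (\int[P]_omega h (\sum_(i < n) c i * f (t i) omega)%R =
   \int[g]_z h (comb_mean + Num.sqrt comb_var * z)%R)%E.
Proof.
by move=> mh h0; apply: (normal_integral mY) => //; exact: comb_law.
Qed.

End combination.

Lemma field_law t (A : set R) : T t -> measurable A ->
  P [set omega | A (f t omega)] = normal_law (mu t) (sdev f t) A.
Proof.
move=> Tt mA; have := @comb_law 1 (fun=> t) (fun=> 1) (fun=> Tt) A mA.
rewrite /comb_mean /comb_var !big_ord1 !mul1r => <-.
by congr (P _); apply/seteqP; split => x /=; rewrite big_ord1 mul1r.
Qed.

Lemma increment_law s t (A : set R) : T s -> T t -> measurable A ->
  P [set omega | A (f s omega - f t omega)] =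
  normal_law (mu s - mu t) (Num.sqrt (C s s + C t t - 2 * C s t)) A.
Proof.
move=> Ts Tt mA.
pose tt (i : 'I_2) := if i == ord0 then s else t.
pose c (i : 'I_2) : R := if i == ord0 then 1 else -1.
have Ttt i : T (tt i) by rewrite /tt; case: ifP.
have := @comb_law 2 tt c Ttt A mA.
rewrite /comb_mean /comb_var !big_ord_recl !big_ord0 /tt /c/=.
rewrite (covC t s).
have -> : 1 * mu s + (-1 * mu t + 0) = mu s - mu t by ring.
have -> : 1 * 1 * C s s + (1 * -1 * C s t + 0) +
  (-1 * 1 * C s t + (-1 * -1 * C t t + 0) + 0) = C s s + C t t - 2 * C s t by ring.
move=> <-; congr (P _); apply/seteqP.
by split => x /=; rewrite !big_ord_recl big_ord0/= !mul1r !mulN1r addr0.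
Qed.

End gaussian_linear.

(** * Chaining and the tail of the maximum *)

Section tails.
Context (R : realType).

Lemma expr_small (r e : R) : 0 <= r -> r < 1 -> 0 < e ->
  exists k1, forall k, (k1 <= k)%N -> r ^+ k <= e.
Proof.
move=> r0 r1 e0.
have /cvgrPdist_le/(_ e e0)[k1 _ h] : (fun k => r ^+ k) @ \oo --> (0 : R).
  by apply: cvg_expr; rewrite ger0_norm.
exists k1 => k k1k; have := h k k1k.
by rewrite /= sub0r normrN ger0_norm// exprn_ge0.
Qed.

Lemma expr_le_expR (p : nat) (c : R) : 0 < c ->
  exists2 K : R, 0 < K & forall u, 0 <= u -> u ^+ p <= K * expR (c * u).
Proof.
move=> c0; have [->|p0] := posnP p.
  by exists 1 => // u u0; rewrite expr0 mul1r -expR0 ler_expR mulr_ge0// ltW.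
have p0' : 0 < p%:R :> R by rewrite ltr0n.
exists ((p%:R / c) ^+ p) => [|u u0]; first by rewrite exprn_gt0// divr_gt0.
have -> : expR (c * u) = expR (c * u / p%:R) ^+ p.
  by rewrite -expRM_natr; congr expR; rewrite -mulrA mulVf ?mulr1// gt_eqF.
rewrite -exprMn; apply: lerXn2r; rewrite ?nnegrE//.
  by rewrite mulr_ge0 ?expR_ge0// divr_ge0// ltW.
rewrite -[leLHS](_ : p%:R / c * (c * u / p%:R) = u); last first.
  by field; rewrite !gt_eqF.
rewrite ler_pM2l ?divr_gt0//.
by apply: le_trans (expR_ge1Dx _); rewrite lerDr.
Qed.

(** Choosing p with r^p <= (A + 1)^-1 gives A^k <= (r^-k)^p, a power of r^-k, which the exponential
    dominates. It makes a doubly exponential tail absorb the size of a grid. *)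
Lemma exprn_le_expR (A r c : R) : 0 <= A -> 0 < r -> r < 1 -> 0 < c ->
  exists2 K : R, 0 < K & forall k, A ^+ k <= K * expR (c * r ^- k).
Proof.
move=> A0 r0 r1 c0.
have [p hp] : exists p, forall q, (p <= q)%N -> r ^+ q <= (A + 1)^-1.
  by apply: expr_small; rewrite ?invr_gt0 ?ltr_wpDl// ltW.
have [K K0 hK] := @expr_le_expR p c c0.
exists K => // k.
apply: le_trans (hK _ _); last by rewrite invr_ge0 exprn_ge0// ltW.
rewrite -exprVn -exprM mulnC exprM; apply: lerXn2r; rewrite ?nnegrE//.
  by rewrite exprn_ge0// invr_ge0 ltW.
apply: (@le_trans _ _ (A + 1)); first by rewrite lerDl.
have Ap : 0 < A + 1 by rewrite ltr_wpDl.
rewrite exprVn -[leLHS]invrK lef_pV2 ?posrE ?exprn_gt0 ?invr_gt0//.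
exact: hp.
Qed.

(** Since |m| <= y/2, the event |m + s z| > y forces |z| >= a with a = y / (2 sqrt V), and a^2/2 =
    y^2 / (8 V). *)
Lemma normal_abs_tail (m s V y : R) : 0 <= s -> 0 < V -> s ^+ 2 <= V ->
  2 * `|m| <= y ->
  (normal_law m s [set z : R | (y < `|z|)%R] <= (2 * expR (- (y ^+ 2 / (8 * V))))%:E)%E.
Proof.
move=> s0 V0 sV my.
have y0 : 0 <= y by apply: le_trans my; rewrite mulr_ge0.
have mS (z : R -> R) : measurable_fun setT z -> measurable [set x : R | y < `|z x|].
  move=> mz; rewrite (_ : [set _ | _] = [set x | `]y, +oo[%classic `|z x|]).
    by apply: measurable_preimageT => //; exact: measurableT_comp.
  by apply/seteqP; split => x /=; rewrite in_itv/= andbT.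
rewrite normal_lawE; last exact: (mS id).
set a := y / (2 * Num.sqrt V).
have sV0 : 0 < Num.sqrt V by rewrite sqrtr_gt0.
have a0 : 0 <= a by rewrite divr_ge0// mulr_ge0// ltW.
have ea : - (y ^+ 2 / (8 * V)) = - a ^+ 2 / 2.
  rewrite mulNr; congr (- _); rewrite /a exprMn exprVn exprMn sqr_sqrtr ?ltW//.
  by field; rewrite gt_eqF.
have mI : measurable (`[a, +oo[%classic : set R) by [].
have mIN : measurable [set z : R | `[a, +oo[%classic (- z)].
  by apply: (@measurable_preimageT _ _ _ _ (fun z : R => - z)) => //; exact: measurableT_comp.
apply: (@le_trans _ _ (@std_normal R (`[a, +oo[%classic `|` [set z : R | `[a, +oo[%classic (- z)]))).
  apply: le_measure; rewrite ?inE//.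
  - apply: mS; under eq_fun do rewrite addrC; exact: measurable_affine.
  - exact: measurableU.
  move=> z /= yz.
  suff : a <= `|z|.
    rewrite !in_itv/= !andbT; have [z0|z0] := leP 0 z.
      by rewrite ger0_norm//; left.
    by rewrite ltr0_norm//; right.
  rewrite /a ler_pdivrMr ?mulr_gt0//.
  have sz : s * `|z| <= Num.sqrt V * `|z|.
    by rewrite ler_wpM2r// -[s]ger0_norm// -sqrtr_sqr ler_wsqrtr.
  have := ler_normD m (s * z); rewrite normrM (ger0_norm s0) => tri.
  by lra.
apply: (le_trans (@measureU2 _ _ _ (@std_normal R) _ _ mI mIN)).
have h := std_normal_tail_le a0.
have h' : (@std_normal R [set z | `[a, +oo[%classic (- z)%R] <= (expR (- a ^+ 2 / 2))%:E)%E.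
  by rewrite std_normal_oppr.
rewrite mulr2n mulrDl !mul1r EFinD ea; apply: leeD; first exact: h.
exact: h'.
Qed.

End tails.

(** * Tails of a single increment *)

Section increments.
Context (R : realType) (disp : measure_display) (Omega : measurableType disp).
Context (P : probability Omega R) (d : nat) (T : set 'rV[R]_d).
Context (f : 'rV[R]_d -> {RV P >-> R}) (N : nat).
Hypothesis T0 : T !=set0.
Hypothesis TN : forall x, T x -> forall j, `|x ord0 j| <= N%:R.
Hypothesis gaussf : gaussian_field T f.
Hypothesis hvar : forall t, T t -> 0 < cov f t t.
Variables kappaH beta : R.
Hypotheses (hkappaH : 0 < kappaH) (hbeta : 0 < beta).
Hypotheses (hA2 : condA2 T f kappaH beta) (hA3 : condA3 T f kappaH beta).

Lemma grid_small (delta : R) (D : nat) : 0 < delta ->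
  exists k1, forall k, (k1 <= k)%N -> D%:R * 2 ^- k < delta.
Proof.
move=> d0.
have i0 : 0 <= 2^-1 :> R by rewrite invr_ge0.
have i1 : 2^-1 < 1 :> R by rewrite invf_lt1// ltr1n.
have e0 : 0 < delta / D.+1%:R by rewrite divr_gt0// ltr0n.
have [k1 h] := expr_small i0 i1 e0.
exists k1 => k /h; rewrite exprVn ler_pdivlMr ?ltr0n// mulrC.
apply: lt_le_trans; rewrite ltr_pM2r ?invr_gt0 ?exprn_gt0//.
by rewrite ltr_nat.
Qed.

(** Every point of [T] is within delta of one of finitely many cell points, so the sum of the
    absolute values at these points plus [c] is a bound. *)
Lemma locally_bounded (h : 'rV[R]_d -> R) (delta c : R) : 0 < delta ->
  (forall s t, T s -> T t -> norm1 (s - t) < delta -> `|h t - h s| <= c) ->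
  exists2 S : R, 0 < S & forall t, T t -> `|h t| <= S.
Proof.
move=> d0 hc.
have [k hk] := grid_small d d0.
have c0 : 0 <= c.
  have [t Tt] := T0; have := hc t t Tt Tt.
  by rewrite !subrr normr0 => ->//; rewrite /norm1 big1// => j _; rewrite mxE normr0.
exists (1 + c + \sum_(i : {ffun 'I_d -> 'I_(grid_bound N k).+1}) `|h (cell_point T i)|).
  by rewrite ltr_pwDl ?sumr_ge0// ltr_pwDl.
move=> t Tt.
have tri : `|h t| <= `|h t - h (proj T N k t)| + `|h (proj T N k t)|.
  by rewrite -[leLHS](_ : `|(h t - h (proj T N k t)) + h (proj T N k t)| = _) ?ler_normD// subrK.
have h1 : `|h t - h (proj T N k t)| <= c.
  apply: hc => //; first exact: (T_proj N T0).
  rewrite norm1_distC; apply: le_lt_trans (hk k _) => //.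
  by apply: proj_norm1.
have h2 : `|h (proj T N k t)| <= \sum_(i : {ffun 'I_d -> 'I_(grid_bound N k).+1}) `|h (cell_point T i)|.
  by rewrite /proj (bigD1 (cell_index N k t))//= lerDl sumr_ge0.
by lra.
Qed.

Lemma mean_sdev_bounded : exists2 S : R, 0 < S &
  forall t, T t -> `|mean f t| <= S /\ sdev f t <= S.
Proof.
have [delta d0 h] := hA2.
have [S1 S10 h1] : exists2 S : R, 0 < S & forall t, T t -> `|mean f t| <= S.
  apply: (@locally_bounded _ delta (kappaH * delta `^ beta)) => // s t Ts Tt st.
  have := h s t Ts Tt st.
  have : norm1 (s - t) `^ beta <= delta `^ beta.
    by rewrite ge0_ler_powR ?nnegrE ?norm1_ge0 ?ltW.
  rewrite -(ler_pM2l hkappaH).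
  have := normr_ge0 (sdev f t - sdev f s); lra.
have [S2 S20 h2] : exists2 S : R, 0 < S & forall t, T t -> `|sdev f t| <= S.
  apply: (@locally_bounded _ delta (kappaH * delta `^ beta)) => // s t Ts Tt st.
  have := h s t Ts Tt st.
  have : norm1 (s - t) `^ beta <= delta `^ beta.
    by rewrite ge0_ler_powR ?nnegrE ?norm1_ge0 ?ltW.
  rewrite -(ler_pM2l hkappaH).
  have := normr_ge0 (mean f t - mean f s); lra.
exists (S1 + S2); first exact: addr_gt0.
move=> t Tt; have := h1 t Tt; have := h2 t Tt.
by have := ler_norm (sdev f t); split; lra.
Qed.

(** Increments across a distance 2^-k have variance of order 2^(-k beta), the 4k-th power of this
    ratio; its k-th power is the increment tolerated at level k. *)
Definition hoelder_ratio : R := 2 `^ (- (beta / 4)).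
Local Notation r0 := hoelder_ratio.

Lemma hoelder_ratio_gt0 : 0 < r0.
Proof. exact: powR_gt0. Qed.

Lemma hoelder_ratio_lt1 : r0 < 1.
Proof.
rewrite /r0 powRN invf_lt1 ?powR_gt0//.
have b0 : 0 < beta / 4 by rewrite divr_gt0.
by rewrite -[ltLHS](congr1 (fun h => h (beta / 4)) (@powR1 R)) gt0_ltr_powR// ?nnegrE// ltr1n.
Qed.

Lemma hoelder_ratioX k : (2 ^- k) `^ beta = r0 ^+ (4 * k).
Proof.
rewrite -powR_invn// -powRrM /r0 -powR_mulrn ?powR_ge0// -powRrM.
by congr (2 `^ _); rewrite natrM; field.
Qed.

Lemma sqr_sdev t : T t -> sdev f t ^+ 2 = cov f t t.
Proof. by move=> Tt; rewrite sqr_sqrtr// ltW// hvar. Qed.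

Lemma sdev_gt0 t : T t -> 0 < sdev f t.
Proof. by move=> Tt; rewrite sqrtr_gt0 hvar. Qed.

(** (A2) controls the differences of means and deviations, (A3) the defect 1 - corr; the variance is
    thus of order r0^(4k), and a threshold x r0^k leaves x^2 r0^(-2k) in the exponent. The distance
    3d 2^-k covers every pair of cell points met in the chaining. *)
Lemma increment_tail : exists2 K : R, 0 < K & exists k1, forall k, (k1 <= k)%N ->
  forall p q, T p -> T q -> norm1 (p - q) <= (3 * d)%:R * 2 ^- k ->
  forall x, 1 <= x ->
  (P [set omega | (x * r0 ^+ k < `|f p omega - f q omega|)%R] <=
   (2 * expR (- (K * x ^+ 2 * (r0 ^+ 2) ^- k)))%:E)%E.
Proof.
have [delta2 d20 h2] := hA2; have [delta3 d30 h3] := hA3.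
have [S S0 hS] := mean_sdev_bounded.
have r00 := hoelder_ratio_gt0; have r01 := hoelder_ratio_lt1.
pose D := (3 * d)%:R : R; pose Db := D `^ beta.
have Db0 : 0 <= Db by exact: powR_ge0.
(* Bounds the variance in units of r0^(4k): the squared difference of deviations, then 2 S^2 (1 -
   corr), and 1 for positivity. *)
pose K1 := kappaH ^+ 2 * Db ^+ 2 + 2 * S ^+ 2 * kappaH * Db + 1.
have K1p : 0 < K1.
  by rewrite /K1 ltr_wpDl// addr_ge0 ?mulr_ge0// ?sqr_ge0 ?ltW.
have [ka hka] := grid_small (3 * d) d20.
have [kb hkb] := grid_small (3 * d) d30.
have B0 : 0 < 2 * kappaH * Db + 1 by rewrite ltr_wpDl// !mulr_ge0// ltW.
(* From level [kc] on, twice the difference of means is below r0^k, hence below the threshold, as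
   [normal_abs_tail] demands. *)
have [kc hkc] := @expr_small R r0 (2 * kappaH * Db + 1)^-1 (ltW r00) r01 (etrans (invr_gt0 _) B0).
exists (8 * K1)^-1; first by rewrite invr_gt0 mulr_gt0.
exists (maxn ka (maxn kb kc)) => k; rewrite !geq_max => /and3P[kak kbk kck].
move=> p q Tp Tq pq x x1.
have pq2 : norm1 (q - p) < delta2 by rewrite norm1_distC; exact: le_lt_trans (hka _ kak).
have pq3 : norm1 (p - q) < delta3 by exact: le_lt_trans (hkb _ kbk).
pose u := norm1 (p - q) `^ beta.
pose rk := r0 ^+ k.
have rk0 : 0 < rk by rewrite exprn_gt0.
have rk1 : rk <= 1 by rewrite exprn_ile1// ltW.
have u0 : 0 <= u by exact: powR_ge0.
have uD : u <= Db * rk ^+ 4.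
  apply: (@le_trans _ _ ((D * 2 ^- k) `^ beta)).
    apply: ge0_ler_powR pq; rewrite ?nnegrE ?norm1_ge0//; first exact: ltW.
  by rewrite powRM ?invr_ge0 ?exprn_ge0// hoelder_ratioX mulnC exprM.
have h2pq := h2 q p Tq Tp pq2; rewrite norm1_distC -/u in h2pq.
have corrpp : corr f p p = 1.
  by rewrite /corr -sqr_sdev// expr2 divff// mulf_neq0// gt_eqF// sdev_gt0.
have h3pq : `|1 - corr f p q| <= kappaH * u.
  have := h3 p q p p Tp Tq Tp Tp pq3.
  rewrite corrpp subrr /norm1 => /(_ _).
  have -> : \sum_(j < d) `|(0 : 'rV[R]_d) ord0 j| = 0 by rewrite big1// => j _; rewrite mxE normr0.
  rewrite powR0 ?gt_eqF// add0r; apply.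
  exact: d30.
have Cpq : cov f p q = corr f p q * (sdev f p * sdev f q).
  by rewrite /corr mulfVK// mulf_neq0// gt_eqF// sdev_gt0.
set y := x * r0 ^+ k.
have rk4 : rk ^+ 4 <= rk ^+ 2.
  by rewrite ler_wiXn2l// ltW.
have mI : measurable [set z : R | y < `|z|].
  rewrite (_ : [set _ | _] = [set x | `]y, +oo[%classic `|x|]).
    by apply: measurable_preimageT => //; exact: measurableT_comp.
  by apply/seteqP; split => z /=; rewrite in_itv/= andbT.
rewrite [leLHS](increment_law gaussf Tp Tq mI).
have ms : `|sdev f p - sdev f q| <= kappaH * u.
  by have := normr_ge0 (mean f p - mean f q); lra.
have mm : `|mean f p - mean f q| <= kappaH * u.
  by have := normr_ge0 (sdev f p - sdev f q); lra.
have [_ Sp] := hS p Tp; have [_ Sq] := hS q Tq.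
have sp0 := sdev_gt0 Tp; have sq0 := sdev_gt0 Tq.
have Vle : cov f p p + cov f q q - 2 * cov f p q <= K1 * rk ^+ 4.
  rewrite -!sqr_sdev// Cpq.
  (* This splitting separates what (A2) bounds from what (A3) bounds. *)
  have -> : sdev f p ^+ 2 + sdev f q ^+ 2 - 2 * (corr f p q * (sdev f p * sdev f q)) =
    (sdev f p - sdev f q) ^+ 2 + 2 * (sdev f p * sdev f q) * (1 - corr f p q) by ring.
  have e1 : (sdev f p - sdev f q) ^+ 2 <= kappaH ^+ 2 * Db ^+ 2 * rk ^+ 4.
    rewrite -real_normK ?num_real// -exprMn.
    apply: (@le_trans _ _ ((kappaH * u) ^+ 2)).
      by rewrite lerXn2r ?nnegrE// mulr_ge0// ltW.
    apply: (@le_trans _ _ ((kappaH * (Db * rk ^+ 4)) ^+ 2)).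
      have k0 : 0 <= kappaH by exact: ltW.
      have rk40 : 0 <= rk ^+ 4 by rewrite exprn_ge0// ltW.
      apply: lerXn2r; rewrite ?nnegrE; [exact: mulr_ge0|exact: mulr_ge0 k0 (mulr_ge0 Db0 rk40)|].
      by rewrite ler_pM2l.
    rewrite mulrA [leLHS]exprMn ler_wpM2l ?sqr_ge0// -exprM.
    by rewrite ler_wiXn2l// ltW.
  have e2 : 2 * (sdev f p * sdev f q) * (1 - corr f p q) <= 2 * S ^+ 2 * kappaH * Db * rk ^+ 4.
    apply: (@le_trans _ _ (2 * (S * S) * (kappaH * (Db * rk ^+ 4)))).
      apply: (@le_trans _ _ (2 * (sdev f p * sdev f q) * (kappaH * (Db * rk ^+ 4)))).
        rewrite ler_wpM2l//; first by rewrite !mulr_ge0// ltW.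
        apply: le_trans (ler_norm _) (le_trans h3pq _).
        by rewrite ler_pM2l.
      rewrite ler_wpM2r//; first by rewrite !mulr_ge0// ?exprn_ge0// ltW.
      by rewrite ler_wpM2l// ler_pM// ltW.
    by rewrite le_eqVlt; apply/orP; left; apply/eqP; ring.
  have : 0 <= rk ^+ 4 by rewrite exprn_ge0// ltW.
  rewrite /K1; lra.
have V0 : 0 < K1 * rk ^+ 4 by rewrite mulr_gt0// exprn_gt0.
have my : 2 * `|mean f p - mean f q| <= y.
  apply: (@le_trans _ _ (2 * (kappaH * (Db * rk ^+ 4)))).
    by rewrite ler_wpM2l// (le_trans mm)// ler_pM2l.
  have : rk ^+ 4 <= rk * (2 * kappaH * Db + 1)^-1.
    have -> : rk ^+ 4 = rk * rk ^+ 3 by ring.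
    rewrite ler_pM2l//.
    apply: le_trans (hkc k kck).
    by rewrite -[leRHS]expr1 ler_wiXn2l// ltW.
  move=> h.
  have : rk ^+ 4 * (2 * kappaH * Db + 1) <= rk by rewrite -ler_pdivlMr.
  have : 0 <= rk ^+ 4 by rewrite exprn_ge0// ltW.
  have : rk <= y by rewrite /y -/rk ler_peMl// ltW.
  lra.
have V00 : 0 <= cov f p p + cov f q q - 2 * cov f p q.
  have := @comb_var_ge0 _ _ _ _ _ _ _ gaussf 2 (fun i => if i == ord0 then p else q)
    (fun i => if i == ord0 then 1 else -1) _.
  rewrite /comb_var !big_ord_recl !big_ord0/= (covC f q p) => /(_ _).
  have -> : 1 * 1 * cov f p p + (1 * -1 * cov f p q + 0) +
    (-1 * 1 * cov f p q + (-1 * -1 * cov f q q + 0) + 0) =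
    cov f p p + cov f q q - 2 * cov f p q by ring.
  by apply => i; case: ifP.
apply: (le_trans (@normal_abs_tail R _ _ (K1 * rk ^+ 4) y (sqrtr_ge0 _) V0 _ my)).
  by rewrite sqr_sqrtr.
rewrite lee_fin ler_wpM2l// ler_expR lerN2 le_eqVlt; apply/orP; left; apply/eqP.
rewrite /y -/rk exprAC -/rk.
by field; rewrite !gt_eqF.
Qed.

End increments.

Lemma measure_bigsetU_le d (X : measurableType d) (R : realType)
    (mu : {measure set X -> \bar R}) (I : Type) (s : seq I) (F : I -> set X) :
  (forall i, measurable (F i)) ->
  (mu (\big[setU/set0]_(i <- s) F i) <= \sum_(i <- s) mu (F i))%E.
Proof.
move=> mF; elim: s => [|i s IH]; first by rewrite !big_nil measure0.
rewrite !big_cons; apply: (le_trans (@measureU2 _ _ _ mu _ _ (mF i) _)).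
  exact: bigsetU_measurable.
exact: leeD.
Qed.

Section linear.
Context (R : realFieldType).
Implicit Types a b c e p q u v : R.

(** Stated over bare variables, this and the next two inequalities keep the large terms of the
    chaining out of [lra]. *)
Lemma chain_lin1 a b u v : a <= u -> b <= v -> v <= u -> 0 <= u -> a + b <= 3 * u.
Proof. lra. Qed.

Lemma chain_lin2 a b c p q u : a <= u -> c <= u -> b <= p + c -> p <= q -> q <= u ->
  a + b <= 3 * u.
Proof. lra. Qed.

Lemma chain_lin3 a b c e p q : a <= p -> c <= p -> b <= q -> e <= b + c ->
  a + e <= p + p + q.
Proof. lra. Qed.

End linear.

(** * Chaining, modulus of continuity and tails of the maximum *)

Section chaining.
Context (R : realType) (disp : measure_display) (Omega : measurableType disp).
Context (P : probability Omega R) (d : nat) (hd : (0 < d)%N) (T : set 'rV[R]_d).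
Context (f : 'rV[R]_d -> {RV P >-> R}) (N : nat) (G : set Omega).
Hypothesis T0 : T !=set0.
Hypothesis cT : compact T.
Hypothesis TN : forall x, T x -> forall j, `|x ord0 j| <= N%:R.
Hypothesis mG : measurable G.
Hypothesis PG : P (~` G) = 0%E.
Hypothesis Gc : forall omega, G omega ->
  {within T, continuous (fun t => f t omega : R)}.
Hypothesis gaussf : gaussian_field T f.
Hypothesis hvar : forall t, T t -> 0 < cov f t t.
Variables kappaH beta : R.
Hypotheses (hkappaH : 0 < kappaH) (hbeta : 0 < beta).
Hypotheses (hA2 : condA2 T f kappaH beta) (hA3 : condA3 T f kappaH beta).

Local Notation I k := {ffun 'I_d -> 'I_(grid_bound N k).+1}.
Local Notation r0 := (hoelder_ratio beta).
Let r00 : 0 < r0 := hoelder_ratio_gt0 beta.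
Let r01 : r0 < 1 := hoelder_ratio_lt1 hbeta.

Lemma measurable_increment s t (y : R) :
  measurable [set omega | y < `|f s omega - f t omega|].
Proof.
rewrite (_ : [set _ | _] = [set x | `]y, +oo[%classic `|f s x - f t x|]).
  apply: measurable_preimageT => //; apply: measurableT_comp => //.
  exact: measurable_funB.
by apply/seteqP; split => z /=; rewrite in_itv/= andbT.
Qed.

Definition chain_point k (j : I k + I k.+1) : 'rV[R]_d :=
  match j with inl i => cell_point T i | inr i => cell_point T i end.

(** Pairs within one level join the projections of two nearby points; pairs with the next level join
    consecutive projections of one point. Hence the sum type of the second index. *)
Definition chain_step k (x : R) : set Omega :=
  \bigcup_(j in [set j : I k * (I k + I k.+1) |
      norm1 (cell_point T j.1 - chain_point j.2) <= (3 * d)%:R * 2 ^- k])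
    [set omega | x * r0 ^+ k < `|f (cell_point T j.1) omega - f (chain_point j.2) omega|].

Definition chain_bad k (x : R) : set Omega := \bigcup_n chain_step (k + n) x.

Lemma measurable_chain_step k x : measurable (chain_step k x).
Proof.
apply: fin_bigcup_measurable => [|j _]; first exact: finite_finset.
exact: measurable_increment.
Qed.

Lemma measurable_chain_bad k x : measurable (chain_bad k x).
Proof. by apply: bigcupT_measurable => n; exact: measurable_chain_step. Qed.

Lemma T_chain_point k j : T (@chain_point k j).
Proof. by case: j => j; exact: T_cell_point. Qed.

Let A : R := ((2 * (2 * N).+1) ^ d)%:R.

Lemma card_grid k l : (l <= 1)%N -> (#|I (k + l)|%:R : R) <= A * (2 ^+ d) ^+ k.
Proof.
move=> l1; rewrite card_ffun !card_ord /A -!natrX -natrM ler_nat.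
rewrite -expnM (mulnC d k) expnM -expnMn leq_exp2r// /grid_bound.
rewrite -addn1 expnD.
have : (2 ^ l <= 2)%N by case: l l1 => [|[|]].
have : (0 < 2 ^ k)%N by rewrite expn_gt0.
nia.
Qed.

Lemma card_chain_step k :
  (#|{: I k * (I k + I k.+1)}|%:R : R) <= 2 * A ^+ 2 * (4 ^+ d) ^+ k.
Proof.
rewrite card_prod card_sum natrM natrD.
have h1 := @card_grid k 0 isT; have h2 := @card_grid k 1 isT.
rewrite addn0 in h1; rewrite addn1 in h2.
have a0 : 0 <= A * (2 ^+ d) ^+ k by rewrite mulr_ge0// /A ?exprn_ge0// ler0n.
have -> : 2 * A ^+ 2 * (4 ^+ d) ^+ k = A * (2 ^+ d) ^+ k * (A * (2 ^+ d) ^+ k + A * (2 ^+ d) ^+ k).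
  have -> : (4 ^+ d) ^+ k = (2 ^+ d) ^+ k * (2 ^+ d) ^+ k :> R.
    by rewrite -!exprMn; congr ((_ ^+ _) ^+ _); ring.
  by ring.
by apply: ler_pM => //; apply: lerD.
Qed.

(** A union bound over at most 2 A^2 4^(dl) pairs at each level l. Half of the exponent of
    [increment_tail] absorbs this number and leaves a factor 2^-l to sum over the levels; the other
    half gives the stated tail at level k. *)
Lemma chaining_tail : exists c C : R, exists k1, [/\ 0 < c, 0 < C &
  forall k, (k1 <= k)%N -> forall x, 1 <= x ->
  (P (chain_bad k x) <= (C * expR (- (c * x ^+ 2 * (r0 ^+ 2) ^- k)))%:E)%E].
Proof.
have [K K0 [k1 hK]] := increment_tail T0 TN gaussf hvar hkappaH hbeta hA2 hA3.
have r20 : 0 < r0 ^+ 2 by rewrite exprn_gt0.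
have r21 : r0 ^+ 2 < 1 by rewrite exprn_ilt1// ltW.
have K20 : 0 < K / 2 by rewrite divr_gt0.
have d40 : 0 <= 2 * 4 ^+ d :> R by rewrite mulr_ge0// exprn_ge0.
(* The base is 2 4^d and not 4^d: the extra 2^l is the factor that makes the levels summable. *)
have [K' K'0 hK'] := exprn_le_expR d40 r20 r21 K20.
have A0 : 0 < A by rewrite /A ltr0n expn_gt0.
have A20 : 0 < 4 * A ^+ 2 by rewrite mulr_gt0// exprn_gt0.
exists (K / 2), (2 * (4 * A ^+ 2 * K')), k1; split => //; first by rewrite !mulr_gt0.
move=> k kk1 x x1.
set e := expR (- (K / 2 * x ^+ 2 * (r0 ^+ 2) ^- k)).
have e0 : 0 <= e by exact: expR_ge0.
have step n : (P (chain_step (k + n) x) <= ((4 * A ^+ 2 * K' * e) * 2 ^- n)%:E)%E.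
  set l := (k + n)%N.
  have kl : (k1 <= l)%N by rewrite (leq_trans kk1)// leq_addr.
  set q := (r0 ^+ 2) ^- l.
  have q0 : 0 <= q by rewrite invr_ge0 exprn_ge0// ltW.
  have x2 : 1 <= x ^+ 2 by rewrite exprn_ege1.
  apply: (@le_trans _ _ (2 * A ^+ 2 * (4 ^+ d) ^+ l * (2 * expR (- (K * x ^+ 2 * q))))%:E).
    apply: (@le_trans _ _ (\sum_(j : I l * (I l + I l.+1)) (2 * expR (- (K * x ^+ 2 * q)))%:E)%E).
      rewrite /chain_step bigcup_mkcond.
      rewrite (_ : \bigcup_i _ = \big[setU/set0]_(j : I l * (I l + I l.+1))
        (if j \in [set j : I l * (I l + I l.+1) | norm1 (cell_point T j.1 - chain_point j.2) <=
            (3 * d)%:R * 2 ^- l]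
         then [set omega | x * r0 ^+ l < `|f (cell_point T j.1) omega - f (chain_point j.2) omega|]
         else set0)); last first.
        rewrite -bigcup_seq; apply/seteqP; split => omega [j _ hj]; exists j => //=.
        exact: mem_index_enum.
      apply: (le_trans (@measure_bigsetU_le _ _ _ P _ _ _ _)) => [j|].
        case: ifP => // _; exact: measurable_increment.
      apply: lee_sum => j _; case: ifPn => [|_]; last first.
        by rewrite measure0 lee_fin mulr_ge0// expR_ge0.
      rewrite inE/= => hj; apply: hK => //; first exact: T_cell_point.
      exact: T_chain_point.
    rewrite sumEFin sumr_const lee_fin -[leLHS]mulr_natl ler_wpM2r//.
    by apply: le_trans (card_chain_step l); rewrite ler_nat; apply: eq_leq; exact: eq_card.
  rewrite lee_fin.
  have h1 : (2 * 4 ^+ d) ^+ l <= K' * expR (K / 2 * x ^+ 2 * q).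
    apply: (le_trans (hK' l)); rewrite ler_pM2l// ler_expR -/q.
    by rewrite ler_wpM2r// ler_peMr// ltW.
  have h2 : expR (- (K / 2 * x ^+ 2 * q)) <= e.
    rewrite ler_expR lerN2 ler_wpM2l//; first by rewrite mulr_ge0 ?sqr_ge0// ltW.
    rewrite lef_pV2 ?posrE ?exprn_gt0//; apply: ler_wiXn2l; rewrite ?leq_addr//; exact: ltW.
  have e2 : expR (- (K * x ^+ 2 * q)) =
      expR (- (K / 2 * x ^+ 2 * q)) * expR (- (K / 2 * x ^+ 2 * q)).
    by rewrite -expRD; congr expR; field.
  have e3 : expR (K / 2 * x ^+ 2 * q) * expR (- (K / 2 * x ^+ 2 * q)) = 1.
    by rewrite -expRD subrr expR0.
  have h3 : (2 * 4 ^+ d) ^+ l * expR (- (K * x ^+ 2 * q)) <= K' * e.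
    rewrite e2 mulrA.
    apply: (@le_trans _ _ (K' * expR (K / 2 * x ^+ 2 * q) * expR (- (K / 2 * x ^+ 2 * q)) * e)).
      apply: ler_pM => //; rewrite ?mulr_ge0 ?expR_ge0 ?exprn_ge0//.
      by apply: ler_wpM2r; rewrite ?expR_ge0.
    by rewrite -(mulrA K') e3 mulr1.
  have h4 : (4 ^+ d) ^+ l * expR (- (K * x ^+ 2 * q)) <= 2 ^- l * (K' * e).
    rewrite -ler_pdivrMl; last by rewrite invr_gt0 exprn_gt0.
    by rewrite invrK mulrA -exprMn.
  have h5 : 2 ^- l <= 2 ^- n :> R.
    by rewrite lef_pV2 ?posrE ?exprn_gt0// ler_eXn2l ?ltr1n// leq_addl.
  apply: (@le_trans _ _ (4 * A ^+ 2 * (2 ^- l * (K' * e)))).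
    rewrite (_ : _ * (2 * _) = 4 * A ^+ 2 * ((4 ^+ d) ^+ l * expR (- (K * x ^+ 2 * q)))); last by ring.
    by apply: ler_wpM2l => //; exact: ltW.
  rewrite (_ : 4 * _ * K' * e * _ = 4 * A ^+ 2 * (2 ^- n * (K' * e))); last by ring.
  apply: ler_wpM2l; first exact: ltW.
  by apply: ler_wpM2r => //; rewrite mulr_ge0// ltW.
apply: (le_trans (@measure_sigma_subadditive _ _ _ P (chain_bad k x) (fun n => chain_step (k + n) x) _ _ _)) => //.
- by move=> n; exact: measurable_chain_step.
- exact: measurable_chain_bad.
apply: (@le_trans _ _ (\sum_(0 <= n <oo) ((2 * (4 * A ^+ 2 * K' * e))%:E * (2 ^- n.+1)%:E))%E).
  apply: lee_nneseries => n; first by [].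
  move=> _; apply: (le_trans (step n)).
  rewrite -EFinM lee_fin le_eqVlt; apply/orP; left; apply/eqP.
  by rewrite [2 ^+ n.+1]exprS; field; rewrite expf_neq0.
(* With zero terms this is the sum of the geometric series 2^-(n+1). *)
have := @epsilon_trick R (fun=> 0%E) (2 * (4 * A ^+ 2 * K' * e)) xpredT (fun=> lexx _).
have -> : (\sum_(0 <= i <oo) (0 : \bar R))%E = 0%E by rewrite eseries0.
rewrite add0e => h.
apply: (@le_trans _ _ (2 * (4 * A ^+ 2 * K' * e))%:E); last by rewrite lee_fin -!mulrA.
have E0 : 0 <= 2 * (4 * A ^+ 2 * K' * e).
  by apply: mulr_ge0 => //; apply: mulr_ge0 => //; apply: mulr_ge0; exact: ltW.
apply: le_trans (h E0).
apply: lee_nneseries => n.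
  by move=> _ _; apply: mule_ge0; rewrite lee_fin// invr_ge0 exprn_ge0.
by move=> _; rewrite add0e -EFinM natrX.
Qed.

(** Telescoping along the projections of [s]: the step at level l is at most x r0^l off the bad
    event, and continuity of the path at [s] passes to the limit of the geometric sums. *)
Lemma chain_proj omega k x s : 0 <= x -> G omega -> ~ chain_bad k x omega -> T s ->
  `|f s omega - f (proj T N k s) omega| <= x * r0 ^+ k / (1 - r0).
Proof.
move=> x0 Gw nb Ts.
have d1 : 0 < 1 - r0 by rewrite subr_gt0.
have step n : `|f (proj T N (k + n) s) omega - f (proj T N (k + n.+1) s) omega| <= x * r0 ^+ (k + n).
  rewrite leNgt; apply/negP => h; apply: nb; exists n => //.
  rewrite addnS in h *.
  exists (cell_index N (k + n) s, inr (cell_index N (k + n).+1 s)) => //=.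
  have h1 := proj_norm1 TN (k + n) Ts.
  have h2 := proj_norm1 TN (k + n).+1 Ts.
  rewrite -/(proj T N (k + n) s) -/(proj T N (k + n).+1 s).
  have -> : proj T N (k + n) s - proj T N (k + n).+1 s =
    (proj T N (k + n) s - s) + (s - proj T N (k + n).+1 s) by rewrite addrA subrK.
  apply: (le_trans (norm1_triangle _ _)); rewrite norm1_distC.
  have h3 : 2 ^- (k + n).+1 <= 2 ^- (k + n) :> R.
    by rewrite lef_pV2 ?posrE ?exprn_gt0// ler_eXn2l ?ltr1n.
  have h4 : 0 <= 2 ^- (k + n) :> R by rewrite invr_ge0 exprn_ge0.
  have h5 : d%:R * 2 ^- (k + n).+1 <= d%:R * 2 ^- (k + n) :> R by rewrite ler_wpM2l.
  have h6 : 0 <= d%:R * 2 ^- (k + n) :> R by rewrite mulr_ge0.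
  by rewrite natrM -mulrA; exact: chain_lin1 h1 h2 h5 h6.
have sum n : `|f (proj T N (k + n) s) omega - f (proj T N k s) omega| <=
    x * r0 ^+ k * (1 - r0 ^+ n) / (1 - r0).
  elim: n => [|n IH]; first by rewrite addn0 subrr normr0 expr0 subrr mulr0 mul0r.
  apply: (@le_trans _ _ (x * r0 ^+ (k + n) + x * r0 ^+ k * (1 - r0 ^+ n) / (1 - r0))).
    apply: (@le_trans _ _ (`|f (proj T N (k + n) s) omega - f (proj T N (k + n.+1) s) omega|
        + `|f (proj T N (k + n) s) omega - f (proj T N k s) omega|)).
      rewrite [X in _ <= X + _]distrC.
      apply: le_trans (ler_normD _ _); rewrite le_eqVlt; apply/orP; left; apply/eqP.
      by congr (`|_|); rewrite addrA subrK.
    exact: lerD.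
  rewrite le_eqVlt; apply/orP; left; apply/eqP.
  by rewrite exprD exprS; field; rewrite gt_eqF.
have cv : (fun n => f (proj T N (k + n) s) omega) @ \oo --> (f s omega : R).
  have := @cvg_proj _ _ _ _ T0 TN _ _ (Gc Gw) Ts.
  by rewrite -(@cvg_shiftn k _ (fun n => f (proj T N n s) omega)); under eq_fun do rewrite addnC.
have cv2 : (fun n => `|f (proj T N (k + n) s) omega - f (proj T N k s) omega|) @ \oo -->
    `|f s omega - f (proj T N k s) omega|.
  by apply: cvg_norm; apply: cvgB => //; exact: cvg_cst.
rewrite -(cvg_lim (@Rhausdorff R) cv2); apply: limr_le; first by apply/cvg_ex; exists `|f s omega - f (proj T N k s) omega|.
near=> n; apply: (le_trans (sum n)); rewrite ler_pM2r ?invr_gt0//.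
have r0n m : 0 <= r0 ^+ m by rewrite exprn_ge0// ltW.
by rewrite ler_piMr// ?mulr_ge0// lerBlDr lerDl.
Unshelve. all: by end_near. Qed.

(** Two chains lead from [s] and [t] to their projections of level k, which lie within d 2^-k + 2^-k
    + d 2^-k of each other and form an admissible pair of that level. *)
Lemma chain_modulus omega k x s t : 0 <= x -> G omega -> ~ chain_bad k x omega ->
  T s -> T t -> norm1 (s - t) <= 2 ^- k ->
  `|f s omega - f t omega| <= x * r0 ^+ k * (2 / (1 - r0) + 1).
Proof.
move=> x0 Gw nb Ts Tt st.
have h1 := chain_proj x0 Gw nb Ts; have h2 := chain_proj x0 Gw nb Tt.
have h3 : `|f (proj T N k s) omega - f (proj T N k t) omega| <= x * r0 ^+ k.
  rewrite leNgt; apply/negP => h; apply: nb; exists 0%N => //; rewrite addn0.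
  exists (cell_index N k s, inl (cell_index N k t)) => //=.
  have g1 := proj_norm1 TN k Ts.
  have g2 := proj_norm1 TN k Tt.
  rewrite -/(proj T N k s) -/(proj T N k t).
  have -> : proj T N k s - proj T N k t =
    (proj T N k s - s) + ((s - t) + (t - proj T N k t)) by rewrite !addrA !subrK.
  apply: (le_trans (norm1_triangle _ _)); rewrite norm1_distC.
  have h7 := norm1_triangle (s - t) (t - proj T N k t).
  have h4 : 0 <= 2 ^- k :> R by rewrite invr_ge0 exprn_ge0.
  have h5 : 2 ^- k <= d%:R * 2 ^- k :> R by rewrite ler_peMl// ler1n.
  by rewrite natrM -mulrA; exact: chain_lin2 g1 g2 h7 st h5.
have -> : f s omega - f t omega = (f s omega - f (proj T N k s) omega) +
   ((f (proj T N k s) omega - f (proj T N k t) omega) + (f (proj T N k t) omega - f t omega)).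
  by rewrite !addrA !subrK.
apply: (le_trans (ler_normD _ _)); have h4 := ler_normD (f (proj T N k s) omega - f (proj T N k t) omega) (f (proj T N k t) omega - f t omega).
rewrite [X in _ <= _ + X]distrC in h4.
have -> : x * r0 ^+ k * (2 / (1 - r0) + 1) = x * r0 ^+ k / (1 - r0) + x * r0 ^+ k / (1 - r0) + x * r0 ^+ k by ring.
exact: chain_lin3 h1 h2 h3 h4.
Qed.

(** One point of [T] suffices: the maximum dominates a single normal variable, whose tail is bounded
    below over an interval of unit length. *)
Lemma w_lower : exists c C : R, [/\ 0 < c, 0 < C &
  forall b, 1 <= b -> c * expR (- (C * b ^+ 2)) <= w T f b].
Proof.
have [t Tt] := T0.
set m := mean f t; set s := sdev f t.
have s0 : 0 < s by exact: (sdev_gt0 hvar).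
(* Makes (b + |m|) / s + 1 <= B b for all b >= 1. *)
pose B := (1 + `|m|) / s + 1.
have B0 : 0 < B by rewrite /B ltr_wpDl// divr_ge0// ?addr_ge0// ltW.
exists (normal_peak 1), (B ^+ 2 / 2); split.
- by rewrite normal_peak_gt0.
- by rewrite divr_gt0// exprn_gt0.
move=> b b1.
rewrite /w (pr_maxT T0 cT TN mG PG Gc).
pose a := (b + `|m|) / s.
have a0 : 0 <= a by apply: divr_ge0; [apply: addr_ge0 => //; exact: le_trans b1|exact: ltW].
have aB : a + 1 <= B * b.
  rewrite /a /B [leRHS]mulrDl mul1r; apply: lerD => //.
  by rewrite mulrAC ler_pM2r ?invr_gt0// mulrDl mul1r lerD2l ler_peMr.
have mA : measurable (`]b, +oo[%classic : set R) by [].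
have Pt : P [set omega | b < f t omega] = std_normal [set z | `]b, +oo[%classic (m + s * z)].
  rewrite -normal_lawE// -(field_law gaussf Tt mA); congr (P _).
  by apply/seteqP; split => z /=; rewrite in_itv/= andbT.
rewrite -lee_fin fineK; last first.
  by rewrite fin_num_measure//; exact: measurable_path_above.
apply: (@le_trans _ _ (P [set omega | b < f t omega])).
  rewrite Pt; apply: (@le_trans _ _ (@std_normal R `]a, +oo[)).
    apply: le_trans (std_normal_ray_ge a0 ltr01).
    rewrite mul1r lee_fin std_pdfE; rewrite ler_pM2l ?normal_peak_gt0//.
    rewrite ler_expR mulNr lerN2 [leRHS]mulrAC ler_pM2r ?invr_gt0// -exprMn.
    apply: lerXn2r => //; rewrite nnegrE; first by rewrite addr_ge0.
    by rewrite mulr_ge0// ?ltW// (lt_le_trans _ b1).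
  apply: le_measure; rewrite ?inE//.
    apply: (@measurable_preimageT _ _ _ _ (fun z : R => m + s * z)) => //.
    by under eq_fun do rewrite addrC; exact: measurable_affine.
  move=> z /=; rewrite !in_itv/= !andbT /a ltr_pdivrMr// mulrC => h.
  by have := ler_norm (- m); rewrite normrN; lra.
have mGC : measurable (~` G) by exact: measurableC.
have mp := measurable_path_above T f N b.
apply: (@le_trans _ _ (P (path_above T f N b `|` ~` G))).
  apply: le_measure; rewrite ?inE//; first exact: measurable_above.
    exact: measurableU.
  move=> omega bf; have [Gw|] := pselect (G omega); last by right.
  by left; apply/(path_aboveP T0 cT TN Gc b Gw)/(maxT_gtP T0 cT Gc b Gw); exists t.
apply: (le_trans (@measureU2 _ _ _ P _ _ mp mGC)).
by rewrite [X in (_ + X)%E]PG adde0.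
Qed.

(** At a fixed level k, a path that exceeds b and is not bad moves by at most b/2 along a chain, so
    it exceeds b/2 at one of finitely many cell points. *)
Lemma w_upper : exists c C b1 : R, [/\ 0 < c, 0 < C &
  forall b, b1 <= b -> w T f b <= C * expR (- (c * b ^+ 2))].
Proof.
have [c [C [k [c0 C0 hC]]]] := chaining_tail.
have [S S0 hS] := mean_sdev_bounded T0 TN hkappaH hbeta hA2.
have d1 : 0 < 1 - r0 by rewrite subr_gt0.
set n := #|I k|.
have rk : 1 <= (r0 ^+ 2) ^- k.
  rewrite -exprVn exprn_ege1// invf_ge1 ?exprn_gt0//.
  by rewrite exprn_ile1// ltW.
(* The rate is the worse of two: the chaining exponent at x = b (1 - r0) / 2, and (b/2)^2 / (8 S^2)
   = b^2 / (32 S^2) for one normal variable. The threshold on b ensures x >= 1 and that means are at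
   most b/4. *)
exists (Num.min (c * (1 - r0) ^+ 2 / 4) (32 * S ^+ 2)^-1), (C + n%:R * 2), (2 / (1 - r0) + 4 * S).
split.
- by rewrite lt_min !(divr_gt0, mulr_gt0, exprn_gt0, invr_gt0).
- by rewrite ltr_pwDl// mulr_ge0.
move=> b hb.
have b2 : 2 / (1 - r0) <= b by apply: le_trans hb; rewrite lerDl mulr_ge0// ltW.
have bS : 4 * S <= b by apply: le_trans hb; rewrite lerDr divr_ge0// ltW.
have b0 : 0 <= b by apply: le_trans b2; rewrite divr_ge0// ltW.
set e := expR _.
(* The total displacement x r0^k / (1 - r0) of a chain is then at most b/2. *)
pose x := b / 2 * (1 - r0).
have x1 : 1 <= x.
  rewrite /x mulrAC ler_pdivlMr// mul1r.
  by rewrite ler_pdivrMr in b2.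
rewrite /w (pr_maxT T0 cT TN mG PG Gc).
rewrite -lee_fin fineK; last first.
  by rewrite fin_num_measure//; exact: measurable_path_above.
pose U := \big[setU/set0]_(i : I k) [set omega | b / 2 < `|f (cell_point T i) omega|].
have mi (i : I k) : measurable [set omega | b / 2 < `|f (cell_point T i) omega|].
  rewrite (_ : [set _ | _] = [set omega | `]b / 2, +oo[%classic `|f (cell_point T i) omega|]).
    by apply: measurable_preimageT => //; exact: measurableT_comp.
  by apply/seteqP; split => z /=; rewrite in_itv/= andbT.
have mU : measurable U by exact: bigsetU_measurable.
have mB := measurable_chain_bad k x.
have mGC : measurable (~` G) by exact: measurableC.
have PU : (P U <= (n%:R * 2 * e)%:E)%E.
  apply: (le_trans (@measure_bigsetU_le _ _ _ P _ _ _ mi)).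
  apply: (@le_trans _ _ (\sum_(i : I k) (2 * e)%:E)%E).
    apply: lee_sum => i _.
    have Ti : T (cell_point T i) by exact: T_cell_point.
    have [Sm Ss] := hS _ Ti.
    have mI : measurable [set z : R | b / 2 < `|z|].
      rewrite (_ : [set _ | _] = [set x | `]b / 2, +oo[%classic `|x|]).
        by apply: measurable_preimageT => //; exact: measurableT_comp.
      by apply/seteqP; split => z /=; rewrite in_itv/= andbT.
    rewrite [leLHS](field_law gaussf Ti mI).
    have S20 : 0 < S ^+ 2 by rewrite exprn_gt0.
    have s2 : sdev f (cell_point T i) ^+ 2 <= S ^+ 2.
      by apply: lerXn2r; rewrite ?nnegrE ?sqrtr_ge0// ltW.
    have my : 2 * `|mean f (cell_point T i)| <= b / 2 by lra.
    apply: (le_trans (normal_abs_tail (sqrtr_ge0 _) S20 s2 my)).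
    rewrite lee_fin ler_wpM2l// /e ler_expR lerN2.
    rewrite (_ : (b / 2) ^+ 2 / (8 * S ^+ 2) = (32 * S ^+ 2)^-1 * b ^+ 2); last first.
      by field; rewrite gt_eqF.
    by rewrite ler_wpM2r ?sqr_ge0// ge_min lexx orbT.
  rewrite sumEFin sumr_const lee_fin -[leLHS]mulr_natl mulrA ler_wpM2r ?expR_ge0// ler_wpM2r// ler_nat.
have PB : (P (chain_bad k x) <= (C * e)%:E)%E.
  apply: (le_trans (hC k (leqnn k) x x1)).
  rewrite lee_fin ler_pM2l// /e ler_expR lerN2.
  apply: (@le_trans _ _ (c * x ^+ 2)); last first.
    by rewrite ler_peMr// mulr_ge0 ?sqr_ge0// ltW.
  have -> : c * x ^+ 2 = c * (1 - r0) ^+ 2 / 4 * b ^+ 2 by rewrite /x; field.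
  by rewrite ler_wpM2r ?sqr_ge0// ge_min lexx.
apply: (@le_trans _ _ (P ((chain_bad k x `|` U) `|` ~` G))).
  apply: le_measure; rewrite ?inE//.
  - exact: measurable_path_above.
  - by apply: measurableU => //; exact: measurableU.
  move=> omega pa.
  have [Gw|] := pselect (G omega); last by right.
  left; have [bad|nb] := pselect (chain_bad k x omega); [by left|right].
  have [t Tt bt] := (maxT_gtP T0 cT Gc b Gw).1 ((path_aboveP T0 cT TN Gc b Gw).2 pa).
  have x0 : 0 <= x by apply: le_trans x1.
  have := chain_proj x0 Gw nb Tt.
  have : x * r0 ^+ k / (1 - r0) <= b / 2.
    rewrite /x mulrAC mulfK ?gt_eqF// ler_piMr ?divr_ge0//.
    by rewrite exprn_ile1// ltW.
  move=> h1 h2.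
  rewrite /U -bigcup_seq; exists (cell_index N k t); first exact: mem_index_enum.
  rewrite /= -/(proj T N k t).
  have := ler_norm (f (proj T N k t) omega); have := ler_norm (f t omega - f (proj T N k t) omega).
  lra.
apply: (le_trans (@measureU2 _ _ _ P _ _ (measurableU _ _ mB mU) mGC)).
rewrite [X in (_ + X)%E]PG adde0.
apply: (le_trans (@measureU2 _ _ _ P _ _ mB mU)).
by rewrite mulrDl EFinD; apply: leeD.
Qed.

End chaining.

(** * Bias of the discretization *)

Lemma ceil_abs_ge (R : realType) (x : R) : x <= (`|Num.ceil x|%N)%:R.
Proof.
apply: (le_trans (ceil_ge x)); rewrite natr_absz.
by rewrite ler_int ler_norm.
Qed.

Lemma ceil_abs_le (R : realType) (x : R) : 0 <= x -> (`|Num.ceil x|%N)%:R <= x + 1.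
Proof.
move=> x0; rewrite natr_absz ger0_norm; last by rewrite ceil_ge0// (lt_le_trans _ x0)// ltrN10.
by have := gt_pred_ceil x; rewrite intrB => /ltW; rewrite lerBlDr.
Qed.

Section volume.
Context (R : realType) (d : nat) (T : set 'rV[R]_d) (N : nat).
Hypothesis mT : measurable T.
Hypothesis TN : forall x, T x -> forall j, `|x ord0 j| <= N%:R.
Hypothesis A4 : condA4 T.
Hypothesis hd : (0 < d)%N.

Lemma measurable_norm1 (t : 'rV[R]_d) : measurable_fun setT (fun s : 'rV[R]_d => norm1 (t - s)).
Proof.
rewrite /norm1; apply: measurable_sum => j; apply: measurableT_comp => //.
under eq_fun do rewrite !mxE.
by apply: measurable_funB => //; exact: measurable_coord.
Qed.

Lemma measurable_cball1 (t : 'rV[R]_d) e : measurable (cball1 t e).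
Proof.
rewrite (_ : cball1 t e = [set s | `]-oo, e]%classic (norm1 (t - s))]).
  by apply: measurable_preimageT => //; exact: measurable_norm1.
by apply/seteqP; split => s /=; rewrite in_itv.
Qed.

Lemma measurable_cube (a b : R) : measurable [set x : 'rV[R]_d | forall j, a <= x ord0 j <= b].
Proof.
rewrite (_ : [set x | _] = \big[setI/setT]_(j < d) [set x : 'rV[R]_d | `[a, b]%classic (x ord0 j)]).
  apply: bigsetI_measurable => j _.
  by apply: measurable_preimageT => //; exact: measurable_coord.
rewrite -bigcap_seq; apply/seteqP; split => x /= h j; first by move=> _ /=; rewrite in_itv/=; exact: h.
by have := h j (mem_index_enum j); rewrite /= in_itv.
Qed.

Lemma lebesgue_rV_cube (a b : R) : a <= b ->
  lebesgue_rV [set x : 'rV[R]_d | forall j, a <= x ord0 j <= b] = ((b - a) ^+ d)%:E.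
Proof.
move=> ab; rewrite /lebesgue_rV.
rewrite (_ : [set v | _] = [set v : d.-tuple R | forall i, `[a, b]%classic (tnth v i)]); last first.
  by apply/seteqP; split => v /= h i; have := h i; rewrite in_itv/= mxE.
rewrite power_measure_box// [X in (X ^+ _)%E](lebesgue_measure_itv `[a, b])/= lte_fin.
have [ab'|ba] := ltP a b; first by rewrite -EFinB EFin_expe.
have -> : b = a by apply/eqP; rewrite eq_le ab ba.
by rewrite -EFin_expe subrr.
Qed.

Lemma lebesgue_T_fin : lebesgue_rV T \is a fin_num.
Proof.
rewrite ge0_fin_numE//.
apply: (@le_lt_trans _ _ (lebesgue_rV [set x : 'rV[R]_d | forall j, - N%:R <= x ord0 j <= N%:R])).
  apply: le_measure; rewrite ?inE//.
    exact: measurable_cube.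
  by move=> x Tx /= j; rewrite -ler_norml; exact: TN.
by rewrite lebesgue_rV_cube ?ltry// -subr_ge0 opprK addr_ge0.
Qed.

(** The ball for the sum norm contains the cube with sides [0, 1/d]. *)
Lemma lebesgue_unit_ball : (0 < lebesgue_rV (@cball1 R d 0 1))%E.
Proof.
have d0 : 0 < d%:R :> R by rewrite ltr0n.
have h : lebesgue_rV [set x : 'rV[R]_d | forall j, 0 <= x ord0 j <= d%:R^-1] = ((d%:R^-1 - 0) ^+ d)%:E.
  by rewrite lebesgue_rV_cube// invr_ge0.
apply: (@lt_le_trans _ _ ((d%:R^-1 - 0) ^+ d)%:E).
  by rewrite lte_fin subr0 exprn_gt0// invr_gt0.
rewrite -h; apply: le_measure; rewrite ?inE.
- exact: measurable_cube.
- exact: measurable_cball1.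
- move=> x /= hx; rewrite /cball1/= sub0r norm1N.
  rewrite -[leRHS](@mulfV _ d%:R) ?gt_eqF//; apply: norm1_le => j.
  by have /andP[x0 x1] := hx j; rewrite ger0_norm.
Qed.

Lemma lebesgue_T_neq0 : lebesgue_rV T != 0%E.
Proof.
have [T0 [k [e1 [k0 e10 h]]]] := A4.
have e0 : 0 < e1 / 2 by rewrite divr_gt0.
have ee : e1 / 2 < e1 by rewrite ltr_pdivrMr// ltr_pMr// ltr1n.
have := h 0 _ T0 e0 ee.
have : (0 < (k * (e1 / 2) ^+ d)%:E * lebesgue_rV (@cball1 R d 0 1))%E.
  by rewrite mule_gt0 ?lebesgue_unit_ball// lte_fin mulr_gt0// exprn_gt0.
move=> p1 p2; rewrite gt_eqF//; apply: (lt_le_trans p1); apply: (le_trans p2).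
apply: le_measure; rewrite ?inE//.
by apply: measurableI => //; exact: measurable_cball1.
Qed.

Lemma ball_uniform : exists kap e1 : R, [/\ 0 < kap, 0 < e1 &
  forall t e, T t -> 0 < e -> e < e1 -> ((kap * e ^+ d)%:E <= uniform_on T (cball1 t e `&` T))%E].
Proof.
have [T0 [k [e1 [k0 e10 h]]]] := A4.
have v0 : 0 < fine (lebesgue_rV T).
  by rewrite fine_gt0// lt0e lebesgue_T_neq0 measure_ge0 ltey_eq lebesgue_T_fin.
have B0 := lebesgue_unit_ball.
(* Capping the volume of the unit ball at 1 gives a finite positive lower bound without computing
   that volume. *)
pose v := fine (mine (lebesgue_rV (@cball1 R d 0 1)) 1%E).
have vE : v%:E = mine (lebesgue_rV (@cball1 R d 0 1)) 1%E.
  rewrite /v fineK// ge0_fin_numE; last by rewrite le_min ltW//= lee_fin.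
  by rewrite gt_min ltry orbT.
have vp : 0 < v by rewrite -lte_fin vE lt_min B0 lte_fin ltr01.
exists (k * v / fine (lebesgue_rV T)), e1; split => //.
  by rewrite divr_gt0// mulr_gt0.
move=> t e Tt e0 ee; rewrite /uniform_on -setIA setIid.
rewrite (_ : k * v / _ * _ = k * e ^+ d * v / fine (lebesgue_rV T)); last by ring.
rewrite EFinM; apply: lee_wpmul2r; first by rewrite lee_fin invr_ge0 ltW.
apply: le_trans (h t e Tt e0 ee); rewrite EFinM; apply: lee_wpmul2l.
  by rewrite lee_fin mulr_ge0 ?exprn_ge0 ?ltW.
by rewrite vE ge_min lexx.
Qed.

End volume.

Section bias.
Context (R : realType) (disp : measure_display) (Omega : measurableType disp).
Context (P : probability Omega R) (d : nat) (hd : (0 < d)%N) (T : set 'rV[R]_d).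
Context (f : 'rV[R]_d -> {RV P >-> R}) (N : nat) (G : set Omega).
Hypothesis T0 : T !=set0.
Hypothesis cT : compact T.
Hypothesis TN : forall x, T x -> forall j, `|x ord0 j| <= N%:R.
Hypothesis mG : measurable G.
Hypothesis PG : P (~` G) = 0%E.
Hypothesis Gc : forall omega, G omega ->
  {within T, continuous (fun t => f t omega : R)}.
Hypothesis mT : measurable T.
Hypotheses (Tn0 : lebesgue_rV T != 0%E) (Tfin : lebesgue_rV T \is a fin_num).
Local Notation U := (uniform_law mT Tn0 Tfin).
Local Notation Um M := (power_measure U (n := M)).

Lemma le_prob_good (A B : set Omega) : measurable A -> measurable B ->
  (forall omega, G omega -> A omega -> B omega) -> (P A <= P B)%E.
Proof.
move=> mA mB AB; have mGC : measurable (~` G) by exact: measurableC.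
apply: (@le_trans _ _ (P (B `|` ~` G))).
  apply: le_measure; rewrite ?inE//; first exact: measurableU.
  by move=> omega Aw; have [Gw|] := pselect (G omega); [left; exact: AB|right].
apply: (le_trans (@measureU2 _ _ _ P _ _ mB mGC)).
by rewrite [X in (_ + X)%E]PG adde0.
Qed.

Lemma eq_prob_good (A B : set Omega) : measurable A -> measurable B ->
  (forall omega, G omega -> A omega <-> B omega) -> P A = P B.
Proof.
move=> mA mB AB; apply/eqP; rewrite eq_le; apply/andP.
by split; apply: le_prob_good => // omega Gw; have [] := AB omega Gw.
Qed.

(** [0 < M] makes the set of values nonempty; the supremum of the empty set would be a default
    value. *)
Lemma max_at_gtP M (u : M.-tuple 'rV[R]_d) omega g : (0 < M)%N ->
  (g < max_at f u omega) <-> exists i : 'I_M, g < f (tnth u i) omega.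
Proof.
move=> M0; set S := [set f (tnth u i) omega | i in [set: 'I_M]].
have hS : has_sup S.
  split; first by exists (f (tnth u (Ordinal M0)) omega); exists (Ordinal M0).
  exists (\sum_(i < M) `|f (tnth u i) omega|) => _ [i _ <-].
  by rewrite (bigD1 i)//= (le_trans (ler_norm _))// lerDl sumr_ge0.
split => [|[i gi]]; last first.
  by apply: (lt_le_trans gi); apply: sup_ubound; [case: hS|exists i].
by move=> /(sup_gt hS.1)[_ [i _ <-] h]; exists i.
Qed.

Definition hit_at M (g : R) (u : M.-tuple 'rV[R]_d) : set Omega :=
  [set omega | exists i : 'I_M, g < f (tnth u i) omega].

Lemma measurable_hit_at M g (u : M.-tuple 'rV[R]_d) : measurable (hit_at g u).
Proof.
rewrite (_ : hit_at g u = \bigcup_(i in [set: 'I_M]) [set omega | g < f (tnth u i) omega]).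
  apply: fin_bigcup_measurable => [|i _]; first exact: finite_finset.
  exact: measurable_above.
by apply/seteqP; split => omega [i //]; [exists i|exists i].
Qed.

Lemma wM_integral M g : (0 < M)%N ->
  (wM T f M g)%:E = (\int[Um M]_(u in @points R d T M) P (hit_at g u))%E.
Proof.
move=> M0; set S := [set p : M.-tuple 'rV[R]_d * Omega | points T p.1 /\ g < max_at f p.1 p.2].
have -> : wM T f M g = fine (\int[Um M]_u P (xsection S u))%E by [].
have -> : (\int[Um M]_u P (xsection S u) =
  \int[Um M]_(u in @points R d T M) P (hit_at g u))%E.
  rewrite [RHS]integral_mkcond; apply: eq_integral => u _; rewrite patchE /=.
  case: ifPn => [/set_mem Tu|/negP Tu].
    congr (P _); apply/seteqP; split => omega; rewrite /xsection/= inE/=.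
      by case=> _ /(max_at_gtP _ _ _ M0).
    by move=> h; split => //; apply/(max_at_gtP _ _ _ M0).
  rewrite (_ : xsection _ _ = set0) ?measure0//.
  by apply/seteqP; split => // omega; rewrite /xsection/= inE/= => -[Tu' _]; apply: Tu; rewrite inE.
rewrite fineK// ge0_fin_numE; last by apply: integral_ge0 => u _; exact: measure_ge0.
rewrite integral_mkcond.
apply: (@le_lt_trans _ _ (\int[Um M]_u 1)%E).
  apply: ge0_le_integral_nonmeas => u _; rewrite patchE; case: ifP => // _.
  by apply: probability_le1; exact: measurable_hit_at.
by rewrite integral_cst// mul1e [ltLHS](power_measureT U) ltry.
Qed.

(** Defined through [good_vector] so as to be measurable jointly in the points and the path. *)
Definition hit M (g : R) : set (M.-tuple 'rV[R]_d * Omega) :=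
  [set p | points T p.1 /\ exists i : 'I_M, g < tnth (good_vector T f G p) i].

Lemma measurable_hit M g : measurable (@hit M g).
Proof.
have mv := measurable_good_vector T0 cT TN mG Gc (M := M).
have mp : measurable (@points R d T M) := @measurable_points _ _ _ _ cT TN M.
rewrite (_ : hit g = [set p | points T p.1] `&`
   \bigcup_(i in [set: 'I_M]) [set p | `]g, +oo[%classic (tnth (good_vector T f G p) i)]).
  apply: measurableI.
    by apply: (measurable_preimageT (@measurable_fst _ _ _ _)).
  apply: fin_bigcup_measurable => [|i _]; first exact: finite_finset.
  apply: (@measurable_preimageT _ _ _ _ (fun p : M.-tuple 'rV[R]_d * Omega => tnth (good_vector T f G p) i)) => //.
  by apply: (measurableT_comp (measurable_tnth i) mv).
apply/seteqP; split => p /= [Tp].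
  by move=> [i gi]; split => //; exists i => //=; rewrite in_itv/= gi.
by move=> [i _ /=]; rewrite in_itv/= andbT => gi; split => //; exists i.
Qed.

(** Integrating over the points first, for a fixed path, turns the discretized maximum into a
    statement about independent uniform points. *)
Lemma wM_fubini M g : (0 < M)%N ->
  (wM T f M g)%:E = (\int[P]_omega Um M (ysection (@hit M g) omega))%E.
Proof.
move=> M0; rewrite wM_integral//.
have mh := @measurable_hit M g.
have -> : (\int[Um M]_(u in @points R d T M) P (hit_at g u) = (Um M \x P) (@hit M g))%E.
  rewrite integral_mkcond; apply: eq_integral => u _; rewrite patchE /=.
  case: ifPn => [/set_mem Tu|/negP Tu].
    apply: eq_prob_good; [exact: measurable_hit_at|exact: measurable_xsection|].
    move=> omega Gw; rewrite /xsection/= inE/=; split.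
      move=> [i gi]; split => //; exists i.
      by rewrite (good_vectorE _ Tu Gw) tnth_mktuple.
    by move=> [_ [i gi]]; exists i; move: gi; rewrite (good_vectorE _ Tu Gw) tnth_mktuple.
  rewrite (_ : xsection _ _ = set0) ?measure0//.
  by apply/seteqP; split => // omega; rewrite /xsection/= inE/= => -[Tu' _]; apply: Tu; rewrite inE.
rewrite (@product_measure_unique _ _ _ _ R (Um M) P (Um M \x^ P)%E _ _ mh)//.
by move=> A B mA mB; exact: product_measure2E.
Qed.

Lemma uniform_points M : Um M (@points R d T M) = 1%E.
Proof.
by rewrite /points power_measure_box// [X in (X ^+ _)%E](uniform_lawT mT) -EFin_expe expr1n.
Qed.

(** By independence all points miss [B] with probability at most (1 - p)^M; a point of [T] in [B]
    sees a value above [g]. *)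
Lemma hit_section_ge M g omega (B : set 'rV[R]_d) (p : R) : G omega -> measurable B ->
  (forall s, T s -> B s -> g < f s omega) -> 0 <= p -> p <= 1 -> (p%:E <= U (B `&` T))%E ->
  ((1 - (1 - p) ^+ M)%:E <= Um M (ysection (@hit M g) omega))%E.
Proof.
move=> Gw mB hB p0 p1 pU.
have mh := @measurable_hit M g.
have mp : measurable (@points R d T M) := @measurable_points _ _ _ _ cT TN M.
have mBT : measurable (B `&` T) by exact: measurableI.
have mC : measurable (~` (B `&` T)) by exact: measurableC.
set V := [set u : M.-tuple 'rV[R]_d | forall i, (~` (B `&` T)) (tnth u i)].
have mV : measurable V.
  rewrite (_ : V = \big[setI/setT]_(i < M) [set u : M.-tuple 'rV[R]_d | (~` (B `&` T)) (tnth u i)]).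
    apply: bigsetI_measurable => i _.
    by apply: (measurable_preimageT (measurable_tnth i)).
  rewrite -bigcap_seq; apply/seteqP; split => x /= h i; first by move=> _; exact: h.
  exact: h (mem_index_enum i).
have UV : (Um M V <= ((1 - p) ^+ M)%:E)%E.
  rewrite power_measure_box// [X in (X ^+ _)%E](probability_setC U mBT).
  have Ufin : U (B `&` T) \is a fin_num by rewrite fin_num_measure.
  have U1 : (U (B `&` T) <= 1)%E by exact: probability_le1.
  have [r hr] : exists r, U (B `&` T) = r%:E by exists (fine (U (B `&` T))); rewrite fineK.
  rewrite hr !lee_fin in pU U1.
  rewrite [X in (X ^+ _)%E](_ : _ = (1 - r)%:E); last by rewrite EFinB -hr.
  by rewrite -EFin_expe lee_fin; apply: lerXn2r; rewrite ?nnegrE ?subr_ge0// lerB.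
have : (Um M (@points R d T M) <= Um M (ysection (@hit M g) omega `|` V))%E.
  apply: le_measure; rewrite ?inE//.
    by apply: measurableU => //; exact: measurable_ysection.
  move=> u Tu; rewrite /ysection/=.
  have [hV|/existsNP[i hi]] := pselect (V u); [by right|left].
  rewrite inE/=; split => //; exists i.
  rewrite (good_vectorE _ Tu Gw) tnth_mktuple.
  have [Bi _] : (B `&` T) (tnth u i) by exact: contrapT.
  by apply: hB => //; exact: Tu.
rewrite uniform_points => h.
have h2 := le_trans h (@measureU2 _ _ _ (Um M) _ _ (measurable_ysection omega mh) mV).
have h3 : (1 <= Um M (ysection (@hit M g) omega) + ((1 - p) ^+ M)%:E)%E.
  by apply: (le_trans h2); rewrite leeD2l.
by rewrite EFinB leeBlDr.
Qed.

Lemma hit_section_le M g omega : G omega -> maxT T f omega <= g ->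
  Um M (ysection (@hit M g) omega) = 0%E.
Proof.
move=> Gw mg; rewrite (_ : ysection _ _ = set0) ?measure0//.
apply/seteqP; split => // u; rewrite /ysection/= inE/= => -[Tu [i]].
rewrite (good_vectorE _ Tu Gw) tnth_mktuple => gi.
have := maxT_ge T0 cT Gc Gw (Tu i); rewrite leNgt; case/negP.
exact: le_lt_trans gi.
Qed.

Lemma pr_fin A : measurable A -> (fine (P A))%:E = P A.
Proof. by move=> mA; rewrite fineK// fin_num_measure. Qed.

Lemma wE b : (w T f b)%:E = P (path_above T f N b).
Proof.
rewrite /w (pr_maxT T0 cT TN mG PG Gc) pr_fin//; exact: measurable_path_above.
Qed.

Lemma wM_le M g : (0 < M)%N -> wM T f M g <= w T f g.
Proof.
move=> M0; rewrite -lee_fin (@wM_fubini M g M0) (wE g).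
have mp := measurable_path_above T f N g.
have e : (\int[P]_x (\1_(path_above T f N g `|` ~` G) x)%:E)%E = P (path_above T f N g).
  rewrite integral_indic//; last by apply: measurableU => //; exact: measurableC.
  rewrite setIT; apply: eq_prob_good => //.
    by apply: measurableU => //; exact: measurableC.
  by move=> omega Gw; split; [case|left].
rewrite -e; apply: ge0_le_integral_nonmeas => omega _; first by rewrite measure_ge0.
rewrite indicE; have [pa|np] := pselect ((path_above T f N g `|` ~` G) omega).
  by rewrite mem_set//; apply: probability_le1; exact: (measurable_ysection omega (@measurable_hit M g)).
have Gw : G omega by apply: contrapT => nG; apply: np; right.
rewrite memNset// (@hit_section_le M g omega Gw)// leNgt; apply/negP => gm; apply: np; left.
exact: (path_aboveP T0 cT TN Gc g Gw).1 gm.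
Qed.

(** A path that exceeds b at some t and is not bad exceeds [g] on the whole ball of radius 2^-k
    about t, by [chain_modulus]. The hitting probability of this ball is bounded below uniformly in
    t, hence for every such path. *)
Lemma wM_ge M b g (k : nat) beta (p q : R) : (0 < M)%N -> 0 < beta ->
  0 <= p -> p <= 1 -> 0 <= q -> (1 - p) ^+ M <= q -> q <= 1 ->
  (forall t, T t -> (p%:E <= U (cball1 t (2 ^- k) `&` T))%E) ->
  hoelder_ratio beta ^+ k * (2 / (1 - hoelder_ratio beta) + 1) <= b - g ->
  (1 - q) * (w T f b - fine (P (chain_bad T f N beta k 1))) <= wM T f M g.
Proof.
move=> M0 hbeta p0 p1 q0 Mq q1 pU modk.
have mp := measurable_path_above T f N b.
have mB := measurable_chain_bad T f N beta k 1.
set E := path_above T f N b `\` (chain_bad T f N beta k 1 `|` ~` G).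
have mE : measurable E.
  by apply: measurableD => //; apply: measurableU => //; exact: measurableC.
have wb : w T f b - fine (P (chain_bad T f N beta k 1)) <= fine (P E).
  rewrite lerBlDr -lee_fin wE EFinD !pr_fin//.
  apply: le_trans (@measureU2 _ _ _ P _ _ mE mB).
  apply: le_prob_good => //; first exact: measurableU.
  move=> omega Gw pa; have [bad|nb] := pselect (chain_bad T f N beta k 1 omega).
    by right.
  by left; split => // -[].
have q10 : 0 <= 1 - q by rewrite subr_ge0.
apply: (le_trans (ler_wpM2l q10 wb)).
rewrite -lee_fin wM_fubini// EFinM pr_fin//.
have -> : P E = (\int[P]_x (\1_E x)%:E)%E by rewrite integral_indic// setIT.
rewrite -ge0_integralZl_EFin//; last first.
  by apply/measurable_EFinP; exact: measurable_indic.
apply: ge0_le_integral_nonmeas => omega _; first by rewrite mule_ge0// lee_fin.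
rewrite indicE; have [[pa nb]|nE] := pselect (E omega); last first.
  by rewrite memNset// mule0; exact: measure_ge0.
have Gw : G omega by apply: contrapT => nG; apply: nb; right.
have nbad : ~ chain_bad T f N beta k 1 omega by move=> h; apply: nb; left.
rewrite mem_set; last by split.
rewrite mule1.
have [t Tt bt] := (maxT_gtP T0 cT Gc b Gw).1 ((path_aboveP T0 cT TN Gc b Gw).2 pa).
apply: (@le_trans _ _ (1 - (1 - p) ^+ M)%:E); first by rewrite lee_fin lerB.
apply: (@hit_section_ge M g omega (cball1 t (2 ^- k)) p) => //.
- exact: measurable_cball1.
- move=> s Ts ts.
  have := chain_modulus hd T0 TN Gc hbeta ler01 Gw nbad Tt Ts ts.
  have := ler_norm (f t omega - f s omega); rewrite mul1r; lra.
- exact: pU.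
Qed.

End bias.

Section bias_arith.
Context (R : realFieldType).
Implicit Types b e x y z t u : R.

Lemma sum5_le x y z t u b : 1 <= x -> 0 <= y -> 0 <= z -> 0 <= t -> 0 <= u ->
  x + y + z + t + u <= b -> x <= b /\ y <= b /\ t <= b /\ u <= b /\ z <= b.
Proof. by move=> *; do !split; lra. Qed.

Lemma eighth_le1 e : 0 < e -> e <= 1 -> e / 8 <= 1.
Proof. lra. Qed.

(** (1 + e/2) (1 - e/4) >= 1 for e in [0, 1]. *)
Lemma gap_upper e x y : 0 < e -> e <= 1 -> 0 <= x -> x * (1 - e / 4) <= y ->
  x <= (1 + e / 2) * y.
Proof.
move=> e0 e1 x0 h.
have k1 : 0 <= 1 + e / 2 by lra.
have k2 : 0 <= e / 4 - e ^+ 2 / 8 by have : e ^+ 2 <= e; [rewrite expr2 ler_piMr// ltW|lra].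
have := ler_wpM2l k1 h; apply: le_trans.
have -> : (1 + e / 2) * (x * (1 - e / 4)) = x + x * (e / 4 - e ^+ 2 / 8) by field.
by rewrite lerDl mulr_ge0.
Qed.

Lemma gap_lower e x : 0 <= x -> (1 - e / 4) * x <= (1 - e / 8) * (x - e / 8 * x).
Proof.
move=> x0.
have -> : (1 - e / 8) * (x - e / 8 * x) = (1 - e / 4) * x + e ^+ 2 / 64 * x by field.
by rewrite lerDl mulr_ge0// divr_ge0// sqr_ge0.
Qed.

Lemma gap_both e x y z : 0 < e -> 0 <= x -> y <= z -> z <= (1 + e / 2) * x ->
  (1 - e / 4) * x <= y -> `|x - y| <= e / 2 * x.
Proof.
move=> e0 x0 h1 h2 h3; have h4 : 0 <= e * x by rewrite mulr_ge0// ltW.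
by rewrite ler_distl; apply/andP; split; lra.
Qed.

Lemma gap_double e x z : e <= 1 -> 0 <= x -> z <= (1 + e / 2) * x -> z <= 2 * x.
Proof. by move=> e1 x0 h; apply: (le_trans h); rewrite ler_wpM2r//; lra. Qed.

End bias_arith.

(** * Choice of the scale and size of the bias *)

Section bias_rate.
Context (R : realType) (disp : measure_display) (Omega : measurableType disp).
Context (P : probability Omega R) (d : nat) (hd : (0 < d)%N) (T : set 'rV[R]_d).
Context (f : 'rV[R]_d -> {RV P >-> R}) (N : nat) (G : set Omega).
Hypothesis T0 : T !=set0.
Hypothesis cT : compact T.
Hypothesis TN : forall x, T x -> forall j, `|x ord0 j| <= N%:R.
Hypothesis mG : measurable G.
Hypothesis PG : P (~` G) = 0%E.
Hypothesis Gc : forall omega, G omega ->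
  {within T, continuous (fun t => f t omega : R)}.
Hypothesis gaussf : gaussian_field T f.
Hypothesis hvar : forall t, T t -> 0 < cov f t t.
Variables kappaH beta : R.
Hypotheses (hkappaH : 0 < kappaH) (hbeta : 0 < beta).
Hypotheses (hA2 : condA2 T f kappaH beta) (hA3 : condA3 T f kappaH beta).
Hypothesis A4 : condA4 T.

Let mT : measurable T := measurable_T cT TN.
Let Tn0 : lebesgue_rV T != 0%E := lebesgue_T_neq0 mT A4 hd.
Let Tfin : lebesgue_rV T \is a fin_num := lebesgue_T_fin mT TN.
Local Notation r0 := (hoelder_ratio beta).
Let r00 : 0 < r0 := hoelder_ratio_gt0 beta.
Let r01 : r0 < 1 := hoelder_ratio_lt1 hbeta.

(** The source of the exponent 4d/beta: it converts the oscillation r0^k at level k into the volume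
    2^(-kd) of the ball on which it is guaranteed. *)
Lemma hoelder_ratio_volume k : (r0 ^+ k) `^ (4 * d%:R / beta) = (2 ^- k) ^+ d.
Proof.
rewrite /hoelder_ratio -powR_mulrn ?powR_ge0// -powRrM -powRrM.
have -> : - (beta / 4) * (k%:R * (4 * d%:R / beta)) = - (k * d)%:R.
  by rewrite natrM; field; rewrite gt_eqF.
by rewrite powR_invn// exprM exprVn.
Qed.

Lemma expRN_le_inv (x : R) : 0 < x -> expR (- x) <= x^-1.
Proof.
move=> x0; rewrite expRN lef_pV2 ?posrE ?expR_gt0//.
by apply: le_trans (expR_ge1Dx x); rewrite lerDr.
Qed.

(** (1 - p)^M <= exp(-p M) <= (p M)^-1. *)
Lemma missing_prob (p e : R) (M : nat) : 0 < p -> p <= 1 -> 0 < e -> e^-1 <= M%:R * p ->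
  (1 - p) ^+ M <= e.
Proof.
move=> p0 p1 e0 eM.
have Mp : 0 < M%:R * p by apply: lt_le_trans eM; rewrite invr_gt0.
apply: (@le_trans _ _ (expR (- p) ^+ M)).
  apply: lerXn2r; rewrite ?nnegrE ?subr_ge0 ?expR_ge0//.
  exact: expR_ge1Dx.
rewrite -expRM_natr mulNr mulrC.
apply: (le_trans (expRN_le_inv Mp)).
by rewrite -[leRHS]invrK lef_pV2 ?posrE ?invr_gt0.
Qed.

(** The level k is matched to eta: the oscillation L r0^k stays below eta, while the ball of radius
    2^-k keeps a volume of order at least eta^(4d/beta). *)
Lemma bias_of_scale : exists c0 c C eta0 : R, [/\ 0 < c0, 0 < c, 0 < C, 0 < eta0 &
  forall (b eta e : R) (M : nat), 0 < eta -> eta <= eta0 -> 0 < e -> e <= 1 ->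
    c0 * e^-1 * eta^-1 `^ (4 * d%:R / beta) <= M%:R ->
    (1 - e) * (w T f b - C * expR (- (c / eta ^+ 2))) <= wM T f M (b - eta)].
Proof.
have [c [C [k1 [c0 C0 hC]]]] := chaining_tail hd T0 TN gaussf hvar hkappaH hbeta hA2 hA3.
have [kap [e1 [kap0 e10 hkap]]] := ball_uniform mT TN A4 hd.
pose L := 2 / (1 - r0) + 1.
have d1 : 0 < 1 - r0 by rewrite subr_gt0.
have L0 : 0 < L by rewrite /L ltr_wpDl// divr_ge0// ltW.
have [kb hkb] := grid_small 1 e10.
pose q := 4 * d%:R / beta.
have q0 : 0 <= q by rewrite /q divr_ge0 ?mulr_ge0// ltW.
(* Capping at 1 keeps the hitting probability [p] below 1. *)
pose kap1 := Num.min kap 1.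
have kap10 : 0 < kap1 by rewrite lt_min kap0 ltr01.
have rL0 : 0 < r0 / L by rewrite divr_gt0.
(* The first witness is the inverse of the constant in the volume bound [pE]. The last one forces
   the level above [k1], where the chaining tail holds, and above [kb], where balls are small enough
   for [ball_uniform]. *)
exists (kap1 * (r0 / L) `^ q)^-1, (c * L ^+ 2), C, (L * r0 ^+ (maxn k1 kb)); split => //.
- by rewrite invr_gt0 mulr_gt0// powR_gt0.
- by rewrite mulr_gt0// exprn_gt0.
- by rewrite mulr_gt0// exprn_gt0.
move=> b eta e M eta0 hle e0 e1' hM.
pose y := eta / L.
have y0 : 0 < y by rewrite divr_gt0.
have [k' hk'] := @expr_small R r0 y (ltW r00) r01 y0.
have ex : exists k, r0 ^+ k <= y by exists k'; exact: hk'.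
case: (ex_minnP ex) => k kP kmin.
(* Minimality of k: the level is not finer than needed by more than one step. At k = 0 the bound
   holds because eta0 <= L. *)
have yr : r0 * y <= r0 ^+ k.
  case: k kP kmin => [|k] _ kmin.
    rewrite expr0; apply: (@le_trans _ _ y); first by rewrite ler_piMl// ltW.
    rewrite /y ler_pdivrMr// mul1r; apply: (le_trans hle).
    by rewrite ler_piMr ?(ltW L0)// exprn_ile1// ltW.
  rewrite exprS ler_pM2l// leNgt; apply/negP => h.
  by have := kmin k (ltW h); rewrite ltnn.
have kge : (maxn k1 kb <= k)%N.
  rewrite leqNgt; apply/negP => kk.
  have : r0 ^+ (maxn k1 kb) < r0 ^+ k.
    by rewrite ltr_iXn2l.
  rewrite ltNge => /negP; apply.
  apply: (le_trans kP); rewrite /y ler_pdivrMr// mulrC.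
  exact: hle.
have /andP[kk1 kkb] : (k1 <= k)%N && (kb <= k)%N by rewrite -geq_max.
pose p := kap1 * (2 ^- k) ^+ d.
have p0 : 0 < p by rewrite mulr_gt0// exprn_gt0// invr_gt0 exprn_gt0.
have p1 : p <= 1.
  have h2 : 2 ^- k <= 1 :> R by rewrite invf_le1 ?exprn_gt0// exprn_ege1// ler1n.
  have h20 : 0 <= 2 ^- k :> R by rewrite invr_ge0 exprn_ge0.
  apply: mulr_ile1; [exact: ltW|exact: exprn_ge0|by rewrite ge_min lexx orbT|exact: exprn_ile1].
have pE : kap1 * (r0 * y) `^ q <= p.
  rewrite /p -hoelder_ratio_volume -/q ler_pM2l//.
  have r0y : 0 <= r0 * y by apply: mulr_ge0; exact: ltW.
  by apply: ge0_ler_powR => //; rewrite nnegrE exprn_ge0// ltW.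
have eM : e^-1 <= M%:R * p.
  apply: (@le_trans _ _ (((kap1 * (r0 / L) `^ q)^-1 * e^-1 * eta^-1 `^ q) * (kap1 * (r0 * y) `^ q))).
    have -> : r0 * y = (r0 / L) * eta by rewrite /y; ring.
    have rLq : 0 < (r0 / L) `^ q by exact: powR_gt0.
    have eta_ge0 : 0 <= eta by exact: ltW.
    have ee : eta^-1 `^ q * eta `^ q = 1.
      by rewrite -powRM ?invr_ge0// mulVf ?gt_eqF// powR1.
    rewrite (powRM _ (ltW rL0) eta_ge0).
    rewrite (_ : _ * (kap1 * _) = (kap1 * (r0 / L) `^ q)^-1 * (kap1 * (r0 / L) `^ q) * e^-1 * (eta^-1 `^ q * eta `^ q)); last by ring.
    rewrite ee mulr1 mulVf ?mul1r//; apply: lt0r_neq0; exact: mulr_gt0.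
  have kq0 : 0 <= (kap1 * (r0 / L) `^ q)^-1 by rewrite invr_ge0 mulr_ge0 ?powR_ge0// ltW.
  apply: ler_pM => //.
  - apply: mulr_ge0; last exact: powR_ge0.
    by apply: mulr_ge0 => //; rewrite invr_ge0 ltW.
  - by apply: mulr_ge0; [exact: ltW|exact: powR_ge0].
have M0 : (0 < M)%N.
  rewrite lt0n; apply/negP => /eqP M0; move: eM; rewrite M0 mul0r leNgt.
  by rewrite invr_gt0 e0.
have Mq : (1 - p) ^+ M <= e by exact: missing_prob.
have := @wM_ge R disp Omega P d hd T f N G T0 cT TN mG PG Gc mT Tn0 Tfin M b (b - eta) k beta p e
  M0 hbeta (ltW p0) p1 (ltW e0) Mq e1' _ _.
have e1e : 0 <= 1 - e by rewrite subr_ge0.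
move=> h; apply: le_trans (h _ _).
- apply: ler_wpM2l => //; rewrite lerB//.
  have mB := measurable_chain_bad T f N beta k 1.
  rewrite -lee_fin fineK; last by rewrite fin_num_measure.
  apply: (le_trans (hC k kk1 1 (lexx _))).
  rewrite lee_fin ler_pM2l// ler_expR lerN2 expr1n mulr1 -mulrA ler_pM2l//.
  rewrite -expr_div_n -exprM mulnC exprM -exprVn; apply: lerXn2r.
  + by rewrite nnegrE divr_ge0// ltW.
  + by rewrite nnegrE invr_ge0 exprn_ge0// ltW.
  rewrite -invf_div lef_pV2 ?posrE ?exprn_gt0//.
- move=> t Tt; apply: (@le_trans _ _ (kap * (2 ^- k) ^+ d)%:E).
    rewrite lee_fin /p ler_wpM2r ?exprn_ge0 ?invr_ge0 ?exprn_ge0//.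
    by rewrite ge_min lexx.
  apply: hkap => //.
  by have := hkb k kkb; rewrite mul1r.
- by rewrite subKr -/L -ler_pdivlMr.
Qed.

Variables (lambda b0 rho : R).
Hypotheses (hlambda : 0 < lambda) (hb0 : 1 <= b0) (hrho : 1 <= rho).
Hypothesis gap : forall a b : R, 0 < a -> b0 <= b ->
  pr P [set omega | gamma a b < maxT T f omega] * (1 - lambda * a * b `^ rho)
  <= pr P [set omega | b < maxT T f omega].

Lemma w_ge0 b : 0 <= w T f b.
Proof. by rewrite /w /pr fine_ge0// mu_ext_ge0. Qed.

Lemma bias (nu : R) : 4 * d%:R / beta <= nu -> exists c b1 : R, [/\ 0 < c, b0 <= b1 &
  forall eps b : R, 0 < eps -> eps <= 1 -> b1 <= b -> forall M : nat,
  let a := eps / (4 * lambda * b `^ rho) in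
  c * eps^-1 * (b / a) `^ nu <= M%:R ->
  `|w T f b - wM T f M (gamma a b)| <= eps / 2 * w T f b /\
  w T f (gamma a b) <= 2 * w T f b].
Proof.
move=> hnu.
have [c0 [c [C [eta0 [c00 cp C0 eta00 hsc]]]]] := bias_of_scale.
have [c' [C' [c'0 C'0 hw]]] := w_lower T0 cT TN mG PG Gc gaussf hvar.
pose D := c * (4 * lambda) ^+ 2.
have D0 : 0 < D by rewrite mulr_gt0// exprn_gt0// mulr_gt0.
(* One summand per requirement on b: eta <= eta0, then eta <= 1, then D b^4 / 2 >= (C' + 1) b^2,
   then absorption of the constants in front of the exponentials. *)
exists (8 * c0), (b0 + (4 * lambda * eta0)^-1 + (4 * lambda)^-1 + 2 * (C' + 1) / D + 16 * C / (c' * D)).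
split; first by rewrite mulr_gt0.
  by rewrite -!addrA lerDl !addr_ge0 ?divr_ge0 ?invr_ge0 ?mulr_ge0 ?addr_ge0// ltW.
move=> eps b eps0 eps1 hb M a hM.
have p1 : 0 <= (4 * lambda * eta0)^-1 by rewrite invr_ge0 !mulr_ge0// ltW.
have p2 : 0 <= 2 * (C' + 1) / D by rewrite divr_ge0 ?mulr_ge0 ?addr_ge0// ltW.
have p3 : 0 <= 16 * C / (c' * D) by rewrite divr_ge0 ?mulr_ge0// ltW.
have p4 : 0 <= (4 * lambda)^-1 by rewrite invr_ge0 mulr_ge0// ltW.
have [bb0 [hb1 [hb2 [hb3 hb4]]]] : b0 <= b /\ (4 * lambda * eta0)^-1 <= b /\
    2 * (C' + 1) / D <= b /\ 16 * C / (c' * D) <= b /\ (4 * lambda)^-1 <= b.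
  exact: sum5_le hb.
have b1 : 1 <= b by apply: le_trans bb0.
have bp : 0 < b by apply: lt_le_trans b1.
have br1 : 1 <= b `^ rho by rewrite -[1](powRr0 b) ler_powR// (le_trans _ hrho).
have brb : b <= b `^ rho by rewrite -[leLHS](powRr1 (ltW bp)) ler_powR.
have brp : 0 < b `^ rho by apply: lt_le_trans br1.
have a0 : 0 < a by rewrite divr_gt0// !mulr_gt0.
pose eta := a / b.
have eta_gt0 : 0 < eta by rewrite divr_gt0.
have etaE : eta = eps / (4 * lambda * (b * b `^ rho)).
  by rewrite /eta /a; field; rewrite !gt_eqF.
have bb : b * b <= b * b `^ rho by rewrite ler_pM2l.
have l4 : 0 < 4 * lambda by rewrite mulr_gt0.
have eta_le : eta <= (4 * lambda * b)^-1.
  rewrite etaE -[leRHS]mul1r; apply: ler_pM => //; first exact: ltW.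
    by rewrite invr_ge0 !mulr_ge0// ltW.
  rewrite lef_pV2 ?posrE ?mulr_gt0// ler_pM2l//.
  by apply: le_trans bb; rewrite ler_peMr// ltW.
have eta_small : eta <= eta0.
  apply: (le_trans eta_le); rewrite -[leRHS]invrK lef_pV2 ?posrE ?invr_gt0 ?mulr_gt0//.
  rewrite -ler_pdivrMl// mulrC.
  by apply: le_trans hb1; rewrite le_eqVlt; apply/orP; left; apply/eqP; field; rewrite !gt_eqF.
have eta1 : eta <= 1.
  apply: (le_trans eta_le); rewrite invf_le1 ?mulr_gt0//.
  by rewrite -ler_pdivrMl// mulr1.
have e8 : 0 < eps / 8 by rewrite divr_gt0.
have e81 : eps / 8 <= 1 by exact: eighth_le1.
have gE : gamma a b = b - eta by [].
have bE : b / a = eta^-1 by rewrite /eta [RHS]invf_div.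
have hM' : c0 * (eps / 8)^-1 * eta^-1 `^ (4 * d%:R / beta) <= M%:R.
  apply: le_trans hM; rewrite bE.
  have -> : c0 * (eps / 8)^-1 = 8 * c0 * eps^-1 by field; rewrite gt_eqF.
  apply: ler_wpM2l; first by rewrite !mulr_ge0 ?invr_ge0// ltW.
  by rewrite ler_powR// invf_ge1.
have low := hsc b eta (eps / 8) M eta_gt0 eta_small e8 e81 hM'.
have bad : C * expR (- (c / eta ^+ 2)) <= eps / 8 * w T f b.
  apply: (@le_trans _ _ (eps / 8 * (c' * expR (- (C' * b ^+ 2))))); last first.
    by rewrite ler_pM2l// hw.
  have ce : c / eta ^+ 2 = D * (b * b `^ rho) ^+ 2 / eps ^+ 2.
    by rewrite etaE /D; field; rewrite !gt_eqF.
  have D2 : 0 < D / 2 by rewrite divr_gt0.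
  have b2 : 1 <= b ^+ 2 by rewrite exprn_ege1.
  have b4 : b ^+ 4 <= (b * b `^ rho) ^+ 2.
    have -> : b ^+ 4 = (b * b) ^+ 2 by ring.
    by apply: lerXn2r => //; rewrite nnegrE mulr_ge0// ltW.
  have b41 : 1 <= b ^+ 4 by rewrite exprn_ege1.
  have ei : 1 <= eps ^- 2 by rewrite invf_ge1 ?exprn_gt0// exprn_ile1// ltW.
  (* The exponent is split into halves: one carries b^4 and beats [w], the other carries eps^-2 and
     yields the factor eps. *)
  have h1 : D / 2 * b ^+ 4 + D / 2 / eps ^+ 2 <= c / eta ^+ 2.
    rewrite ce.
    have s1 : b ^+ 4 <= (b * b `^ rho) ^+ 2 / eps ^+ 2.
      by apply: (le_trans b4); rewrite ler_peMr// sqr_ge0.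
    have s2 : eps ^- 2 <= (b * b `^ rho) ^+ 2 / eps ^+ 2.
      by rewrite ler_peMl ?invr_ge0 ?sqr_ge0// (le_trans b41).
    have t1 := ler_wpM2l (ltW D2) s1; have t2 := ler_wpM2l (ltW D2) s2.
    have -> : D * (b * b `^ rho) ^+ 2 / eps ^+ 2 =
      D / 2 * ((b * b `^ rho) ^+ 2 / eps ^+ 2) + D / 2 * ((b * b `^ rho) ^+ 2 / eps ^+ 2).
      by field; rewrite gt_eqF.
    exact: lerD.
  have h2 : expR (- (c / eta ^+ 2)) <= expR (- (D / 2 * b ^+ 4)) * expR (- (D / 2 / eps ^+ 2)).
    by rewrite -expRD ler_expR -opprD lerN2.
  have h3 : expR (- (D / 2 / eps ^+ 2)) <= 2 / D * eps.
    apply: (le_trans (expRN_le_inv _)); first by rewrite divr_gt0// exprn_gt0.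
    have -> : (D / 2 / eps ^+ 2)^-1 = 2 / D * (eps * eps) by field; rewrite !gt_eqF.
    by rewrite ler_pM2l ?divr_gt0// ler_piMr// ltW.
  (* Out of b^4 come C' b^2, which matches the lower bound on [w], and a spare b^2, whose
     exponential absorbs the constants. *)
  have h4 : expR (- (D / 2 * b ^+ 4)) <= expR (- (C' * b ^+ 2)) * (c' * D / (16 * C)).
    have h41 : b ^+ 2 + C' * b ^+ 2 <= D / 2 * b ^+ 4.
      have -> : D / 2 * b ^+ 4 = (D / 2 * (b * b)) * b ^+ 2 by ring.
      have -> : b ^+ 2 + C' * b ^+ 2 = (C' + 1) * b ^+ 2 by ring.
      rewrite ler_wpM2r ?sqr_ge0//.
      apply: (@le_trans _ _ (D / 2 * b)).
        by rewrite mulrAC ler_pdivlMr// mulrC (mulrC D) -ler_pdivrMr.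
      by rewrite ler_pM2l// ler_peMr// ltW.
    apply: (@le_trans _ _ (expR (- (C' * b ^+ 2)) * expR (- b ^+ 2))).
      by rewrite -expRD ler_expR -opprD lerN2 addrC.
    rewrite ler_pM2l ?expR_gt0//.
    apply: (le_trans (expRN_le_inv _)); first by rewrite exprn_gt0.
    rewrite -invf_div lef_pV2 ?posrE ?exprn_gt0 ?divr_gt0 ?mulr_gt0//.
    by apply: (le_trans hb3); rewrite expr2 ler_peMr// ltW.
  apply: (@le_trans _ _ (C * ((expR (- (C' * b ^+ 2)) * (c' * D / (16 * C))) * (2 / D * eps)))).
    rewrite ler_pM2l//; apply: (le_trans h2).
    by apply: ler_pM => //; rewrite expR_ge0.
  rewrite le_eqVlt; apply/orP; left; apply/eqP.
  by field; rewrite !gt_eqF.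
have M0 : (0 < M)%N.
  rewrite lt0n; apply/negP => /eqP M0; move: hM'; rewrite M0 leNgt.
  by rewrite !mulr_gt0 ?invr_gt0 ?powR_gt0 ?invr_gt0.
have up : wM T f M (gamma a b) <= w T f (gamma a b).
  exact: (wM_le T0 cT TN mG PG Gc mT Tn0 Tfin).
have w0 := w_ge0 b; have wg0 := w_ge0 (gamma a b).
have gp := gap a0 bb0.
have lab : lambda * a * b `^ rho = eps / 4 by rewrite /a; field; rewrite !gt_eqF.
rewrite lab -/(w T f (gamma a b)) -/(w T f b) in gp.
rewrite -gE in low.
have wg : w T f (gamma a b) <= (1 + eps / 2) * w T f b by exact: gap_upper gp.
have lo2 : (1 - eps / 4) * w T f b <= wM T f M (gamma a b).
  apply: le_trans low.
  apply: (@le_trans _ _ ((1 - eps / 8) * (w T f b - eps / 8 * w T f b))).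
    exact: gap_lower.
  by apply: ler_wpM2l; [rewrite subr_ge0|rewrite lerB].
by split; [exact: gap_both up wg lo2|exact: gap_double wg].
Qed.

End bias_rate.

(** * Output law and cost of programs *)

Section semantics_theory.
Context (R : realType) (d : nat) (T : set 'rV[R]_d).
Variables (mu : 'rV[R]_d -> R) (C : 'rV[R]_d -> 'rV[R]_d -> R).
Hypothesis mT : measurable T.
Hypotheses (Tn0 : lebesgue_rV T != 0%E) (Tfin : lebesgue_rV T \is a fin_num).
Local Notation U := (uniform_law mT Tn0 Tfin).
Local Notation E := (expect T mu C).
Local Notation cost := (cost T mu C).
Local Notation prog := (prog R d).
Local Open Scope ereal_scope.

Lemma expect_ge0 A (p : prog A) g : (forall a, 0 <= g a) -> 0 <= E p g.
Proof.
elim: p g => //=.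
- by move=> A0 B p IHp k IHk g g0; apply: IHp => a; exact: IHk.
- move=> A0 p IHp g g0; apply: mule_ge0.
    by apply: nneseries_ge0 => j _ _; apply: expe_ge0; apply: IHp => -[].
  by apply: IHp => -[a|] //.
- move=> g g0; have : 0 <= \int[U]_(u in T) g u by apply: integral_ge0 => x _.
  exact.
- by move=> g g0; apply: integral_ge0 => x _.
Qed.

Lemma cost_ge0 A (p : prog A) : 0 <= cost p.
Proof.
elim: p => //=.
- by move=> A0 B p IHp k IHk; apply: adde_ge0 => //; apply: expect_ge0 => a.
- move=> A0 p IHp; apply: mule_ge0 => //.
  by apply: nneseries_ge0 => j _ _; apply: expe_ge0; apply: expect_ge0 => -[].
Qed.

(** A deterministic program: its value is [a] whatever the test function. The cost is enclosed
    rather than given because branches may differ in cost. *)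
Definition returns A (p : prog A) (a : A) (lo hi : nat) : Prop :=
  (forall g, E p g = g a) /\ lo%:R%:E <= cost p <= hi%:R%:E.

Lemma returns_Ret A (a : A) : returns (Ret a) a 0 0.
Proof. by split => //=; rewrite lexx. Qed.

Lemma returns_Add x y : returns (Add x y) (x + y)%R 1 1.
Proof. by split => //=; rewrite lexx. Qed.
Lemma returns_Sub x y : returns (Defs.Sub x y) (x - y)%R 1 1.
Proof. by split => //=; rewrite lexx. Qed.
Lemma returns_Mul x y : returns (Mul x y) (x * y)%R 1 1.
Proof. by split => //=; rewrite lexx. Qed.
Lemma returns_Div x y : returns (Div x y) (x / y)%R 1 1.
Proof. by split => //=; rewrite lexx. Qed.
Lemma returns_Sqrt x : returns (Sqrt x) (Num.sqrt x) 1 1.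
Proof. by split => //=; rewrite lexx. Qed.
Lemma returns_Leq x y : returns (Leq x y) (x <= y)%R 1 1.
Proof. by split => //=; rewrite lexx. Qed.
Lemma returns_Phi x : returns (Phi x) (Phi_normal x) 1 1.
Proof. by split => //=; rewrite lexx. Qed.
Lemma returns_Mean t : returns (Mean t) (mu t) 1 1.
Proof. by split => //=; rewrite lexx. Qed.
Lemma returns_Cov s t : returns (Cov s t) (C s t) 1 1.
Proof. by split => //=; rewrite lexx. Qed.

Lemma returns_Bind A B (p : prog A) (k : A -> prog B) a b l h l' h' :
  returns p a l h -> returns (k a) b l' h' -> returns (Bind p k) b (l + l') (h + h').
Proof.
move=> [Ep /andP[lp hp]] [Ek /andP[lk hk]]; split => [g|] /=; first by rewrite Ep.
by rewrite Ep !natrD !EFinD !leeD.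
Qed.

Lemma returns_le A (p : prog A) a l h l' h' : returns p a l h ->
  (l' <= l)%N -> (h <= h')%N -> returns p a l' h'.
Proof.
move=> [Ep /andP[lp hp]] ll hh; split => //; apply/andP; split.
  by apply: le_trans lp; rewrite lee_fin ler_nat.
by apply: le_trans hp _; rewrite lee_fin ler_nat.
Qed.

Lemma returns_if A (b : bool) (p q : prog A) a l h :
  (b -> returns p a l h) -> (~~ b -> returns q a l h) -> returns (if b then p else q) a l h.
Proof. by case: b => h1 h2; [exact: h1|exact: h2]. Qed.

(** The states [st i] are prescribed in advance and the cost of a step may depend on its index, as
    it does for the growing rows of the Cholesky factor. *)
Lemma returns_foldP A S (k : A -> S -> prog S) (a0 : A) (l : seq A) (st : nat -> S)
    (lo hi : nat -> nat) :
  (forall i, (i < size l)%N -> returns (k (nth a0 l i) (st i)) (st i.+1) (lo i) (hi i)) ->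
  returns (foldP k (st 0%N) l) (st (size l))
    (\sum_(i < size l) lo i) (\sum_(i < size l) hi i).
Proof.
elim: l st lo hi => [|a l IH] st lo hi h /=; first by rewrite !big_ord0; exact: returns_Ret.
rewrite !big_ord_recl; apply: returns_Bind; first exact: (h 0%N).
apply: (IH (fun i => st i.+1) (fun i => lo i.+1) (fun i => hi i.+1)) => i il.
exact: (h i.+1).
Qed.

Lemma returns_mapP A B (k : A -> prog B) (F : A -> B) (l : seq A) (lo hi : nat) :
  (forall a, returns (k a) (F a) lo hi) ->
  returns (Defs.mapP k l) (map F l) (size l * lo) (size l * hi).
Proof.
move=> h; elim: l => [|a l IH] /=; first exact: returns_Ret.
rewrite !mulSn; apply: returns_Bind; first exact: h.
rewrite -[(size l * lo)%N]addn0 -[(size l * hi)%N]addn0.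
by apply: returns_Bind; [exact: IH|exact: returns_Ret].
Qed.

Lemma returns_foldl A S (k : A -> S -> prog S) (F : S -> A -> S) (l : seq A) (s : S) (lo hi : nat) :
  (forall a s, returns (k a s) (F s a) lo hi) ->
  returns (foldP k s l) (foldl F s l) (size l * lo) (size l * hi).
Proof.
move=> h; elim: l s => [|a l IH] s /=; first exact: returns_Ret.
by rewrite !mulSn; apply: returns_Bind; [exact: h|exact: IH].
Qed.

Definition dot (u v : seq R) : R := (\sum_(p <- zip u v) p.1 * p.2)%R.

Lemma foldl_sum A (F : A -> R) (l : seq A) (s : R) :
  foldl (fun s x => s + F x)%R s l = (s + \sum_(x <- l) F x)%R.
Proof.
elim: l s => [|a l IH] s /=; first by rewrite big_nil addr0.
by rewrite IH big_cons addrA.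
Qed.

Lemma returns_sumP l : returns (sumP l) (\sum_(x <- l) x)%R (size l) (size l).
Proof.
rewrite -[(\sum_(x <- l) x)%R]add0r -(foldl_sum id) -(muln1 (size l)).
by apply: returns_foldl => a s; exact: returns_Add.
Qed.

Lemma returns_dotP u v : returns (dotP u v) (dot u v) (minn (size u) (size v) * 2)
  (minn (size u) (size v) * 2).
Proof.
rewrite /dot -[(\sum_(x <- _) _)%R]add0r -(foldl_sum (fun p => p.1 * p.2)%R) -size_zip.
apply: returns_foldl => a s.
by apply: (returns_Bind (returns_Mul _ _)); exact: returns_Add.
Qed.

Lemma returns_upper_tail x : returns (upper_tail x) (1 - Phi_normal x)%R 3 3.
Proof.
apply: (returns_Bind (l' := 2) (h' := 2) (returns_Leq 0 x)).
apply: returns_if => x0.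
  by apply: (returns_Bind (returns_Phi _)); exact: returns_Sub.
apply: (returns_Bind (returns_Sub _ _)); rewrite sub0r -PhiN; exact: returns_Phi.
Qed.

(* Q holds for every value that p can return. *)
Definition bounded A (p : prog A) (Q : A -> Prop) (lo hi : R) : Prop :=
  [/\ forall g h, (forall a, 0 <= g a) -> (forall a, Q a -> g a <= h a) -> E p g <= E p h,
      forall c : R, (0 <= c)%R -> E p (fun=> c%:E) = c%:E &
      lo%:E <= cost p <= hi%:E].

Lemma returns_bounded A (p : prog A) a l h : returns p a l h ->
  bounded p (fun x => x = a) l%:R h%:R.
Proof. by move=> [Ep cp]; split => // g g' g0 gg'; rewrite !Ep; exact: gg'. Qed.

Lemma bounded_weaken A (p : prog A) (Q Q' : A -> Prop) lo hi lo' hi' :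
  bounded p Q lo hi -> (forall a, Q a -> Q' a) -> (lo' <= lo)%R -> (hi <= hi')%R ->
  bounded p Q' lo' hi'.
Proof.
move=> [mp cp /andP[h1 h2]] QQ ll hh; split => //.
  by move=> g h g0 gh; apply: mp => // a Qa; apply: gh; exact: QQ.
by apply/andP; split; [apply: le_trans h1|apply: (le_trans h2)]; rewrite lee_fin.
Qed.

Lemma bounded_Bind A B (p : prog A) (k : A -> prog B) Q Q' lo hi lo' hi' :
  (0 <= lo')%R ->
  bounded p Q lo hi -> (forall a, Q a -> bounded (k a) Q' lo' hi') ->
  bounded (Bind p k) Q' (lo + lo') (hi + hi').
Proof.
move=> lo0 [mp cp /andP[p1 p2]] hk.
have le01 (c : R) : (0 <= c)%R -> forall g : A -> \bar R, (forall a, 0 <= g a) ->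
    (forall a, Q a -> g a = c%:E) -> E p g = c%:E.
  move=> c0 g g0 gc; rewrite -(cp c c0); apply/eqP; rewrite eq_le; apply/andP; split.
    by apply: mp => // a Qa; rewrite gc.
  by apply: mp => [a|a Qa]; rewrite ?lee_fin// gc.
split => /=.
- move=> g h g0 gh; apply: mp => [a|a Qa]; first exact: expect_ge0.
  by have [mk _ _] := hk a Qa; exact: mk.
- move=> c c0; apply: le01 => // a; first by apply: expect_ge0 => x; rewrite lee_fin.
  by move=> Qa; have [_ ck _] := hk a Qa; exact: ck.
- apply/andP; split; rewrite EFinD; apply: leeD => //.
    rewrite -(cp lo' lo0); apply: mp => [a|a Qa]; first by rewrite lee_fin.
    by have [_ _ /andP[]] := hk a Qa.
  have [hi0|hi0] := leP 0%R hi'.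
    rewrite -(cp hi' hi0); apply: mp => [a|a Qa]; first exact: cost_ge0.
    by have [_ _ /andP[]] := hk a Qa.
  (* Costs are nonnegative, so a negative [hi'] would leave no value satisfying [Q], and [p] would
     have total mass 0 instead of 1. *)
  have nQ a : ~ Q a.
    move=> Qa; have [_ _ /andP[_ h]] := hk a Qa.
    by have := le_trans (cost_ge0 (k a)) h; rewrite lee_fin leNgt hi0.
  have := @mp (fun=> 1) (fun=> 0) (fun=> lee01) (fun a Qa => False_ind _ (nQ a Qa)).
  by rewrite (cp 1%R) ?ler01// (cp 0%R)// lee_fin ler10.
Qed.

Lemma bounded_mapP A B (k : A -> prog B) (Q : B -> Prop) (l : seq A) lo hi : (0 <= lo)%R ->
  (forall a, bounded (k a) Q lo hi) ->
  bounded (Defs.mapP k l) (fun bs => size bs = size l) ((size l)%:R * lo) ((size l)%:R * hi).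
Proof.
move=> lo0 hk; elim: l => [|a l IH] /=.
  rewrite !mul0r; apply: (bounded_weaken (returns_bounded (returns_Ret _))) => //.
  by move=> x ->.
rewrite -natr1 !mulrDl !mul1r addrC [X in bounded _ _ _ X]addrC.
apply: (bounded_Bind (Q := Q)) => //; first by rewrite mulr_ge0.
move=> b _; rewrite -[(_ * lo)%R]addr0 -[(_ * hi)%R]addr0.
apply: (bounded_Bind _ IH) => // bs sbs.
apply: (bounded_weaken (returns_bounded (returns_Ret _))) => //.
by move=> x -> /=; rewrite sbs.
Qed.

Lemma bounded_Uniform : bounded Defs.Uniform T 1 1.
Proof.
have UT : U T = 1 := uniform_lawT mT Tn0 Tfin.
have b : [/\ forall g h : 'rV[R]_d -> \bar R, (forall a, 0 <= g a) -> (forall a, T a -> g a <= h a) ->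
    \int[U]_(u in T) g u <= \int[U]_(u in T) h u,
   forall c : R, (0 <= c)%R -> \int[U]_(u in T) c%:E = c%:E &
   (1%R)%:E <= (1 : \bar R) <= (1%R)%:E].
  split; last by rewrite lexx.
    move=> g h g0 gh; rewrite [leLHS]integral_mkcond [leRHS]integral_mkcond.
    apply: ge0_le_integral_nonmeas => x _; rewrite !patchE; case: ifPn => //.
    by rewrite inE; exact: gh.
  by move=> c c0; rewrite integral_cst//= UT mule1.
exact: b.
Qed.

Lemma bounded_Gauss : bounded Gauss (fun=> True) 1 1.
Proof.
split => /=; last by rewrite lexx.
  by move=> g h g0 gh; apply: ge0_le_integral_nonmeas => x _ //; exact: gh.
move=> c c0; rewrite integral_cst//.
by rewrite [X in _ * X](probability_setT (@std_normal R)) mule1.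
Qed.

End semantics_theory.

(** * The Cholesky factorization *)

Section gram.
Context (R : rcfType).
Variables (C L : nat -> nat -> R) (n : nat).
Hypothesis L_lower : forall i k, (i < k)%N -> L i k = 0.
Hypothesis L_pivot : forall k i, (k <= i)%N -> (i < n)%N -> L k k = 0 -> L i k = 0.
Hypothesis gramE : forall i j, (i < n)%N -> (j < n)%N ->
  \sum_(k < n) L i k * L j k = C i j.
Hypothesis C_sym : forall i j, C i j = C j i.
Hypothesis C_psd : forall a : nat -> R,
  0 <= \sum_(i < n.+1) \sum_(j < n.+1) a i * a j * C i j.

(** Back substitution from the last unknown. At a zero pivot the whole column vanishes by [L_pivot]
    and [L_lower], so the equation is solvable exactly when the right-hand side vanishes there. *)
Lemma lower_solve m (y : nat -> R) : (m <= n)%N ->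
  (forall k, (k < m)%N -> L k k = 0 -> y k = 0) ->
  exists a : nat -> R, forall k, (k < m)%N -> \sum_(i < m) a i * L i k = y k.
Proof.
elim: m y => [|m IH] y mn hy; first by exists (fun=> 0).
pose am := if L m m == 0 then 0 else y m / L m m.
have [a ha] : exists a : nat -> R, forall k, (k < m)%N ->
    \sum_(i < m) a i * L i k = y k - am * L m k.
  apply: IH; first exact: ltnW.
  move=> k km Lkk; rewrite hy ?(ltnW km)// ?ltnS ?(ltnW km)// (L_pivot (ltnW km))// ?mulr0 ?subr0//.
exists (fun i => if i == m then am else a i) => k km.
rewrite big_ord_recr /= eqxx.
rewrite (eq_bigr (fun i : 'I_m => a i * L i k)); last first.
  by move=> i _; rewrite ltn_eqF.
move: km; rewrite ltnS leq_eqVlt => /orP[/eqP ->|km]; last by rewrite ha// subrK.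
rewrite big1; last by move=> i _; rewrite L_lower ?mulr0.
rewrite add0r /am; case: eqP => [Lm|/eqP Lm]; last by rewrite mulfVK.
by rewrite mul0r hy.
Qed.

Lemma gram_form (a : nat -> R) : \sum_(i < n) \sum_(j < n) a i * a j * C i j =
  \sum_(k < n) (\sum_(i < n) a i * L i k) ^+ 2.
Proof.
under [RHS]eq_bigr do rewrite expr2 mulr_suml.
rewrite [RHS]exchange_big /=; apply: eq_bigr => i _.
under [RHS]eq_bigr do rewrite mulr_sumr.
rewrite [RHS]exchange_big /=; apply: eq_bigr => j _.
rewrite -gramE// mulr_sumr; apply: eq_bigr => k _; ring.
Qed.

(** The quadratic form at the vector (t a, 1), its leading block rewritten through the factor. *)
Lemma psd_extend (a : nat -> R) (t : R) :
  0 <= t ^+ 2 * \sum_(k < n) (\sum_(i < n) a i * L i k) ^+ 2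
       + 2 * t * \sum_(i < n) a i * C n i + C n n.
Proof.
have := C_psd (fun i => if i == n then 1 else t * a i).
rewrite big_ord_recr /= eqxx.
under eq_bigr => i _ do rewrite big_ord_recr /= eqxx ltn_eqF//.
rewrite big_split /= big_ord_recr /= eqxx mulr1 mul1r.
rewrite -gram_form.
have -> : \sum_(i < n) \sum_(j < n) t * a i * (if (j == n :> nat) then 1 else t * a j) * C i j =
  t ^+ 2 * \sum_(i < n) \sum_(j < n) a i * a j * C i j.
  rewrite mulr_sumr; apply: eq_bigr => i _; rewrite mulr_sumr; apply: eq_bigr => j _.
  by rewrite ltn_eqF//; ring.
have -> : \sum_(i < n) t * a i * 1 * C i n = t * \sum_(i < n) a i * C n i.
  by rewrite mulr_sumr; apply: eq_bigr => i _; rewrite C_sym; ring.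
have -> : \sum_(i < n) 1 * (if (i == n :> nat) then 1 else t * a i) * C n i = t * \sum_(i < n) a i * C n i.
  by rewrite mulr_sumr; apply: eq_bigr => i _; rewrite ltn_eqF//; ring.
by move=> h; apply: le_trans h _; rewrite le_eqVlt; apply/orP; left; apply/eqP; ring.
Qed.

(** For such [a] the form at (t a, 1) is affine in t and nonnegative for all t, so its slope
    vanishes. *)
Lemma psd_kernel (a : nat -> R) : (forall k, (k < n)%N -> \sum_(i < n) a i * L i k = 0) ->
  \sum_(i < n) a i * C n i = 0.
Proof.
move=> h; set S := \sum_(i < n) _; apply/eqP/negPn/negP => S0.
(* If the slope were nonzero, this t would give the form the value -1. *)
have := psd_extend a (- (C n n + 1) / (2 * S)).
rewrite big1; last by move=> k _; rewrite h// expr0n.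
rewrite mulr0 add0r -/S.
have -> : 2 * (- (C n n + 1) / (2 * S)) * S + C n n = -1 by field.
by rewrite leNgt ltrN10.
Qed.

Variable l : nat -> R.
Hypothesis l_pivot : forall j, (j < n)%N -> L j j = 0 -> l j = 0.
Hypothesis l_entry : forall j, (j < n)%N -> L j j != 0 ->
  l j = (C n j - \sum_(k < j) l k * L j k) / L j j.

Lemma row_sum j : (j < n)%N ->
  \sum_(k < n) l k * L j k = \sum_(k < j) l k * L j k + l j * L j j.
Proof.
move=> jn; rewrite (big_ord_widen n (fun k => l k * L j k) (ltnW jn)).
rewrite (bigID (fun k : 'I_n => (k < j)%N)) /=; congr (_ + _).
rewrite (bigD1 (Ordinal jn)) ?ltnn//= big1 ?addr0// => k /andP[kj nkj].
by rewrite L_lower ?mulr0// ltn_neqAle leqNgt kj andbT eq_sym.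
Qed.

(** At a nonzero pivot this is the defining equation of [l j]. At a zero pivot, row j of the factor
    is a combination of earlier rows; the corresponding vector lies in the kernel, and [psd_kernel]
    carries the same linear relation over to row n of the matrix, where induction applies. *)
Lemma new_row j : (j < n)%N -> \sum_(k < n) l k * L j k = C n j.
Proof.
elim/ltn_ind: j => j IH jn.
have [Lj|Lj] := eqVneq (L j j) 0; last first.
  by rewrite row_sum// l_entry// mulfVK// addrC subrK.
have [a ha] : exists a : nat -> R, forall k, (k < j)%N -> \sum_(i < j) a i * L i k = - L j k.
  apply: (lower_solve (y := fun k => - L j k)); first exact: ltnW.
  by move=> k kj Lk; rewrite (L_pivot (ltnW kj))// oppr0.
have hk k : \sum_(i < j) a i * L i k = - L j k.
  have [kj|jk] := ltnP k j; first exact: ha.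
  have -> : L j k = 0 by move: jk; rewrite leq_eqVlt => /orP[/eqP <-//|]; exact: L_lower.
  rewrite oppr0 big1// => i _; rewrite L_lower ?mulr0//; exact: leq_trans jk.
pose b i : R := if (i < j)%N then a i else if i == j then 1 else 0.
have bsum (F : nat -> R) : \sum_(i < n) b i * F i = \sum_(i < j) a i * F i + F j.
  rewrite (big_ord_widen n (fun i => a i * F i) (ltnW jn)).
  rewrite (bigID (fun k : 'I_n => (k < j)%N)) /=; congr (_ + _).
    by apply: eq_bigr => i ij; rewrite /b ij.
  rewrite (bigD1 (Ordinal jn)) ?ltnn//= big1 ?addr0.
    by rewrite /b ltnn eqxx mul1r.
  move=> i /andP[/negPf ij nij]; rewrite /b ij.
  by move: nij; rewrite -val_eqE /= => /negPf ->; rewrite mul0r.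
have := psd_kernel (a := b) _.
rewrite bsum => h.
have {}h : \sum_(i < j) a i * C n i + C n j = 0.
  by apply: h => k kn; rewrite (bsum (fun i => L i k)) hk addNr.
have e : \sum_(i < j) a i * C n i = - \sum_(k < n) l k * L j k.
  rewrite (eq_bigr (fun i : 'I_j => \sum_(k < n) l k * (a i * L i k))); last first.
    move=> i _; rewrite -IH//; last exact: ltn_trans jn.
    by rewrite mulr_sumr; apply: eq_bigr => k _; ring.
  rewrite exchange_big /= -sumrN; apply: eq_bigr => k _.
  by rewrite -mulr_sumr hk mulrN.
by apply/eqP; rewrite eq_sym -subr_eq0 addrC -e h.
Qed.

(** At the vector (a, 1), where [a] solves the transposed system with right-hand side - l, the form
    equals C n n - sum l_k^2, the Schur complement whose square root is the new pivot. *)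
Lemma new_pivot_ge0 : \sum_(k < n) l k ^+ 2 <= C n n.
Proof.
have [a ha] : exists a : nat -> R, forall k, (k < n)%N -> \sum_(i < n) a i * L i k = - l k.
  apply: (lower_solve (y := fun k => - l k)) => //.
  by move=> k kn Lk; rewrite l_pivot// oppr0.
have := psd_extend a 1.
rewrite expr1n mul1r mulr1.
rewrite (eq_bigr (fun k : 'I_n => l k ^+ 2)); last by move=> k _; rewrite ha// sqrrN.
have -> : \sum_(i < n) a i * C n i = - \sum_(k < n) l k ^+ 2.
  rewrite (eq_bigr (fun i : 'I_n => \sum_(k < n) l k * (a i * L i k))); last first.
    move=> i _; rewrite -new_row// mulr_sumr; apply: eq_bigr => k _; ring.
  rewrite exchange_big /= -sumrN; apply: eq_bigr => k _.
  by rewrite -mulr_sumr ha// mulrN expr2.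
move: (\sum_(k < n) _) => s; lra.
Qed.

End gram.

(** * The factor computed by the program *)

Section cholesky_program.
Context (R : realType).
Implicit Types (c row u v : seq R) (Ls : seq (seq R)).

Lemma dotE u v n : (size u <= n)%N -> dot u v = \sum_(k < n) u`_k * v`_k.
Proof.
rewrite /dot; elim: u v n => [|x u IH] v n.
  by case: v => [|y v] _; rewrite big_nil big1// => k _; rewrite nth_nil mul0r.
case: v => [|y v]; first by rewrite big_nil big1// => k _; rewrite nth_nil mulr0.
case: n => [//|n] un; rewrite /= big_cons big_ord_recl /=; congr (_ + _).
exact: IH.
Qed.

(** An appended entry depends on the entries before it only, and these are still the prefix [take j]
    of the final result. *)
Lemma foldl_rcons_nth (A B : Type) (b0 : B) (F : A -> seq B -> B) (a0 : A) (s : seq A) :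
  let r := foldl (fun (r : seq B) p => rcons r (F p r)) [::] s in
  size r = size s /\ forall j, (j < size s)%N -> nth b0 r j = F (nth a0 s j) (take j r).
Proof.
elim/last_ind: s => [|s a [IHs IHn]] /=; first by split.
rewrite !foldl_rcons size_rcons; set r := foldl _ _ s in IHs IHn *.
split; first by rewrite size_rcons IHs.
move=> j; rewrite size_rcons ltnS leq_eqVlt => /orP[/eqP ->|js].
  by rewrite !nth_rcons IHs !ltnn !eqxx -IHs -cats1 take_size_cat.
rewrite !nth_rcons IHs js IHn// -cats1 takel_cat// IHs; exact: ltnW.
Qed.

(** [p] pairs an entry of the matrix row with a previous row of the factor, whose last element is
    its pivot. Pivots are square roots, so [<= 0] means zero. *)
Definition chol_entry (p : R * seq R) row : R :=
  if last 0 p.2 <= 0 then 0 else (p.1 - dot row p.2) / last 0 p.2.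

Definition chol_partial c Ls :=
  foldl (fun row p => rcons row (chol_entry p row)) [::] (zip c Ls).

Definition chol_row c Ls :=
  rcons (chol_partial c Ls) (Num.sqrt (c`_(size Ls) - dot (chol_partial c Ls) (chol_partial c Ls))).

Definition chol (Cs : seq (seq R)) :=
  foldl (fun Ls c => rcons Ls (chol_row c Ls)) [::] Cs.

Definition mat_entry (A : seq (seq R)) (i j : nat) : R := (nth [::] A i)`_j.

Lemma size_chol_partial c Ls : size (chol_partial c Ls) = minn (size c) (size Ls).
Proof.
have [h _] := foldl_rcons_nth 0 chol_entry (0, [::]) (zip c Ls).
by rewrite /chol_partial h size_zip.
Qed.

(** The invariant of the factorization. The clause on zero pivots, whose columns vanish below them,
    is what lets the recursion proceed for singular covariance matrices, for instance when points
    coincide. *)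
Definition is_chol (C : nat -> nat -> R) Ls n : Prop :=
  [/\ size Ls = n,
      forall i, (i < n)%N -> size (nth [::] Ls i) = i.+1 /\ 0 <= mat_entry Ls i i,
      forall k i, (k <= i)%N -> (i < n)%N -> mat_entry Ls k k = 0 -> mat_entry Ls i k = 0 &
      forall i j, (i < n)%N -> (j < n)%N ->
        \sum_(k < n) mat_entry Ls i k * mat_entry Ls j k = C i j].

Lemma is_chol_rcons (C : nat -> nat -> R) Ls n c : is_chol C Ls n ->
  (forall i j, C i j = C j i) ->
  (forall a : nat -> R, 0 <= \sum_(i < n.+1) \sum_(j < n.+1) a i * a j * C i j) ->
  (n < size c)%N -> (forall j, (j <= n)%N -> c`_j = C n j) ->
  is_chol C (rcons Ls (chol_row c Ls)) n.+1.
Proof.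
move=> [sL rL pL gL] symC psdC nc cE.
pose L i k := if (i < n)%N then mat_entry Ls i k else 0.
have LE i k : (i < n)%N -> L i k = mat_entry Ls i k by rewrite /L => ->.
have L_lower i k : (i < k)%N -> L i k = 0.
  rewrite /L; case: ifP => // in_ ik; rewrite /mat_entry nth_default//.
  by have [-> _] := rL i in_.
have L_pivot k i : (k <= i)%N -> (i < n)%N -> L k k = 0 -> L i k = 0.
  move=> ki in_; have kn := leq_ltn_trans ki in_.
  by rewrite !LE//; exact: pL.
have gramE i j : (i < n)%N -> (j < n)%N -> \sum_(k < n) L i k * L j k = C i j.
  by move=> in_ jn; rewrite -gL//; apply: eq_bigr => k _; rewrite !LE.
pose row := chol_partial c Ls.
have srow : size row = n by rewrite size_chol_partial sL; apply/minn_idPr; exact: ltnW.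
pose l k := row`_k.
have lE j : (j < n)%N -> l j = chol_entry (C n j, nth [::] Ls j) (take j row).
  move=> jn; have [_ h] := foldl_rcons_nth 0 chol_entry (0, [::]) (zip c Ls).
  rewrite /l /row /chol_partial h; last first.
    by rewrite size_zip sL (minn_idPr (ltnW nc)).
  rewrite nth_zip_cond size_zip sL (minn_idPr (ltnW nc)) jn.
  by rewrite cE// ltnW.
have lastE j : (j < n)%N -> last 0 (nth [::] Ls j) = L j j.
  move=> jn; have [s _] := rL j jn.
  by rewrite (last_nth 0) LE// /mat_entry; case: (nth [::] Ls j) s => //= x s [->].
have L_ge0 j : (j < n)%N -> 0 <= L j j by move=> jn; rewrite LE//; have [] := rL j jn.
have l_pivot j : (j < n)%N -> L j j = 0 -> l j = 0.
  by move=> jn Lj; rewrite lE// /chol_entry/= lastE// Lj lexx.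
have l_entry j : (j < n)%N -> L j j != 0 -> l j = (C n j - \sum_(k < j) l k * L j k) / L j j.
  move=> jn Lj; rewrite lE// /chol_entry/= lastE//.
  rewrite leNgt lt_neqAle eq_sym Lj L_ge0//=.
  congr ((_ - _) / _).
  rewrite (@dotE _ _ j); last by rewrite size_take srow jn.
  by apply: eq_bigr => k _; rewrite nth_take// LE.
have nrow := new_row L_lower L_pivot gramE symC psdC l_entry.
have npiv := new_pivot_ge0 L_lower L_pivot gramE symC psdC l_pivot l_entry.
have rr : dot row row = \sum_(k < n) l k ^+ 2.
  by rewrite (@dotE _ _ n) ?srow//; apply: eq_bigr => k _; rewrite expr2.
set v := Num.sqrt (C n n - dot row row).
have vE : v ^+ 2 = C n n - \sum_(k < n) l k ^+ 2.
  by rewrite /v rr sqr_sqrtr// subr_ge0.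
have crE : chol_row c Ls = rcons row v by rewrite /chol_row -/row sL cE.
have M1 i k : (i < n)%N -> mat_entry (rcons Ls (chol_row c Ls)) i k = L i k.
  by move=> in_; rewrite /mat_entry nth_rcons sL in_ LE.
have M2 k : (k < n)%N -> mat_entry (rcons Ls (chol_row c Ls)) n k = l k.
  by move=> kn; rewrite /mat_entry nth_rcons sL ltnn eqxx crE nth_rcons srow kn.
have M3 : mat_entry (rcons Ls (chol_row c Ls)) n n = v.
  by rewrite /mat_entry nth_rcons sL ltnn eqxx crE nth_rcons srow ltnn eqxx.
have split_le k : (k < n.+1)%N -> k = n \/ (k < n)%N.
  by rewrite ltnS leq_eqVlt => /orP[/eqP|]; [left|right].
split.
- by rewrite size_rcons sL.
- move=> i; rewrite ltnS leq_eqVlt => /orP[/eqP ->|in_].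
    split; last by rewrite M3 sqrtr_ge0.
    by rewrite nth_rcons sL ltnn eqxx crE size_rcons srow.
  split; last by rewrite M1// L_ge0.
  by rewrite nth_rcons sL in_; have [] := rL i in_.
- move: (mat_entry _) M1 M2 M3 => Mx M1 M2 M3 k i ki iL.
  have [iE|in_] := split_le i iL; last first.
    by rewrite !M1//; [exact: L_pivot|exact: leq_ltn_trans in_].
  move: ki; rewrite iE leq_eqVlt => /orP[/eqP ->//|kn].
  by rewrite M1// M2//; exact: l_pivot.
- move: (mat_entry _) M1 M2 M3 => Mx M1 M2 M3 i j iL jL; rewrite big_ord_recr /=.
  have Ln i' : (i' < n)%N -> Mx i' n = 0 by move=> in_; rewrite M1// L_lower.
  have [->|in_] := split_le i iL; have [->|jn] := split_le j jL.
  + have -> : \sum_(k < n) Mx n k * Mx n k = \sum_(k < n) l k ^+ 2.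
      by apply: eq_bigr => k _; rewrite M2// expr2.
    by rewrite M3 -expr2 vE addrC subrK.
  + rewrite (Ln j)// mulr0 addr0 -nrow//; apply: eq_bigr => k _.
    by rewrite M2// M1.
  + rewrite (Ln i)// mul0r addr0 symC -nrow//; apply: eq_bigr => k _.
    by rewrite M2// M1// mulrC.
  + rewrite (Ln i)// mul0r addr0 -gramE//; apply: eq_bigr => k _.
    by rewrite !M1.
Qed.

Lemma psd_restrict (C : nat -> nat -> R) (m n : nat) (a : nat -> R) : (m <= n)%N ->
  (forall a : nat -> R, 0 <= \sum_(i < n) \sum_(j < n) a i * a j * C i j) ->
  0 <= \sum_(i < m) \sum_(j < m) a i * a j * C i j.
Proof.
move=> mn h; have := h (fun i => if (i < m)%N then a i else 0).
move/le_trans; apply; rewrite le_eqVlt; apply/orP; left; apply/eqP.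
rewrite [RHS](big_ord_widen n (fun i => \sum_(j < m) a i * a j * C i j) mn).
rewrite [RHS]big_mkcond /=; apply: eq_bigr => i _; case: ifP => im; last first.
  by rewrite big1// => j _; rewrite !mul0r.
rewrite [RHS](big_ord_widen n (fun j => a i * a j * C i j) mn).
rewrite [RHS]big_mkcond /=; apply: eq_bigr => j _; case: ifP => jm //.
by rewrite mulr0 mul0r.
Qed.

Lemma cholP (Cs : seq (seq R)) (C : nat -> nat -> R) :
  (forall i j, C i j = C j i) ->
  (forall a : nat -> R, 0 <= \sum_(i < size Cs) \sum_(j < size Cs) a i * a j * C i j) ->
  (forall i, (i < size Cs)%N -> size (nth [::] Cs i) = size Cs) ->
  (forall i j, (i < size Cs)%N -> (j < size Cs)%N -> mat_entry Cs i j = C i j) ->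
  forall n, (n <= size Cs)%N -> is_chol C (chol (take n Cs)) n.
Proof.
move=> symC psdC sC CE; elim=> [|n IH] nC.
  by rewrite take0; split => // [i|k i|i j]; rewrite ?ltn0// ltn0.
rewrite (take_nth [::])// /chol foldl_rcons -/(chol _).
apply: is_chol_rcons => //.
- by apply: IH; exact: ltnW.
- by move=> a; exact: psd_restrict nC psdC.
- by rewrite sC.
- by move=> j jn; apply: CE => //; exact: leq_ltn_trans nC.
Qed.

End cholesky_program.

(** * Cost of the factorization *)

Section cholesky_cost.
Context (R : realType) (d : nat) (T : set 'rV[R]_d).
Variables (mu : 'rV[R]_d -> R) (C : 'rV[R]_d -> 'rV[R]_d -> R).
Local Notation returns := (returns T mu C).

Lemma returns_chol_row (c : seq R) (Ls : seq (seq R)) : (size Ls <= size c)%N ->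
  (forall j, (j < size Ls)%N -> size (nth [::] Ls j) = j.+1) ->
  returns (cholesky_row c Ls) (chol_row c Ls)
    ((size Ls).+1 * (size Ls).+2) (size Ls * size Ls + 4 * size Ls + 2).
Proof.
move=> sLc sL; set n := size Ls.
have sz : size (zip c Ls) = n by rewrite size_zip; apply/minn_idPr.
pose st j := foldl (fun row p => rcons row (chol_entry p row)) [::] (take j (zip c Ls)).
have stn : st n = chol_partial c Ls by rewrite /st -sz take_size.
have ss j : (j <= n)%N -> size (st j) = j.
  move=> jn; have [h _] := foldl_rcons_nth 0 (@chol_entry R) (0, [::]) (take j (zip c Ls)).
  by rewrite /st h size_take sz; case: ltngtP jn.
apply: (@returns_le _ _ _ _ _ _ _ _ (\sum_(j < n) (j * 2 + 2) + (n * 2 + 2))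
   (\sum_(j < n) (j * 2 + 3) + (n * 2 + 2))); first last.
- have -> : (\sum_(j < n) (j * 2 + 3) = n * n + 2 * n)%N.
    by elim: (n) => [|m IH]; [rewrite big_ord0|rewrite big_ord_recr/= IH; lia].
  by lia.
- have -> : (\sum_(j < n) (j * 2 + 2) = n * n + n)%N.
    by elim: (n) => [|m IH]; [rewrite big_ord0|rewrite big_ord_recr/= IH; lia].
  by nia.
apply: (returns_Bind (a := chol_partial c Ls)).
  have st0 : st 0%N = [::] by rewrite /st take0.
  rewrite -stn -sz -st0.
  apply: (@returns_foldP R d T mu C _ _ _ (0, [::]) _ st (fun j => j * 2 + 2)%N (fun j => j * 2 + 3)%N) => i; rewrite sz => iN.
  have siE : size (nth (0, [::]) (zip c Ls) i).2 = i.+1.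
    by rewrite nth_zip_cond sz iN /= sL.
  have -> : st i.+1 = rcons (st i) (chol_entry (nth (0, [::]) (zip c Ls) i) (st i)).
    by rewrite /st (take_nth (0, [::])) ?sz// -cats1 foldl_cat.
  have sdot := returns_dotP T mu C (st i) (nth (0, [::]) (zip c Ls) i).2.
  rewrite siE ss ?(ltnW iN)// (minn_idPl (leqnSn i)) in sdot.
  have -> : (i * 2 + 2 = i * 2 + (1 + (1 + (0 + 0))))%N by [].
  have -> : (i * 2 + 3 = i * 2 + (1 + (1 + (1 + 0))))%N by [].
  apply: (returns_Bind sdot); apply: (returns_Bind (returns_Sub _ _ _ _ _)).
  apply: (returns_Bind (returns_Leq _ _ _ _ _)).
  apply: (returns_Bind _ (returns_Ret _ _ _ _)).
  rewrite /chol_entry; case: ifP => _; last exact: returns_le (returns_Div _ _ _ _ _) _ _.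
  exact: returns_le (returns_Ret _ _ _ _) _ _.
have sdot := returns_dotP T mu C (chol_partial c Ls) (chol_partial c Ls).
rewrite size_chol_partial (minn_idPr sLc) minnn -/n in sdot.
apply: (returns_Bind sdot).
apply: (returns_Bind (l' := 1) (h' := 1) (returns_Sub _ _ _ _ _)).
apply: (returns_Bind (l' := 0) (h' := 0) (returns_Sqrt _ _ _ _)).
exact: returns_Ret.
Qed.

Lemma chol_sizes (Cs : seq (seq R)) n : (n <= size Cs)%N ->
  (forall i, (i < size Cs)%N -> size (nth [::] Cs i) = size Cs) ->
  size (chol (take n Cs)) = n /\
  forall i, (i < n)%N -> size (nth [::] (chol (take n Cs)) i) = i.+1.
Proof.
move=> nC sC; elim: n nC => [|n IH] nC; first by rewrite take0.
have [s1 s2] := IH (ltnW nC).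
rewrite (take_nth [::])// /chol foldl_rcons -/(chol _) size_rcons s1.
split => // i; rewrite ltnS nth_rcons s1 leq_eqVlt => /orP[/eqP ->|in_].
  rewrite ltnn eqxx size_rcons size_chol_partial s1 sC//.
  by rewrite (minn_idPr (ltnW nC)).
by rewrite in_ s2.
Qed.

Lemma returns_cholesky (Cs : seq (seq R)) :
  (forall i, (i < size Cs)%N -> size (nth [::] Cs i) = size Cs) ->
  returns (cholesky Cs) (chol Cs)
    (\sum_(i < size Cs) i.+1 * i.+2) (7 * size Cs ^ 3).
Proof.
move=> sC; set M := size Cs.
apply: (@returns_le _ _ _ _ _ _ _ _ (\sum_(i < M) i.+1 * i.+2) (\sum_(i < M) (i * i + 4 * i + 2))) => //; last first.
  apply: (@leq_trans (\sum_(i < M) 7 * M ^ 2)); last first.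
    by rewrite sum_nat_const card_ord !expnS expn0; nia.
  apply: leq_sum => i _; have := ltn_ord i; rewrite !expnS expn0; nia.
rewrite -[in chol Cs](take_size Cs) -/M.
have c0 : chol (take 0 Cs) = [::] by rewrite take0.
rewrite /cholesky -[in foldP _ _ _]c0.
apply: (@returns_foldP R d T mu C _ _ _ [::] Cs (fun i => chol (take i Cs))
  (fun i => i.+1 * i.+2)%N (fun i => i * i + 4 * i + 2)%N) => i iM.
have [s1 s2] := chol_sizes (ltnW iM) sC.
rewrite (take_nth [::])// [chol (rcons _ _)]foldl_rcons -/(chol _).
rewrite -[(i.+1 * i.+2)%N]addn0 -[(i * i + 4 * i + 2)%N]addn0.
apply: (returns_Bind _ (returns_Ret _ _ _ _)).
rewrite -{3 4 5 6 7}s1.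
have := @returns_chol_row (nth [::] Cs i) (chol (take i Cs)); rewrite s1.
by apply; rewrite ?sC// ltnW.
Qed.

(** Three times the sum is M (M + 1) (M + 2). *)
Lemma cholesky_cost_lower M : (M ^ 3 <= 3 * \sum_(i < M) i.+1 * i.+2)%N.
Proof.
have -> : (3 * \sum_(i < M) i.+1 * i.+2 = M * M.+1 * M.+2)%N.
  elim: M => [|M IH]; first by rewrite big_ord0.
  by rewrite big_ord_recr/= mulnDr IH; nia.
by rewrite !expnS expn0; nia.
Qed.

End cholesky_cost.

(** * Repetition, uniform variables and random indices *)

Section sampling.
Context (R : realType) (d : nat) (T : set 'rV[R]_d).
Variables (mu : 'rV[R]_d -> R) (C : 'rV[R]_d -> 'rV[R]_d -> R).
Hypothesis mT : measurable T.
Hypotheses (Tn0 : lebesgue_rV T != 0%E) (Tfin : lebesgue_rV T \is a fin_num).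
Local Notation U := (uniform_law mT Tn0 Tfin).
Local Notation E := (expect T mu C).
Local Notation cost := (cost T mu C).
Local Notation returns := (returns T mu C).
Local Notation bounded := (bounded T mu C).
Local Notation prog := (prog R d).
Local Notation gs := (@std_normal R).
Local Notation phi := (@std_pdf R).
Local Notation Phi := (@Phi_normal R).
Local Notation leb := (@lebesgue_measure R).
Local Open Scope ereal_scope.

Lemma expect_mono A (p : prog A) g h : (forall a, 0 <= g a) -> (forall a, g a <= h a) ->
  E p g <= E p h.
Proof.
have E0 := @expect_ge0 R d T mu C mT Tn0 Tfin.
elim: p g h => //=.
- by move=> A0 B p IHp k IHk g h g0 gh; apply: IHp => a; [exact: E0|exact: IHk].
- move=> A0 p IHp g h g0 gh; apply: lee_wpmul2l.
    by apply: nneseries_ge0 => j _ _; apply: expe_ge0; apply: E0 => -[].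
  by apply: IHp => -[a|] //.
- move=> g h g0 gh.
  have : \int[U]_(u in T) g u <= \int[U]_(u in T) h u.
    rewrite [leLHS]integral_mkcond [leRHS]integral_mkcond.
    by apply: ge0_le_integral_nonmeas => x _; rewrite !patchE; case: ifPn.
  exact.
- by move=> g h g0 gh; apply: ge0_le_integral_nonmeas => x _.
Qed.

Lemma geometric_eseries (q : R) : (0 <= q)%R -> (q < 1)%R ->
  \sum_(0 <= j <oo) q%:E ^+ j = ((1 - q)^-1)%:E.
Proof.
move=> q0 q1.
have h : series (geometric 1 q) @ \oo --> (1 / (1 - q))%R.
  by apply: cvg_geometric_series; rewrite ger0_norm.
rewrite div1r in h.
apply/cvg_lim => //.
rewrite (_ : (fun n => _) = EFin \o series (geometric 1 q)).
  by apply: cvg_EFin => //; near=> n.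
apply/funext => n /=; rewrite /series/= -sumEFin; apply: eq_bigr => i _.
by rewrite mul1r EFin_expe.
Unshelve. all: by end_near. Qed.

(** The failures before the first success form a geometric series with ratio q < 1. *)
Lemma expect_Repeat A (p : prog (option A)) (q : R) g : (0 <= q)%R -> (q < 1)%R ->
  E p (fun o => if o is None then 1 else 0) = q%:E ->
  E (Repeat p) g = ((1 - q)^-1)%:E * E p (fun o => if o is Some a then g a else 0).
Proof. by move=> q0 q1 Eq; rewrite /= Eq geometric_eseries. Qed.

Lemma cost_Repeat A (p : prog (option A)) (q : R) : (0 <= q)%R -> (q < 1)%R ->
  E p (fun o => if o is None then 1 else 0) = q%:E ->
  cost (Repeat p) = ((1 - q)^-1)%:E * cost p.
Proof. by move=> q0 q1 Eq; rewrite /= Eq geometric_eseries. Qed.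

Lemma expect_unit_uniform g :
  E unit_uniform g = \int[gs]_z g (2 * Phi `|z| - 1)%R.
Proof.
rewrite /unit_uniform/=; apply: eq_integral => z _.
case: ifPn => [z0|]; first by rewrite /= ger0_norm// mulr2n mulrDl mul1r.
rewrite -ltNge => z0 /=.
by rewrite sub0r ltr0_norm// mulr2n mulrDl mul1r.
Qed.

Lemma bounded_unit_uniform : bounded unit_uniform (fun=> True) 0 6.
Proof.
suff h : bounded unit_uniform (fun=> True) (1 + 4)%R (1 + 5)%R by apply: (bounded_weaken h) => //; lra.
apply: (bounded_Bind mT Tn0 Tfin _ (bounded_Gauss _ _ _)); first by lra.
move=> z _; pose y := if (0 <= z)%R then z else (0 - z)%R.
apply: (bounded_weaken (returns_bounded (a := (Phi y + Phi y - 1)%R) (l := 4) (h := 5) _)) => //.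
apply: (returns_Bind (l' := 3) (h' := 4) (returns_Leq _ _ _ _ _)).
apply: (returns_Bind (a := y) (l := 0) (h := 1) (l' := 3) (h' := 3)).
  rewrite /y; case: ifP => _; last exact: returns_le (returns_Sub _ _ _ _ _) _ _.
  exact: returns_le (returns_Ret _ _ _ _) _ _.
apply: (returns_Bind (l' := 2) (h' := 2) (returns_Phi _ _ _ _)).
by apply: (returns_Bind (returns_Add _ _ _ _ _)); exact: returns_Sub.
Qed.

Fixpoint pick_index_of (i : nat) (acc t : R) (ws : seq R) : nat :=
  if ws is w :: ws' then if (t <= acc + w)%R then i else pick_index_of i.+1 (acc + w) t ws'
  else i.

Lemma returns_pick_from i acc t ws :
  returns (pick_from i acc t ws) (pick_index_of i acc t ws) 0 (2 * size ws).
Proof.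
elim: ws i acc => [|w ws IH] i acc /=; first exact: returns_Ret.
rewrite mulnS; apply: (returns_le (l := 1 + (1 + 0)) (h := 1 + (1 + (2 * size ws)))) => //.
apply: (returns_Bind (returns_Add _ _ _ _ _)); apply: (returns_Bind (returns_Leq _ _ _ _ _)).
by case: ifP => _; [exact: returns_le (returns_Ret _ _ _ _) _ _|exact: IH].
Qed.

(** Positive weights make the partial sums increase, so having stopped by index i is the same as the
    i-th partial sum having reached t. *)
Lemma pick_index_ofP (ws : seq R) i0 acc t i : all (fun x => 0 < x)%R ws -> (i < size ws)%N ->
  (pick_index_of i0 acc t ws <= i0 + i)%N = (t <= acc + \sum_(k < i.+1) ws`_k)%R.
Proof.
have ge i1 acc1 ws1 : (i1 <= pick_index_of i1 acc1 t ws1)%N.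
  elim: ws1 i1 acc1 => [//|w ws1 IH] i1 acc1 /=; case: ifP => // _.
  exact: ltnW (IH i1.+1 _).
elim: ws i0 acc i => [//|w ws IH] i0 acc i /= /andP[w0 ws0] iw.
rewrite big_ord_recl /= addrA; case: ifP => [h|/negbT]; last rewrite -ltNge => h.
  rewrite leq_addr; apply/esym; apply: (le_trans h); rewrite lerDl sumr_ge0// => k _.
  have nn l : (0 <= ws`_l)%R.
    have [lw|wl] := ltnP l (size ws); last by rewrite nth_default.
    by rewrite ltW//; apply: (allP ws0); exact: mem_nth.
  exact: nn.
case: i iw => [|i] iw.
  rewrite big_ord0 addr0 addn0 [RHS]leNgt h /=.
  by apply/negbTE; rewrite -ltnNge; exact: ge.
by rewrite addnS -addSn IH.
Qed.

(** With v uniform on [0, 1], the index is at most i exactly when v is at most the (i + 1)-st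
    partial sum divided by the total; consecutive differences give the weights. *)
Lemma expect_pick_index (ws : seq R) g : all (fun x => 0 < x)%R ws -> (0 < size ws)%N ->
  (forall i, 0 <= g i) -> let total := (\sum_(x <- ws) x)%R in
  E (pick_index ws total) g = \sum_(i < size ws) (ws`_i / total)%:E * g i.
Proof.
move=> ws0 s0 g0 total; set M := size ws in s0 *.
have wsi i : (i < M)%N -> (0 < ws`_i)%R by move=> iM; apply: (allP ws0); exact: mem_nth.
pose S i := (\sum_(k < i) ws`_k)%R.
have totalE : total = S M.
  by rewrite /total (big_nth 0%R) big_mkord.
have t0 : (0 < total)%R.
  rewrite totalE /S (bigD1 (Ordinal s0))//=.
  by rewrite ltr_pwDl ?wsi// sumr_ge0// => k _; rewrite ltW// wsi.
have S_le i : (i <= M)%N -> (0 <= S i)%R /\ (S i <= total)%R.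
  move=> iM; split; first by apply: sumr_ge0 => k _; rewrite ltW// wsi// (leq_trans _ iM).
  rewrite totalE /S (big_ord_widen M (fun k => ws`_k) iM) [leRHS](bigID (fun k : 'I_M => (k < i)%N))/=.
  by rewrite lerDl sumr_ge0// => k _; rewrite ltW// wsi.
pose v (z : R) := (2 * Phi `|z| - 1)%R.
have mv : measurable_fun setT v := @measurable_abs_cdf R.
pose J z := pick_index_of 0 0 (v z * total)%R ws.
have JP i z : (i < M)%N -> (J z <= i)%N = (v z <= S i.+1 / total)%R.
  by move=> iM; rewrite -(add0n i) pick_index_ofP// add0r add0n -ler_pdivlMr.
(* As v <= 1, the total is always reached and the fallthrough value of [pick_index_of] never
   occurs. *)
have JM z : (J z < M)%N.
  have v1 : (v z <= 1)%R by rewrite /v; have := Phi_le1 `|z|%R; lra.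
  have M1 : (M.-1 < M)%N by rewrite prednK.
  by rewrite -[M](prednK s0) ltnS JP// (prednK s0) -totalE divff// gt_eqF.
have vset t : measurable [set z : R | (v z <= t)%R].
  rewrite (_ : [set _ | _] = [set z | `]-oo, t]%classic (v z)]).
    by apply: measurable_preimageT.
  by apply/seteqP; split => z /=; rewrite in_itv.
pose Jset i := [set z : R | J z = i].
have JsetE i : (i < M)%N -> Jset i = [set z | (v z <= S i.+1 / total)%R] `\`
    (if i is 0%N then set0 else [set z | (v z <= S i / total)%R]).
  move=> iM; apply/seteqP; split => z /=.
    move=> Ji; split; first by rewrite -JP// Ji.
    case: i iM Ji => [|i] iM Ji h; first by case: h.
    by have := JP i z (ltnW iM); rewrite [RHS]h Ji ltnn.
  move=> [h1 h2]; have h3 : (J z <= i)%N by rewrite JP.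
  case: i iM h1 h2 h3 => [|i] iM h1 h2 h3; first by apply/eqP; rewrite -leqn0.
  apply/eqP; rewrite eqn_leq h3 ltnNge JP ?(ltnW iM)//.
  exact/negP.
have mJ i : (i < M)%N -> measurable (Jset i).
  move=> iM; rewrite JsetE//; apply: measurableD => //.
  by case: i iM => [|i] iM; [exact: measurable0|exact: vset].
have gJ i : (i < M)%N -> gs (Jset i) = (ws`_i / total)%:E.
  move=> iM; rewrite JsetE//.
  have cdf k : (k <= M)%N -> gs [set z | (v z <= S k / total)%R] = (S k / total)%:E.
    move=> kM; have [h0 h1] := S_le k kM.
    by apply: std_normal_abs_cdf; [rewrite divr_ge0// ltW|rewrite ler_pdivrMr ?mul1r].
  case: i iM => [|i] iM.
    by rewrite setD0 cdf// /S big_ord1.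
  rewrite measureD//=; [|exact: vset|exact: vset|by rewrite (cdf i.+2)// ltry].
  rewrite setIidr; last first.
    move=> z /= h; apply: (le_trans h); rewrite ler_pM2r ?invr_gt0//.
    by rewrite /S [leRHS]big_ord_recr/= lerDl ltW// wsi.
  rewrite (cdf i.+2)// (cdf i.+1 (ltnW iM)) -EFinB -mulrBl; congr (_ / _)%:E.
  have -> : S i.+2 = (S i.+1 + ws`_i.+1)%R by rewrite [LHS]big_ord_recr.
  by rewrite addrAC subrr add0r.
have -> : E (pick_index ws total) g = \int[gs]_z g (J z).
  rewrite [LHS](_ : _ = E unit_uniform (fun v0 => g (pick_index_of 0 0 (v0 * total) ws))).
    by rewrite expect_unit_uniform.
  have h : (fun v0 => g (pick_index_of 0 0 (v0 * total)%R ws)) = (fun v0 => E (pick_from 0 0 (v0 * total)%R ws) g).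
    by apply/funext => v0; have [-> _] := returns_pick_from 0 0 (v0 * total)%R ws.
  by rewrite h.
transitivity (\int[gs]_z \sum_(i < M) (\1_(Jset i) z)%:E * g i).
  apply: eq_integral => z _; rewrite (bigD1 (Ordinal (JM z)))//= indicE mem_set// mul1e.
  rewrite big1 ?adde0// => i; rewrite -val_eqE /= => ij.
  by rewrite indicE memNset ?mul0e// => h; move: ij; rewrite -h eqxx.
rewrite ge0_integral_sum//; first last.
- by move=> i z _; rewrite mule_ge0.
- move=> i; apply: emeasurable_funM => //; apply/measurable_EFinP.
  by apply: measurable_indic; exact: mJ.
apply: eq_bigr => i _; rewrite ge0_integralZr//; last first.
  by apply/measurable_EFinP; apply: measurable_indic; exact: mJ.
have mi := mJ i (ltn_ord i).
by rewrite integral_indic// setIT; congr (_ * _); exact: gJ.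
Qed.

Lemma bounded_pick_index (ws : seq R) total :
  bounded (pick_index ws total) (fun=> True) 0 (7 + 2 * (size ws)%:R).
Proof.
suff h : bounded (pick_index ws total) (fun=> True) (0 + 0)%R (6 + (1 + 2 * (size ws)%:R))%R.
  by apply: (bounded_weaken h) => //; lra.
apply: (bounded_Bind mT Tn0 Tfin _ bounded_unit_uniform) => // v _.
rewrite (_ : 1 + _ = (1 + 2 * size ws)%:R)%R; last by rewrite natrD natrM.
apply: (bounded_weaken (returns_bounded (l := 1 + 0) _)) => //; last first.
  by apply: (returns_Bind (returns_Mul _ _ _ _ _)); exact: returns_pick_from.
Qed.

End sampling.

(** * Sampling above a threshold *)

Section gauss_above.
Context (R : realType) (d : nat) (T : set 'rV[R]_d).
Variables (mu : 'rV[R]_d -> R) (C : 'rV[R]_d -> 'rV[R]_d -> R).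
Hypothesis mT : measurable T.
Hypotheses (Tn0 : lebesgue_rV T != 0%E) (Tfin : lebesgue_rV T \is a fin_num).
Local Notation E := (expect T mu C).
Local Notation cost := (cost T mu C).
Local Notation returns := (returns T mu C).
Local Notation bounded := (bounded T mu C).
Local Notation prog := (prog R d).
Local Notation gs := (@std_normal R).
Local Notation phi := (@std_pdf R).
Local Notation Phi := (@Phi_normal R).
Local Notation leb := (@lebesgue_measure R).
Local Open Scope ereal_scope.

Definition radius (x y z : R) : R := Num.sqrt (x ^+ 2 + (y ^+ 2 + z ^+ 2)).

Lemma measurable_sqrt_shift (x : R) : measurable_fun [set: R] (fun t : R => Num.sqrt (x ^+ 2 + t)).
Proof.
apply: (@measurableT_comp _ _ _ _ _ _ (@Num.sqrt R)).
  apply: continuous_measurable_fun; exact: sqrt_continuous.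
by apply: measurable_funD => //; exact: measurable_cst.
Qed.

Lemma std_pdf_shift (x u : R) : (0 < x)%R ->
  (phi (Num.sqrt (x ^+ 2 + u ^+ 2)) * phi 0 = phi x * phi u)%R.
Proof.
move=> x0; apply: std_pdfM; rewrite expr0n addr0 sqr_sqrtr//.
by rewrite addr_ge0 ?sqr_ge0.
Qed.

Section radial_law.
Variables (x : R) (x0 : (0 < x)%R).

(** The density of sqrt(x^2 + z1^2 + z2^2) with respect to the standard law: w exp(-(w^2 - x^2)/2)
    on w >= x, divided by phi w. *)
Let D (w : R) : R := ((w / phi x) * \1_`[x, +oo[%classic w)%R.
Let mD : measurable_fun setT D.
Proof.
by apply: measurable_funM; [apply: measurable_funM|exact: measurable_indic].
Qed.
Let D0 w : (0 <= D w)%R.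
Proof.
rewrite /D indicE; have [xw|nxw] := pselect (`[x, +oo[%classic w).
  rewrite mem_set// mulr1 divr_ge0 ?std_pdf_ge0//.
  by move: xw; rewrite /= in_itv/= andbT => /(le_trans (ltW x0)).
by rewrite memNset// mulr0.
Qed.

Let r (p : R * R) : R := radius x p.1 p.2.
Let mr : measurable_fun setT r.
Proof.
apply: (@measurableT_comp _ _ _ _ _ _ (fun t : R => Num.sqrt (x ^+ 2 + t))).
  exact: measurable_sqrt_shift.
by apply: measurable_funD; apply: measurable_funX; [exact: measurable_fst|exact: measurable_snd].
Qed.

Let m1 : {measure set R -> \bar R} := image_measure (gs \x gs) mr.
Let nu := density_measure gs mD D0.
(* [nu] lives on [measurableTypeR R], whose display is not that of [R]. *)
Let mid : measurable_fun setT (id : measurableTypeR R -> R).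
Proof. exact: measurable_id. Qed.
Let m2 : {measure set R -> \bar R} := image_measure nu mid.

Let m1_ray a : m1 `[a, +oo[%classic =
  (phi (Num.max a x) / phi x)%:E.
Proof.
have mI : measurable (`[a, +oo[%classic : set R) by [].
have -> : m1 `[a, +oo[%classic = \int[gs]_y \int[gs]_z (\1_`[a, +oo[%classic (radius x y z))%:E.
  have -> : m1 `[a, +oo[%classic = \int[m1]_w (\1_`[a, +oo[%classic w)%:E by rewrite integral_indic ?setIT.
  rewrite [LHS](@integral_image_measure _ _ _ _ _ (gs \x gs) r mr (fun w => (\1_`[a, +oo[%classic w)%:E)); first last.
  - by move=> w; rewrite lee_fin.
  - by apply/measurable_EFinP; exact: measurable_indic.
  - rewrite (@fubini_tonelli1 _ _ _ _ R gs gs)//.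
    + by apply/measurable_EFinP; apply: (@measurableT_comp _ _ _ _ _ _ (\1_`[a, +oo[%classic : R -> R)) => //; exact: measurable_indic.
pose sq (t : R) : R := Num.sqrt (x ^+ 2 + t).
have mh : measurable_fun [set: R] (fun t : R => (\1_`[a, +oo[%classic (sq t) : R)%:E).
  apply/measurable_EFinP; apply: (@measurableT_comp _ _ _ _ _ _ (\1_`[a, +oo[%classic : R -> R)).
    exact: measurable_indic.
  exact: measurable_sqrt_shift.
rewrite [LHS](@std_normal_rayleigh R (fun t => (\1_`[a, +oo[%classic (sq t))%:E) mh); last first.
  by move=> t; rewrite lee_fin.
set c := Num.max a x.
have cx : (x <= c)%R by rewrite le_max lexx orbT.
have c0 : (0 < c)%R by exact: lt_le_trans cx.
(* The value of sqrt(z1^2 + z2^2) at which the radius reaches max(a, x). *)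
pose u0 := Num.sqrt (c ^+ 2 - x ^+ 2).
have cx2 : (0 <= c ^+ 2 - x ^+ 2)%R.
  by rewrite subr_ge0; apply: lerXn2r => //; rewrite nnegrE ltW.
have u00 : (0 <= u0)%R by exact: sqrtr_ge0.
have u02 : (u0 ^+ 2 = c ^+ 2 - x ^+ 2)%R by rewrite sqr_sqrtr.
have -> : \int[leb]_(u in `[0%R, +oo[) ((u * phi u)%:E * (\1_`[a, +oo[%classic (Num.sqrt (x ^+ 2 + u ^+ 2)))%:E)
   = \int[leb]_(u in `[u0, +oo[) (u * phi u)%:E.
  rewrite [LHS]integral_mkcond [RHS]integral_mkcond; apply: eq_integral => u _.
  rewrite !patchE.
  have [u_ge0|u_lt0] := leP 0%R u; last first.
    rewrite memNset; last by rewrite /= in_itv/= andbT leNgt u_lt0.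
    by rewrite memNset// /= in_itv/= andbT => /(le_trans u00); rewrite leNgt u_lt0.
  rewrite mem_set; last by rewrite /= in_itv/= u_ge0.
  have q0 : (0 <= Num.sqrt (x ^+ 2 + u ^+ 2))%R by exact: sqrtr_ge0.
  have xq : (x <= Num.sqrt (x ^+ 2 + u ^+ 2))%R.
    by rewrite -{1}[x](ger0_norm (ltW x0)) -sqrtr_sqr ler_wsqrtr// lerDl sqr_ge0.
  have key : (a <= Num.sqrt (x ^+ 2 + u ^+ 2))%R = (u0 <= u)%R.
    have -> : (a <= Num.sqrt (x ^+ 2 + u ^+ 2))%R = (c <= Num.sqrt (x ^+ 2 + u ^+ 2))%R.
      by rewrite /c ge_max xq andbT.
    rewrite -(@ler_pXn2r _ 2%N)// ?nnegrE ?(ltW c0)//.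
    rewrite -[RHS](@ler_pXn2r _ 2%N)// ?nnegrE//.
    by rewrite u02 sqr_sqrtr ?addr_ge0 ?sqr_ge0// lerBlDl.
  rewrite indicE; case: (boolP (u0 <= u)%R) => h.
    rewrite mem_set; last by rewrite /= in_itv/= andbT key.
    by rewrite mem_set ?mule1// /= in_itv/= h.
  rewrite memNset; last by rewrite /= in_itv/= andbT key; apply/negP.
  by rewrite mule0 memNset// /= in_itv/= andbT; apply/negP.
rewrite integral_itvcy_mul_std_pdf// -EFinM; congr EFin.
have h := std_pdf_shift u0 x0.
have e : Num.sqrt (x ^+ 2 + u0 ^+ 2) = c.
  by rewrite u02 addrC subrK sqrtr_sqr ger0_norm// ltW.
rewrite e in h.
have p0 := std_pdf_gt0 (0 : R); have px := std_pdf_gt0 x.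
apply: (@mulIf _ (phi x * phi 0)%R); first by rewrite mulf_neq0// gt_eqF.
rewrite [RHS](_ : _ = phi c * phi 0)%R; last by field; rewrite gt_eqF.
by rewrite h; field; rewrite gt_eqF.
Qed.

Let m2_ray a : m2 `[a, +oo[%classic = (phi (Num.max a x) / phi x)%:E.
Proof.
set c := Num.max a x.
have cx : (x <= c)%R by rewrite le_max lexx orbT.
have px := std_pdf_gt0 x.
have c0 : (0 <= c)%R by rewrite (le_trans (ltW x0)).
have -> : m2 `[a, +oo[%classic = \int[gs]_w (\1_`[c, +oo[%classic w * (w / phi x))%:E.
  rewrite /m2 /image_measure /pushforward /= preimage_id /nu /density_measure integral_mkcond; apply: eq_integral => w _.
  rewrite patchE /D !indicE.
  have -> : (w \in `[c, +oo[%classic) = (w \in `[a, +oo[%classic) && (w \in `[x, +oo[%classic).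
    by rewrite !mem_setE !in_itv/= !andbT /c ge_max.
  by case: ifP => _ /=; rewrite ?mul0r// mulrC.
have pos w : (0 <= \1_`[c, +oo[%classic w * (w / phi x))%R.
  rewrite indicE; have [cw|ncw] := pselect (`[c, +oo[%classic w); last by rewrite memNset ?mul0r.
  rewrite mem_set// mul1r divr_ge0 ?std_pdf_ge0//.
  by move: cw; rewrite /= in_itv/= andbT; exact: le_trans.
have mf : measurable_fun [set: R] (fun w : R => (\1_`[c, +oo[%classic w * (w / phi x))%R).
  by apply: measurable_funM; [exact: measurable_indic|exact: measurable_funM].
rewrite integral_std_normal//; last exact/measurable_EFinP.
transitivity (\int[leb]_w ((phi x)^-1%:E * (\1_`[c, +oo[%classic w * (w * phi w))%:E)).
  by apply: eq_integral => w _; rewrite -!EFinM; congr EFin; ring.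
have pos2 w : (0 <= \1_`[c, +oo[%classic w * (w * phi w))%R.
  rewrite indicE; have [cw|ncw] := pselect (`[c, +oo[%classic w); last by rewrite memNset ?mul0r.
  rewrite mem_set// mul1r mulr_ge0 ?std_pdf_ge0//.
  by move: cw; rewrite /= in_itv/= andbT; exact: le_trans.
rewrite ge0_integralZl_EFin//; first last.
- by rewrite invr_ge0 std_pdf_ge0.
- apply/measurable_EFinP; apply: measurable_funM; first exact: measurable_indic.
  by apply: measurable_funM => //; exact: measurable_std_pdf.
- by move=> w _; rewrite lee_fin.
rewrite (_ : \int[leb]_w _ = \int[leb]_(w in `[c, +oo[) (w * phi w)%:E); last first.
  rewrite [RHS]integral_mkcond; apply: eq_integral => w _; rewrite patchE indicE.
  by case: ifP => _; rewrite ?mul0r ?mul1r.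
by rewrite integral_itvcy_mul_std_pdf// -EFinM mulrC.
Qed.

(** Both sides are integrals against measures that give a closed ray the mass phi (max(a, x)) / phi
    x, and rays determine them. *)
Lemma radial_law (H : R -> \bar R) : measurable_fun setT H -> (forall w, 0 <= H w) ->
  \int[gs]_y \int[gs]_z H (radius x y z) =
  \int[gs]_(w in `[x, +oo[) ((w / phi x)%:E * H w).
Proof.
move=> mH H0.
have e : forall A : set R, measurable A -> m1 A = m2 A.
  apply: (@ray_measure_unique R m1 m2) => a; first by rewrite m1_ray m2_ray.
  by rewrite m1_ray ltry.
have -> : \int[gs]_y \int[gs]_z H (radius x y z) = \int[m1]_w H w.
  rewrite integral_image_measure//.
  rewrite (@fubini_tonelli1 _ _ _ _ R gs gs)//.
  exact: measurableT_comp.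
have -> : \int[m1]_w H w = \int[m2]_w H w by apply: eq_measure_integral => A mA _; exact: e.
rewrite integral_image_measure// (@ge0_integral_density _ _ R gs nu D)//.
rewrite [RHS]integral_mkcond; apply: eq_integral => w _; rewrite patchE /D indicE.
by case: ifP => _; rewrite muleC ?mulr1// mulr0 mul0e.
Qed.

End radial_law.

Lemma sqrt_dot3 (x y z : R) : Num.sqrt (dot [:: x; y; z] [:: x; y; z]) = radius x y z.
Proof.
by rewrite /dot /= !big_cons big_nil /= addr0 /radius !expr2.
Qed.

Lemma integral_std_normal_ray (x : R) (H : R -> \bar R) : measurable_fun setT H ->
  (forall w, 0 <= H w) ->
  \int[gs]_(w in `[x, +oo[) H w = \int[gs]_(w in `]x, +oo[) H w.
Proof.
move=> mH H0; rewrite [LHS]integral_mkcond [RHS]integral_mkcond.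
have mr b : measurable_fun setT (H \_ [set` Interval (BSide b x) +oo%O]).
  by apply/(measurable_restrictT _ _).1 => //; exact: measurable_funTS.
have r0 b w : 0 <= (H \_ [set` Interval (BSide b x) +oo%O]) w by exact: erestrict_ge0.
rewrite integral_std_normal// [RHS]integral_std_normal//.
transitivity (\int[leb]_(w in `[x, +oo[) (H w * (phi w)%:E)).
  rewrite [RHS]integral_mkcond; apply: eq_integral => w _; rewrite !patchE.
  by case: ifP => _; rewrite ?mul0e.
rewrite -integral_itv_obnd_cbnd; last first.
  by apply: measurable_funTS; apply: emeasurable_funM => //; exact: measurable_std_pdf_EFin.
rewrite integral_mkcond; apply: eq_integral => w _; rewrite !patchE.
by case: ifP => _; rewrite ?mul0e.
Qed.

(** For integrands such as w / phi x, which are nonnegative on the half-line only; composing with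
    max(w, 0) leaves them unchanged there. *)
Lemma integral_std_normal_ray_pos (x : R) (H : R -> \bar R) : measurable_fun setT H ->
  (0 <= x)%R -> (forall w, (0 <= w)%R -> 0 <= H w) ->
  \int[gs]_(w in `[x, +oo[) H w = \int[gs]_(w in `]x, +oo[) H w.
Proof.
move=> mH x0 H0; pose G (w : R) := H (Num.max w 0%R).
have e b : \int[gs]_(w in [set` Interval (BSide b x) +oo%O]) H w
         = \int[gs]_(w in [set` Interval (BSide b x) +oo%O]) G w.
  apply: eq_integral => w; rewrite inE /= in_itv/= andbT /G => xw.
  by rewrite max_l// (le_trans x0)// (lteifW xw).
rewrite (e true) (e false); apply: integral_std_normal_ray.
- apply: (measurableT_comp mH); exact: measurable_maxr.
- by move=> w; apply: H0; rewrite le_max lexx orbT.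
Qed.

Lemma acceptance (x r : R) : (0 <= x)%R -> (x <= r)%R -> (0 < r)%R ->
  gs [set z | (2 * Phi `|z| - 1) * r <= x]%R = (x / r)%:E.
Proof.
move=> x0 xr r0.
have -> : [set z : R | (2 * Phi `|z| - 1) * r <= x]%R = [set z | 2 * Phi `|z| - 1 <= x / r]%R.
  by apply/seteqP; split => z /=; rewrite ler_pdivlMr.
by apply: std_normal_abs_cdf; [rewrite divr_ge0// ltW|rewrite ler_pdivrMr ?mul1r].
Qed.

Definition accepts (x r z : R) : bool := ((2 * Phi `|z| - 1) * r <= x)%R.

(** The body of the second [Repeat] in [gauss_above], named so that it can be studied alone. *)
Definition marsaglia (x : R) : prog (option R) := (
  z1 <-- Gauss ;
  z2 <-- Gauss ;
  v <-- unit_uniform ;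
  s <-- dotP [:: x; z1; z2] [:: x; z1; z2] ;
  r <-- Sqrt s ;
  t <-- Mul v r ;
  ok <-- Leq t x ;
  Ret (if ok then Some r else None))%prog.

Lemma expect_marsaglia (x : R) (g : option R -> \bar R) :
  E (marsaglia x) g = \int[gs]_y \int[gs]_z \int[gs]_u
     g (if accepts x (radius x y z) u then Some (radius x y z) else None).
Proof.
rewrite /marsaglia; apply: eq_integral => y _; apply: eq_integral => z _.
pose k v : prog (option R) := (s <-- dotP [:: x; y; z] [:: x; y; z] ;
  r <-- Sqrt s ; t <-- Mul v r ; ok <-- Leq t x ; Ret (if ok then Some r else None))%prog.
transitivity (E unit_uniform (fun v => E (k v) g)); first by [].
have -> : (fun v => E (k v) g) =
    fun v => g (if (v * radius x y z <= x)%R then Some (radius x y z) else None).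
  apply/funext => v; have [h _] := returns_dotP T mu C [:: x; y; z] [:: x; y; z].
  have := h (fun s => g (if (v * Num.sqrt s <= x)%R then Some (Num.sqrt s) else None)).
  by rewrite sqrt_dot3.
by rewrite expect_unit_uniform.
Qed.

Lemma integral_accepts (x r : R) (c1 c0 : \bar R) : (0 <= x)%R -> (x <= r)%R -> (0 < r)%R ->
  0 <= c1 -> 0 <= c0 ->
  \int[gs]_u (if accepts x r u then c1 else c0) = (x / r)%:E * c1 + (1 - x / r)%:E * c0.
Proof.
move=> x0 xr r0 c1_0 c0_0; pose A := [set z | accepts x r z].
have mA : measurable A.
  rewrite (_ : A = [set z | `]-oo, x]%classic ((2 * Phi `|z| - 1) * r)%R]); last first.
    by apply/seteqP; split => z /=; rewrite in_itv.
  apply: measurable_preimageT => //; apply: measurable_funM => //.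
  exact: measurable_abs_cdf.
have gA : gs A = (x / r)%:E by exact: acceptance.
have gAC : gs (~` A) = (1 - x / r)%:E.
  have h : gs (~` A) = 1 - gs A by exact: probability_setC.
  by rewrite h gA.
rewrite (_ : \int[gs]_u _ = \int[gs]_u ((\1_A u)%:E * c1 + (\1_(~` A) u)%:E * c0)); last first.
  apply: eq_integral => u _; rewrite !indicE; case: ifPn => h.
    by rewrite mem_set// memNset ?mul1e ?mul0e ?adde0//; exact.
  by rewrite memNset ?mem_set ?mul1e ?mul0e ?add0e//; apply/negP.
have mi (B : set R) (c : \bar R) : measurable B -> measurable_fun setT (fun u => (\1_B u)%:E * c).
  move=> mB; apply: emeasurable_funM => //; apply/measurable_EFinP; exact: measurable_indic.
have p (B : set R) (c : \bar R) u : 0 <= c -> 0 <= (\1_B u)%:E * c.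
  by move=> c_0; rewrite mule_ge0.
have e (B : set R) (c : \bar R) : 0 <= c -> measurable B -> \int[gs]_u ((\1_B u)%:E * c) = gs B * c.
  move=> c_0 mB; rewrite ge0_integralZr//; last first.
    by apply/measurable_EFinP; exact: measurable_indic.
  by rewrite integral_indic// setIT.
rewrite ge0_integralD//.
- rewrite !e//; last exact: measurableC.
  by congr (_ * _ + _ * _); [exact: gA|exact: gAC].
- by move=> u _; exact: p.
- exact: mi.
- by move=> u _; exact: p.
- by apply: mi; exact: measurableC.
Qed.

Section marsaglia.
Variables (x : R) (x0 : (0 < x)%R).

Let xr y z : (x <= radius x y z)%R.
Proof.
rewrite -{1}[x](ger0_norm (ltW x0)) -sqrtr_sqr /radius ler_wsqrtr// lerDl.
by rewrite addr_ge0// sqr_ge0.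
Qed.

(** Acceptance with probability x / r cancels the factor r of the radial density; what remains is
    the constant x / phi x times the normal law above x. *)
Lemma expect_marsaglia_success (g : R -> \bar R) : measurable_fun setT g -> (forall r, 0 <= g r) ->
  E (marsaglia x) (fun o => if o is Some r then g r else 0) =
  (x / phi x)%:E * \int[gs]_(r in `]x, +oo[) g r.
Proof.
move=> mg g0; rewrite expect_marsaglia.
transitivity (\int[gs]_y \int[gs]_z ((x / radius x y z)%:E * g (radius x y z))).
  apply: eq_integral => y _; apply: eq_integral => z _.
  have r0 : (0 < radius x y z)%R by apply: lt_le_trans (xr y z).
  rewrite -[RHS]adde0 -[in RHS](mule0 (1 - x / radius x y z)%:E).
  rewrite -integral_accepts ?(ltW x0)//.
  by apply: eq_integral => u _; case: ifP.
(* The inverse is written as a power, a measurable function on the whole line that agrees with it on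
   the range of the radius. *)
pose H (w : R) : \bar R := (x * w `^ (- 1))%:E * g w.
have HE w : (0 <= w)%R -> H w = (x / w)%:E * g w by move=> w0; rewrite /H powR_inv1.
have mH : measurable_fun setT H.
  apply: emeasurable_funM => //; apply/measurable_EFinP; apply: measurable_funM => //.
have H0 w : 0 <= H w by rewrite mule_ge0// lee_fin mulr_ge0 ?(ltW x0)// powR_ge0.
rewrite (_ : \int[gs]_y _ = \int[gs]_y \int[gs]_z H (radius x y z)); last first.
  apply: eq_integral => y _; apply: eq_integral => z _; rewrite HE//.
  exact: le_trans (ltW x0) (xr y z).
rewrite radial_law// -integral_std_normal_ray//.
rewrite -ge0_integralZl_EFin//; first last.
- by rewrite divr_ge0 ?std_pdf_ge0// ltW.
- exact: measurable_funTS.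
- apply: eq_integral => w; rewrite inE /= in_itv/= andbT => xw.
  have w0 : (0 < w)%R by exact: lt_le_trans xw.
  rewrite HE ?(ltW w0)// muleA -EFinM; congr (_%:E * _).
  by field; rewrite !gt_eqF// std_pdf_gt0.
Qed.

Let alpha := (x / phi x * (1 - Phi x))%R.

Lemma marsaglia_failure :
  E (marsaglia x) (fun o => if o is None then 1 else 0) = (1 - alpha)%:E.
Proof.
rewrite expect_marsaglia.
transitivity (\int[gs]_y \int[gs]_z (1 - x / radius x y z)%:E).
  apply: eq_integral => y _; apply: eq_integral => z _.
  have r0 : (0 < radius x y z)%R by apply: lt_le_trans (xr y z).
  rewrite -[RHS]mule1 -[RHS]add0e -[in RHS](mule0 (x / radius x y z)%:E).
  rewrite -integral_accepts ?(ltW x0)//.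
  by apply: eq_integral => u _; case: ifP.
(* The failure probability 1 - x / w, truncated at 0 to be nonnegative on the whole line; the radius
   never falls below x. *)
pose H (w : R) : R := Num.max (1 - x * w `^ (- 1))%R 0%R.
have HE w : (x <= w)%R -> H w = (1 - x / w)%R.
  move=> xw; have w0 : (0 < w)%R by exact: lt_le_trans xw.
  by rewrite /H powR_inv1 ?(ltW w0)// max_l// subr_ge0 ler_pdivrMr// mul1r.
have mH : measurable_fun setT H.
  apply: measurable_maxr => //; apply: measurable_funB => //; apply: measurable_funM => //.
have mHE : measurable_fun setT (EFin \o H) by exact/measurable_EFinP.
have H0 w : (0 <= H w)%R by rewrite /H le_max lexx orbT.
rewrite (_ : \int[gs]_y _ = \int[gs]_y \int[gs]_z (EFin \o H) (radius x y z)); last first.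
  by apply: eq_integral => y _; apply: eq_integral => z _ /=; rewrite HE// xr.
have px := std_pdf_gt0 x.
have mw : measurable_fun [set: R] (fun w : R => (w / phi x)%:E).
  by apply/measurable_EFinP; apply: measurable_funM.
rewrite radial_law//.
rewrite (@integral_std_normal_ray_pos x (fun w => (w / phi x)%:E * (EFin \o H) w)); first last.
- by move=> w w0; rewrite mule_ge0 ?lee_fin// divr_ge0 ?(ltW px).
- exact: ltW.
- exact: emeasurable_funM.
pose I := \int[gs]_(w in `]x, +oo[) ((w / phi x)%:E * (H w)%:E).
(* Failure and acceptance add up to the total mass of the law of the radius. *)
have one : I + alpha%:E = 1.
  have -> : alpha%:E = \int[gs]_(w in `]x, +oo[) (x / phi x)%:E.
    by rewrite integral_cst// /alpha EFinM -std_normal_tailE.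
  rewrite -ge0_integralD//=.
  - transitivity (\int[gs]_(w in `]x, +oo[) ((w / phi x)%:E * 1)).
      apply: eq_integral => w; rewrite inE /= in_itv/= andbT => xw.
      rewrite mule1 -EFinM -EFinD HE ?(ltW xw)//; congr EFin.
      by field; rewrite !gt_eqF// (lt_trans x0).
    rewrite -(@integral_std_normal_ray_pos x (fun w => (w / phi x)%:E * 1)); first last.
    - by move=> w w0; rewrite mule_ge0 ?lee_fin// divr_ge0 ?(ltW px).
    - exact: ltW.
    - exact: emeasurable_funM.
    rewrite -(radial_law x0 (H := fun=> 1))//.
    have i1 : \int[gs]__ 1 = 1 :> \bar R by rewrite integral_cst// mul1e; exact: probability_setT.
    by rewrite !i1.
  - move=> w; rewrite /= in_itv/= andbT => xw.
    by rewrite mule_ge0 ?lee_fin// divr_ge0 ?(ltW px)// ltW// (lt_trans x0).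
  - by apply: measurable_funTS; exact: emeasurable_funM.
  - by move=> w _; rewrite lee_fin divr_ge0 ?ltW.
by rewrite EFinB -one addeK.
Qed.

Let Phi1 : (0 < 1 - Phi x)%R.
Proof. by rewrite subr_gt0 Phi_lt1. Qed.

Let alpha_gt0 : (0 < alpha)%R.
Proof. by rewrite /alpha mulr_gt0// divr_gt0// std_pdf_gt0. Qed.

Let alpha_le1 : (alpha <= 1)%R.
Proof.
have := @expect_ge0 _ _ _ mu C mT Tn0 Tfin _ (marsaglia x) (fun o => if o is None then 1 else 0).
by rewrite marsaglia_failure lee_fin subr_ge0; apply => -[].
Qed.

(** The tail at x is at least phi (x + 1/x) / x, and (x + 1/x)^2 exceeds x^2 by 2 + x^-2 <= 3. A
    rate bounded below uniformly in x is what keeps the expected cost bounded as the threshold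
    grows. *)
Lemma marsaglia_acceptance_ge : (1 <= x)%R -> (expR (- (3 / 2)) <= alpha)%R.
Proof.
move=> x1; have px := std_pdf_gt0 x.
have h0 : (0 < x^-1)%R by rewrite invr_gt0.
have := std_normal_ray_ge (ltW x0) h0; rewrite std_normal_tailE lee_fin => h.
rewrite /alpha mulrAC ler_pdivlMr//.
apply: (@le_trans _ _ (x * (x^-1 * phi (x + x^-1)))%R); last by rewrite ler_pM2l.
rewrite mulrA divff ?gt_eqF// mul1r !std_pdfE mulrCA ler_pM2l; last exact/normal_peak_gt0/oner_neq0.
rewrite -expRD ler_expR.
have xi : (x^-1 <= 1)%R by rewrite invf_le1.
have xx : (x * x^-1 = 1)%R by rewrite divff// gt_eqF.
have -> : ((x + x^-1) ^+ 2 = x ^+ 2 + 2 + x^-1 ^+ 2)%R by rewrite sqrrD xx.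
have : (x^-1 ^+ 2 <= 1)%R by rewrite expr_le1// ltW.
move: (x ^+ 2)%R (x^-1 ^+ 2)%R => p q; lra.
Qed.

Lemma expect_Repeat_marsaglia (g : R -> \bar R) : measurable_fun setT g -> (forall r, 0 <= g r) ->
  E (Repeat (marsaglia x)) g = ((1 - Phi x)^-1)%:E * \int[gs]_(r in `]x, +oo[) g r.
Proof.
move=> mg g0; rewrite (@expect_Repeat _ _ _ _ _ _ _ (1 - alpha)%R).
- rewrite expect_marsaglia_success// muleA -EFinM; congr (_%:E * _).
  rewrite opprB addrC subrK /alpha invfM invf_div.
  have px := std_pdf_gt0 x.
  by field; rewrite !gt_eqF ?Phi1.
- by rewrite subr_ge0.
- by rewrite ltrBlDr ltrDl.
- exact: marsaglia_failure.
Qed.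

Lemma cost_marsaglia : cost (marsaglia x) <= 20%:E.
Proof.
have h : bounded (marsaglia x) (fun=> True) (1 + (1 + (0 + 8)))%R (1 + (1 + (6 + 9)))%R.
  apply: (bounded_Bind mT Tn0 Tfin _ (bounded_Gauss _ _ _)) => [|y _]; first by lra.
  apply: (bounded_Bind mT Tn0 Tfin _ (bounded_Gauss _ _ _)) => [|z _]; first by lra.
  apply: (bounded_Bind mT Tn0 Tfin _ (bounded_unit_uniform _ _ mT Tn0 Tfin)) => [|v _]; first by lra.
  pose s := radius x y z.
  apply: (bounded_weaken (returns_bounded (a := if (v * s <= x)%R then Some s else None) (l := 6 + (1 + (1 + (1 + 0)))) (h := 6 + (1 + (1 + (1 + 0)))) _)) => //; try lra.
  apply: (returns_Bind (returns_dotP _ _ _ _ _)).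
  rewrite /s -sqrt_dot3.
  apply: (returns_Bind (returns_Sqrt _ _ _ _)); apply: (returns_Bind (returns_Mul _ _ _ _ _)).
  by apply: (returns_Bind (returns_Leq _ _ _ _ _)); exact: returns_Ret.
by have [_ _ /andP[_ c]] := h; apply: (le_trans c); rewrite lee_fin; lra.
Qed.

Lemma cost_Repeat_marsaglia : (1 <= x)%R ->
  cost (Repeat (marsaglia x)) <= (20 * expR (3 / 2))%:E.
Proof.
move=> x1; rewrite (@cost_Repeat _ _ _ _ _ _ _ (1 - alpha)%R) ?subr_ge0//; last exact: marsaglia_failure.
  rewrite opprB addrC subrK mulrC EFinM lee_pmul//; first by rewrite lee_fin invr_ge0 ltW.
  - exact: cost_ge0.
  - by rewrite lee_fin -[leRHS]invrK -expRN lef_pV2 ?posrE ?expR_gt0// marsaglia_acceptance_ge.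
  - exact: cost_marsaglia.
by rewrite ltrBlDr ltrDl.
Qed.

End marsaglia.

Let reject (x : R) : prog (option R) := (
  z <-- Gauss ;
  fail <-- Leq z x ;
  Ret (if fail then None else Some z))%prog.

Let reject_failure x : E (reject x) (fun o => if o is None then 1 else 0) = (Phi x)%:E.
Proof.
rewrite Phi_normalE; transitivity (\int[gs]_z (\1_`]-oo, x]%classic z)%:E); last first.
  by rewrite integral_indic ?setIT.
apply: eq_integral => z _ /=; rewrite indicE.
by case: ifPn => h; [rewrite mem_set|rewrite memNset]; rewrite //= in_itv//=; exact/negP.
Qed.

Let reject_success x (g : R -> \bar R) :
  E (reject x) (fun o => if o is Some r then g r else 0) = \int[gs]_(r in `]x, +oo[) g r.
Proof.
rewrite [RHS]integral_mkcond; apply: eq_integral => z _ /=; rewrite patchE.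
rewrite mem_setE in_itv/= andbT ltNge; by case: ifP.
Qed.

Let cost_reject x : cost (reject x) = 2%:E.
Proof.
have h : bounded (reject x) (fun=> True) (1 + 1)%R (1 + 1)%R.
  apply: (bounded_Bind mT Tn0 Tfin _ (bounded_Gauss _ _ _)) => [|z _]; first by lra.
  apply: (bounded_weaken (returns_bounded (a := if (z <= x)%R then None else Some z) (l := 1 + 0) (h := 1 + 0) _)) => //.
  by apply: (returns_Bind (returns_Leq _ _ _ _ _)); exact: returns_Ret.
by have [_ _ h2] := h; apply/eqP; rewrite eq_le andbC.
Qed.

Lemma expect_gauss_above (x : R) (g : R -> \bar R) : measurable_fun setT g -> (forall r, 0 <= g r) ->
  E (gauss_above x) g = ((1 - Phi x)^-1)%:E * \int[gs]_(r in `]x, +oo[) g r.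
Proof.
move=> mg g0; rewrite /gauss_above [LHS](_ : _ = E (if (x <= 1)%R then Repeat (reject x) else Repeat (marsaglia x)) g)//.
case: leP => x1.
  by rewrite (@expect_Repeat _ _ _ _ _ _ _ (Phi x)) ?Phi_ge0 ?Phi_lt1// reject_success.
by rewrite expect_Repeat_marsaglia// (lt_trans _ x1).
Qed.

(** Plain rejection for x <= 1 succeeds with probability at least 1 - Phi 1, the other sampler with
    probability at least exp(-3/2); the sum of the two bounds covers both branches. *)
Lemma cost_gauss_above (x : R) :
  cost (gauss_above x) <= (1 + (2 / (1 - Phi 1) + 20 * expR (3 / 2)))%:E.
Proof.
rewrite /gauss_above [leLHS](_ : _ = 1 + cost (if (x <= 1)%R then Repeat (reject x) else Repeat (marsaglia x)))//.
rewrite EFinD leeD2l//; case: (leP x 1%R) => x1.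
  rewrite (@cost_Repeat _ _ _ _ _ _ _ (Phi x)) ?Phi_ge0 ?Phi_lt1// cost_reject -EFinM lee_fin.
  rewrite ler_wpDr ?mulr_ge0 ?expR_ge0// mulrC ler_pM2l// lef_pV2 ?posrE ?subr_gt0 ?Phi_lt1//.
  by rewrite lerD2l lerN2 Phi_le.
apply: (le_trans (cost_Repeat_marsaglia _ _)); [by rewrite (lt_trans _ x1)|exact: ltW|].
by rewrite lee_fin lerDr divr_ge0// subr_ge0 Phi_le1.
Qed.

Lemma bounded_gauss_above : exists2 K : R, (0 < K)%R &
  forall x, bounded (gauss_above x) (fun=> True) 0 K.
Proof.
exists (1 + (2 / (1 - Phi 1) + 20 * expR (3 / 2)))%R.
  rewrite ltr_pwDl// addr_ge0 ?mulr_ge0 ?expR_ge0// ?invr_ge0 ?subr_ge0 ?Phi_le1//.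
move=> x; split.
- by move=> g h g0 gh; apply: expect_mono => // a; exact: gh.
- move=> c c0; rewrite expect_gauss_above// integral_cst// [X in _ * (_ * X)]std_normal_tailE -!EFinM.
  by rewrite mulrCA mulVf ?mulr1// gt_eqF// subr_gt0 Phi_lt1.
- by apply/andP; split; [exact: cost_ge0|exact: cost_gauss_above].
Qed.

End gauss_above.

(** * Law of one replication *)

Section image_probability.
Context d1 d2 (X : measurableType d1) (Y : measurableType d2) (R : realType).
Variables (mu : probability X R) (phi : X -> Y) (mphi : measurable_fun setT phi).

Definition image_probability : set Y -> \bar R := image_measure mu mphi.

HB.instance Definition _ := Measure.on image_probability.

Let image_setT : image_probability setT = 1%E.
Proof. exact: (@probability_setT _ _ _ mu). Qed.

HB.instance Definition _ := Measure_isProbability.Build _ _ _ image_probability image_setT.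

End image_probability.

Section gauss_vectors.
Context (R : realType).
Local Notation gs := (@std_normal R).
Local Notation gsn n := (power_measure gs (n := n)).
Local Open Scope ereal_scope.

Lemma measurable_affine_tuple n (a0 : R) (beta : 'I_n -> R) :
  measurable_fun setT (fun v : n.-tuple R => a0 + \sum_(k < n) beta k * tnth v k)%R.
Proof.
apply: measurable_funD => //; apply: measurable_sum => k.
by apply: measurable_funM => //; exact: measurable_tnth.
Qed.

(** Induction on n: the last n coordinates act as one normal variable, which [std_normal_rotation]
    merges with the first. *)
Lemma integral_affine_normal n (a0 : R) (beta : 'I_n -> R) (h : R -> \bar R) :
  measurable_fun setT h -> (forall x, 0 <= h x) ->
  \int[gsn n]_v h (a0 + \sum_(k < n) beta k * tnth v k)%R
  = \int[gs]_z h (a0 + Num.sqrt (\sum_(k < n) beta k ^+ 2) * z)%R.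
Proof.
move=> mh h0; elim: n a0 beta => [|n IH] a0 beta.
  rewrite integral_power_measure0 !big_ord0 addr0 sqrtr0.
  under eq_integral do rewrite mul0r addr0.
  rewrite integral_cst//.
  have g1 : gs setT = 1 by exact: probability_setT.
  by rewrite [X in _ * X]g1 mule1.
rewrite integral_power_measureS//; last first.
  apply: measurableT_comp => //; exact: measurable_affine_tuple.
pose s := (\sum_(k < n) beta (lift ord0 k) ^+ 2)%R.
have s0 : (0 <= s)%R by apply: sumr_ge0 => k _; exact: sqr_ge0.
transitivity (\int[gs]_x \int[gs]_z (fun t => h (a0 + t)%R) (beta ord0 * x + Num.sqrt s * z)%R).
  apply: eq_integral => x _; rewrite -[RHS](_ : \int[gs]_z h ((a0 + beta ord0 * x) + Num.sqrt s * z)%R = _).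
    rewrite -(IH (a0 + beta ord0 * x)%R (fun k => beta (lift ord0 k))).
    apply: eq_integral => v _; rewrite big_ord_recl addrA tnth0.
    by congr (h (_ + _)%R); apply: eq_bigr => k _; rewrite tnthS.
  by apply: eq_integral => z _; rewrite addrA.
rewrite (@std_normal_rotation R _ _ (fun t => h (a0 + t)%R))//; last first.
  by apply: measurableT_comp => //; exact: measurable_funD.
by rewrite sqr_sqrtr// big_ord_recl.
Qed.

End gauss_vectors.

Section gauss_vector_law.
Context (R : realType) (disp : measure_display) (Omega : measurableType disp).
Context (P : probability Omega R) (d : nat) (T : set 'rV[R]_d).
Context (f : 'rV[R]_d -> {RV P >-> R}).
Hypothesis gaussf : gaussian_field T f.
Local Notation gs := (@std_normal R).
Local Notation gsn n := (power_measure gs (n := n)).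
Local Open Scope ereal_scope.

Definition affine_tuple M n (a : 'I_M -> R) (B : 'I_M -> 'I_n -> R) (v : n.-tuple R) :
  M.-tuple R := [tuple (a j + \sum_(k < n) B j k * tnth v k)%R | j < M].

Lemma measurable_affine_tuples M n (a : 'I_M -> R) (B : 'I_M -> 'I_n -> R) :
  measurable_fun setT (affine_tuple a B).
Proof.
apply/measurable_fun_tnthP => j.
rewrite (_ : _ \o _ = fun v : n.-tuple R => (a j + \sum_(k < n) B j k * tnth v k)%R).
  exact: measurable_affine_tuple.
by apply/funext => v /=; rewrite tnth_mktuple.
Qed.

(** Any linear combination of either vector is normal with the same mean, and with the same variance
    by the Gram identity; [cramer_wold] then identifies the laws. *)
Lemma affine_normal_law M n (u : M.-tuple 'rV[R]_d) (B : 'I_M -> 'I_n -> R)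
    (h : M.-tuple R -> \bar R) : points T u ->
  (forall j l, \sum_(k < n) B j k * B l k = cov f (tnth u j) (tnth u l))%R ->
  measurable_fun setT h -> (forall x, 0 <= h x) ->
  \int[gsn n]_v h (affine_tuple (fun j => mean f (tnth u j)) B v) =
  \int[P]_omega h (Xat f u omega).
Proof.
move=> Tu BB mh h0; pose a j := mean f (tnth u j).
have mX := measurable_Xat f u; have mV := measurable_affine_tuples a B.
have e (A : set (M.-tuple R)) : measurable A ->
    image_probability (gsn n) mV A = image_probability P mX A.
  apply: cramer_wold => b c.
  pose cosb (y : R) : \bar R := (1 + cos (b + y))%:E.
  have mcos : measurable_fun setT cosb.
    apply/measurable_EFinP; apply: measurable_funD => //.
    by apply: measurableT_comp; [apply: continuous_measurable_fun; exact: continuous_cos|exact: measurable_funD].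
  have cos0 y : 0 <= cosb y by rewrite lee_fin -lerBlDl sub0r cos_geN1.
  have mlin : measurable_fun setT (fun x => cosb (lin c x)).
    apply: measurableT_comp => //; apply: measurable_sum => j.
    by apply: measurable_funM => //; exact: measurable_tnth.
  rewrite [LHS](@integral_image_measure _ _ _ _ _ (gsn n) _ mV (fun x => cosb (lin c x)))//.
  rewrite [RHS](@integral_image_measure _ _ _ _ _ P _ mX (fun x => cosb (lin c x)))//.
  transitivity (\int[P]_omega cosb (\sum_(i < M) c i * f (tnth u i) omega)%R); last first.
    apply: eq_integral => omega _; congr (cosb _).
    by apply: eq_bigr => i _; rewrite tnth_mktuple.
  rewrite (@comb_integral _ _ _ _ _ _ _ gaussf M (tnth u) c Tu)//.
  transitivity (\int[gsn n]_v cosb (comb_mean f (tnth u) c + \sum_(k < n) (\sum_(j < M) c j * B j k) * tnth v k)%R).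
    apply: eq_integral => v _; congr (cosb _); rewrite /lin.
    transitivity (\sum_(j < M) (c j * a j + \sum_(k < n) c j * B j k * tnth v k))%R.
      by apply: eq_bigr => j _; rewrite tnth_mktuple mulrDr mulr_sumr; congr (_ + _)%R; apply: eq_bigr => k _; rewrite mulrA.
    rewrite big_split/=; congr (_ + _)%R; rewrite exchange_big/=.
    by apply: eq_bigr => k _; rewrite mulr_suml.
  rewrite integral_affine_normal//; apply: eq_integral => z _; congr (cosb (_ + Num.sqrt _ * _)%R).
  transitivity (\sum_(k < n) \sum_(i < M) \sum_(j < M) c i * c j * (B i k * B j k))%R.
    apply: eq_bigr => k _; rewrite expr2 mulr_suml; apply: eq_bigr => i _.
    by rewrite mulr_sumr; apply: eq_bigr => j _; ring.
  rewrite exchange_big/=; apply: eq_bigr => i _; rewrite exchange_big/=.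
  by apply: eq_bigr => j _; rewrite -mulr_sumr BB.
rewrite -(@integral_image_measure _ _ _ _ _ (gsn n) _ mV)//.
rewrite -(@integral_image_measure _ _ _ _ _ P _ mX)//.
by apply: eq_measure_integral => A mA _; exact: e.
Qed.

(* The update by the i-th column of C replaces the i-th coordinate of a
   centred Gaussian vector by an independent copy and keeps the law. *)
Lemma conditioned_gram M (C A : 'I_M -> 'I_M -> R) (i j l : 'I_M) : C i i != 0%R ->
  (0 <= C i i)%R -> (forall j l, C j l = C l j) ->
  (forall j l, \sum_(k < M) A j k * A l k = C j l)%R ->
  let B j k := (if unlift ord0 k is Some k' then A j k' - C i j / C i i * A i k'
                else C i j / C i i * Num.sqrt (C i i))%R in
  (\sum_(k < M.+1) B j k * B l k = C j l)%R.
Proof.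
move=> Ci0 Ci symC AA B; rewrite big_ord_recl /B unlift_none.
under eq_bigr do rewrite liftK.
set r := (C i j / C i i)%R; set s := (C i l / C i i)%R.
have -> : (\sum_(k < M) (A j k - r * A i k) * (A l k - s * A i k) =
    \sum_(k < M) A j k * A l k - s * \sum_(k < M) A j k * A i k
    - r * \sum_(k < M) A i k * A l k + r * s * \sum_(k < M) A i k * A i k)%R.
  rewrite !mulr_sumr -!sumrB -big_split/=; apply: eq_bigr => k _; ring.
rewrite !AA (symC j i).
have -> : (r * Num.sqrt (C i i) * (s * Num.sqrt (C i i)) = r * s * C i i)%R.
  by rewrite mulrACA -expr2 sqr_sqrtr.
have -> : C i l = (s * C i i)%R by rewrite /s mulfVK.
have -> : C i j = (r * C i i)%R by rewrite /r mulfVK.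
ring.
Qed.

End gauss_vector_law.

(** * The estimator for given points *)

Section estimate.
Context (R : realType) (d : nat) (T : set 'rV[R]_d).
Variables (mu : 'rV[R]_d -> R) (C : 'rV[R]_d -> 'rV[R]_d -> R).
Local Notation E := (expect T mu C).
Local Notation cost := (cost T mu C).
Local Notation returns := (returns T mu C).
Local Notation bounded := (bounded T mu C).
Local Notation prog := (prog R d).
Local Notation gs := (@std_normal R).
Local Notation gsn n := (power_measure gs (n := n)).
Local Notation Phi := (@Phi_normal R).
Local Open Scope ereal_scope.

Lemma expect_returns A B (p : prog A) a l h (k : A -> prog B) g :
  returns p a l h -> E (Bind p k) g = E (k a) g.
Proof. by case=> Ep _; rewrite /= Ep. Qed.

(** Programs return lists, while measures live on tuples: measurability is asked of the test
    function on tuples of length n only. *)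
Lemma expect_repeat d' (X : measurableType d') (nu : probability X R) (p : prog X) :
  (forall h, measurable_fun setT h -> (forall x, 0 <= h x) -> E p h = \int[nu]_x h x) ->
  forall n (F : seq X -> \bar R), measurable_fun setT (fun v : n.-tuple X => F v) ->
  (forall l, 0 <= F l) ->
  E (repeatP n p) F = \int[power_measure nu (n := n)]_v F v.
Proof.
move=> pnu; rewrite /repeatP => n; move: (0%N) => m; elim: n m => [|n IH] m F mF F0.
  exact: esym (integral_power_measure0 nu (fun v => F v)).
rewrite integral_power_measureS//.
have mx x : measurable_fun setT (fun v : n.-tuple X => F (x :: v)).
  apply: (@measurableT_comp _ _ _ _ _ _ (fun w : n.+1.-tuple X => F w) _ (fun v : n.-tuple X => [tuple of x :: v])) => //.
  by apply: measurable_cons.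
have e : (fun x => E (Defs.mapP (fun=> p) (iota m.+1 n)) (fun l => F (x :: l))) =
    fun x => \int[power_measure nu (n := n)]_v F (x :: v).
  by apply/funext => x; rewrite (IH m.+1 (fun l => F (x :: l))).
rewrite [LHS](_ : _ = E p (fun x => \int[power_measure nu (n := n)]_v F (x :: v))); last by rewrite -e.
rewrite pnu//; last by move=> x; apply: integral_ge0 => v _.
apply: (@measurable_fun_fubini_tonelli_F _ _ _ _ _ (power_measure nu (n := n)) (fun q => F (tcons q))) => //.
apply: (@measurableT_comp _ _ _ _ _ _ (fun w : n.+1.-tuple X => F w)) => //.
exact: measurable_tcons.
Qed.

Definition means (us : seq 'rV[R]_d) := map mu us.
Definition covs (us : seq 'rV[R]_d) := map (fun s => map (C s) us) us.
Definition sdevs (us : seq 'rV[R]_d) := map (fun t => Num.sqrt (C t t)) us.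
Definition thresholds (g : R) us :=
  map (fun p : R * R => (g - p.1) / p.2)%R (zip (means us) (sdevs us)).
Definition tails (g : R) us := map (fun x => 1 - Phi x)%R (thresholds g us).

Definition gauss_values (ms : seq R) (Cs : seq (seq R)) (zs : seq R) : seq R :=
  map (fun p : R * seq R => p.1 + dot p.2 zs)%R (zip ms (chol Cs)).

Definition update (g : R) (Cs : seq (seq R)) (total : R) (i : nat) (xi : R) (Y : seq R) : R :=
  let k := ((xi - Y`_i) / (nth [::] Cs i)`_i)%R in
  let X := map (fun p : R * R => p.1 * k + p.2)%R (zip (nth [::] Cs i) Y) in
  (total / foldl (fun n x => if (x <= g)%R then n else (n + 1)%R) 0%R X)%R.

(** The part of [replication] after the index [i] and the normal variable [z] are drawn. With
    [estimate] it cuts the program at its random choices, so that each can be integrated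
    separately. *)
Definition conditional (g : R) (ms : seq R) (Cs : seq (seq R)) (sds : seq R) (total : R)
    (i : nat) (z : R) : prog R := (
  sz <-- Mul (nth 0%R sds i) z ;
  xi <-- Add (nth 0%R ms i) sz ;
  Y <-- gauss_vector ms Cs ;
  delta <-- Defs.Sub xi (nth 0%R Y i) ;
  k <-- Div delta (nth 0%R (nth [::] Cs i) i) ;
  X <-- Defs.mapP (fun p => t <-- Mul p.1 k ; Add p.2 t) (zip (nth [::] Cs i) Y) ;
  N <-- foldP (fun x n => below <-- Leq x g ; if below then Ret n else Add n 1%R)
        0%R X ;
  Div total N)%prog.

Definition estimate (g : R) (us : seq 'rV[R]_d) : prog R := (
  ms <-- Defs.mapP Mean us ;
  Cs <-- Defs.mapP (fun s => Defs.mapP (fun t => Cov s t) us) us ;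
  sds <-- Defs.mapP (fun t => c <-- Cov t t ; Sqrt c) us ;
  xs <-- Defs.mapP (fun p => y <-- Defs.Sub g p.1 ; Div y p.2) (zip ms sds) ;
  ps <-- Defs.mapP upper_tail xs ;
  total <-- sumP ps ;
  i <-- pick_index ps total ;
  z <-- gauss_above (nth 0%R xs i) ;
  conditional g ms Cs sds total i z)%prog.

Lemma replicationE a b M : replication a b M = (
  q <-- Div a b ; g <-- Defs.Sub b q ; us <-- repeatP M Defs.Uniform ; estimate g us)%prog.
Proof. by []. Qed.

Lemma returns_means us : returns (Defs.mapP Mean us) (means us) (size us) (size us).
Proof. by rewrite -(muln1 (size us)); apply: returns_mapP => t; exact: returns_Mean. Qed.

Lemma returns_covs us : returns (Defs.mapP (fun s => Defs.mapP (fun t => Cov s t) us) us) (covs us)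
  (size us * size us) (size us * size us).
Proof.
apply: returns_mapP => s; rewrite -{1 2}(muln1 (size us)).
by apply: returns_mapP => t; exact: returns_Cov.
Qed.

Lemma returns_sdevs us : returns (Defs.mapP (fun t => c <-- Cov t t ; Sqrt c)%prog us) (sdevs us)
  (size us * 2) (size us * 2).
Proof.
apply: returns_mapP => t.
by apply: (returns_Bind (returns_Cov _ _ _ _ _)); exact: returns_Sqrt.
Qed.

Lemma size_means us : size (means us) = size us. Proof. exact: size_map. Qed.
Lemma size_sdevs us : size (sdevs us) = size us. Proof. exact: size_map. Qed.
Lemma size_covs us : size (covs us) = size us. Proof. exact: size_map. Qed.
Lemma size_thresholds g us : size (thresholds g us) = size us.
Proof. by rewrite size_map size_zip size_means size_sdevs minnn. Qed.

Lemma size_covs_row us i : (i < size us)%N -> size (nth [::] (covs us) i) = size us.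
Proof. by move=> iM; rewrite (nth_map 0%R)// size_map. Qed.

Lemma returns_thresholds g us :
  returns (Defs.mapP (fun p => y <-- Defs.Sub g p.1 ; Div y p.2)%prog (zip (means us) (sdevs us)))
    (thresholds g us) (size us * 2) (size us * 2).
Proof.
have -> : size us = size (zip (means us) (sdevs us)) by rewrite size_zip size_means size_sdevs minnn.
apply: returns_mapP => p.
by apply: (returns_Bind (returns_Sub _ _ _ _ _)); exact: returns_Div.
Qed.

Lemma returns_tails g us :
  returns (Defs.mapP upper_tail (thresholds g us)) (tails g us) (size us * 3) (size us * 3).
Proof.
by rewrite -(size_thresholds g us); apply: returns_mapP => x; exact: returns_upper_tail.
Qed.

Lemma returns_gauss_values ms Cs zs :
  returns (Defs.mapP (fun p => s <-- dotP p.2 zs ; Add p.1 s)%prog (zip ms (chol Cs)))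
    (gauss_values ms Cs zs) 0 (size ms * (size zs * 2 + 1)).
Proof.
have h : returns (Defs.mapP (fun p => s <-- dotP p.2 zs ; Add p.1 s)%prog (zip ms (chol Cs)))
    (gauss_values ms Cs zs) (size (zip ms (chol Cs)) * 0)
    (size (zip ms (chol Cs)) * (size zs * 2 + 1)).
  apply: returns_mapP => p.
  have hd := returns_Bind (k := Add p.1) (returns_dotP T mu C p.2 zs) (returns_Add T mu C p.1 (dot p.2 zs)).
  by apply: (returns_le hd) => //; rewrite leq_add2r leq_mul2r geq_minr.
apply: (returns_le h) => //.
by rewrite leq_mul2r size_zip geq_minl orbT.
Qed.

Lemma returns_update g Cs total i xi Y :
  returns (delta <-- Defs.Sub xi (nth 0%R Y i) ;
    k <-- Div delta (nth 0%R (nth [::] Cs i) i) ;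
    X <-- Defs.mapP (fun p => t <-- Mul p.1 k ; Add p.2 t) (zip (nth [::] Cs i) Y) ;
    N <-- foldP (fun x n => below <-- Leq x g ; if below then Ret n else Add n 1%R) 0%R X ;
    Div total N)%prog
  (update g Cs total i xi Y) 0 (3 + size Y * 4).
Proof.
pose k := ((xi - Y`_i) / (nth [::] Cs i)`_i)%R.
pose z := zip (nth [::] Cs i) Y.
pose X := map (fun p : R * R => p.1 * k + p.2)%R z.
have sz : (size z <= size Y)%N by rewrite size_zip geq_minr.
have sX : size X = size z by rewrite size_map.
apply: (@returns_le _ _ _ _ _ _ _ _ (1 + (1 + (size z * 2 + (size X * 0 + 1))))
  (1 + (1 + (size z * 2 + (size X * 2 + 1))))) => //; last by rewrite sX; lia.
apply: (returns_Bind (returns_Sub _ _ _ _ _)).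
apply: (returns_Bind (returns_Div _ _ _ _ _)); rewrite -/k -/z.
apply: (returns_Bind (a := X)).
  apply: returns_mapP => p; rewrite addrC.
  by apply: (returns_Bind (returns_Mul _ _ _ _ _)); exact: returns_Add.
apply: (returns_Bind (a := foldl (fun n x => if (x <= g)%R then n else (n + 1)%R) 0%R X)); last exact: returns_Div.
apply: returns_foldl => x n.
apply: (@returns_le _ _ _ _ _ _ _ _ (1 + 0) (1 + 1)) => //.
apply: (returns_Bind (returns_Leq _ _ _ _ _)).
case: ifP => _; first exact: returns_le (returns_Ret _ _ _ _) _ _.
exact: returns_le (returns_Add _ _ _ _ _) _ _.
Qed.

Lemma expect_conditional g us total i z h : 
  let M := size us in
  let F zs := h (update g (covs us) total i ((means us)`_i + (sdevs us)`_i * z)%R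
    (gauss_values (means us) (covs us) zs)) in
  measurable_fun setT (fun v : M.-tuple R => F v) -> (forall y, 0 <= h y) ->
  E (conditional g (means us) (covs us) (sdevs us) total i z) h = \int[gsn M]_v F v.
Proof.
move=> M F mF h0; rewrite -(@expect_repeat _ _ gs Gauss _ M F)//; last by move=> l; exact: h0.
rewrite /conditional (expect_returns _ _ (returns_Mul _ _ _ _ _)).
rewrite (expect_returns _ _ (returns_Add _ _ _ _ _)).
have rc : returns (cholesky (covs us)) (chol (covs us)) (\sum_(i < size (covs us)) i.+1 * i.+2) (7 * size (covs us) ^ 3).
  by apply: returns_cholesky => j; rewrite size_covs => jM; exact: size_covs_row.
rewrite [LHS]/= (proj1 rc) size_means; congr (E _ _); apply/funext => zs.
have [-> _] := returns_gauss_values (means us) (covs us) zs.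
have [hu _] := returns_update g (covs us) total i ((means us)`_i + (sdevs us)`_i * z)%R
  (gauss_values (means us) (covs us) zs).
exact: hu.
Qed.

Lemma expect_estimate g us h :
  let total := (\sum_(x <- tails g us) x)%R in
  E (estimate g us) h = E (pick_index (tails g us) total) (fun i =>
    E (gauss_above (thresholds g us)`_i) (fun z =>
      E (conditional g (means us) (covs us) (sdevs us) total i z) h)).
Proof.
rewrite /estimate (expect_returns _ _ (returns_means us)).
rewrite (expect_returns _ _ (returns_covs us)) (expect_returns _ _ (returns_sdevs us)).
rewrite (expect_returns _ _ (returns_thresholds g us)) (expect_returns _ _ (returns_tails g us)).
by rewrite (expect_returns _ _ (returns_sumP _ _ _ _)).
Qed.

End estimate.

Section field_estimate.
Context (R : realType) (disp : measure_display) (Omega : measurableType disp).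
Context (P : probability Omega R) (d : nat) (T : set 'rV[R]_d).
Context (f : 'rV[R]_d -> {RV P >-> R}).
Hypothesis gaussf : gaussian_field T f.
Hypothesis hvar : forall t, T t -> 0 < cov f t t.
Hypothesis mT : measurable T.
Hypotheses (Tn0 : lebesgue_rV T != 0%E) (Tfin : lebesgue_rV T \is a fin_num).
Local Notation mu := (mean f).
Local Notation C := (cov f).
Local Notation E := (expect T mu C).
Local Notation gs := (@std_normal R).
Local Notation gsn n := (power_measure gs (n := n)).
Local Notation Phi := (@Phi_normal R).
Local Open Scope ereal_scope.

Lemma tail_field_law g t : T t ->
  P [set omega | g < f t omega]%R = (1 - Phi ((g - mu t) / sdev f t))%:E.
Proof.
move=> Tt; have s0 : (0 < sdev f t)%R by exact: sdev_gt0 hvar _ Tt.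
have := field_law gaussf Tt (measurable_itv `]g, +oo[); rewrite normal_lawE//.
have -> : [set omega | `]g, +oo[%classic (f t omega)] = [set omega | g < f t omega]%R.
  by apply/seteqP; split => w /=; rewrite in_itv/= andbT.
move=> ->; rewrite -std_normal_tailE; congr (std_normal _); apply/seteqP.
by split => z /=; rewrite !in_itv/= !andbT ltr_pdivrMr// [(z * _)%R]mulrC ltrBlDl.
Qed.

Definition hits M (g : R) (x : M.-tuple R) : R := (\sum_(j < M) (g < tnth x j)%R%:R)%R.

Lemma measurable_gt_indicator (g : R) : measurable_fun setT (fun x : R => (g < x)%R%:R : R).
Proof.
rewrite (_ : (fun x : R => _) = \1_`]g, +oo[%classic); first exact: measurable_indic.
by apply/funext => x; rewrite indicE mem_setE in_itv/= andbT.
Qed.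

Lemma measurable_hits M g : measurable_fun setT (@hits M g).
Proof.
apply: measurable_sum => j.
apply: (@measurableT_comp _ _ _ _ _ _ (fun x : R => (g < x)%R%:R : R)).
  exact: measurable_gt_indicator.
exact: measurable_tnth.
Qed.

Lemma foldl_count (g : R) (X : seq R) :
  foldl (fun n x => if (x <= g)%R then n else (n + 1)%R) 0%R X =
  (\sum_(x <- X) (g < x)%R%:R)%R :> R.
Proof.
rewrite -[RHS]add0r -(foldl_sum (fun x => (g < x)%R%:R)%R); congr (foldl _ _ _).
by apply/funext => n; apply/funext => x; rewrite ltNge; case: ifP => _; rewrite ?addr0.
Qed.

Section fixed_points.
Variables (M : nat) (u : M.-tuple 'rV[R]_d).
Hypothesis Tu : points T u.
Local Notation Cu j l := (C (tnth u j) (tnth u l)).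

Let su : size u = M. Proof. exact: size_tuple. Qed.

Let nth_u (j : 'I_M) : nth 0%R u j = tnth u j.
Proof. by rewrite (tnth_nth 0%R). Qed.

Let A (j k : nat) : R := mat_entry (chol (covs C u)) j k.

Let chol_u : is_chol (fun i j => C (nth 0%R u i) (nth 0%R u j)) (chol (covs C u)) M.
Proof.
have sc : size (covs C u) = M by rewrite size_covs su.
have := @cholP R (covs C u) (fun i j => C (nth 0%R u i) (nth 0%R u j)) _ _ _ _ _ (leqnn _).
rewrite take_size sc; apply.
- by move=> i j; rewrite covC.
- move=> a; have := comb_var_ge0 gaussf (fun i : 'I_M => a i) Tu.
  rewrite /comb_var; congr (_ <= _)%R; apply: eq_bigr => i _; apply: eq_bigr => j _.
  by rewrite !nth_u.
- by move=> i iM; rewrite size_covs_row ?su.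
- by move=> i j iM jM; rewrite /mat_entry (nth_map 0%R) ?su// (nth_map 0%R) ?su.
Qed.

Let A_gram (j l : 'I_M) : (\sum_(k < M) A j k * A l k)%R = Cu j l.
Proof. by have [_ _ _ h] := chol_u; rewrite h// !nth_u. Qed.

(** Coefficients of the updated vector in M + 1 independent normals: column 0 belongs to the
    variable [z] drawn for coordinate i, the others to the normals of the Cholesky sample. *)
Let B (i j : 'I_M) (k : 'I_M.+1) : R :=
  if unlift ord0 k is Some k' then (A j k' - Cu i j / Cu i i * A i k')%R
  else (Cu i j / Cu i i * Num.sqrt (Cu i i))%R.

Let V i := affine_tuple (fun j => mu (tnth u j)) (B i).

Let Ci0 i : (0 < Cu i i)%R. Proof. exact/hvar/Tu. Qed.

Let B_gram (i j l : 'I_M) : (\sum_(k < M.+1) B i j k * B i l k)%R = Cu j l.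
Proof.
apply: (conditioned_gram (C := fun j l => Cu j l) (A := fun j k => A j k)) => //.
- by rewrite gt_eqF.
- exact: ltW.
- by move=> j' l'; rewrite covC.
Qed.

Let gauss_valuesE (j : 'I_M) (v : M.-tuple R) :
  (gauss_values (means mu u) (covs C u) v)`_j =
  (mu (tnth u j) + \sum_(k < M) A j k * tnth v k)%R.
Proof.
have [sL rL _ _] := chol_u; have [sj _] := rL j (ltn_ord j).
have sz : size (zip (means mu u) (chol (covs C u))) = M.
  by rewrite size_zip sL size_means su minnn.
rewrite /gauss_values (nth_map (0%R, [::])) ?sz// nth_zip_cond sz ltn_ord /=.
rewrite (nth_map 0%R) ?su// nth_u (@dotE _ _ _ M); last by rewrite sj.
by congr (_ + _)%R; apply: eq_bigr => k _; rewrite (tnth_nth 0%R).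
Qed.

Let V_cons (i j : 'I_M) (z : R) (v : M.-tuple R) :
  tnth (V i [tuple of z :: v]) j =
  (mu (tnth u j) + \sum_(k < M) A j k * tnth v k +
   Cu i j / Cu i i * (Num.sqrt (Cu i i) * z - \sum_(k < M) A i k * tnth v k))%R.
Proof.
rewrite tnth_mktuple big_ord_recl tnth0 /B unlift_none.
set r := (Cu i j / Cu i i)%R.
have -> : (\sum_(k < M) match unlift ord0 (lift ord0 k) with
    | Some k' => A j k' - r * A i k' | None => r * Num.sqrt (Cu i i) end * tnth [tuple of z :: v] (lift ord0 k)
   = \sum_(k < M) A j k * tnth v k - r * \sum_(k < M) A i k * tnth v k)%R.
  rewrite mulr_sumr -sumrB; apply: eq_bigr => k _.
  by rewrite liftK tnthS mulrBl mulrA.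
by ring.
Qed.

(** The drawn coordinate survives the update, so the condition that [z] lies above its threshold
    reads X_i > g. *)
Let V_self (i : 'I_M) (z : R) (v : M.-tuple R) :
  tnth (V i [tuple of z :: v]) i = (mu (tnth u i) + Num.sqrt (Cu i i) * z)%R.
Proof. by rewrite V_cons divff ?gt_eqF// mul1r addrACA subrr addr0. Qed.


Let updateE (g total : R) (i : 'I_M) (z : R) (v : M.-tuple R) :
  update g (covs C u) total i ((means mu u)`_i + (sdevs C u)`_i * z)%R
    (gauss_values (means mu u) (covs C u) v) =
  (total / hits g (V i [tuple of z :: v]))%R.
Proof.
rewrite /update foldl_count; congr (_ / _)%R.
set Y := gauss_values _ _ _.
have [sL _ _ _] := chol_u.
have sY : size Y = M by rewrite size_map size_zip sL size_means su minnn.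
have sr : size (nth [::] (covs C u) i) = M by rewrite size_covs_row ?su.
have Cij (j : 'I_M) : (nth [::] (covs C u) i)`_j = Cu i j.
  by rewrite (nth_map 0%R) ?su// (nth_map 0%R) ?su// !nth_u.
rewrite big_map (big_nth (0%R, 0%R)) size_zip sr sY minnn big_mkord.
apply: eq_bigr => j _; congr ((g < _)%R%:R).
rewrite nth_zip_cond size_zip sr sY minnn ltn_ord /= !Cij !gauss_valuesE V_cons.
rewrite (nth_map 0%R) ?su// (nth_map 0%R) ?su// !nth_u.
rewrite [LHS]addrC; congr (_ + _)%R.
set s := (\sum_(k < M) _)%R; by ring.
Qed.

Let thresholdE g (i : 'I_M) :
  (thresholds mu C g u)`_i = ((g - mu (tnth u i)) / sdev f (tnth u i))%R.
Proof.
have sz : size (zip (means mu u) (sdevs C u)) = M by rewrite size_zip size_means size_sdevs su minnn.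
rewrite (nth_map (0%R, 0%R)) ?sz// nth_zip_cond sz ltn_ord /=.
by rewrite (nth_map 0%R) ?su// (nth_map 0%R) ?su// nth_u.
Qed.

Let tailE g (i : 'I_M) : (tails mu C g u)`_i = ptail f g u i.
Proof.
by rewrite (nth_map 0%R) ?size_thresholds ?su// thresholdE /ptail tail_field_law//.
Qed.

Lemma ptail_gt0 g (i : 'I_M) : (0 < ptail f g u i)%R.
Proof.
rewrite /ptail tail_field_law; last exact: Tu.
by rewrite subr_gt0 Phi_lt1.
Qed.

Let size_tails g : size (tails mu C g u) = M.
Proof. by rewrite size_map size_thresholds su. Qed.

Let sum_tails g : (\sum_(x <- tails mu C g u) x = \sum_(i < M) ptail f g u i)%R.
Proof.
rewrite (big_nth 0%R) size_tails big_mkord.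
by apply: eq_bigr => i _; exact: tailE.
Qed.

(** The index i is drawn with weight [ptail] over the sum of tails, and conditioning [z] divides by
    the same [ptail]: the two cancel. With [z] unconditioned the vector has the law of f at [u], so
    the conditioning survives as the indicator of f(u_i) > g. *)
Lemma expect_estimate_field (g : R) (h : R -> \bar R) : (0 < M)%N ->
  measurable_fun setT h -> (forall y, 0 <= h y) ->
  E (estimate g u) h = ((\sum_(i < M) ptail f g u i)^-1)%:E *
    \sum_(i < M) \int[P]_omega ((g < f (tnth u i) omega)%R%:R%:E * h (Lb f g u (Xat f u omega))).
Proof.
move=> M0 mh h0; pose S := (\sum_(i < M) ptail f g u i)%R.
have S0 : (0 < S)%R.
  rewrite /S (bigD1 (Ordinal M0))//=; apply: ltr_pwDl; first exact: ptail_gt0.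
  by apply: sumr_ge0 => i _; exact/ltW/ptail_gt0.
rewrite expect_estimate expect_pick_index; first last.
- move=> i; do 2! apply: (expect_ge0 _ _ mT Tn0 Tfin) => ?; exact: h0.
- by rewrite size_tails.
- apply/allP => x /(nthP 0%R)[i]; rewrite size_tails => iM <-.
  by rewrite (tailE g (Ordinal iM)) ptail_gt0.
rewrite !sum_tails size_tails -/S ge0_sume_distrr; last first.
  move=> i _; apply: integral_ge0 => omega _; apply: mule_ge0 => //.
apply: eq_bigr => i _; rewrite tailE.
pose hh (x : M.-tuple R) := h (S / hits g x)%R.
have mhh : measurable_fun setT hh.
  apply: measurableT_comp => //.
  have e : (fun x : M.-tuple R => S / hits g x)%R = (fun x => S * (hits g x) `^ (- 1))%R.
    by apply/funext => x; rewrite powR_inv1//; apply: sumr_ge0 => j _; rewrite ler0n.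
  rewrite e; apply: measurable_funM; first exact: measurable_cst.
  exact: (measurableT_comp (@measurable_powR R (- 1)%R) (@measurable_hits M g)).
have mV : measurable_fun setT (V i) by exact: measurable_affine_tuples.
have mhV : measurable_fun setT (fun w => hh (V i w)) by exact: measurableT_comp.
have mcons z : measurable_fun setT (fun v : M.-tuple R => hh (V i [tuple of z :: v])).
  apply: (@measurableT_comp _ _ _ _ _ _ (fun w => hh (V i w)) _ (fun v : M.-tuple R => [tuple of z :: v])) => //.
  by apply: measurable_cons.
pose G z := \int[gsn M]_v hh (V i [tuple of z :: v]).
have mG : measurable_fun setT G.
  apply: (@measurable_fun_fubini_tonelli_F _ _ _ _ _ (gsn M) (fun p => hh (V i (tcons p)))).
    exact: (measurableT_comp mhV (@measurable_tcons _ _ M)).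
  by move=> p; exact: h0.
have G0 z : 0 <= G z by apply: integral_ge0 => v _; exact: h0.
have -> : (fun z => E (conditional d g (means mu u) (covs C u) (sdevs C u) S i z) h) = G.
  apply/funext => z.
  have e (v : M.-tuple R) : h (update g (covs C u) S i ((means mu u)`_i + (sdevs C u)`_i * z)%R
    (gauss_values (means mu u) (covs C u) v)) = hh (V i [tuple of z :: v]).
    by rewrite updateE.
  have := @expect_conditional R d T mu C g u S i z h; rewrite su /= => -> //.
    by apply: eq_integral => v _; exact: e.
  by rewrite (_ : (fun v => _) = fun v : M.-tuple R => hh (V i [tuple of z :: v]))//; apply/funext => v; exact: e.
rewrite expect_gauss_above// -/(ptail f g u i) thresholdE.
set x := ((g - _) / _)%R.
have px : (1 - Phi x)%R = ptail f g u i by rewrite /ptail tail_field_law//; exact: Tu.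
rewrite px muleA -EFinM (_ : ptail f g u i / S / ptail f g u i = S^-1)%R; last first.
  by rewrite mulrAC divff ?mul1r// gt_eqF// ptail_gt0.
congr (_ * _).
pose H (y : M.-tuple R) := (g < tnth y i)%R%:R%:E * hh y.
have mH : measurable_fun setT H.
  apply: emeasurable_funM => //; apply/measurable_EFinP.
  apply: (@measurableT_comp _ _ _ _ _ _ (fun x : R => (g < x)%R%:R : R)).
    exact: measurable_gt_indicator.
  exact: measurable_tnth.
have H0 y : 0 <= H y by rewrite mule_ge0// h0.
transitivity (\int[gsn M.+1]_w H (V i w)).
  have mHV : measurable_fun setT (fun w => H (V i w)) by exact: measurableT_comp.
  rewrite (@integral_power_measureS _ _ _ gs M (fun w => H (V i w)) mHV); last by move=> w; exact: H0.
  rewrite integral_mkcond; apply: eq_integral => z _; rewrite patchE.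
  have sd0 : (0 < sdev f (tnth u i))%R by exact: sdev_gt0 hvar _ (Tu i).
  have e (v : M.-tuple R) : H (V i [tuple of z :: v]) = (x < z)%R%:R%:E * hh (V i [tuple of z :: v]).
    rewrite /H V_self; congr (_%:R%:E * _).
    by rewrite /x ltr_pdivrMr// [(z * _)%R]mulrC ltrBlDl.
  under [RHS]eq_integral do rewrite e.
  rewrite mem_setE in_itv/= andbT; case: ifP => _.
    by apply: eq_integral => v _; rewrite mul1e.
  by rewrite integral0_eq// => v _; rewrite mul0e.
rewrite (affine_normal_law gaussf Tu (B_gram i) mH H0).
by apply: eq_integral => omega _; rewrite /H tnth_mktuple.
Qed.

End fixed_points.

End field_estimate.

Lemma measure_indic (R : realType) d (X : measurableType d) (mu : {measure set X -> \bar R})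
    (A : set X) : measurable A -> mu A = (\int[mu]_x (\1_A x)%:E)%E.
Proof. by move=> mA; rewrite integral_indic// setIT. Qed.

(** * Averaging over random points *)

Section replication_law.
Context (R : realType) (disp : measure_display) (Omega : measurableType disp).
Context (P : probability Omega R) (d : nat) (hd : (0 < d)%N) (T : set 'rV[R]_d).
Context (f : 'rV[R]_d -> {RV P >-> R}) (N : nat) (G : set Omega).
Hypothesis T0 : T !=set0.
Hypothesis cT : compact T.
Hypothesis TN : forall x, T x -> forall j, (`|x ord0 j| <= N%:R)%R.
Hypothesis mG : measurable G.
Hypothesis PG : P (~` G) = 0%E.
Hypothesis Gc : forall omega, G omega ->
  {within T, continuous (fun t => f t omega : R)}.
Hypothesis mT : measurable T.
Hypotheses (Tn0 : lebesgue_rV T != 0%E) (Tfin : lebesgue_rV T \is a fin_num).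
Hypothesis gaussf : gaussian_field T f.
Hypothesis hvar : forall t, T t -> 0 < cov f t t.
Local Notation U := (uniform_law mT Tn0 Tfin).
Local Notation Um M := (power_measure U (n := M)).
Local Notation mu := (mean f).
Local Notation C := (cov f).
Local Notation E := (expect T mu C).
Local Open Scope ereal_scope.

Lemma points_cons M (x : 'rV[R]_d) (v : M.-tuple 'rV[R]_d) : T x ->
  ([tuple of x :: v] \in @points R d T M.+1) = (v \in @points R d T M).
Proof.
move=> Tx; apply/idP/idP => /set_mem h; apply/mem_set => i.
  by have := h (lift ord0 i); rewrite tnthS.
by case: (unliftP ord0 i) => [j ->|->]; [rewrite tnthS; exact: h|rewrite tnth0].
Qed.

Lemma points_consN M (x : 'rV[R]_d) (v : M.-tuple 'rV[R]_d) : ~ T x ->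
  ([tuple of x :: v] \in @points R d T M.+1) = false.
Proof.
by move=> nTx; apply/negP => /set_mem h; apply: nTx; have := h ord0; rewrite tnth0.
Qed.

(** Each draw integrates over [T] only, which restricts the tuple to [points T]. Measurability is
    asked of the restricted function, because nothing constrains the field outside [T]. *)
Lemma expect_repeat_Uniform M (F : seq 'rV[R]_d -> \bar R) :
  measurable_fun setT ((fun u : M.-tuple 'rV[R]_d => F u) \_ (@points R d T M)) ->
  (forall l, 0 <= F l) ->
  E (repeatP M Defs.Uniform) F = \int[Um M]_(u in @points R d T M) F u.
Proof.
suff : forall m (F : seq 'rV[R]_d -> \bar R),
    measurable_fun setT ((fun u : M.-tuple 'rV[R]_d => F u) \_ (@points R d T M)) ->
    (forall l, 0 <= F l) ->
    E (Defs.mapP (fun=> Defs.Uniform) (iota m M)) F = \int[Um M]_(u in @points R d T M) F u.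
  exact.
elim: M {F} => [|n IH] m F mF F0.
  rewrite integral_mkcond; apply/esym.
  apply: etrans (integral_power_measure0 U _) _.
  by rewrite patchE mem_set// => -[].
rewrite [RHS]integral_mkcond.
rewrite (@integral_power_measureS _ _ _ U n _ mF); last by move=> u; exact: erestrict_ge0.
transitivity (\int[U]_(x in T) E (Defs.mapP (fun=> Defs.Uniform) (iota m.+1 n)) (fun l => F (x :: l))).
  by [].
rewrite [LHS]integral_mkcond; apply: eq_integral => x _; rewrite patchE.
have [Tx|nTx] := pselect (T x); last first.
  rewrite memNset// integral0_eq// => v _; by rewrite patchE points_consN.
rewrite mem_set//.
have e : (fun v : n.-tuple 'rV[R]_d => ((fun u : n.+1.-tuple 'rV[R]_d => F u) \_ (@points R d T n.+1)) [tuple of x :: v])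
   = (fun v : n.-tuple 'rV[R]_d => F (x :: v)) \_ (@points R d T n).
  by apply/funext => v; rewrite !patchE points_cons.
rewrite e -integral_mkcond; apply: IH => //.
rewrite -e; apply: (measurableT_comp mF).
by apply: measurable_cons.
Qed.

Section weight.
Variables (M : nat) (g : R).
Hypothesis M0 : (0 < M)%N.
Local Notation X := (good_vector T f G (M := M)).

(** An integral of [good_vector] instead of a sum of [ptail]: Fubini makes it measurable in [u], and
    the two agree when the points lie in [T]. *)
Definition tail_sum (u : M.-tuple 'rV[R]_d) : R :=
  fine (\int[P]_omega (hits g (X (u, omega)))%:E).

Let mX : measurable_fun setT X. Proof. exact: measurable_good_vector T0 cT TN mG Gc M. Qed.

Let mhX : measurable_fun setT (fun p => hits g (X p)).
Proof. by apply: measurableT_comp => //; exact: measurable_hits. Qed.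

Let hits_ge0 (x : M.-tuple R) : (0 <= hits g x)%R.
Proof. by apply: sumr_ge0 => j _; rewrite ler0n. Qed.

Lemma tail_sumE u : points T u -> tail_sum u = (\sum_(i < M) ptail f g u i)%R.
Proof.
move=> Tu; rewrite /tail_sum -(integral_Xat_good T0 cT TN mG PG Gc (h := fun x => (hits g x)%:E))//; last first.
  by apply/measurable_EFinP; exact: measurable_hits.
under eq_integral do rewrite /hits -sumEFin.
rewrite ge0_integral_sum//; last first.
  move=> i; apply/measurable_EFinP; apply: (@measurableT_comp _ _ _ _ _ _ (fun x : R => (g < x)%R%:R : R)).
    exact: measurable_gt_indicator.
  by apply: (@measurableT_comp _ _ _ _ _ _ (fun x : M.-tuple R => tnth x i)); [exact: measurable_tnth|exact: measurable_Xat].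
have e i : \int[P]_omega ((g < tnth (Xat f u omega) i)%R%:R)%:E = (ptail f g u i)%:E.
  have mA := measurable_above f (tnth u i) g.
  rewrite /ptail fineK; last by rewrite fin_num_measure.
  transitivity (\int[P]_omega (\1_[set omega | g < f (tnth u i) omega]%R omega)%:E).
    by apply: eq_integral => omega _; rewrite indicE mem_setE tnth_mktuple.
  by rewrite integral_indic// setIT.
by under eq_bigr do rewrite e; rewrite sumEFin.
Qed.

Lemma measurable_tail_sum : measurable_fun setT tail_sum.
Proof.
apply: (@measurableT_comp _ _ _ _ _ _ (@fine R)); first exact: fine_measurable.
apply: (@measurable_fun_fubini_tonelli_F _ _ _ _ _ P (fun p => (hits g (X p))%:E)).
  exact/measurable_EFinP.
by move=> p; rewrite lee_fin.
Qed.

Let tail_sum_ge0 u : (0 <= tail_sum u)%R.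
Proof. by rewrite fine_ge0// integral_ge0// => omega _; rewrite lee_fin. Qed.

(* The powers with exponent -1 are inverses, written so as to be measurable. *)
Definition weight (p : M.-tuple 'rV[R]_d * Omega) : R :=
  (\1_(@points R d T M) p.1 * (tail_sum p.1 `^ (- 1) * hits g (X p)))%R.

Definition estimator (p : M.-tuple 'rV[R]_d * Omega) : R :=
  (tail_sum p.1 * hits g (X p) `^ (- 1))%R.

Let mpoints : measurable (@points R d T M).
Proof. exact: (@measurable_points _ _ _ _ cT TN M). Qed.

Lemma measurable_weight : measurable_fun setT weight.
Proof.
apply: measurable_funM.
  by apply: measurableT_comp => //; exact: measurable_indic.
apply: measurable_funM => //.
apply: (measurableT_comp (@measurable_powR R (- 1)%R)).
by apply: measurableT_comp => //; exact: measurable_tail_sum.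
Qed.

Lemma weight_ge0 p : (0 <= weight p)%R.
Proof. by rewrite mulr_ge0// mulr_ge0// powR_ge0. Qed.

Lemma measurable_estimator : measurable_fun setT estimator.
Proof.
apply: measurable_funM.
  by apply: measurableT_comp => //; exact: measurable_tail_sum.
exact: (measurableT_comp (@measurable_powR R (- 1)%R)).
Qed.

Lemma estimator_ge0 p : (0 <= estimator p)%R.
Proof. by rewrite mulr_ge0// powR_ge0. Qed.

Lemma measurable_Lb (u : M.-tuple 'rV[R]_d) :
  measurable_fun setT (fun omega => Lb f g u (Xat f u omega)).
Proof.
rewrite (_ : (fun omega => _) = fun omega =>
    ((\sum_(i < M) ptail f g u i) * (hits g (Xat f u omega)) `^ (- 1))%R); last first.
  by apply/funext => omega; rewrite powR_inv1.
apply: measurable_funM; first exact: measurable_cst.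
apply: (measurableT_comp (@measurable_powR R (- 1)%R)).
by apply: (measurableT_comp (@measurable_hits R M g)); exact: measurable_Xat.
Qed.

Section expectation.
Variables (h : R -> \bar R) (mh : measurable_fun setT h) (h0 : forall y, 0 <= h y).

Let K u := \int[P]_omega ((weight (u, omega))%:E * h (estimator (u, omega))).

Let mWh : measurable_fun setT (fun p => (weight p)%:E * h (estimator p)).
Proof.
apply: emeasurable_funM; first by apply/measurable_EFinP; exact: measurable_weight.
by apply: measurableT_comp => //; exact: measurable_estimator.
Qed.

Let Wh0 p : 0 <= (weight p)%:E * h (estimator p).
Proof. by rewrite mule_ge0// lee_fin weight_ge0. Qed.

Let K_estimate u : points T u -> K u = E (estimate g u) h.
Proof.
move=> Tu; rewrite (expect_estimate_field gaussf hvar mT Tn0 Tfin Tu)//.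
pose S := (\sum_(i < M) ptail f g u i)%R.
pose H (x : M.-tuple R) := (S^-1 * hits g x)%:E * h (S * (hits g x) `^ (- 1))%R.
have S0 : (0 <= S)%R by rewrite /S -tail_sumE.
have mhitsV : measurable_fun setT (fun x : M.-tuple R => (hits g x) `^ (- 1))%R.
  by apply: (measurableT_comp (@measurable_powR R (- 1)%R)); exact: measurable_hits.
have mH : measurable_fun setT H.
  apply: emeasurable_funM.
    by apply/measurable_EFinP; apply: measurable_funM => //; exact: measurable_hits.
  by apply: measurableT_comp => //; exact: measurable_funM.
have H0 x : 0 <= H x by rewrite mule_ge0// lee_fin mulr_ge0// invr_ge0.
transitivity (\int[P]_omega H (X (u, omega))).
  apply: eq_integral => omega _; rewrite /weight /estimator /= indicE mem_set// mul1r.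
  by rewrite powR_inv1 ?tail_sum_ge0// tail_sumE.
rewrite -(integral_Xat_good T0 cT TN mG PG Gc mH H0 Tu).
have mX1 i : measurable_fun setT (fun omega => tnth (Xat f u omega) i).
  by apply: (@measurableT_comp _ _ _ _ _ _ (fun x : M.-tuple R => tnth x i)); [exact: measurable_tnth|exact: measurable_Xat].
have mLb : measurable_fun setT (fun omega => h (Lb f g u (Xat f u omega))).
  by apply: (measurableT_comp mh); exact: measurable_Lb.
have mi i : measurable_fun setT (fun omega => (g < f (tnth u i) omega)%R%:R%:E * h (Lb f g u (Xat f u omega))).
  apply: emeasurable_funM => //; apply/measurable_EFinP.
  apply: (@measurableT_comp _ _ _ _ _ _ (fun x : R => (g < x)%R%:R : R)) => //.
  exact: measurable_gt_indicator.
have pos i omega : 0 <= (g < f (tnth u i) omega)%R%:R%:E * h (Lb f g u (Xat f u omega)).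
  by rewrite mule_ge0// h0.
rewrite -ge0_integral_sum//.
rewrite -ge0_integralZl_EFin//; first last.
- by rewrite invr_ge0.
- exact: emeasurable_sum.
- by move=> omega _; apply: sume_ge0 => i _; exact: pos.
apply: eq_integral => omega _; rewrite /H powR_inv1//.
rewrite EFinM -muleA; congr (_ * _); rewrite -ge0_sume_distrl; last by move=> i _; rewrite lee_fin.
congr (_ * _); rewrite /hits -sumEFin; apply: eq_bigr => i _.
by rewrite tnth_mktuple.
Qed.

Let K_off u : ~ points T u -> K u = 0.
Proof.
move=> nTu; rewrite /K integral0_eq// => omega _.
by rewrite /weight indicE memNset// mul0r mul0e.
Qed.

(** Measurability in [u] of the inner expectation comes from writing it, on [points T], as the
    partial integral [K] of a jointly measurable function. *)
Lemma expect_replication_points a b : gamma a b = g ->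
  E (replication a b M) h = \int[Um M]_(u in @points R d T M) E (estimate g u) h.
Proof.
move=> gE; rewrite replicationE (expect_returns _ _ (returns_Div _ _ _ _ _)).
rewrite (expect_returns _ _ (returns_Sub _ _ _ _ _)) -/(gamma a b) gE.
apply: (@expect_repeat_Uniform M (fun us => E (estimate g us) h)); last first.
  by move=> l; apply: (expect_ge0 _ _ mT Tn0 Tfin).
rewrite (_ : _ \_ _ = K).
  by apply: (@measurable_fun_fubini_tonelli_F _ _ _ _ _ P _ mWh).
apply/funext => u; rewrite patchE; case: ifPn => [/set_mem Tu|/negP Tu].
  by rewrite K_estimate.
by rewrite K_off// => Tu'; apply: Tu; rewrite inE.
Qed.

Lemma expect_replication a b : gamma a b = g ->
  E (replication a b M) h = \int[(Um M \x P)%E]_p ((weight p)%:E * h (estimator p)).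
Proof.
move=> gE; rewrite expect_replication_points//.
rewrite (@fubini_tonelli1 _ _ _ _ R (Um M) P)//.
rewrite integral_mkcond; apply: eq_integral => u _; rewrite patchE.
rewrite /fubini_F -/(K u); case: ifPn => [/set_mem Tu|/negP Tu]; first by rewrite K_estimate.
by rewrite K_off// => Tu'; apply: Tu; rewrite inE.
Qed.

End expectation.

Local Notation m := (Um M \x P)%E.
Local Notation hit := (hit T f G (M := M) g).

Lemma hits_gt0 (x : M.-tuple R) : (exists i, g < tnth x i)%R -> (1 <= hits g x)%R.
Proof.
move=> [i gi]; by rewrite /hits (bigD1 i)//= gi lerDl; apply: sumr_ge0.
Qed.

Lemma hits_eq0 (x : M.-tuple R) : ~ (exists i, g < tnth x i)%R -> hits g x = 0%R.
Proof.
move=> h; rewrite /hits big1// => i _; case: ltP => // gi.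
by exfalso; apply: h; exists i.
Qed.

(** With S the tail sum and N the number of hits, N / S times S / N is 1 wherever N > 0. Hence the
    estimator is unbiased for the probability of a hit. *)
Lemma weight_estimator p : (weight p * estimator p)%R = \1_hit p.
Proof.
case: p => u omega; rewrite /weight /estimator /=.
have [Tu|nTu] := pselect (points T u); last first.
  by rewrite !indicE !memNset ?mul0r// => -[].
rewrite [X in (X * _ * _)%R]indicE mem_set// mul1r !powR_inv1//.
have S0 : (0 < tail_sum u)%R.
  rewrite tail_sumE// (bigD1 (Ordinal M0))//=; apply: ltr_pwDl; first exact: (ptail_gt0 gaussf hvar Tu).
  by apply: sumr_ge0 => i _; apply: ltW; exact: (ptail_gt0 gaussf hvar Tu).
have [hx|nhx] := pselect (exists i, g < tnth (X (u, omega)) i)%R.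
  rewrite indicE mem_set//; have N1 := hits_gt0 hx.
  have N0 : (0 < hits g (X (u, omega)))%R by exact: lt_le_trans N1.
  by apply: (@etrans _ _ 1%R) => //; field; rewrite !gt_eqF.
by rewrite (hits_eq0 nhx) mulr0 mul0r indicE memNset// => -[].
Qed.

Lemma ptail_le_w (u : M.-tuple 'rV[R]_d) i : points T u -> (ptail f g u i <= w T f g)%R.
Proof.
move=> Tu; rewrite -lee_fin (wE T0 cT TN mG PG Gc) /ptail fineK; last first.
  by rewrite fin_num_measure//; exact: measurable_above.
apply: (le_prob_good mG PG) => //.
- exact: measurable_above.
- exact: measurable_path_above.
- move=> omega Gw gf; apply/(path_aboveP T0 cT TN Gc _ Gw); apply/(maxT_gtP T0 cT Gc _ Gw).
  by exists (tnth u i) => //; exact: Tu.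
Qed.

Lemma hit_prob : m hit = (wM T f M g)%:E.
Proof.
have mh := measurable_hit T0 cT TN mG Gc (M := M) g.
rewrite (wM_fubini T0 cT TN mG PG Gc mT Tn0 Tfin)//.
rewrite (@product_measure_unique _ _ _ _ R (Um M) P (Um M \x^ P)%E _ _ mh)//.
by move=> A B mA mB; exact: product_measure2E.
Qed.

(** One factor of the square is cancelled by the weight; the other is S / N <= S <= M w(g), as N >=
    1 on a hit and each tail is at most w(g). *)
Lemma second_moment p : (weight p * estimator p ^+ 2 <= M%:R * w T f g * \1_hit p)%R.
Proof.
have w0 : (0 <= w T f g)%R by exact: w_ge0.
rewrite expr2 mulrA weight_estimator mulrC [leRHS]mulrC.
rewrite indicE; case: (boolP (p \in hit)) => [/set_mem hp|]; last by rewrite mul0r mulr0.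
rewrite mul1r mulr1; case: p hp => u omega [/= Tu hx].
have N1 := hits_gt0 hx; rewrite /estimator /= powR_inv1//.
rewrite ler_pdivrMr ?(lt_le_trans _ N1)//.
apply: (@le_trans _ _ (M%:R * w T f g)%R); last by rewrite ler_peMr// mulr_ge0.
rewrite tail_sumE// -[M in leRHS]card_ord -sum1_card natr_sum mulr_suml.
by apply: ler_sum => i _; rewrite mul1r; exact: ptail_le_w.
Qed.

(** The product of p_U(i) with the conditional probability in [Q''] collapses to the probability of
    the joint event divided by the tail sum, the i-th term of [expect_estimate_field]. *)
Lemma expect_replication_Lb_law a b (A : set R) : gamma a b = g -> measurable A ->
  E (replication a b M) (fun y => (\1_A y)%:E) = Lb_law T f M g A.
Proof.
move=> gE mA.
have mI : measurable_fun setT (fun y : R => (\1_A y : R)%:E) by apply/measurable_EFinP; exact: measurable_indic.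
rewrite (expect_replication_points (h := fun y => (\1_A y)%:E))//.
apply: eq_integral => u /set_mem Tu.
rewrite (expect_estimate_field gaussf hvar mT Tn0 Tfin Tu)//.
rewrite /Q'' -sumEFin ge0_sume_distrr; last first.
  by move=> i _; apply: integral_ge0 => omega _; rewrite mule_ge0.
apply: eq_bigr => i _.
pose B := [set omega | A (Lb f g u (Xat f u omega)) /\ g < f (tnth u i) omega]%R.
have mB : measurable B.
  by apply: measurableI; [exact: measurable_preimageT (measurable_Lb u) mA|exact: measurable_above].
have -> : \int[P]_omega ((g < f (tnth u i) omega)%R%:R%:E * (\1_A (Lb f g u (Xat f u omega)))%:E) = P B.
  rewrite (measure_indic P mB); apply: eq_integral => omega _.
  rewrite -EFinM !indicE; congr EFin.
  have -> : (omega \in B) = (g < f (tnth u i) omega)%R && (Lb f g u (Xat f u omega) \in A).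
    by apply/idP/andP => [/set_mem[/mem_set -> ->]|[gi /set_mem Ai]]//; apply/mem_set.
  by case: (g < _)%R => /=; rewrite ?mul1r ?mul0r.
rewrite -[P B]fineK ?fin_num_measure// -EFinM; congr EFin.
have := ptail_gt0 gaussf hvar Tu g i => p0.
by rewrite /pU /= [RHS]mulrC mulrA mulfVK ?gt_eqF// mulrC.
Qed.

(** The law of one replication as a genuine measure, which the variance argument needs, whereas
    [expect] only gives a functional. *)
Definition replication_measure : set R -> \bar R :=
  image_measure (density_measure m measurable_weight weight_ge0) measurable_estimator.

HB.instance Definition _ := Measure.on replication_measure.

Let integral_replication (h : R -> \bar R) : measurable_fun setT h -> (forall y, 0 <= h y) ->
  \int[replication_measure]_y h y = \int[m]_p ((weight p)%:E * h (estimator p)).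
Proof.
move=> mh h0; rewrite integral_image_measure//.
rewrite (@ge0_integral_density _ _ R m (density_measure m measurable_weight weight_ge0) weight)//.
- by apply: eq_integral => p _; rewrite muleC.
- exact: measurable_weight.
- exact: weight_ge0.
- by apply: measurableT_comp => //; exact: measurable_estimator.
Qed.

Lemma replication_integral a b h : gamma a b = g -> measurable_fun setT h -> (forall y, 0 <= h y) ->
  E (replication a b M) h = \int[replication_measure]_y h y.
Proof. by move=> gE mh h0; rewrite integral_replication// expect_replication. Qed.

(** The absolute value keeps the integrand nonnegative everywhere; it is dropped later by
    [replication_ge0]. *)
Lemma replication_abs_moment : \int[replication_measure]_y (`|y|)%:E = (wM T f M g)%:E.
Proof.
rewrite integral_replication//; last by apply/measurable_EFinP; exact: normr_measurable.
have mh := measurable_hit T0 cT TN mG Gc (M := M) g.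
rewrite -hit_prob (measure_indic m mh); apply: eq_integral => p _.
by rewrite -weight_estimator ger0_norm ?estimator_ge0.
Qed.

Lemma replication_second_moment :
  \int[replication_measure]_y (y ^+ 2)%:E <= (M%:R * w T f g * wM T f M g)%:E.
Proof.
rewrite integral_replication//; first last.
- by move=> y; rewrite lee_fin sqr_ge0.
- by apply/measurable_EFinP; exact: measurable_funX.
have mh := measurable_hit T0 cT TN mG Gc (M := M) g.
have w0 : (0 <= M%:R * w T f g)%R by rewrite mulr_ge0// w_ge0.
rewrite EFinM -hit_prob (measure_indic m mh) -ge0_integralZl_EFin//; last first.
  by apply/measurable_EFinP; exact: measurable_indic.
apply: ge0_le_integral_nonmeas => p _; rewrite -EFinM ?lee_fin.
  by rewrite mulr_ge0 ?sqr_ge0 ?weight_ge0.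
exact: second_moment.
Qed.

Lemma replication_ge0 : replication_measure [set y | y < 0]%R = 0.
Proof.
rewrite /replication_measure /image_measure /pushforward.
rewrite (_ : _ @^-1` _ = set0) ?measure0//; apply/seteqP; split => // p /=.
by rewrite ltNge estimator_ge0.
Qed.

End weight.

End replication_law.

(** * Cost of one replication *)

Section replication_cost.
Context (R : realType) (d : nat) (T : set 'rV[R]_d).
Variables (mu : 'rV[R]_d -> R) (C : 'rV[R]_d -> 'rV[R]_d -> R).
Hypothesis mT : measurable T.
Hypotheses (Tn0 : lebesgue_rV T != 0%E) (Tfin : lebesgue_rV T \is a fin_num).
Local Notation returns := (returns T mu C).
Local Notation bounded := (bounded T mu C).
Local Notation prog := (prog R d).

Lemma bounded_returns A B (p : prog A) a l h (k : A -> prog B) Q lo hi : 0 <= lo ->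
  returns p a l h -> bounded (k a) Q lo hi -> bounded (Bind p k) Q (l%:R + lo) (h%:R + hi).
Proof.
move=> lo0 rp bk; apply: (bounded_Bind mT Tn0 Tfin lo0 (returns_bounded rp)).
by move=> x ->.
Qed.

Lemma bounded_repeatP A n (p : prog A) Q lo hi : 0 <= lo -> bounded p Q lo hi ->
  bounded (repeatP n p) (fun l => size l = n) (n%:R * lo) (n%:R * hi).
Proof.
move=> lo0 bp.
have := @bounded_mapP _ _ _ mu C mT Tn0 Tfin _ _ (fun=> p) Q (iota 0 n) lo hi lo0 (fun=> bp).
by rewrite size_iota.
Qed.

Lemma bounded_gauss_vector M ms Cs : size ms = M -> size Cs = M ->
  (forall i, (i < M)%N -> size (nth [::] Cs i) = M) ->
  bounded (gauss_vector ms Cs) (fun Y => (size Y <= M)%N)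
    ((\sum_(i < M) i.+1 * i.+2)%:R) ((7 * M ^ 3)%:R + (M%:R + (M * (M * 2 + 1))%:R)).
Proof.
move=> sm sC sCr.
have rc : returns (cholesky Cs) (chol Cs) (\sum_(i < M) i.+1 * i.+2) (7 * M ^ 3).
  by rewrite -sC; apply: returns_cholesky; rewrite sC.
rewrite -[X in bounded _ _ X]addr0; apply: (bounded_returns _ rc) => //.
rewrite sm -[X in bounded _ _ X]addr0.
have bz : bounded (repeatP M Gauss) (fun zs => size zs = M) 0 M%:R.
  apply: (bounded_weaken (bounded_repeatP M _ (bounded_Gauss _ _ _))) => //.
  by rewrite mulr1.
apply: (bounded_Bind mT Tn0 Tfin _ bz) => // zs sz; have := returns_gauss_values T mu C ms Cs zs; rewrite sm sz => rg.
apply: (bounded_weaken (returns_bounded rg)) => // Y ->.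
by rewrite size_map size_zip sm geq_minl.
Qed.

Lemma bounded_conditional g us total i z M : size us = M ->
  bounded (conditional d g (means mu us) (covs C us) (sdevs C us) total i z) (fun=> True)
    ((\sum_(i < M) i.+1 * i.+2)%:R) ((7 * M ^ 3 + M * (M * 2 + 1) + 5 * M + 5)%:R).
Proof.
move=> sus.
suff h : bounded (conditional d g (means mu us) (covs C us) (sdevs C us) total i z) (fun=> True)
    (1%:R + (1%:R + ((\sum_(i < M) i.+1 * i.+2)%:R + 0%:R)))
    (1%:R + (1%:R + ((7 * M ^ 3)%:R + (M%:R + (M * (M * 2 + 1))%:R) + (3 + M * 4)%:R))).
  by apply: (bounded_weaken h) => //; rewrite -!natrD ler_nat; lia.
apply: (bounded_returns _ (returns_Mul _ _ _ _ _)); first by rewrite !addr_ge0.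
apply: (bounded_returns _ (returns_Add _ _ _ _ _)); first by rewrite !addr_ge0.
apply: (bounded_Bind mT Tn0 Tfin _ (bounded_gauss_vector _ _ _)) => //.
- by rewrite size_means.
- by rewrite size_covs.
- by move=> j jM; rewrite size_covs_row sus.
move=> Y sY; apply: (bounded_weaken (returns_bounded (returns_update _ _ _ _ _ _ _ _ _))) => //.
by rewrite ler_nat leq_add2l leq_mul2r sY orbT.
Qed.

(** The lower bound uses the Cholesky factorization alone, which also dominates the upper one: every
    other stage is at most quadratic in M, and drawing [z] costs at most a constant on average. *)
Lemma bounded_replication : exists2 K : R, 0 < K & forall a b M, (0 < M)%N ->
  bounded (replication a b M) (fun=> True) (M%:R ^+ 3 / 3) (K * M%:R ^+ 3).
Proof.
have [K0 K0_gt0 bg] := bounded_gauss_above mu C mT Tn0 Tfin.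
(* 42 = 7 + 3 + 18 + 14 is the sum of the coefficients of the polynomial bound, each power of M
   being at most M^3. *)
exists (42 + K0); first by rewrite addr_gt0.
move=> a b M M0; rewrite replicationE.
pose lo : R := (\sum_(i < M) i.+1 * i.+2)%:R.
pose hi : R := (7 * M ^ 3 + M * (M * 2 + 1) + 5 * M + 5)%:R.
have lo0 : 0 <= lo by [].
have bE g us : size us = M -> bounded (estimate g us) (fun=> True)
    (M%:R + ((M * M)%:R + ((M * 2)%:R + ((M * 2)%:R + ((M * 3)%:R + (M%:R + (0 + (0 + lo))))))))
    (M%:R + ((M * M)%:R + ((M * 2)%:R + ((M * 2)%:R + ((M * 3)%:R + (M%:R + (7 + 2 * M%:R + (K0 + hi)))))))).
  move=> sus; subst M.
  apply: (bounded_returns _ (returns_means _ _ _ us)); first by rewrite !addr_ge0.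
  apply: (bounded_returns _ (returns_covs _ _ _ us)); first by rewrite !addr_ge0.
  apply: (bounded_returns _ (returns_sdevs _ _ _ us)); first by rewrite !addr_ge0.
  apply: (bounded_returns _ (returns_thresholds _ _ _ g us)); first by rewrite !addr_ge0.
  apply: (bounded_returns _ (returns_tails _ _ _ g us)); first by rewrite !addr_ge0.
  have sp : size (tails mu C g us) = size us by rewrite size_map size_thresholds.
  have := returns_sumP T mu C (tails mu C g us); rewrite sp => rs.
  apply: (bounded_returns _ rs); first by rewrite !addr_ge0.
  have := bounded_pick_index mu C mT Tn0 Tfin (tails mu C g us) (\sum_(x <- tails mu C g us) x).
  rewrite sp => bp; apply: (bounded_Bind mT Tn0 Tfin _ bp) => [|i _]; first by rewrite !addr_ge0.
  apply: (bounded_Bind mT Tn0 Tfin _ (bg _)) => // z _.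
  exact: bounded_conditional.
set lE := (M%:R + _) in bE *; set hE := (M%:R + _) in bE *.
suff h : bounded (q <-- Div a b ; g <-- Defs.Sub b q ; us <-- repeatP M Defs.Uniform ; estimate g us)%prog
    (fun=> True) (1 + (1 + (M%:R * 1 + lE))) (1 + (1 + (M%:R * 1 + hE))).
  apply: (bounded_weaken h) => //.
    apply: (@le_trans _ _ lo); last by rewrite /lE mulr1 !add0r !addrA lerDr !addr_ge0.
    by rewrite ler_pdivrMr// mulrC -natrX -natrM ler_nat cholesky_cost_lower.
  rewrite /hE /hi mulr1 [leRHS]mulrDl.
  have -> : 1 + (1 + (M%:R + (M%:R + ((M * M)%:R + ((M * 2)%:R + ((M * 2)%:R + ((M * 3)%:R +
      (M%:R + (7 + 2 * M%:R + (K0 + (7 * M ^ 3 + M * (M * 2 + 1) + 5 * M + 5)%:R))))))))))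
      = (7 * M ^ 3 + 3 * M ^ 2 + 18 * M + 14)%:R + K0 :> R.
    by rewrite !(natrD, natrM, natrX); ring.
  rewrite lerD//; last first.
    by rewrite ler_peMr ?(ltW K0_gt0)// -natrX ler1n expn_gt0 M0.
  by rewrite -natrX -natrM ler_nat !expnS expn0; nia.
have lE0 : 0 <= lE by rewrite !addr_ge0.
apply: (bounded_returns _ (returns_Div _ _ _ _ _)); first by rewrite !addr_ge0.
apply: (bounded_returns _ (returns_Sub _ _ _ _ _)); first by rewrite !addr_ge0.
have bU := bounded_repeatP M ler01 (bounded_Uniform mu C mT Tn0 Tfin).
apply: (bounded_Bind mT Tn0 Tfin lE0 bU) => us sus; exact: bE.
Qed.

Lemma bounded_average n (p : prog R) Q lo hi : 0 <= lo -> bounded p Q lo hi ->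
  bounded (average n p) (fun=> True) (n%:R * lo) (n%:R * hi + n%:R + 1).
Proof.
move=> lo0 bp.
suff h : bounded (average n p) (fun=> True) (n%:R * lo + (n%:R + 1)) (n%:R * hi + (n%:R + 1)).
  by apply: (bounded_weaken h) => //; rewrite ?addrA// -addrA lerDl addr_ge0.
apply: (bounded_Bind mT Tn0 Tfin _ (bounded_repeatP n lo0 bp)); first by rewrite addr_ge0.
move=> xs sx; have := returns_sumP T mu C xs; rewrite sx => rs.
apply: (bounded_returns _ rs) => //.
exact: bounded_weaken (returns_bounded (returns_Div _ _ _ _ _)) _ _ _.
Qed.

End replication_cost.

(** * Chebyshev bound and rates *)

Definition total_one d (X : measurableType d) (R : realType) (m : {measure set X -> \bar R})
  (m1 : m setT = 1%E) : set X -> \bar R := m.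

Section total_one.
Context d (X : measurableType d) (R : realType) (m : {measure set X -> \bar R}).
Hypothesis m1 : m setT = 1%E.

HB.instance Definition _ := Measure.on (total_one m1).
HB.instance Definition _ := Measure_isProbability.Build _ _ _ (total_one m1) m1.

End total_one.

Section chebyshev.
Context (R : realType) (d : nat) (T : set 'rV[R]_d).
Variables (mu : 'rV[R]_d -> R) (C : 'rV[R]_d -> 'rV[R]_d -> R).
Local Notation E := (expect T mu C).
Variables (rep : prog R d R) (nu : probability R R) (m v : R).
Local Open Scope ereal_scope.
Hypothesis rep_law : forall h, measurable_fun setT h -> (forall x, 0 <= h x) ->
  E rep h = \int[nu]_x h x.
Hypothesis nu_ge0 : nu [set y | y < 0]%R = 0.
Hypothesis abs_moment : \int[nu]_y (`|y|)%:E = m%:E.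
Hypothesis second_moment : \int[nu]_y (y ^+ 2)%:E <= v%:E.
Local Notation nun n := (power_measure nu (n := n)).

Let I2 := fine (\int[nu]_y (y ^+ 2)%:E).

Let I2E : \int[nu]_y (y ^+ 2)%:E = I2%:E.
Proof.
rewrite fineK// ge0_fin_numE; first exact: le_lt_trans second_moment (ltry _).
by apply: integral_ge0 => y _; rewrite lee_fin sqr_ge0.
Qed.

Let int1 : nu.-integrable setT (fun y => y%:E).
Proof.
apply/integrableP; split; first exact/measurable_EFinP.
by rewrite (_ : \int[nu]_y _ = m%:E) ?ltry// -abs_moment.
Qed.

Let int2 : nu.-integrable setT (fun y => (y ^+ 2)%:E).
Proof.
apply/integrableP; split; first by apply/measurable_EFinP; exact: measurable_funX.
rewrite (_ : \int[nu]_y _ = I2%:E) ?ltry// -I2E.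
by apply: eq_integral => y _; rewrite gee0_abs// lee_fin sqr_ge0.
Qed.

Let mean_rep : \int[nu]_y y%:E = m%:E.
Proof.
rewrite -abs_moment; apply: ae_eq_integral => //.
  by apply/measurable_EFinP; exact: normr_measurable.
exists [set y | y < 0]%R; split => //.
  by rewrite (_ : [set y | y < 0]%R = `]-oo, 0%R[%classic)//.
move=> y /= /not_implyP[_ h]; rewrite ltNge; apply/negP => y0; apply: h.
by rewrite ger0_norm.
Qed.

Let V := (I2 - m ^+ 2)%R.

Let shifted (s : R) : \int[nu]_y ((s + (y - m)) ^+ 2)%:E = (s ^+ 2 + V)%:E.
Proof.
have -> : (fun y : R => ((s + (y - m)) ^+ 2)%:E) =
    (fun y => (y ^+ 2)%:E + ((2 * (s - m))%:E * y%:E + ((s - m) ^+ 2)%:E)).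
  by apply/funext => y; rewrite -EFinM -!EFinD; congr EFin; ring.
have intc : nu.-integrable setT (fun=> ((s - m) ^+ 2)%:E) by exact: finite_measure_integrable_cst.
have intz : nu.-integrable setT (fun y => (2 * (s - m))%:E * y%:E) by exact: integrableZl.
rewrite integralD//=; last exact: integrableD.
rewrite integralD//= integralZl// integral_cst//= probability_setT mule1 mean_rep I2E.
by rewrite -EFinM -!EFinD; congr EFin; rewrite /V; ring.
Qed.

Let V_ge0 : (0 <= V)%R.
Proof.
have := shifted 0; rewrite expr0n add0r => h; rewrite -lee_fin -h.
by apply: integral_ge0 => y _; rewrite lee_fin sqr_ge0.
Qed.

Let V_le : (V <= v)%R.
Proof.
apply: (@le_trans _ _ I2); first by rewrite gerBl sqr_ge0.
by rewrite -lee_fin -I2E.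
Qed.

(** Drawing one value at a time, with the partial sum kept in [s]: each centred draw adds its
    variance and the cross term vanishes. The variance of the sum comes from this recursion on the
    program. *)
Let sum_moment (s : R) n : E (repeatP n rep) (fun xs => ((s + \sum_(x <- xs) (x - m)) ^+ 2)%:E)
  = (s ^+ 2 + n%:R * V)%:E.
Proof.
suff : forall k s, E (Defs.mapP (fun=> rep) (iota k n))
    (fun xs => ((s + \sum_(x <- xs) (x - m)) ^+ 2)%:E) = (s ^+ 2 + n%:R * V)%:E by exact.
elim: n {s} => [|n IH] k s.
  by rewrite /= big_nil addr0 mul0r addr0.
transitivity (E rep (fun y => ((s + (y - m)) ^+ 2 + n%:R * V)%:E)).
  congr (E rep _); apply/funext => y; rewrite -(IH k.+1) /=; congr (E _ _).
  by apply/funext => xs; rewrite /= big_cons addrA.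
have mf : measurable_fun setT (fun y : R => ((s + (y - m)) ^+ 2)%:E).
  apply/measurable_EFinP; apply: measurable_funX; apply: measurable_funD => //.
  exact: measurable_funB.
have nV : (0 <= n%:R * V)%R by rewrite mulr_ge0.
rewrite rep_law; first last.
- by move=> y; rewrite lee_fin addr_ge0// sqr_ge0.
- by under eq_fun do rewrite EFinD; exact: emeasurable_funD.
under eq_integral do rewrite EFinD.
rewrite ge0_integralD//; last by move=> y _; rewrite lee_fin sqr_ge0.
rewrite integral_cst//= probability_setT mule1 shifted -EFinD; congr EFin.
by rewrite -natr1; ring.
Qed.

(** Chebyshev's inequality, stated as a lower bound on the success probability so that it applies
    directly to the confidence level. *)
Lemma average_chebyshev n (r : R) : (0 < n)%N -> (0 < r)%R ->
  (1 - v / (n%:R * r ^+ 2))%:E <=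
  E (average n rep) (fun y => (\1_[set y | `|y - m| <= r]%R y)%:E).
Proof.
move=> n0 r0; have n_gt0 : (0 < n%:R :> R)%R by rewrite ltr0n.
pose A (xs : seq R) : R := ((\sum_(x <- xs) x) / n%:R)%R.
have msum : measurable_fun setT (fun w : n.-tuple R => \sum_(x <- w) x)%R.
  rewrite (_ : (fun w : n.-tuple R => _) = fun w => \sum_(i < n) tnth w i)%R.
    by apply: measurable_sum => i; exact: measurable_tnth.
  by apply/funext => w; rewrite big_tuple.
have mA : measurable_fun setT (fun w : n.-tuple R => A w) by exact: measurable_funM.
pose D : set R := [set y | `|y - m| <= r]%R.
have mD : measurable D.
  rewrite (_ : D = [set y | `]-oo, r]%classic `|y - m|%R]).
    by apply: measurable_preimageT => //; apply: measurableT_comp => //; exact: measurable_funB.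
  by apply/seteqP; split => y /=; rewrite in_itv.
have mind : measurable_fun setT (fun w : n.-tuple R => (\1_D (A w) : R)%:E).
  apply/measurable_EFinP; apply: (measurableT_comp _ mA).
  exact: measurable_indic.
have msq : measurable_fun setT (fun w : n.-tuple R => (((A w) - m) ^+ 2)%:E).
  by apply/measurable_EFinP; apply: measurable_funX; exact: measurable_funB.
have -> : E (average n rep) (fun y => (\1_D y)%:E) = \int[nun n]_w (\1_D (A w))%:E.
  rewrite -(expect_repeat rep_law (F := fun xs => (\1_D (A xs))%:E))//.
  rewrite /average /=; congr (E _ _); apply/funext => xs.
  by have [-> _] := returns_sumP T mu C xs.
have sq : \int[nun n]_w (((A w) - m) ^+ 2)%:E = (V / n%:R)%:E.
  have ms2 : measurable_fun setT (fun w : n.-tuple R => ((0 + \sum_(x <- w) (x - m)) ^+ 2)%:E).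
    rewrite (_ : (fun w : n.-tuple R => _) = fun w : n.-tuple R => ((\sum_(x <- w) x - n%:R * m) ^+ 2)%:E).
      by apply/measurable_EFinP; apply: measurable_funX; exact: measurable_funB.
    apply/funext => w; rewrite add0r sumrB big_const_seq count_predT size_tuple iter_addr_0.
    by rewrite -[(m *+ n)%R]mulr_natl.
  have := sum_moment 0 n; rewrite (expect_repeat rep_law)//; last first.
    by move=> l; rewrite lee_fin sqr_ge0.
  rewrite expr0n add0r => h.
  transitivity (\int[nun n]_w (((n%:R ^+ 2)^-1)%:E * ((0 + \sum_(x <- w) (x - m)) ^+ 2)%:E)).
    apply: eq_integral => w _; rewrite -EFinM; congr EFin.
    rewrite add0r sumrB big_const_seq count_predT size_tuple iter_addr_0 -[(m *+ n)%R]mulr_natl /A.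
    by field; rewrite gt_eqF.
  rewrite ge0_integralZl_EFin//; last by move=> w _; rewrite lee_fin sqr_ge0.
  rewrite h -EFinM; congr EFin; field; by rewrite gt_eqF.
(* Pointwise, either the indicator is 1 or the square exceeds r^2. *)
have one : 1 <= \int[nun n]_w ((\1_D (A w))%:E + (r ^- 2)%:E * (((A w) - m) ^+ 2)%:E).
  rewrite -(power_measureT nu n) -[leLHS]mul1e -integral_cst//.
  apply: ge0_le_integral_nonmeas => w _ //; rewrite -EFinM -EFinD lee_fin.
  have r2 : (0 < r ^+ 2)%R by rewrite exprn_gt0.
  rewrite indicE; case: (boolP (A w \in D)) => [_|/negP nD].
    by rewrite lerDl mulr_ge0 ?sqr_ge0// invr_ge0 ltW.
  rewrite add0r mulrC ler_pdivlMr// mul1r -(real_normK (num_real (A w - m))).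
  rewrite ler_sqr ?nnegrE ?(ltW r0)// ltW// ltNge; apply/negP => h.
  by apply: nD; rewrite inE.
move: one; rewrite ge0_integralD//; first last.
- exact: emeasurable_funM.
- by move=> w _; rewrite mule_ge0// lee_fin ?invr_ge0 sqr_ge0.
rewrite ge0_integralZl_EFin//; first last.
- by rewrite invr_ge0 sqr_ge0.
- by move=> w _; rewrite lee_fin sqr_ge0.
rewrite sq -EFinM => one.
rewrite EFinB leeBlDr//; apply: (le_trans one); rewrite leeD2l// lee_fin.
rewrite [leLHS](_ : _ = V / (n%:R * r ^+ 2))%R; last by rewrite [in RHS]invfM; ring.
by rewrite ler_wpM2r// invr_ge0 mulr_ge0// sqr_ge0.
Qed.

End chebyshev.

(** * Growth of the number of points and of the logarithm *)

Section rates.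
Context (R : realType).
Variables (c lambda rho kappa : R).
Hypotheses (c0 : 0 < c) (lambda0 : 0 < lambda) (rho0 : 0 <= rho) (kappa0 : 0 <= kappa).

Let K0 := c * (4 * lambda) `^ kappa.

Let K0_gt0 : 0 < K0. Proof. by rewrite mulr_gt0// powR_gt0// mulr_gt0. Qed.

(** The order of the number of points in terms of eps and b, once a is replaced by its value. *)
Definition growth (eps b : R) : R := eps `^ (- (1 + kappa)) * b `^ ((rho + 1) * kappa).

Lemma growth_ge1 eps b : 0 < eps -> eps <= 1 -> 1 <= b -> 1 <= growth eps b.
Proof.
move=> e0 e1 b1; rewrite -[leLHS]mul1r ler_pM//.
  rewrite powRN -[leLHS]invr1 lef_pV2 ?posrE ?powR_gt0//.
  have e01 : 0 < eps <= 1 by rewrite e0.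
  by have /(_ 0 (1 + kappa)) := ger_powR e01; rewrite powRr0; apply; rewrite addr_ge0.
have h1 : 1 `^ ((rho + 1) * kappa) = 1 :> R by rewrite powR1.
rewrite -[leLHS]h1 ge0_ler_powR ?nnegrE//.
- by rewrite mulr_ge0// addr_ge0.
- exact: le_trans b1.
Qed.

Lemma point_count_growth eps b : 0 < eps -> 0 < b ->
  c * eps^-1 * (b / (eps / (4 * lambda * b `^ rho))) `^ kappa = K0 * growth eps b.
Proof.
move=> e0 b0.
have -> : b / (eps / (4 * lambda * b `^ rho)) = 4 * lambda * (eps^-1 * b `^ (rho + 1)).
  rewrite powRD; last by rewrite (gt_eqF b0) implybT.
  by rewrite powRr1 ?(ltW b0)//; field; rewrite !gt_eqF ?powR_gt0.
have l0 : 0 <= 4 * lambda by rewrite mulr_ge0// ltW.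
have ei : eps^-1 = eps `^ (- 1) by rewrite powR_inv1 ?ltW.
rewrite powRM//; last by rewrite mulr_ge0 ?powR_ge0// invr_ge0 ltW.
rewrite (powRM _ _ (powR_ge0 b (rho + 1))) ?invr_ge0 ?(ltW e0)//.
rewrite -(powRrM b) {2}ei -(powRrM eps) mulN1r.
rewrite /K0 /growth opprD powRD; last by rewrite (gt_eqF e0) implybT.
by rewrite -ei; ring.
Qed.

Variables (c1 c2 : R) (lw : R -> R) (b1 : R).
Hypotheses (c10 : 0 < c1) (c20 : 0 < c2) (b1_ge1 : 1 <= b1).
Hypothesis lwP : forall b, b1 <= b -> c1 * b ^+ 2 <= lw b <= c2 * b ^+ 2.

(** Before rounding, the number of points is K0 Z with Z = [growth eps b] >= 1, so rounding up stays
    below (K0 + 1) Z; the fifth power of b^((rho + 1) kappa) is the q-th power of b^2, which [lw]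
    replaces. *)
Lemma growth_rate : let q := 5 * (rho + 1) * kappa / 2 in
  exists k1 k2 : R, [/\ 0 < k1, 0 < k2 & forall (eps b : R) (M : nat),
    0 < eps -> eps <= 1 -> b1 <= b ->
    let X := c * eps^-1 * (b / (eps / (4 * lambda * b `^ rho))) `^ kappa in
    X <= M%:R -> M%:R <= X + 1 ->
    k1 * (eps `^ (- (2 + 5 * (1 + kappa))) * lw b `^ q) <= M%:R ^+ 5 * eps ^- 2 <=
    k2 * (eps `^ (- (2 + 5 * (1 + kappa))) * lw b `^ q)].
Proof.
move=> q; have q0 : 0 <= q by rewrite divr_ge0// !mulr_ge0// addr_ge0.
exists (K0 ^+ 5 / c2 `^ q), ((K0 + 1) ^+ 5 / c1 `^ q); split.
- by rewrite divr_gt0 ?exprn_gt0 ?powR_gt0.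
- by rewrite divr_gt0 ?exprn_gt0 ?powR_gt0// addr_gt0.
move=> eps b M e0 e1 bb X; have b_ge1 : 1 <= b by exact: le_trans bb.
have b_gt0 : 0 < b by exact: lt_le_trans b_ge1.
rewrite /X point_count_growth//; set Z := growth eps b => XM MX.
have Z1 : 1 <= Z by exact: growth_ge1.
have Z0 : 0 < Z by exact: lt_le_trans Z1.
have Z5 : Z ^+ 5 * eps ^- 2 = eps `^ (- (2 + 5 * (1 + kappa))) * (b ^+ 2) `^ q.
  rewrite /Z /growth exprMn -!powR_mulrn ?powR_ge0 ?(ltW b_gt0) ?(ltW e0)//.
  rewrite -!powRrM -powRN mulrAC -powRD ?(gt_eqF e0) ?implybT//.
  by congr (_ `^ _ * _ `^ _); rewrite /q; [ring|field].
have /andP[lw1 lw2] := lwP bb.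
have b20 : 0 <= b ^+ 2 by exact: sqr_ge0.
have lw0 : 0 <= lw b by apply: le_trans lw1; rewrite mulr_ge0// ltW.
have l1 : c1 `^ q * (b ^+ 2) `^ q <= lw b `^ q.
  by rewrite -powRM ?(ltW c10)// ge0_ler_powR ?nnegrE// mulr_ge0// ltW.
have l2 : lw b `^ q <= c2 `^ q * (b ^+ 2) `^ q.
  by rewrite -powRM ?(ltW c20)// ge0_ler_powR ?nnegrE// mulr_ge0// ltW.
have e2 : 0 <= eps ^- 2 by rewrite invr_ge0 sqr_ge0.
have ep : 0 <= eps `^ (- (2 + 5 * (1 + kappa))) by exact: powR_ge0.
have p1 : 0 < c1 `^ q by exact: powR_gt0.
have p2 : 0 < c2 `^ q by exact: powR_gt0.
apply/andP; split.
  apply: (@le_trans _ _ ((K0 * Z) ^+ 5 * eps ^- 2)); last first.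
    rewrite ler_wpM2r// lerXn2r ?nnegrE//.
    by rewrite mulr_ge0// ltW.
  rewrite [leRHS](_ : _ = K0 ^+ 5 * (eps `^ (- (2 + 5 * (1 + kappa))) * (b ^+ 2) `^ q)); last first.
    by rewrite exprMn -mulrA Z5.
  rewrite -mulrA ler_pM2l ?exprn_gt0// mulrCA ler_wpM2l//.
  by rewrite ler_pdivrMl.
apply: (@le_trans _ _ (((K0 + 1) * Z) ^+ 5 * eps ^- 2)).
  rewrite ler_wpM2r// lerXn2r ?nnegrE//.
    by rewrite mulr_ge0 ?addr_ge0 ?(ltW K0_gt0) ?(ltW Z0).
  by apply: (le_trans MX); rewrite mulrDl mul1r lerD2l.
rewrite [leLHS](_ : _ = (K0 + 1) ^+ 5 * (eps `^ (- (2 + 5 * (1 + kappa))) * (b ^+ 2) `^ q)); last first.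
  by rewrite exprMn -mulrA Z5.
rewrite -mulrA ler_pM2l ?exprn_gt0 ?addr_gt0// mulrCA ler_wpM2l//.
by rewrite ler_pdivlMl.
Qed.

End rates.

Section log_rate.
Context (R : realType) (w : R -> R) (c1 C1 c2 C2 b2 : R).
Hypotheses (c10 : 0 < c1) (C10 : 0 < C1) (c20 : 0 < c2) (C20 : 0 < C2).
Hypothesis w_ge : forall b, 1 <= b -> c1 * expR (- (C1 * b ^+ 2)) <= w b.
Hypothesis w_le : forall b, b2 <= b -> w b <= C2 * expR (- (c2 * b ^+ 2)).

(** The last condition on b lets half of c2 b^2 absorb ln C2; below, ln c1 is absorbed by b^2 >=
    1. *)
Lemma log_rate b : 1 <= b -> b2 <= b -> 2 * `|ln C2| / c2 <= b ->
  c2 / 2 * b ^+ 2 <= `|ln (w b)| <= (C1 + `|ln c1|) * b ^+ 2.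
Proof.
move=> b1 bb2 bl; have b_gt0 : 0 < b by exact: lt_le_trans b1.
have bb : b <= b ^+ 2 by rewrite expr2 ler_peMr// ltW.
have wpos : 0 < w b by apply: lt_le_trans (w_ge b1); rewrite mulr_gt0// expR_gt0.
have lnge : ln c1 - C1 * b ^+ 2 <= ln (w b).
  rewrite -(expRK (- (C1 * b ^+ 2))) -lnM ?posrE ?expR_gt0//.
  by rewrite ler_ln ?posrE ?mulr_gt0 ?expR_gt0// w_ge.
have lnle : ln (w b) <= ln C2 - c2 * b ^+ 2.
  rewrite -(expRK (- (c2 * b ^+ 2))) -lnM ?posrE ?expR_gt0//.
  by rewrite ler_ln ?posrE ?mulr_gt0 ?expR_gt0// w_le.
have lC : `|ln C2| <= c2 / 2 * b ^+ 2.
  move: bl; rewrite ler_pdivrMr// => bl.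
  rewrite mulrAC ler_pdivlMr// mulrC (le_trans bl)// mulrC ler_pM2l//.
have neg : ln (w b) <= - (c2 / 2 * b ^+ 2).
  apply: (le_trans lnle); have := le_trans (ler_norm _) lC.
  move: (ln C2) (b ^+ 2) => l q; lra.
have p0 : 0 <= c2 / 2 * b ^+ 2 by rewrite mulr_ge0 ?sqr_ge0// divr_ge0// ltW.
have np : ln (w b) <= 0 by apply: (le_trans neg); rewrite oppr_le0.
rewrite ler0_norm//; apply/andP; split; first by rewrite lerNr.
rewrite mulrDl lerNl opprD addrC; apply: le_trans lnge; rewrite lerD2r.
rewrite lerNl -[leLHS]mulr1 (le_trans _ (ler_wpM2l _ (le_trans b1 bb)))//.
by rewrite !mulr1 -normrN ler_norm.
Qed.

Lemma exp_tail_cvg0 : w b @[b --> +oo] --> (0 : R).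
Proof.
apply/cvgrPdist_lt => e e0; near=> b.
have b1 : 1 <= b by near: b; exact: nbhs_pinfty_ge.
have bb2 : b2 <= b by near: b; apply: nbhs_pinfty_ge; exact: num_real.
have bl : C2 / (c2 * e) < b by near: b; apply: nbhs_pinfty_gt; exact: num_real.
have b_gt0 : 0 < b by exact: lt_le_trans b1.
have wpos : 0 < w b by apply: lt_le_trans (w_ge b1); rewrite mulr_gt0// expR_gt0.
rewrite sub0r normrN gtr0_norm//; apply: (le_lt_trans (w_le bb2)).
have bb : b <= b ^+ 2 by rewrite expr2 ler_peMr// ltW.
apply: (@le_lt_trans _ _ (C2 * (c2 * b)^-1)).
  rewrite ler_pM2l//; apply: (@le_trans _ _ (expR (- (c2 * b)))).
    by rewrite ler_expR lerN2 ler_pM2l.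
  by rewrite expRN lef_pV2 ?posrE ?expR_gt0 ?mulr_gt0// (le_trans _ (expR_ge1Dx _))// lerDr.
rewrite ltr_pdivrMr ?mulr_gt0//; move: bl; rewrite ltr_pdivrMr ?mulr_gt0//.
by rewrite mulrCA mulrA mulrC (mulrC e).
Unshelve. all: by end_near. Qed.

End log_rate.

Section replication_number.
Context (R : realType).
Variables (M eps delta : R).
Hypotheses (M1 : 1 <= M) (eps0 : 0 < eps) (eps1 : eps <= 1).
Hypotheses (delta0 : 0 < delta) (delta1 : delta < 1).
Let Y := M ^+ 2 * eps ^- 2 * delta^-1.

Let Y1 : 1 <= Y.
Proof.
rewrite /Y -[leLHS]mul1r ler_pM//; last by rewrite invf_ge1// ltW.
rewrite -[leLHS]mul1r ler_pM//; first by rewrite expr_ge1// (le_trans _ M1).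
by rewrite invf_ge1 ?exprn_gt0// expr_le1// ltW.
Qed.

(** The constant 16 is 4, from the second moment with w(gamma) <= 2 w(b), times 4, from allowing
    half of the relative error. The ceiling adds at most 1, hence 17. *)
Lemma replication_number : let n := `|Num.ceil (16 * Y)|%N in
  [/\ (0 < n)%N, 16 * Y <= n%:R & n%:R <= 17 * Y].
Proof.
move=> n; have h1 := ceil_abs_ge (16 * Y).
have Y0 : 0 <= 16 * Y by rewrite mulr_ge0// (le_trans _ Y1).
have h2 := ceil_abs_le Y0; rewrite -/n in h1 h2.
have n_gt0 : 0 < n%:R :> R by move: Y1 h1; move: Y (n%:R : R) => y m; lra.
split => //; first by rewrite ltr0n in n_gt0.
by move: Y1 h2; move: Y (n%:R : R) => y m; lra.
Qed.

Lemma failure_le (v w n : R) : 0 < w -> v <= 4 * M * w ^+ 2 -> 16 * Y <= n ->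
  v / (n * (eps / 2 * w) ^+ 2) <= delta.
Proof.
move=> w0 vw nY.
have M0 : 0 < M by exact: lt_le_trans M1.
have Y0 : 0 < 16 * Y by rewrite mulr_gt0// (lt_le_trans _ Y1).
have n0 : 0 < n by exact: lt_le_trans nY.
have r0 : 0 < (eps / 2 * w) ^+ 2 by rewrite exprn_gt0// mulr_gt0// divr_gt0.
rewrite ler_pdivrMr ?mulr_gt0//; apply: (le_trans vw).
apply: (@le_trans _ _ (delta * (16 * Y * (eps / 2 * w) ^+ 2))); last first.
  by rewrite ler_pM2l// ler_pM2r.
have -> : delta * (16 * Y * (eps / 2 * w) ^+ 2) = 4 * M ^+ 2 * w ^+ 2.
  by rewrite /Y; field; rewrite !gt_eqF.
by rewrite ler_wpM2r ?sqr_ge0// ler_pM2l// expr2 ler_peMr// ltW.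
Qed.

End replication_number.

Lemma compact_coord_bound (R : realType) (d : nat) (T : set 'rV[R]_d) : compact T ->
  exists N : nat, forall x, T x -> forall j, `|x ord0 j| <= N%:R.
Proof.
move=> /compact_bounded[B [_ hB]].
exists `|Num.ceil (B + 1)|%N => x Tx j.
have BN : B < (`|Num.ceil (B + 1)|%N)%:R.
  by apply: lt_le_trans (ceil_abs_ge _); rewrite ltrDl.
apply: le_trans (hB _ BN x Tx).
rewrite [leRHS](mx_normrE x); exact: (le_bigmax _ (fun ij => `|x ij.1 ij.2|) (ord0, j)).
Qed.

(** [z] stands for eps^-2 delta^-1. Below, 16/3 >= 5; above, the n additions and the final division
    are each paid for by n M^3, hence K + 2. *)
Lemma cost_window (R : realFieldType) (M K n z : R) : 1 <= M -> 0 < K -> 0 <= z -> 1 <= n ->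
  16 * (M ^+ 2 * z) <= n -> n <= 17 * (M ^+ 2 * z) ->
  5 * (M ^+ 5 * z) <= n * (M ^+ 3 / 3) /\
  n * (K * M ^+ 3) + n + 1 <= 17 * (K + 2) * (M ^+ 5 * z).
Proof.
move=> M1 K0 z0 n1 lo hi.
have M0 : 0 < M by exact: lt_le_trans M1.
have m3 : 1 <= M ^+ 3 by rewrite exprn_ege1.
have e5 : M ^+ 5 * z = M ^+ 3 * (M ^+ 2 * z) by ring.
rewrite e5; move: lo hi; set y := M ^+ 2 * z => lo hi.
have y0 : 0 <= y by rewrite mulr_ge0// sqr_ge0.
move: (M ^+ 3) m3 => t t1; have t0 : 0 <= t by exact: le_trans t1.
have ty : 0 <= t * y by rewrite mulr_ge0.
split.
  have h : t * (16 * y) <= t * n by rewrite ler_wpM2l.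
  rewrite [leRHS]mulrA ler_pdivlMr// (mulrC n); apply: le_trans h.
  by rewrite [leRHS]mulrCA; move: (t * y) ty => q; lra.
have h1 : n <= n * t by rewrite ler_peMr// (le_trans _ n1).
have h2 : (K + 2) * t * n <= (K + 2) * t * (17 * y).
  by rewrite ler_wpM2l// mulr_ge0// addr_ge0// ltW.
have -> : 17 * (K + 2) * (t * y) = (K + 2) * t * (17 * y) by ring.
apply: le_trans h2.
have -> : (K + 2) * t * n = n * (K * t) + n * t + n * t by ring.
by rewrite lerD// ?lerD2l// (le_trans n1).
Qed.

(** * Assembly of the bias, the law of a replication, the confidence and the cost *)

Theorem theorem6p6 (R : realType) (disp : measure_display)
    (Omega : measurableType disp) (P : probability Omega R)
    (d : nat) (hd : (0 < d)%N) (T : set 'rV[R]_d) (hT : compact T)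
    (f : 'rV[R]_d -> {RV P >-> R})
    (hgauss : gaussian_field T f)
    (hvar : forall t, T t -> 0 < cov f t t)
    (kappaH beta : R) (hkappaH : 0 < kappaH) (hbeta : 0 < beta)
    (hA1 : condA1 T f) (hA2 : condA2 T f kappaH beta)
    (hA3 : condA3 T f kappaH beta) (hA4 : condA4 T)
    (v : R) (hv : 0 < v) (lambda b0 : R) (hlambda : 0 < lambda) (hb0 : 1 <= b0) :
  let rho := 2 * d%:R / beta + d%:R * v + 1 in
  let maxf := maxT T f in
  (forall a b : R, 0 < a -> b0 <= b ->
    [/\ condpr P [set omega | maxf omega <= b + a / b]
                 [set omega | b < maxf omega]
          <= lambda * a * b `^ rho,
        pr P [set omega | gamma a b < maxf omega /\ maxf omega <= b]
          <= lambda * a * b `^ rho * pr P [set omega | gamma a b < maxf omega] &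
        pr P [set omega | gamma a b < maxf omega] * (1 - lambda * a * b `^ rho)
          <= pr P [set omega | b < maxf omega]]) ->
  let a (eps b : R) := eps / (4 * lambda * b `^ rho) in
  exists c eps0 b1 : R, [/\ 0 < c, 0 < eps0 & b0 <= b1] /\
    let M (eps b : R) :=
      `|Num.ceil (c * eps^-1 * (b / a eps b) `^ ((4 + 4 * v) * d%:R / beta))|%N in
    [/\ forall eps b : R, 0 < eps -> eps <= eps0 -> b1 <= b ->
          `|w T f b - wM T f (M eps b) (gamma (a eps b) b)| <= eps * w T f b,
        (* the program for one replication has the law of L_b(U) under Q'' *)
        forall eps b : R, 0 < eps -> eps <= eps0 -> b1 <= b ->
          forall A : set R, measurable A ->
            expect T (mean f) (cov f) (replication (a eps b) b (M eps b))
              (fun y => (\1_A y)%:E)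
            = Lb_law T f (M eps b) (gamma (a eps b) b) A &
        exists n : R -> R -> R -> nat,
          fpras T (mean f) (cov f) (w T f) eps0 b1
            (fun eps _ b => replication (a eps b) b (M eps b)) n /\
          exists2 K : R, 0 < K & forall eps delta b : R,
            0 < eps -> eps <= eps0 -> 0 < delta -> delta < 1 -> b1 <= b ->
            (cost T (mean f) (cov f)
               (procedureA (a eps b) b (M eps b) (n eps delta b))
             <= (K * ((M eps b)%:R ^+ 3 * (M eps b)%:R ^+ 2
                      * eps ^- 2 * delta^-1))%:E)%E].
Proof.
move=> rho maxf hyp a.
have [T00 _] := hA4; have T0 : T !=set0 by exists 0.
have [N TN] := compact_coord_bound hT.
(* [Z] is a measurable null set outside which paths are continuous; its complement [G] carries all
   path arguments. *)
have [Z [mZ PZ hZ]] := hA1.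
pose G := ~` Z; have mG : measurable G by exact: measurableC.
have PG : P (~` G) = 0%E by rewrite setCK.
have Gc omega : G omega -> {within T, continuous (fun t => f t omega : R)}.
  by move=> Gw; apply: contrapT => h; apply: Gw; exact: hZ.
have mT : measurable T := measurable_T hT TN.
have Tn0 := lebesgue_T_neq0 mT hA4 hd.
have Tfin := lebesgue_T_fin mT TN.
pose kappa := (4 + 4 * v) * d%:R / beta.
have kappa_ge : 4 * d%:R / beta <= kappa.
  by rewrite ler_pM2r ?invr_gt0// ler_wpM2r// lerDl mulr_ge0// ltW.
have kappa0 : 0 <= kappa.
  by rewrite divr_ge0 ?(ltW hbeta)// mulr_ge0// addr_ge0// mulr_ge0// ltW.
have hrho : 1 <= rho.
  by rewrite lerDr addr_ge0// ?divr_ge0 ?mulr_ge0// ltW.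
have rho0 : 0 <= rho by exact: le_trans hrho.
have gap a' b : 0 < a' -> b0 <= b ->
    pr P [set omega | gamma a' b < maxT T f omega] * (1 - lambda * a' * b `^ rho)
    <= pr P [set omega | b < maxT T f omega].
  by move=> a0 bb; have [] := hyp a' b a0 bb.
have [c [b1 [c0 b01 hbias]]] :=
  bias hd T0 hT TN mG PG Gc hgauss hvar hkappaH hbeta hA2 hA3 hA4 hlambda hb0 hrho gap kappa_ge.
have [c1 [C1 [c10 C10 wge]]] := w_lower T0 hT TN mG PG Gc hgauss hvar.
have [c2 [C2 [b2 [c20 C20 wle]]]] := w_upper hd T0 hT TN mG PG Gc hgauss hvar hkappaH hbeta hA2 hA3.
(* Beyond [b3] the bias bound, the upper tail of [w] and the two-sided estimate of |ln w| all
   hold. *)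
pose b3 := Num.max (Num.max b1 b2) (2 * `|ln C2| / c2).
have b3P b : b3 <= b -> [/\ b0 <= b, 1 <= b, b1 <= b, b2 <= b & 2 * `|ln C2| / c2 <= b].
  rewrite !ge_max => /andP[/andP[h1 h2] h3].
  by have h0 := le_trans b01 h1; split => //; exact: le_trans hb0 h0.
exists c, 1, b3; split.
  by split => //; rewrite !le_max b01.
set M := fun _ _ => _.
pose X eps b := c * eps^-1 * (b / a eps b) `^ kappa.
have XM eps b : X eps b <= (M eps b)%:R by exact: ceil_abs_ge.
have b_gt0 b : b3 <= b -> 0 < b by move=> /b3P[_ h _ _ _]; exact: lt_le_trans h.
have X_gt0 eps b : 0 < eps -> b3 <= b -> 0 < X eps b.
  move=> e0 bb; have b_pos := b_gt0 b bb.
  by rewrite mulr_gt0 ?powR_gt0 ?divr_gt0// ?mulr_gt0 ?powR_gt0// mulr_gt0.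
have MX eps b : 0 < eps -> b3 <= b -> (M eps b)%:R <= X eps b + 1.
  by move=> e0 bb; apply: ceil_abs_le; apply: ltW; exact: X_gt0.
have M_gt0 eps b : 0 < eps -> b3 <= b -> (0 < M eps b)%N.
  move=> e0 bb; have := lt_le_trans (X_gt0 _ _ e0 bb) (XM eps b).
  by rewrite ltr0n.
have w_gt0 b : b3 <= b -> 0 < w T f b.
  by move=> /b3P[_ h _ _ _]; apply: lt_le_trans (wge _ h); rewrite mulr_gt0// expR_gt0.
have biasP eps b : 0 < eps -> eps <= 1 -> b3 <= b ->
    `|w T f b - wM T f (M eps b) (gamma (a eps b) b)| <= eps / 2 * w T f b /\
    w T f (gamma (a eps b) b) <= 2 * w T f b.
  by move=> e0 e1 /b3P[_ _ h _ _]; apply: hbias => //; exact: XM.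
split.
- move=> eps b e0 e1 bb; have [h _] := biasP eps b e0 e1 bb; apply: (le_trans h).
  by rewrite ler_wpM2r ?(ltW (w_gt0 _ bb))// ler_pdivrMr// ler_peMr ?(ltW e0)// ler1n.
- move=> eps b e0 e1 bb A mA.
  exact: (expect_replication_Lb_law T0 hT TN mG PG Gc mT Tn0 Tfin hgauss hvar (M_gt0 _ _ e0 bb)).
have [K K0 hK] := bounded_replication (mean f) (cov f) mT Tn0 Tfin.
pose n (eps delta b : R) := `|Num.ceil (16 * ((M eps b)%:R ^+ 2 * eps ^- 2 * delta^-1))|%N.
have M_ge1 eps b : 0 < eps -> b3 <= b -> 1 <= (M eps b)%:R :> R.
  by move=> e0 bb; rewrite ler1n M_gt0.
have costP eps delta b : 0 < eps -> eps <= 1 -> 0 < delta -> delta < 1 -> b3 <= b ->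
    bounded T (mean f) (cov f) (procedureA (a eps b) b (M eps b) (n eps delta b)) (fun=> True)
      (5 * ((M eps b)%:R ^+ 5 * eps ^- 2 * delta^-1))
      (17 * (K + 2) * ((M eps b)%:R ^+ 5 * eps ^- 2 * delta^-1)).
  move=> e0 e1 d0 d1 bb.
  have [n0 n1 n2] := replication_number (M_ge1 _ _ e0 bb) e0 e1 d0 d1.
  rewrite -/(n eps delta b) in n0 n1 n2.
  have lo0 : 0 <= (M eps b)%:R ^+ 3 / 3 :> R by rewrite divr_ge0// exprn_ge0.
  have z0 : 0 <= eps ^- 2 * delta^-1 by rewrite mulr_ge0 ?invr_ge0 ?sqr_ge0// ltW.
  have n1' : 1 <= (n eps delta b)%:R :> R by rewrite ler1n.
  rewrite -mulrA in n1 n2; rewrite -mulrA.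
  have [h1 h2] := cost_window (M_ge1 _ _ e0 bb) K0 z0 n1' n1 n2.
  apply: (bounded_weaken (bounded_average mT Tn0 Tfin (n eps delta b) lo0
    (hK (a eps b) b (M eps b) (M_gt0 _ _ e0 bb)))) => //.
exists n; split; last first.
  exists (17 * (K + 2)); first by rewrite mulr_gt0// addr_gt0.
  move=> eps delta b e0 e1 d0 d1 bb.
  have [_ _ /andP[_ h]] := costP eps delta b e0 e1 d0 d1 bb.
  by apply: (le_trans h); rewrite lee_fin -exprD.
split.
- exact: w_gt0.
- by apply: (@exp_tail_cvg0 R (w T f) c1 C1 c2 C2 b2).
have c22 : 0 < c2 / 2 by rewrite divr_gt0.
have C1c : 0 < C1 + `|ln c1| by rewrite ltr_pwDl.
have b3_ge1 : 1 <= b3 by have [] := b3P b3 (lexx _).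
have lwP b : b3 <= b -> c2 / 2 * b ^+ 2 <= `|ln (w T f b)| <= (C1 + `|ln c1|) * b ^+ 2.
  by move=> /b3P[_ h1 _ h2 h3]; apply: (@log_rate R (w T f) c1 C1 c2 C2 b2).
have [k1 [k2 [k10 k20 hk]]] :=
  growth_rate c0 hlambda rho0 kappa0 c22 C1c b3_ge1 lwP.
(* The running time M^5 eps^-2 delta^-1 fixes all exponents: M contributes five times 1 + kappa in
   1/eps and (rho + 1) kappa in b, half of it in |ln w|; delta enters linearly. *)
exists (5 * (rho + 1) * kappa / 2), (2 + 5 * (1 + kappa)), 1, (5 * k1), (17 * (K + 2) * k2).
split.
  split => //.
  - by apply: divr_ge0 => //; apply: mulr_ge0 => //; apply: mulr_ge0 => //; apply: addr_ge0.
  - by apply: addr_ge0 => //; apply: mulr_ge0 => //; apply: addr_ge0.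
  - exact: mulr_gt0.
  - by apply: mulr_gt0 => //; apply: mulr_gt0 => //; apply: addr_gt0.
move=> eps delta b e0 e1 d0 d1 bb alg bound.
have [n0 n1 n2] := replication_number (M_ge1 _ _ e0 bb) e0 e1 d0 d1.
rewrite -/(n eps delta b) in n0 n1 n2.
have di0 : 0 < delta^-1 by rewrite invr_gt0.
have := hk eps b (M eps b) e0 e1 bb (XM _ _) (MX _ _ e0 bb).
rewrite /bound powR_inv1 ?(ltW d0)//; set A := eps `^ _; set L := `|_| `^ _.
rewrite (mulrAC A); set B := A * L => /andP[r1 r2].
have [_ _ /andP[cost1 cost2]] := costP eps delta b e0 e1 d0 d1 bb.
split => //; last first.
- apply: (le_trans cost2); rewrite lee_fin.
  have -> : 17 * (K + 2) * k2 * (B * delta^-1) = 17 * (K + 2) * (k2 * B * delta^-1) by ring.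
  by rewrite ler_pM2l ?ler_pM2r// mulr_gt0// addr_gt0.
- apply: le_trans cost1; rewrite lee_fin -mulrA ler_pM2l//.
  by rewrite mulrA ler_pM2r.
have [hb hw] := biasP eps b e0 e1 bb.
set g := gamma (a eps b) b in hb hw.
have M0 := M_gt0 _ _ e0 bb.
pose nu0 : {measure set R -> \bar R} :=
  replication_measure T0 hT TN mG Gc mT Tn0 Tfin (M eps b) g.
have rep_law h : measurable_fun setT h -> (forall x, (0 <= h x)%E) ->
    expect T (mean f) (cov f) (replication (a eps b) b (M eps b)) h = (\int[nu0]_x h x)%E.
  by move=> mh h0; exact: (replication_integral T0 hT TN mG PG Gc mT Tn0 Tfin hgauss hvar M0).
(* The total mass is read off from the program: by the constant clause of [bounded] it terminates
   with probability one. *)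
have nu01 : nu0 setT = 1%E.
  have := rep_law (fun=> 1%E) (measurable_cst _) (fun=> lee01).
  have [_ const _] := hK (a eps b) b (M eps b) M0.
  by rewrite (const 1)// integral_cst// mul1e => <-.
have w0 := w_gt0 b bb.
have wMg : wM T f (M eps b) g <= w T f g.
  exact: (wM_le T0 hT TN mG PG Gc mT Tn0 Tfin).
(* The second moment M w(gamma) w_M(gamma) is compared with w(b)^2 through w_M(gamma) <= w(gamma) <=
   2 w(b). *)
have vw : (M eps b)%:R * w T f g * wM T f (M eps b) g <= 4 * (M eps b)%:R * w T f b ^+ 2.
  have wg0 := w_ge0 T f g.
  rewrite -mulrA [leRHS](_ : _ = (M eps b)%:R * (2 * w T f b * (2 * w T f b))); last by ring.
  rewrite ler_wpM2l//; apply: (@le_trans _ _ (w T f g * w T f g)); first by rewrite ler_wpM2l.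
  by rewrite ler_pM.
have ch := @average_chebyshev R d T (mean f) (cov f) (replication (a eps b) b (M eps b))
  (total_one nu01) (wM T f (M eps b) g) _ rep_law
  (replication_ge0 T0 hT TN mG Gc mT Tn0 Tfin (M eps b) g)
  (replication_abs_moment T0 hT TN mG PG Gc mT Tn0 Tfin hgauss hvar g M0)
  (replication_second_moment T0 hT TN mG PG Gc mT Tn0 Tfin hgauss hvar g M0)
  (n eps delta b) (eps / 2 * w T f b) n0.
have r0 : 0 < eps / 2 * w T f b by rewrite mulr_gt0// divr_gt0.
(* Chebyshev is applied around w_M(gamma) with radius (eps/2) w(b); the bias accounts for the other
   half of the relative error. *)
apply: (@le_trans _ _ (1 - ((M eps b)%:R * w T f g * wM T f (M eps b) g)
    / ((n eps delta b)%:R * (eps / 2 * w T f b) ^+ 2))%:E%E).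
  by rewrite lee_fin lerD2l lerN2; exact: (failure_le (M_ge1 _ _ e0 bb)).
apply: (le_trans (ch r0)); apply: (expect_mono _ _ mT Tn0 Tfin) => y; rewrite lee_fin//.
rewrite !indicE; case: (boolP (y \in [set y0 | `|y0 - wM T f (M eps b) g| <= eps / 2 * w T f b])) => // /set_mem h.
rewrite mem_set//=; apply: (le_trans (ler_distD (wM T f (M eps b) g) _ _)).
rewrite (distrC (wM _ _ _ _)); apply: (le_trans (lerD h hb)).
by rewrite -mulrDl -splitr.
Qed.
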